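(* Let $(G,H)$ be a $b$-Lie group, let $\mathfrak{h}$ be the Lie algebra of $H$, and let ${}^bT^*G$ be endowed with the canonical $b$-Poisson structure (the Poisson structure dual to its canonical $b$-symplectic form). Then the Poisson reduction of ${}^bT^*G$ under the cotangent lifted action of $H$ by left translations, that is, the reduced Poisson structure on $({}^bT^*G)/H$, is locally equivalent to the Poisson structure $$\bigl(\mathfrak{h}^*\times{}^bT^*(G/H),\ \Pi^-_{\mathrm{L\text{-}P}}+\Pi_{b\text{-can}}\bigr),$$ where $\Pi^-_{\mathrm{L\text{-}P}}$ is the minus Lie–Poisson structure on $\mathfrak{h}^*$ and $\Pi_{b\text{-can}}$ is the canonical $b$-symplectic structure (viewed as a Poisson structure) on ${}^bT^*(G/H)$, with $G/H$ viewed as a $b$-manifold with critical hypersurface the point $[e]$. Here ''locally equivalent'' means: for every open neighbourhood $V\subset G/H$ of $[e]$ over which the principal $H$-bundle $\pi:G\to G/H$ is trivial, setting $U=\pi^{-1}(V)$, there is a Poisson diffeomorphism between $({}^bT^*U)/H$ with the reduced Poisson structure and $\mathfrak{h}^*\times{}^bT^*V$ with $\Pi^-_{\mathrm{L\text{-}P}}+\Pi_{b\text{-can}}$.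
   Context: A $b$-manifold is a pair $(M,Z)$ with $M$ an oriented manifold and $Z\subset M$ an oriented (embedded) hypersurface, called the critical hypersurface. A $b$-vector field is a vector field on $M$ tangent to $Z$ at every point of $Z$. If $f$ is a local defining function for $Z$ and $(f,z_2,\dots,z_n)$ is a chart, the $b$-vector fields form a free module with basis $f\,\partial/\partial f,\partial/\partial z_2,\dots,\partial/\partial z_n$; the vector bundle whose sections are the $b$-vector fields is the $b$-tangent bundle ${}^bTM$. Its dual is the $b$-cotangent bundle ${}^bT^*M$, and $b$-forms of degree $k$ are sections of $\Lambda^k({}^bT^*M)$. Writing a $b$-form locally as $\alpha\wedge\frac{df}{f}+\beta$ with $\alpha,\beta$ smooth forms, its exterior derivative is $d\alpha\wedge\frac{df}{f}+d\beta$. A $b$-symplectic form is a closed $b$-form of degree 2 of maximal rank in $\Lambda^2({}^bT_p^*M)$ at every $p$; its inverse is a section of $\Lambda^2({}^bTM)$ and, viewed as a smooth bivector field on $M$, is the dual Poisson structure (sign convention: $\omega=dq\wedge dp$ corresponds to $\partial_q\wedge\partial_p$, and $\frac{dq}{q}\wedge dp$ to $q\,\partial_q\wedge\partial_p$). For a $b$-manifold $(M,Z)$, ${}^bT^*M$ is a $b$-manifold with critical hypersurface ${}^bT^*M|_Z$. The $b$-Liouville form $\lambda$ on ${}^bT^*M$ is the $b$-form of degree 1 $\langle\lambda_p,v\rangle=\langle p,\tau_*v\rangle$ for $p\in{}^bT^*M$, $v\in{}^bT_p({}^bT^*M)$, with $\tau:{}^bT^*M\to M$ the projection and $\tau_*:{}^bT({}^bT^*M)\to{}^bTM$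 the induced map; the canonical $b$-symplectic form is $\omega=-d\lambda$. A $b$-Lie group is a $b$-manifold $(G,H)$ where $G$ is a Lie group and $H\subset G$ is a closed codimension one subgroup. $H$ acts on $G$ by left translations $L_h$ ($h\in H$), which preserve the hypersurface $H$, and on ${}^bT^*G$ by the lift $(h,\alpha_g)\mapsto(L_{h^{-1}})^*\alpha_g$, which preserves the canonical $b$-symplectic form. $G/H$ denotes the space of orbits $Hg$, a one-dimensional manifold; $\pi:G\to G/H$ is a principal $H$-bundle, and $[e]=\pi(e)$. The reduced Poisson structure on $({}^bT^*G)/H$ is the one for which the quotient map ${}^bT^*G\to({}^bT^*G)/H$ is a Poisson map; it is the Poisson structure given by the minimal coupling procedure. (Minimal coupling: choose $\theta$, an $\mathfrak{h}$-valued $b$-form of degree 1 on $G$ with $\theta(\frac{d}{dt}|_{t=0}e^{tX}g)=X$ and $\theta((L_h)_*v)=\mathrm{Ad}_h\theta(v)$; use it to identify ${}^bT^*G$ $H$-equivariantly with $\mathcal{H}^\circ\times\mathfrak{h}^*$ via $\alpha_g\mapsto(\alpha_g-\alpha_g\circ\zeta_g\circ\theta_g,\alpha_g\circ\zeta_g)$, where $\zeta_g(X)=\frac{d}{dt}|_{t=0}e^{tX}g$ and $\mathcal{H}^\circ$ is the annihilator in ${}^bT^*G$ of $\mathcal{H}=\mathrm{im}\,\zeta$; transport the $b$-symplectic form and pass to the quotient by $H$.) The minus Lie–Poisson structure on $\mathfrak{h}^*$ is $\{F,K\}(\mu)=-\langle\mu,[dF_\mu,dK_\mu]\rangle$ for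 $F,K\in C^\infty(\mathfrak{h}^* )$, with $dF_\mu,dK_\mu\in\mathfrak{h}$. *)

(* Defs.v *)
From HB Require Import structures.
From mathcomp Require Import all_boot all_order all_algebra.
From mathcomp Require Import boolp classical_sets reals topology normedtype derive.
Import Order.TTheory GRing.Theory Num.Theory numFieldNormedType.Exports.
Set Implicit Arguments.
Unset Strict Implicit.
Unset Printing Implicit Defensive.
Local Open Scope ring_scope.
Local Open Scope classical_set_scope.

(* Smooth functions on R^k.  Partial derivatives are taken along lines, because
   'rV[R]_k is not a normed module when k = 0. *)

Definition partial (R : realType) k (i : 'I_k) (F : 'rV[R]_k -> R) :
  'rV[R]_k -> R := fun u => derive1 (fun t : R => F (u + t *: delta_mx 0 i)) 0.

Fixpoint Ck (R : realType) k (W : set 'rV[R]_k) (m : nat) (F : 'rV[R]_k -> R) :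
  Prop :=
  (forall u, W u -> {for u, continuous F}) /\
  match m with
  | 0 => True
  | m'.+1 => forall i : 'I_k,
      (forall u, W u ->
         derivable (fun t : R => F (u + t *: delta_mx 0 i)) (0 : R) (1 : R)) /\
      Ck W m' (partial i F)
  end.

Definition Cinf (R : realType) k (W : set 'rV[R]_k) (F : 'rV[R]_k -> R) : Prop :=
  forall m, Ck W m F.

(* Smooth spaces are presented by their real-valued smooth functions, as in
   Sikorski's and Nestruev's treatment of differential geometry.  The topology
   is the weakest one making the smooth functions continuous, and a map is
   smooth when it pulls smooth functions back to smooth functions.  No axiom is
   imposed at this level; manifolds are singled out by [is_manifold]. *)

Record diffSpace (R : realType) := DiffSpace {
  carrier :> Type;
  smooth : set (carrier -> R)
}.
Arguments smooth {R d}.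

(* The functions that are locally C^oo functions of finitely many elements of
   S, "locally" referring to the weak topology defined by S. *)
Definition gen (R : realType) (X : Type) (S : set (X -> R)) : set (X -> R) :=
  [set f | forall x, exists k (g : 'I_k -> X -> R) (F : 'rV[R]_k -> R) (e : R),
    [/\ forall i, S (g i), Cinf setT F, 0 < e &
        forall y, (forall i, `|g i y - g i x| < e) ->
          f y = F (\row_i g i y)]].

(* In a space whose smooth functions are closed under [gen], the nonvanishing
   loci of smooth functions are a basis of the topology. *)
Definition dopen (R : realType) (X : diffSpace R) (A : set X) : Prop :=
  forall x, A x ->
    exists f : X -> R, [/\ smooth f, f x != 0 & forall y, f y != 0 -> A y].

Definition smooth_map (R : realType) (X Y : diffSpace R) (phi : X -> Y) : Prop :=
  forall f : Y -> R, smooth f -> smooth (f \o phi).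

Definition diffeo (R : realType) (X Y : diffSpace R) (phi : X -> Y) : Prop :=
  smooth_map phi /\ exists psi : Y -> X,
    [/\ smooth_map psi, cancel phi psi & cancel psi phi].

Definition smooth_on (R : realType) (X : diffSpace R) (W : set X) (f : X -> R) :
  Prop :=
  forall p, W p -> exists (N : set X) (g : X -> R),
    [/\ dopen N, N p, smooth g & forall q, N q -> f q = g q].

Definition subSpace (R : realType) (X : diffSpace R) (A : set X) : diffSpace R :=
  @DiffSpace R {x : X | A x}
    (gen [set f | exists2 g : X -> R, smooth g & f = fun x => g (sval x)]).

Definition prodSpace (R : realType) (X Y : diffSpace R) : diffSpace R :=
  @DiffSpace R (X * Y)%type
    (gen [set f | (exists2 g : X -> R, smooth g & f = fun p => g p.1) \/
                  (exists2 g : Y -> R, smooth g & f = fun p => g p.2)]).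

Definition orbit_of (X : Type) (E : X -> X -> Prop) (x : X) :
  {A : set X | exists y, A = [set z | E y z]} :=
  exist _ [set z | E x z] (ex_intro _ x erefl).

Definition quotSpace (R : realType) (X : diffSpace R) (E : X -> X -> Prop) :
  diffSpace R :=
  @DiffSpace R {A : set X | exists y, A = [set z | E y z]}
    [set f | smooth (fun x : X => f (orbit_of E x))].

Definition quot_map (R : realType) (X : diffSpace R) (E : X -> X -> Prop) :
  X -> quotSpace E := orbit_of E.
Arguments quot_map {R X} E.

Definition is_chart (R : realType) n (M : diffSpace R) (W : set M)
  (x : M -> 'rV[R]_n) : Prop :=
  [/\ dopen W,
      forall p q, W p -> W q -> x p = x q -> p = q,
      open (x @` W) &
      forall f : M -> R, smooth_on W f <->
        exists2 F : 'rV[R]_n -> R, Cinf (x @` W) F &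
          forall q, W q -> f q = F (x q)].

(* The second and third clauses make M Hausdorff and second countable. *)
Definition is_manifold (R : realType) n (M : diffSpace R) : Prop :=
  [/\ gen (@smooth R M) `<=` @smooth R M,
      forall p q : M, p <> q -> exists2 f : M -> R, smooth f & f p != f q,
      exists B : nat -> set M, (forall i, dopen (B i)) /\
        forall (W : set M) p, dopen W -> W p ->
          exists2 i, B i p & B i `<=` W &
      forall p : M, exists W (x : M -> 'rV[R]_n), is_chart W x /\ W p].

(* There is an atlas whose coordinate changes F, x' = F(x), all have positive
   Jacobian determinant. *)
Definition orientable (R : realType) n (M : diffSpace R) : Prop :=
  exists A : set (set M * (M -> 'rV[R]_n)),
  [/\ forall c, A c -> is_chart c.1 c.2,
      forall p : M, exists2 c, A c & c.1 p &
      forall c c', A c -> A c' -> forall F : 'rV[R]_n -> 'rV[R]_n,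
        (forall q, c.1 q -> c'.1 q -> c'.2 q = F (c.2 q)) ->
        forall p, c.1 p -> c'.1 p ->
          0 < \det (\matrix_(i, j) partial i (fun u => F u 0 j) (c.2 p))].

Definition hypersurface (R : realType) n (M : diffSpace R) (Z : set M) : Prop :=
  forall p, Z p -> exists W (x : M -> 'rV[R]_n.+1),
    [/\ is_chart W x, W p & forall q, W q -> (Z q <-> x q 0 0 = 0)].

Definition is_bmanifold (R : realType) n (M : diffSpace R) (Z : set M) : Prop :=
  [/\ is_manifold n.+1 M, orientable n.+1 M, hypersurface n Z &
      orientable n (subSpace Z)].

(* Vector fields are derivations of the smooth functions, b-vector fields those
   that preserve the ideal of Z (Z closed).  To get one operator per derivation
   the value on a function that is not smooth is set to 0. *)

Definition operator (R : realType) (X : diffSpace R) := (X -> R) -> X -> R.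

Definition is_vfield (R : realType) (X : diffSpace R) (D : operator X) : Prop :=
  [/\ forall f, ~ smooth f -> D f = fun=> 0,
      forall f, smooth f -> smooth (D f),
      forall f g, smooth f -> smooth g ->
        D (fun x => f x + g x) = fun x => D f x + D g x,
      forall (a : R) f, smooth f -> D (fun x => a * f x) = fun x => a * D f x &
      forall f g, smooth f -> smooth g ->
        D (fun x => f x * g x) = fun x => f x * D g x + g x * D f x].

Definition is_bfield (R : realType) (X : diffSpace R) (Z : set X)
  (D : operator X) : Prop :=
  is_vfield D /\
  forall f, smooth f -> (forall z, Z z -> f z = 0) -> forall z, Z z -> D f z = 0.

Definition lie_br (R : realType) (X : diffSpace R) (D E : operator X) :
  operator X := fun f x => D (E f) x - E (D f) x.

(* Since the b-vector fields are the sections of the b-tangent bundle, its fibre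
   at p is their quotient by the multiples of functions vanishing at p, and a
   b-covector at p is a functional a with a(fD) = f(p) a(D).  Again the value
   outside the b-vector fields is set to 0. *)
Definition is_bcovector (R : realType) (M : diffSpace R) (Z : set M) (p : M)
  (a : operator M -> R) : Prop :=
  [/\ forall D, ~ is_bfield Z D -> a D = 0,
      forall D E, is_bfield Z D -> is_bfield Z E ->
        a (fun f x => D f x + E f x) = a D + a E &
      forall f D, smooth f -> is_bfield Z D ->
        a (fun h x => f x * D h x) = f p * a D].

Definition bcot_type (R : realType) (M : diffSpace R) (Z : set M) :=
  {e : M * (operator M -> R) | is_bcovector Z e.1 e.2}.

Definition bcot (R : realType) (M : diffSpace R) (Z : set M) : diffSpace R :=
  @DiffSpace R (bcot_type Z)
    (gen [set f | (exists2 g : M -> R, smooth g & f = fun e => g (sval e).1) \/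
                  (exists2 D, is_bfield Z D & f = fun e => (sval e).2 D)]).

Section CanonicalStructure.
Variables (R : realType) (M : diffSpace R) (Z : set M).

Definition bproj (e : bcot Z) : M := (sval e).1.

Definition bpair (e : bcot Z) (D : operator M) : R := (sval e).2 D.

Definition bcot_crit : set (bcot Z) := [set e | Z (bproj e)].

(* The section tau_* V of the pullback of the b-tangent bundle along tau is
   sum_i (a_i) (X_i o tau) near e, with a_i smooth and X_i b-vector fields on M,
   when V (f o tau) = sum_i a_i ((X_i f) o tau) near e for all smooth f; its
   pairing with e is then sum_i a_i(e) <e, X_i>. *)
Definition pushes_to (V : operator (bcot Z)) (e : bcot Z) (c : R) : Prop :=
  exists k (a : 'I_k -> bcot Z -> R) (X : 'I_k -> operator M) (N : set (bcot Z)),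
  [/\ forall i, smooth (a i), forall i, is_bfield Z (X i), dopen N /\ N e,
      forall f : M -> R, smooth f -> forall e', N e' ->
        V (f \o bproj) e' = \sum_i a i e' * X i f (bproj e') &
      c = \sum_i a i e * bpair e (X i)].

Definition liouville (V : operator (bcot Z)) : bcot Z -> R :=
  fun e => xget 0 [set c | pushes_to V e c].

End CanonicalStructure.

(* A b-form of degree k is given by its values on k-tuples of b-vector fields;
   in degree 1 the exterior derivative is
   (d a)(V, W) = V (a W) - W (a V) - a [V, W]. *)
Definition ext_d (R : realType) (X : diffSpace R) (a : operator X -> X -> R)
  (V W : operator X) : X -> R :=
  fun x => V (a W) x - W (a V) x - a (lie_br V W) x.

Definition bcan_form (R : realType) (M : diffSpace R) (Z : set M)
  (V W : operator (bcot Z)) : bcot Z -> R :=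
  fun e => - ext_d (@liouville R M Z) V W e.

(* A Poisson structure is given by its bracket {f, g} = Pi(df, dg). *)

Record poissonSpace (R : realType) := PoissonSpace {
  pcarrier :> diffSpace R;
  pbr : (pcarrier -> R) -> (pcarrier -> R) -> pcarrier -> R
}.
Arguments pbr {R p}.

Definition is_poisson (R : realType) (P : poissonSpace R) : Prop :=
  [/\ forall f g : P -> R, smooth f -> smooth g -> smooth (pbr f g),
      forall f g : P -> R, smooth f -> smooth g ->
        pbr f g = fun x => - pbr g f x,
      forall (a : R) (f f' g : P -> R), smooth f -> smooth f' -> smooth g ->
        pbr (fun x => a * f x + f' x) g = fun x => a * pbr f g x + pbr f' g x,
      forall f f' g : P -> R, smooth f -> smooth f' -> smooth g ->
        pbr (fun x => f x * f' x) g = fun x => f x * pbr f' g x + f' x * pbr f g x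
    & forall f g h : P -> R, smooth f -> smooth g -> smooth h ->
        forall x, pbr f (pbr g h) x + pbr g (pbr h f) x + pbr h (pbr f g) x = 0].

Definition poisson_map (R : realType) (P Q : poissonSpace R) (phi : P -> Q) :
  Prop :=
  smooth_map phi /\
  forall f g : Q -> R, smooth f -> smooth g ->
    pbr (f \o phi) (g \o phi) = pbr f g \o phi.

(* The Hamiltonian field X_g of g satisfies w(X_g, W) = W(g) for every b-vector
   field W, and {f, g} = w(X_f, X_g) = X_g f; thus {q, p} = 1 for
   w = dq /\ dp and {q, p} = q for w = (dq / q) /\ dp. *)
Definition ham_field (R : realType) (X : diffSpace R) (Z : set X)
  (w : operator X -> operator X -> X -> R) (g : X -> R) : operator X :=
  xget ((fun _ _ => 0) : operator X)
    [set D : operator X |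
      is_bfield Z D /\ forall W, is_bfield Z W -> w D W = W g].

Definition bcan (R : realType) (M : diffSpace R) (Z : set M) : poissonSpace R :=
  @PoissonSpace R (bcot Z)
    (fun f g => ham_field (@bcot_crit R M Z) (@bcan_form R M Z) g f).

(* For A open, the bracket on A is computed at each point from smooth functions
   on P with the given germs. *)
Definition psub (R : realType) (P : poissonSpace R) (A : set P) :
  poissonSpace R :=
  @PoissonSpace R (subSpace A)
    (fun f g x => xget 0 [set c | exists f' g' : P -> R, exists2 N : set P,
       [/\ dopen N, N (sval x), smooth f' & smooth g'] &
       (forall y : subSpace A, N (sval y) ->
          f y = f' (sval y) /\ g y = g' (sval y)) /\
       c = pbr f' g' (sval x)]).

Definition pprod (R : realType) (P Q : poissonSpace R) : poissonSpace R :=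
  @PoissonSpace R (prodSpace P Q)
    (fun f g z => pbr (fun x => f (x, z.2)) (fun x => g (x, z.2)) z.1 +
                  pbr (fun y => f (z.1, y)) (fun y => g (z.1, y)) z.2).

(* dim G = n + 1 *)
Record bLieGroup (R : realType) (n : nat) := BLieGroup {
  bgroup :> groupType;
  bsmooth : set (bgroup -> R);
  bspace : diffSpace R := DiffSpace bsmooth;
  bH : set bgroup;
  bgroup_bmanifold : @is_bmanifold R n bspace bH;
  bgroup_mul : smooth_map
    ((fun p => (p.1 * p.2)%g) : prodSpace bspace bspace -> bspace);
  bgroup_inv : smooth_map ((fun x => x^-1%g) : bspace -> bspace);
  bH_closed : @dopen R bspace (~` bH);
  bH1 : bH 1%g;
  bHM : forall x y, bH x -> bH y -> bH (x * y)%g;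
  bHV : forall x, bH x -> bH x^-1%g
}.

Section Reduction.
Variables (R : realType) (n : nat) (G : bLieGroup R n).
Let M := bspace G.
Let H : set M := @bH R n G.

Definition subgroupSpace : diffSpace R := subSpace H.

Definition mulH (h k : subgroupSpace) : subgroupSpace :=
  exist _ (sval h * sval k : G)%g (bHM (svalP h) (svalP k)).

(* The Lie algebra: left-invariant vector fields on H, with the commutator. *)
Definition lieH : set (operator subgroupSpace) :=
  [set D | is_vfield D /\
    forall h f, smooth f -> D (f \o mulH h) = D f \o mulH h].

(* Linear functionals on the Lie algebra, set to 0 outside it. *)
Definition is_hdual (m : operator subgroupSpace -> R) : Prop :=
  (forall D, ~ lieH D -> m D = 0) /\
  forall (a : R) D E, lieH D -> lieH E ->
    m (fun f x => a * D f x + E f x) = a * m D + m E.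

Definition hdual : diffSpace R :=
  @DiffSpace R {m | is_hdual m}
    (gen [set f | exists2 D, lieH D & f = fun m => sval m D]).

Fact hdual_line_subproof (m v : hdual) (t : R) :
  is_hdual (fun D => sval m D + t * sval v D).
Proof.
case: (svalP m) => m0 ml; case: (svalP v) => v0 vl; split=> [D nD | a D E lD lE].
  by rewrite m0 // v0 // mulr0 addr0.
by rewrite ml // vl // !mulrDr addrACA mulrCA.
Qed.

Definition hdual_line (m v : hdual) (t : R) : hdual :=
  exist _ _ (hdual_line_subproof m v t).

(* dF_m, as an element of the Lie algebra. *)
Definition hdiff (F : hdual -> R) (m : hdual) : operator subgroupSpace :=
  xget ((fun _ _ => 0) : operator subgroupSpace)
    [set D : operator subgroupSpace | lieH D /\ forall v : hdual,
       is_derive (0 : R) (1 : R) (fun t : R => F (hdual_line m v t))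
         (sval v D)].

Definition lie_poisson_minus : poissonSpace R :=
  @PoissonSpace R hdual
    (fun F K m => - sval m (lie_br (hdiff F m) (hdiff K m))).

Definition leftrel (x y : M) : Prop :=
  exists2 h : G, H h & y = (h * x : G)%g.

Definition GmodH : diffSpace R := quotSpace leftrel.

Definition base_pt : GmodH := quot_map leftrel (1%g : G).

(* phi_* D, psi being the inverse of phi *)
Definition push_op (phi psi : M -> M) (D : operator M) : operator M :=
  fun f x => D (f \o phi) (psi x).

(* b = (L_(h^-1))^* a for some h in H, i.e. b lies over h * (bproj a) and
   <b, D> = <a, (L_(h^-1))_* D> for every b-vector field D. *)
Definition liftrel (a b : bcot H) : Prop :=
  exists2 h : G, H h &
    bproj b = (h * bproj a : G)%g /\
    forall D, is_bfield H D ->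
      bpair b D = bpair a (push_op (fun x => h^-1 * x : G)%g
                                   (fun x => h * x : G)%g D).

Definition bcot_modH : diffSpace R := quotSpace liftrel.

(* The structure for which the (surjective) quotient map is Poisson. *)
Definition is_reduced
  (red : (bcot_modH -> R) -> (bcot_modH -> R) -> bcot_modH -> R) : Prop :=
  is_poisson (PoissonSpace red) /\
  @poisson_map R (bcan H) (PoissonSpace red) (quot_map liftrel).

Definition preimV (V : set GmodH) : set M := quot_map leftrel @^-1` V.

(* H-equivariant trivialisation of the principal bundle G -> G/H over V *)
Definition trivial_over (V : set GmodH) : Prop :=
  exists2 t : subSpace (preimV V) -> prodSpace subgroupSpace (subSpace V),
    diffeo t &
    (forall x, sval (t x).2 = quot_map leftrel (sval x)) /\
    forall (h : subgroupSpace) (x y : subSpace (preimV V)),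
      sval y = (sval h * sval x : G)%g -> (t y).1 = mulH h (t x).1.

(* (bT*U)/H, U being the preimage of V in G *)
Definition bcot_modH_over (V : set GmodH) : set bcot_modH :=
  quot_map liftrel @` [set e | preimV V (bproj e)].

Definition model : poissonSpace R :=
  pprod lie_poisson_minus (bcan [set base_pt]).

Definition model_over (V : set GmodH) : set model := [set z | V (bproj z.2)].

Definition locally_equivalent
  (red : (bcot_modH -> R) -> (bcot_modH -> R) -> bcot_modH -> R) : Prop :=
  forall V : set GmodH, dopen V -> V base_pt -> trivial_over V ->
    exists2 Phi : psub (P := PoissonSpace red) (bcot_modH_over V) ->
                  psub (model_over V),
      diffeo Phi & poisson_map Phi.

End Reduction.

(* Main.v *)
(* Smooth functions on the b-cotangent bundle are locally generated by the
   functions g o tau and e |-> <e, D>, and the canonical bracket is determined by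
   its values {g o tau, <., D>} = (D g) o tau, {<., D>, <., E>} = - <., [D, E]>.
   Left translations respect these values, so the bracket descends to the
   orbits.  Over V the trivialisation lifts D in lieH and E on G/H to commuting
   invariant b-fields D~ and E~ on G, and the Poisson diffeomorphism sends the
   orbit of e to (D |-> <e, D~>, E |-> <e, E~>); both sides have the same brackets
   on generators.  That G/H is a b-manifold is obtained from a chart of G: the
   differentials of functions pulled back from G/H span a line, so near H they
   are all functions of a single one. *)

From HB Require Import structures.
From mathcomp Require Import all_boot all_order all_algebra.
From mathcomp Require Import boolp classical_sets functions reals topology normedtype derive sequences realfun exp.
From mathcomp Require Import ring lra.
Require Import Defs.
Import Order.TTheory GRing.Theory Num.Theory numFieldNormedType.Exports.
Set Implicit Arguments.
Unset Strict Implicit.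
Unset Printing Implicit Defensive.
Local Open Scope ring_scope.
Local Open Scope classical_set_scope.

(** Two uniqueness principles carry the proof. A derivation at a point is determined by its values
    on generators, by Hadamard's lemma; hence two brackets that are derivations in each argument
    agree once they agree on generators. This gives independence of charts, antisymmetry, invariance
    under translations and the final comparison alike. The second principle concerns the fibres of
    the b-tangent bundle: at a point of Z a b-field can vanish as a derivation and still be non-zero
    in the fibre, so b-covectors are compared on fields that agree near the point. Coefficients in a
    b-frame are smooth because a smooth function vanishing on x = 0 is x times a smooth function;
    this is proved without integrals, by showing that quotients by powers of a coordinate are closed
    under differentiation. Vector fields are operators on global functions, while the trivialisation
    lives over V; the lifted fields therefore carry a cutoff, whose choice does not matter near the
    point considered. Away from V nothing is known about G/H, so its charts are carried there from
    the base point by right translations. *)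

(** * Derivatives and Taylor estimates in one real variable *)

Section OneVariable.
Variable R : realType.
Implicit Types (f df : R -> R) (x d : R).

(** The little-o form has no quotient and no exclusion of h = 0, so estimates of this kind can be
    added, rescaled and substituted into each other. *)
Lemma is_derive_epsP f x d : is_derive x (1 : R) f d <->
  forall e, 0 < e -> exists2 r, 0 < r &
    forall h, `|h| < r -> `|f (x + h) - f x - d * h| <= e * `|h|.
Proof.
split=> [fd e e0|H].
  have /cvgrPdist_le/(_ e e0) : h^-1 *: (f (h + x) - f x) @[h --> 0^'] --> d.
    case: fd => dv <-; have := dv; rewrite /derivable /derive.
    have -> : (fun h : R => h^-1 *: (f (h *: (1 : R) + x) - f x)) = (fun h => h^-1 *: (f (h + x) - f x)).
      by apply/funext => h; rewrite /GRing.scale /= mulr1.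
    by [].
  rewrite near_withinE near_simpl => /nbhs_ballP[r /= r0 Hr].
  exists r => // h hr; have [->|h0] := eqVneq h 0.
    by rewrite addr0 subrr mulr0 subr0 normr0 mulr0.
  have := Hr h; rewrite /ball /= sub0r normrN => /(_ hr h0).
  have -> : d - h^-1 *: (f (h + x) - f x) = - h^-1 * (f (x + h) - f x - d * h).
    by rewrite /GRing.scale /= (addrC x); field.
  by rewrite normrM normrN normfV mulrC ler_pdivrMr ?normr_gt0.
have cv : h^-1 *: (f (h *: (1 : R) + x) - f x) @[h --> (0 : R)^'] --> d.
  apply/cvgrPdist_le => e e0; have [r r0 Hr] := H e e0.
  rewrite near_withinE; apply/nbhs_ballP; exists r => //= h.
  rewrite /ball /= sub0r normrN => hr h0.
  have := Hr h hr; rewrite -ler_pdivrMr ?normr_gt0 // => /(le_trans _); apply.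
  rewrite -normfV -normrM -normrN le_eqVlt; apply/orP; left; apply/eqP; congr (`| _ |).
  by rewrite /GRing.scale /= mulr1 (addrC h); field.
by apply: DeriveDef; [apply/cvg_ex; exists d | apply/cvg_lim].
Qed.

Lemma is_derive_shiftP f x d :
  is_derive x (1 : R) f d <-> is_derive (0 : R) (1 : R) (fun t => f (x + t)) d.
Proof.
by rewrite !is_derive_epsP; split=> H e /H[r r0 Hr]; exists r => // h /Hr;
  rewrite add0r addr0.
Qed.

Lemma is_derive_near f g x d r : 0 < r -> (forall y, `|y - x| < r -> f y = g y) ->
  is_derive x (1 : R) f d -> is_derive x (1 : R) g d.
Proof.
rewrite !is_derive_epsP => r0 fg H e /H[r' r'0 Hr].
exists (Num.min r r') => [|h]; first by rewrite lt_min r0.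
rewrite lt_min => /andP[h1 h2]; rewrite -!fg ?Hr ?subrr ?normr0 //.
by rewrite addrC addKr.
Qed.

(** Locating t by its absolute value covers both signs of h at once. *)
Lemma MVT_abs f df h :
  (forall t, `|t| <= `|h| -> is_derive t (1 : R) f (df t)) ->
  exists2 t, `|t| <= `|h| & f h - f 0 = df t * h.
Proof.
move=> H; have dH a b : (forall t, a <= t <= b -> `|t| <= `|h|) -> a <= b ->
    exists2 t, `|t| <= `|h| & f b - f a = df t * (b - a).
  move=> ab le_ab; have [| |t] := @MVT_segment R f df a b le_ab.
  - by move=> x; rewrite in_itv /= => /andP[/ltW x0 /ltW x1]; apply/H/ab/andP.
  - apply: derivable_within_continuous => x; rewrite in_itv /= => /ab Hx.
    by have [] := H x Hx.
  - by rewrite in_itv /= => /ab ? ->; exists t.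
have [h0|h0] := leP 0 h.
  have [|t ? ->] := dH 0 h _ h0; last by exists t; rewrite ?subr0.
  by move=> t /andP[t0 t1]; rewrite !ger0_norm.
have [|t ? E] := dH h 0 _ (ltW h0); last first.
- by exists t; rewrite // -opprB E sub0r mulrN opprK.
- by move=> t /andP[t0 t1]; rewrite !ler0_norm ?lerN2 // ltW.
Qed.

Lemma is_derive_monomial n x : is_derive x (1 : R)
  (fun t : R => t ^+ n.+1 / n.+1`!%:R) (x ^+ n / n`!%:R).
Proof.
have D := is_deriveZ (n.+1`!%:R^-1) (is_deriveX n.+1 (is_derive_id x (1 : R))).
have {}D := is_derive_eq D (_ : _ = x ^+ n / n`!%:R); apply: (is_derive_near ltr01 _ (D _)) => [y _|].
  by rewrite /GRing.scale /= fctE mulrC.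
rewrite /GRing.scale /= mulr1 factS natrM.
have n0 : n`!%:R != 0 :> R by rewrite pnatr_eq0 -lt0n fact_gt0.
have n1 : n.+1%:R != 0 :> R by rewrite pnatr_eq0.
by rewrite invfM mulrACA mulVf // mul1r mulrC.
Qed.

(** Here [g l] is the derivative of order l and c approximates the one of order N. The remainder
    vanishes at 0 and its derivative is the remainder of [g 1] at order N - 1, so the mean value
    theorem and induction on N suffice. *)
Lemma taylor_bound (g : nat -> R -> R) r e c N :
  (forall l t, (l < N)%N -> `|t| < r -> is_derive t (1 : R) (g l) (g l.+1 t)) ->
  (forall t, `|t| < r -> `|g N t - c| <= e) ->
  forall t, `|t| < r ->
  `|g 0%N t - \sum_(j < N) g j 0 * (t ^+ j / j`!%:R) - c * (t ^+ N / N`!%:R)| <= e * `|t| ^+ N.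
Proof.
elim: N g => [|N IH] g dg gN t tr.
  by rewrite big_ord0 subr0 fact0 divr1 !mulr1 gN.
pose G t := g 0%N t - \sum_(j < N.+1) g j 0 * (t ^+ j / j`!%:R) - c * (t ^+ N.+1 / N.+1`!%:R).
pose G' t := g 1%N t - \sum_(j < N) g j.+1 0 * (t ^+ j / j`!%:R) - c * (t ^+ N / N`!%:R).
have dG x : `|x| <= `|t| -> is_derive x (1 : R) G (G' x).
  move=> xt; have D0 := dg 0%N x isT (le_lt_trans xt tr).
  have D1 : is_derive x (1 : R)
      (fun t => \sum_(j < N.+1) g j 0 * (t ^+ j / j`!%:R)) (\sum_(j < N) g j.+1 0 * (x ^+ j / j`!%:R)).
    have -> : (fun t : R => \sum_(j < N.+1) g j 0 * (t ^+ j / j`!%:R)) =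
        cst (g 0%N 0) \+ \sum_(j < N) (g j.+1 0 \*: (fun t : R => t ^+ j.+1 / j.+1`!%:R)).
      apply/funext => y; rewrite big_ord_recl /= fact0 divr1 mulr1; congr (_ + _).
      by rewrite fct_sumE.
    rewrite -[X in is_derive _ _ _ X]add0r.
    apply: is_deriveD; apply: is_derive_sum => j.
    exact: is_deriveZ (is_derive_monomial j x).
  exact: is_deriveB (is_deriveB D0 D1) (is_deriveZ c (is_derive_monomial N x)).
have [x xt] := MVT_abs dG.
have -> : G 0 = 0.
  rewrite /G big_ord_recl /= expr0 fact0 divr1 mulr1 big1 => [|j _].
    by rewrite addr0 subrr exprS !mul0r mulr0 subr0.
  by rewrite exprS !mul0r mulr0.
rewrite subr0 -/(G t) => ->; rewrite normrM exprSr mulrA ler_wpM2r //.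
have xr := le_lt_trans xt tr.
have e0 : 0 <= e by apply: le_trans (gN t tr).
have dg1 l y : (l < N)%N -> `|y| < r -> is_derive y (1 : R) (g l.+1) (g l.+2 y).
  by move=> lN; apply: dg.
apply: le_trans (IH (fun l => g l.+1) dg1 gN _ xr) _.
by rewrite ler_wpM2l // lerXn2r // nnegrE.
Qed.

End OneVariable.

(** * Open cubes as basic neighbourhoods in R^k *)

Section Cubes.
Variables (R : realType) (k : nat).
Implicit Types (u v a : 'rV[R]_k) (F G : 'rV[R]_k -> R) (W : set 'rV[R]_k).

(** Cubes replace norm balls because they also make sense for k = 0, where each cube is the whole
    space. *)
Definition cube a (d : R) : set 'rV[R]_k := [set u | forall i, `|u 0 i - a 0 i| < d].

Lemma cube_center a d : 0 < d -> cube a d a.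
Proof. by move=> d0 i; rewrite subrr normr0. Qed.

Lemma sub_cube a d d' : d <= d' -> cube a d `<=` cube a d'.
Proof. by move=> dd u H i; apply: lt_le_trans dd. Qed.

Lemma nbhs_cubeP a (A : set 'rV[R]_k) :
  nbhs a A <-> exists2 d, 0 < d & cube a d `<=` A.
Proof.
rewrite nbhs_ballP; split=> -[d d0 H]; exists d => // v Hv; apply: H.
  by split=> // i j; rewrite ord1 /ball /= distrC.
by case: Hv => _ Hv i; have := Hv 0 i; rewrite /ball /= distrC.
Qed.

Lemma open_cubeP W : open W <-> forall a, W a -> exists2 d, 0 < d & cube a d `<=` W.
Proof.
by rewrite openE; split=> H a Wa; have := H a Wa; rewrite /interior nbhs_cubeP.
Qed.

Lemma cont_cubeP F a : {for a, continuous F} <->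
  forall e, 0 < e -> exists2 d, 0 < d & forall v, cube a d v -> `|F v - F a| < e.
Proof.
have cvE : (F @ a --> F a) <-> forall e, 0 < e -> \forall v \near a, `|F a - F v| < e.
  exact: (@cvgrPdist_lt _ _ _ (nbhs a) (nbhs_filter a) F (F a)).
apply: (iff_trans cvE); split=> H e e0.
  have /nbhs_cubeP[d d0 Hd] := H e e0.
  by exists d => // v /Hd /=; rewrite distrC.
have [d d0 Hd] := H e e0.
by apply/nbhs_cubeP; exists d => // v /Hd; rewrite distrC.
Qed.

Lemma ex_common_radius (P : 'I_k -> R -> Prop) :
  (forall i d d', d' <= d -> P i d -> P i d') ->
  (forall i, exists2 d, 0 < d & P i d) -> exists2 d, 0 < d & forall i, P i d.
Proof.
move=> mono H; have {}H i : exists d, 0 < d /\ P i d by have [d] := H i; exists d.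
have [d dP] := choice H.
(* The neutral value 1 keeps the minimum positive when k = 0. *)
exists (\big[Num.min/1]_i d i).
  by apply: lt_bigmin => // i _; case: (dP i).
move=> i; apply: (mono i (d i)) => //; last by case: (dP i).
exact: bigmin_le.
Qed.

Lemma open_cube a d : open (cube a d).
Proof.
apply/open_cubeP => u au.
have [||r r0 Hr] := @ex_common_radius (fun i r => r <= d - `|u 0 i - a 0 i|).
- by move=> i d1 d2; apply: le_trans.
- by move=> i; exists (d - `|u 0 i - a 0 i|); rewrite // subr_gt0.
exists r => // v uv i; have := lt_le_trans (uv i) (Hr i).
rewrite ltrBrDr; apply: le_lt_trans.
by rewrite -(subrKA (u 0 i)) ler_normD.
Qed.

End Cubes.

(** * Functions of class C^m on open subsets of R^k *)

Section DifferentiableFunctions.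
Variable R : realType.

Section Lines.
Variable k : nat.
Implicit Types (u v a : 'rV[R]_k) (F G : 'rV[R]_k -> R) (W : set 'rV[R]_k).

Lemma lineE u i j (t : R) : (u + t *: delta_mx 0 i) 0 j = u 0 j + t *+ (j == i).
Proof. by rewrite !mxE eqxx /= eq_sym mulr_natr. Qed.

Lemma cube_line a d i t u : cube a d u -> `|u 0 i + t - a 0 i| < d ->
  cube a d (u + t *: delta_mx 0 i).
Proof.
by move=> au ti j; rewrite lineE; case: eqVneq => [->|_]; rewrite ?addr0.
Qed.

Lemma line_in W u i : open W -> W u ->
  exists2 d, 0 < d & forall t, `|t| < d -> W (u + t *: delta_mx 0 i).
Proof.
move=> /open_cubeP oW /oW[d d0 Wd]; exists d => // t td; apply/Wd/cube_line.
  exact: cube_center.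
by rewrite addrAC subrr add0r.
Qed.

Lemma partial_eq F i u (d : R) :
  is_derive (0 : R) (1 : R) (fun t : R => F (u + t *: delta_mx 0 i)) d -> partial i F u = d.
Proof. by move=> H; rewrite /partial derive1E derive_val. Qed.

Lemma Ck_cont W m F u : Ck W m F -> W u -> {for u, continuous F}.
Proof. by case: m => [|m] [H _]; apply: H. Qed.

Lemma CkS W m F i : Ck W m.+1 F -> Ck W m (partial i F).
Proof. by case=> _ /(_ i)[]. Qed.

Lemma Ck_partial W m F i u : Ck W m.+1 F -> W u ->
  is_derive (0 : R) (1 : R) (fun t : R => F (u + t *: delta_mx 0 i)) (partial i F u).
Proof.
by case=> _ /(_ i)[H _] /H/derivableP; rewrite /partial derive1E.
Qed.

Lemma Ck_partial_at W m F i u (t : R) : Ck W m.+1 F -> W (u + t *: delta_mx 0 i) ->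
  is_derive t (1 : R) (fun t : R => F (u + t *: delta_mx 0 i))
    (partial i F (u + t *: delta_mx 0 i)).
Proof.
move=> CF /(Ck_partial i CF) H; apply/is_derive_shiftP.
by under eq_fun do rewrite scalerDl addrA.
Qed.

Lemma Ck_pred W m F : Ck W m.+1 F -> Ck W m F.
Proof.
elim: m F => [|m IH] F [c H]; split=> // i; have [d C] := H i; split=> //.
exact: IH.
Qed.

Lemma Ck_sub W W' m F : W' `<=` W -> Ck W m F -> Ck W' m F.
Proof.
move=> WW; elim: m F => [|m IH] F [c H]; (split; first by move=> u /WW/c) => // i.
by have [d C] := H i; split=> [u /WW/d|] //; apply: IH.
Qed.

Lemma cont_near F G u d : 0 < d -> (forall v, cube u d v -> F v = G v) ->
  {for u, continuous F} -> {for u, continuous G}.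
Proof.
move=> d0 FG /cont_cubeP H; apply/cont_cubeP => e /H[r r0 Hr].
exists (Num.min d r); rewrite ?lt_min ?d0 // => v uv.
have [dv rv] : cube u d v /\ cube u r v.
  by split; apply: sub_cube uv; rewrite ge_min lexx ?orbT.
by rewrite -(FG v dv) -(FG u (cube_center u d0)); apply: Hr.
Qed.

Lemma line_near F G u d i (l : R) : 0 < d -> (forall v, cube u d v -> F v = G v) ->
  is_derive (0 : R) (1 : R) (fun t : R => F (u + t *: delta_mx 0 i)) l ->
  is_derive (0 : R) (1 : R) (fun t : R => G (u + t *: delta_mx 0 i)) l.
Proof.
move=> d0 FG; apply: (is_derive_near d0) => t; rewrite subr0 => td.
apply/FG/cube_line; first exact: cube_center.
by rewrite addrAC subrr add0r.
Qed.

(** [Ck] mentions [partial i F] itself, which is prescribed only on W; a formula dF may differ from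
    it elsewhere. The inner statement [ext], that [Ck] on an open W sees only the values on W,
    bridges the gap. *)
Lemma Ck_intro W m F (dF : 'I_k -> 'rV[R]_k -> R) : open W ->
  (forall u, W u -> {for u, continuous F}) ->
  (forall i u, W u ->
    is_derive (0 : R) (1 : R) (fun t : R => F (u + t *: delta_mx 0 i)) (dF i u)) ->
  (forall i, Ck W m (dF i)) -> Ck W m.+1 F.
Proof.
have ext n F1 F2 : open W -> (forall u, W u -> F1 u = F2 u) -> Ck W n F1 -> Ck W n F2.
  move=> /open_cubeP oW.
  elim: n F1 F2 => [|n IH] F1 F2 E [c1 H]; (split; first by move=> u Wu;
      have [d d0 Wd] := oW u Wu; apply: (cont_near d0 _ (c1 u Wu)) => v /Wd/E) => // i.
  have [D C] := H i.
  have D2 u : W u -> is_derive (0 : R) (1 : R)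
      (fun t : R => F2 (u + t *: delta_mx 0 i)) (partial i F1 u).
    move=> Wu; have [d d0 Wd] := oW u Wu.
    apply: (@line_near F1 F2 u d i _ d0); first by move=> v /Wd/E.
    by have /derivableP := D u Wu; rewrite /partial derive1E.
  split=> [u /D2[]//|]; apply: IH C => u Wu.
  by rewrite (partial_eq (D2 u Wu)).
move=> oW c D C; split=> // i; split=> [u /(D i)[]//|].
apply: ext (C i) => // u Wu.
by rewrite (partial_eq (D i u Wu)).
Qed.

Lemma Ck_ext W m F G : open W -> (forall u, W u -> F u = G u) -> Ck W m F -> Ck W m G.
Proof.
move=> oW FG CF; have /open_cubeP oW' := oW.
have cG u : W u -> {for u, continuous G}.
  move=> Wu; have [d d0 Wd] := oW' u Wu.
  by apply: (cont_near d0 _ (Ck_cont CF Wu)) => v /Wd/FG.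
case: m CF => [|m] CF; first by split.
apply: (Ck_intro oW cG (dF := fun i => partial i F)) => i; last exact: CkS.
move=> u Wu; have [d d0 Wd] := oW' u Wu.
by apply: (line_near d0 _ (Ck_partial i CF Wu)) => v /Wd/FG.
Qed.

(** The difference quotients agree for small t, so the limits agree whether or not they exist. *)
Lemma partial_local F G u d i : 0 < d -> (forall v, cube u d v -> F v = G v) ->
  partial i F u = partial i G u.
Proof.
move=> d0 FG; rewrite /partial !derive1E; apply: near_eq_derive.
apply/nbhs_ballP; exists d => // t /=; rewrite /ball /= sub0r normrN => td.
apply/FG/cube_line; first exact: cube_center.
by rewrite addrAC subrr add0r.
Qed.

Lemma Ck_local W m F : open W ->
  (forall u, W u -> exists W' F', [/\ open W', W' u, Ck W' m F' & forall v, W' v -> F v = F' v]) ->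
  Ck W m F.
Proof.
move=> oW; elim: m F => [|m IH] F H.
  split=> // u /H[W' [F' [/open_cubeP oW' Wu C E]]].
  have [d d0 Wd] := oW' u Wu.
  by apply: (cont_near d0 _ (Ck_cont C Wu)) => v /Wd/E.
apply: (Ck_intro oW (dF := fun i => partial i F)).
- move=> u /H[W' [F' [/open_cubeP oW' Wu C E]]].
  have [d d0 Wd] := oW' u Wu.
  by apply: (cont_near d0 _ (Ck_cont C Wu)) => v /Wd/E.
- move=> i u /H[W' [F' [/open_cubeP oW' Wu C E]]].
  have [d d0 Wd] := oW' u Wu.
  rewrite (@partial_local _ F' _ d) //; last by move=> v /Wd/E.
  by apply: (line_near d0 _ (Ck_partial i C Wu)) => v /Wd/E.
- move=> i; apply: IH => u /H[W' [F' [oW' Wu C E]]].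
  exists W', (partial i F'); split=> //; first exact: CkS.
  have /open_cubeP oW'' := oW'; move=> v Wv; have [d d0 Wd] := oW'' v Wv.
  by apply: (partial_local _ d0) => w /Wd/E.
Qed.

Lemma cont_cst u (c : R) : {for u, continuous (fun _ : 'rV[R]_k => c)}.
Proof. by apply/cont_cubeP => e e0; exists 1 => // v _; rewrite subrr normr0. Qed.

Lemma contD F G u : {for u, continuous F} -> {for u, continuous G} ->
  {for u, continuous (fun v => F v + G v)}.
Proof. exact: (@cvgD _ _ _ (nbhs u) (nbhs_filter u) F G). Qed.

Lemma contM F G u : {for u, continuous F} -> {for u, continuous G} ->
  {for u, continuous (fun v => F v * G v)}.
Proof. exact: (@cvgM _ _ (nbhs u) (nbhs_filter u) F G). Qed.

Lemma contV F u : F u != 0 -> {for u, continuous F} ->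
  {for u, continuous (fun v => (F v)^-1)}.
Proof. exact: (@cvgV _ _ (nbhs u) (nbhs_filter u) F). Qed.

Lemma Ck_cst W m (c : R) : open W -> Ck W m (fun=> c).
Proof.
move=> oW; elim: m c => [|m IH] c; first by split=> // *; apply: cont_cst.
apply: (Ck_intro oW (dF := fun _ _ => 0)) => [u _|i u _|i] //.
  exact: cont_cst.
exact: is_derive_cst.
Qed.

Lemma cont_coord (i : 'I_k) u : {for u, continuous (fun v : 'rV[R]_k => v 0 i)}.
Proof. by apply/cont_cubeP => e e0; exists e. Qed.

Lemma is_derive_coord (i j : 'I_k) u :
  is_derive (0 : R) (1 : R) (fun t : R => (u + t *: delta_mx 0 i) 0 j) ((j == i)%:R).
Proof.
apply/is_derive_epsP => e e0; exists 1 => // h _; rewrite !lineE mul0rn addr0 add0r mulr_natl.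
by rewrite (addrC (u 0 j)) addrK subrr normr0 mulr_ge0 // ltW.
Qed.

Lemma Ck_coord W m (i : 'I_k) : open W -> Ck W m (fun v => v 0 i).
Proof.
move=> oW; case: m => [|m]; first by split=> // u _; apply: cont_coord.
apply: (Ck_intro oW (dF := fun j _ => (i == j)%:R)) => [u _|j u _|j].
- exact: cont_coord.
- exact: is_derive_coord.
- exact: Ck_cst.
Qed.

Lemma CkD W m F G : open W -> Ck W m F -> Ck W m G -> Ck W m (fun u => F u + G u).
Proof.
move=> oW; elim: m F G => [|m IH] F G CF CG.
  by split=> // u Wu; apply: contD (Ck_cont CF Wu) (Ck_cont CG Wu).
apply: (Ck_intro oW (dF := fun i u => partial i F u + partial i G u)) => [u Wu|i u Wu|i].
- exact: contD (Ck_cont CF Wu) (Ck_cont CG Wu).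
- exact: is_deriveD (Ck_partial i CF Wu) (Ck_partial i CG Wu).
- by apply: IH; apply: CkS.
Qed.

Lemma CkM W m F G : open W -> Ck W m F -> Ck W m G -> Ck W m (fun u => F u * G u).
Proof.
move=> oW; elim: m F G => [|m IH] F G CF CG.
  by split=> // u Wu; apply: contM (Ck_cont CF Wu) (Ck_cont CG Wu).
apply: (Ck_intro oW (dF := fun i u => F u * partial i G u + G u * partial i F u)) => [u Wu|i u Wu|i].
- exact: contM (Ck_cont CF Wu) (Ck_cont CG Wu).
- have dF := Ck_partial i CF Wu; have dG := Ck_partial i CG Wu.
  by have := is_deriveM dF dG; rewrite scale0r addr0.
- by apply: CkD => //; apply: IH; rewrite //; [apply: Ck_pred|apply: CkS|apply: Ck_pred|apply: CkS].
Qed.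

Lemma Ck_sum W m n (F : 'I_n -> 'rV[R]_k -> R) : open W -> (forall i, Ck W m (F i)) ->
  Ck W m (fun u => \sum_i F i u).
Proof.
move=> oW CF; elim: n F CF => [|n IH] F CF.
  by apply: Ck_ext (Ck_cst m 0 oW) => // u _; rewrite big_ord0.
apply: (@Ck_ext _ _ (fun u => F ord0 u + \sum_(i < n) F (lift ord0 i) u)) => //.
  by move=> u _; rewrite big_ord_recl.
by apply: CkD => //; apply: IH => i.
Qed.

Lemma Ck_inv W m F : open W -> (forall u, W u -> F u != 0) -> Ck W m F ->
  Ck W m (fun u => (F u)^-1).
Proof.
move=> oW F0; elim: m F F0 => [|m IH] F F0 CF.
  by split=> // u Wu; apply: contV (F0 u Wu) (Ck_cont CF Wu).
apply: (Ck_intro oW (dF := fun i u => (- 1) * ((F u)^-1 * (F u)^-1) * partial i F u)) => [u Wu|i u Wu|i].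
- exact: contV (F0 u Wu) (Ck_cont CF Wu).
- have F0u : (fun t : R => F (u + t *: delta_mx 0 i)) 0 != 0 by rewrite scale0r addr0 F0.
  have := is_deriveV F0u (Ck_partial i CF Wu).
  by rewrite scale0r addr0 /GRing.scale /= expr2 invfM mulN1r.
- have CV : Ck W m (fun u => (F u)^-1) by apply: IH => //; apply: Ck_pred.
  apply: CkM (CkS i CF) => //; apply: CkM => //; first exact: Ck_cst.
  exact: CkM.
Qed.

End Lines.
End DifferentiableFunctions.

(** * Total differentiability, the chain rule and composition *)

Section Composition.
Variable R : realType.

(** Passing from u to v one coordinate at a time, each increment is a partial derivative at an
    intermediate point of the cube, and continuity of the partial derivatives at u bounds the
    error. *)
Lemma frechet k (W : set 'rV[R]_k) F u : open W -> Ck W 1 F -> W u ->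
  forall e, 0 < e -> exists2 d, 0 < d & forall v, cube u d v ->
    `|F v - F u - \sum_i partial i F u * (v 0 i - u 0 i)| <= e * \sum_i `|v 0 i - u 0 i|.
Proof.
move=> oW CF Wu e e0; have /open_cubeP/(_ u Wu)[d1 d10 W1] := oW.
have [||d2 d20 H2] := @ex_common_radius R k (fun i d => forall v, cube u d v ->
    `|partial i F v - partial i F u| <= e).
- by move=> i d d' dd H v /(sub_cube dd)/H.
- move=> i; have /cont_cubeP/(_ e e0)[d d0 H] := Ck_cont (CkS i CF) Wu.
  by exists d => // v /H/ltW.
exists (Num.min d1 d2) => [|v]; first by rewrite lt_min d10.
set d := Num.min d1 d2 => vd.
have d0 : 0 < d by rewrite lt_min d10.
pose w j : 'rV[R]_k := \row_i (if (i < j)%N then v 0 i else u 0 i).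
have wd j : cube u d (w j).
  by move=> i; rewrite mxE; case: ifP => // _; rewrite subrr normr0.
have wS (j : 'I_k) : w j.+1 = w j + (v 0 j - u 0 j) *: delta_mx 0 j.
  apply/rowP => i; rewrite lineE !mxE ltnS leq_eqVlt.
  case: eqVneq => [ij|ij].
    have -> : i = j by apply: val_inj.
    by rewrite ltnn eqxx mulr1n addrC subrK.
  have -> : (i == j) = false by apply/eqP => E; rewrite E eqxx in ij.
  by rewrite addr0.
have step (j : 'I_k) : `|F (w j.+1) - F (w j) - partial j F u * (v 0 j - u 0 j)|
    <= e * `|v 0 j - u 0 j|.
  set h := v 0 j - u 0 j.
  have cu (t : R) : `|t| <= `|h| -> cube u d (w j + t *: delta_mx 0 j).
    move=> th; apply: cube_line => //; rewrite mxE ltnn addrAC subrr add0r.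
    exact: le_lt_trans th (vd j).
  have [|t th] := @MVT_abs R (fun t => F (w j + t *: delta_mx 0 j))
      (fun t => partial j F (w j + t *: delta_mx 0 j)) h.
    move=> t th; apply: Ck_partial_at CF _; apply: W1.
    by apply: sub_cube (cu t th); rewrite ge_min lexx.
  rewrite scale0r addr0 -wS => ->; rewrite -mulrBl normrM ler_wpM2r //.
  by apply: H2; apply: sub_cube (cu t th); rewrite ge_min lexx orbT.
have -> : F v - F u = \sum_(j < k) (F (w j.+1) - F (w j)).
  rewrite -(big_mkord xpredT (fun j => F (w j.+1) - F (w j))) telescope_sumr //.
  by congr (F _ - F _); apply/rowP => i; rewrite !mxE ?ltn_ord.
rewrite -sumrB; apply: le_trans (ler_norm_sum _ _ _) _.
by rewrite mulr_sumr; apply: ler_sum => j _; apply: step.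
Qed.

Lemma chain_rule l (O : set 'rV[R]_l) F (c : 'I_l -> R -> R) (dc : 'I_l -> R) x :
  open O -> Ck O 1 F -> O (\row_i c i x) ->
  (forall i, is_derive x (1 : R) (c i) (dc i)) ->
  is_derive x (1 : R) (fun t => F (\row_i c i t))
    (\sum_i partial i F (\row_i c i x) * dc i).
Proof.
move=> oO CF Ox D; apply/is_derive_epsP => e e0.
set u := \row_i c i x in Ox *.
pose A := 1 + \sum_i `|partial i F u|; pose B := 1 + \sum_i (`|dc i| + 1).
have A0 : 0 < A by rewrite ltr_wpDr // sumr_ge0.
have B0 : 0 < B by rewrite ltr_wpDr // sumr_ge0 // => i _; rewrite addr_ge0.
(* A bounds the gradient of F and B the speed of the curve; [e1] controls the linearisation of F and
   [e2] that of the curve, each contributing at most e / 2. The bound 1 in [e2] makes the increment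
   of [c i] at most (|dc i| + 1)|h|. *)
pose e2 := Num.min 1 (e / (2 * A)); pose e1 := e / (2 * B).
have e20 : 0 < e2 by rewrite lt_min ltr01 divr_gt0 // mulr_gt0.
have e10 : 0 < e1 by rewrite divr_gt0 // mulr_gt0.
have [d d0 Hd] := frechet oO CF Ox e10.
have [||r r0 Hr] := @ex_common_radius R l (fun i r => forall h, `|h| < r ->
    `|c i (x + h) - c i x - dc i * h| <= e2 * `|h| /\ `|c i (x + h) - c i x| < d).
- by move=> i r r' rr H h hr; apply: H; apply: lt_le_trans rr.
- move=> i; have := D i; rewrite is_derive_epsP => Di.
  have [r r0 H] := Di e2 e20.
  pose s := Num.min r (d / (`|dc i| + 1 + 1)).
  have C0 : 0 < `|dc i| + 1 + 1 by rewrite addr_gt0 // ltr_wpDl.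
  exists s => [|h]; first by rewrite lt_min r0 divr_gt0.
  rewrite lt_min => /andP[/H Hh hs]; split=> //.
  have -> : c i (x + h) - c i x = (c i (x + h) - c i x - dc i * h) + dc i * h by rewrite subrK.
  apply: le_lt_trans (ler_normD _ _) _.
  have h2 : e2 * `|h| <= 1 * `|h| by rewrite ler_wpM2r // ge_min lexx.
  apply: le_lt_trans (_ : (`|dc i| + 1 + 1) * `|h| < _); last first.
    by rewrite mulrC -ltr_pdivlMr.
  by have h0 : 0 <= `|h| := normr_ge0 h; rewrite normrM; nra.
exists r => // h hr; have Hh i := Hr i h hr.
have cE i : (\row_i c i (x + h)) 0 i - u 0 i = c i (x + h) - c i x by rewrite !mxE.
have /Hd : cube u d (\row_i c i (x + h)) by move=> i; rewrite cE; case: (Hh i).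
under eq_bigr do rewrite cE; under [in X in _ <= X]eq_bigr do rewrite cE.
set S1 := \sum_i partial i F u * (c i (x + h) - c i x); set S2 := \sum_i `|_| => H.
have H2 : S2 <= B * `|h|.
  rewrite mulrDl mul1r ler_wpDl // mulr_suml; apply: ler_sum => i _.
  have [K _] := Hh i.
  have -> : c i (x + h) - c i x = (c i (x + h) - c i x - dc i * h) + dc i * h by rewrite subrK.
  apply: le_trans (ler_normD _ _) _.
  have h2 : e2 * `|h| <= 1 * `|h| by rewrite ler_wpM2r // ge_min lexx.
  by have h0 : 0 <= `|h| := normr_ge0 h; rewrite normrM; nra.
have H1 : `|S1 - (\sum_i partial i F u * dc i) * h| <= A * (e2 * `|h|).
  rewrite mulr_suml -sumrB; apply: le_trans (ler_norm_sum _ _ _) _.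
  rewrite mulrDl mul1r ler_wpDl // ?mulr_ge0 // ?(ltW e20) // mulr_suml.
  apply: ler_sum => i _; rewrite -mulrA -mulrBr normrM ler_wpM2l //.
  by have [] := Hh i.
have eA : A * e2 <= e / 2.
  have : e2 <= e / (2 * A) by rewrite ge_min lexx orbT.
  by rewrite invfM mulrA ler_pdivlMr // mulrC.
have eB : e1 * B = e / 2 by rewrite /e1; field; rewrite gt_eqF.
have -> : F (\row_i c i (x + h)) - F u - (\sum_i partial i F u * dc i) * h =
   (F (\row_i c i (x + h)) - F u - S1) + (S1 - (\sum_i partial i F u * dc i) * h).
  by rewrite addrA subrK.
apply: le_trans (ler_normD _ _) _.
have h0 : 0 <= `|h| by [].
have H3 : e1 * S2 <= e1 * (B * `|h|) by rewrite ler_pM2l.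
have H4 : (A * e2) * `|h| <= (e / 2) * `|h| by rewrite ler_wpM2r.
rewrite [e](splitr e) mulrDl lerD //.
  by apply: le_trans H _; apply: le_trans H3 _; rewrite mulrA eB.
by apply: le_trans H1 _; rewrite mulrA.
Qed.

Lemma cont_comp k l (F : 'rV[R]_l -> R) (G : 'I_l -> 'rV[R]_k -> R) u :
  (forall i, {for u, continuous (G i)}) -> {for \row_i G i u, continuous F} ->
  {for u, continuous (fun v => F (\row_i G i v))}.
Proof.
move=> cG /cont_cubeP cF; apply/cont_cubeP => e /cF[d d0 Hd].
have [||r r0 Hr] := @ex_common_radius R l (fun i r => forall v, cube u r v ->
   `|G i v - G i u| < d).
- by move=> i r r' rr H v /(sub_cube rr)/H.
- by move=> i; have /cont_cubeP/(_ d d0) := cG i.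
by exists r => // v /Hr H; apply: Hd => i; rewrite !mxE.
Qed.

Lemma Ck_comp k l m (W : set 'rV[R]_k) (O : set 'rV[R]_l) F (G : 'I_l -> 'rV[R]_k -> R) :
  open W -> open O -> (forall u, W u -> O (\row_i G i u)) ->
  Ck O m F -> (forall i, Ck W m (G i)) -> Ck W m (fun u => F (\row_i G i u)).
Proof.
move=> oW oO WO; elim: m F => [|m IH] F CF CG.
  split=> // u Wu; apply: cont_comp; last exact: (Ck_cont CF (WO _ Wu)).
  by move=> i; apply: Ck_cont (CG i) Wu.
apply: (Ck_intro oW (dF := fun j u =>
   \sum_i partial i F (\row_i G i u) * partial j (G i) u)) => [u Wu|j u Wu|j].
- apply: cont_comp; last exact: (Ck_cont CF (WO _ Wu)).
  by move=> i; apply: Ck_cont (CG i) Wu.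
- have E : \row_i G i u = \row_i G i (u + 0 *: delta_mx 0 j).
    by apply/rowP => i; rewrite !mxE scale0r addr0.
  rewrite [in X in is_derive _ _ _ X]E.
  apply: (@chain_rule _ O F (fun i t => G i (u + t *: delta_mx 0 j))) => //.
  + have [Cc C1] := CF; split; first exact: Cc.
    move=> i; have [Hd C] := C1 i; split; first exact: Hd.
    by split; [move=> v Ov; exact: Ck_cont C Ov|exact: I].
  + by rewrite -E; apply: WO.
  + by move=> i; apply: Ck_partial (CG i) Wu.
- apply: Ck_sum => // i; apply: CkM => //; last exact: CkS.
  by apply: IH => [|i']; [apply: CkS|apply: Ck_pred].
Qed.

(** The sequence [phi] lists a function of one variable with all its derivatives; the lemma serves
    functions such as exp(-1/x) whose derivatives are known in closed form. *)
Lemma Ck_tower k m (W : set 'rV[R]_k) (phi : nat -> R -> R) l G :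
  open W -> (forall l t, is_derive t (1 : R) (phi l) (phi l.+1 t)) ->
  Ck W m G -> Ck W m (fun u => phi l (G u)).
Proof.
move=> oW D CG.
have c n G1 u : {for u, continuous G1} -> {for u, continuous (fun u : 'rV[R]_k => phi n (G1 u))}.
  move=> cG; have cphi : {for G1 u, continuous (phi n)}.
    by apply/differentiable_continuous/derivable1_diffP; case: (D n (G1 u)).
  move/cont_cubeP: cG => cG; apply/cont_cubeP => e e0.
  move/cvgrPdist_lt/(_ e e0)/nbhs_ballP : cphi => [d d0 Hd].
  have [r r0 Hr] := cG d d0; exists r => // v /Hr H.
  by rewrite distrC; apply: Hd; rewrite /ball /= distrC.
elim: m l G CG => [|m IH] l G CG.
  by split=> // u Wu; apply/c/(Ck_cont CG Wu).
apply: (Ck_intro oW (dF := fun j u => phi l.+1 (G u) * partial j G u)) => [u Wu|j u Wu|j].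
- by apply/c/(Ck_cont CG Wu).
- have := D l (G (u + 0 *: delta_mx 0 j)) => Dl.
  have := @is_derive1_comp R (phi l) (fun t => G (u + t *: delta_mx 0 j)) 0 _ _ Dl
     (Ck_partial j CG Wu).
  by rewrite scale0r addr0.
- by apply: CkM => //; [apply: IH; apply: Ck_pred|apply: CkS].
Qed.

Lemma partial_comp k l (W : set 'rV[R]_k) (O : set 'rV[R]_l) F
    (G : 'I_l -> 'rV[R]_k -> R) j u :
  open O -> W u -> O (\row_i G i u) -> Ck O 1 F -> (forall i, Ck W 1 (G i)) ->
  partial j (fun u => F (\row_i G i u)) u =
  \sum_i partial i F (\row_i G i u) * partial j (G i) u.
Proof.
move=> oO Wu Ou CF CG; apply: partial_eq.
have E : \row_i G i u = \row_i G i (u + 0 *: delta_mx 0 j).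
  by apply/rowP => i; rewrite !mxE scale0r addr0.
rewrite [in X in is_derive _ _ _ X]E.
apply: (@chain_rule _ O F (fun i t => G i (u + t *: delta_mx 0 j))) => //.
  by rewrite -E.
by move=> i; apply: Ck_partial (CG i) Wu.
Qed.

End Composition.

(** * Smooth functions, symmetry of second derivatives, quotients by powers of a coordinate *)

Section SmoothFunctions.
Variables (R : realType) (k : nat).
Implicit Types (u v a : 'rV[R]_k) (F G : 'rV[R]_k -> R) (W : set 'rV[R]_k).

Lemma Cinf_cont W F u : Cinf W F -> W u -> {for u, continuous F}.
Proof. by move=> C; apply: Ck_cont (C 0%N). Qed.
Lemma Cinf_partial W F i : Cinf W F -> Cinf W (partial i F).
Proof. by move=> C m; apply: CkS. Qed.
Lemma Cinf_is_derive W F i u : Cinf W F -> W u ->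
  is_derive (0 : R) (1 : R) (fun t : R => F (u + t *: delta_mx 0 i)) (partial i F u).
Proof. by move=> C; apply: Ck_partial (C 1%N). Qed.
Lemma Cinf_sub W W' F : W' `<=` W -> Cinf W F -> Cinf W' F.
Proof. by move=> WW C m; apply: Ck_sub (C m). Qed.
Lemma Cinf_ext W F G : open W -> (forall u, W u -> F u = G u) -> Cinf W F -> Cinf W G.
Proof. by move=> oW E C m; apply: Ck_ext (C m). Qed.
Lemma Cinf_cst W (c : R) : open W -> Cinf W (fun=> c).
Proof. by move=> oW m; apply: Ck_cst. Qed.
Lemma Cinf_coord W i : open W -> Cinf W (fun v => v 0 i).
Proof. by move=> oW m; apply: Ck_coord. Qed.
Lemma CinfD W F G : open W -> Cinf W F -> Cinf W G -> Cinf W (fun u => F u + G u).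
Proof. by move=> oW CF CG m; apply: CkD. Qed.
Lemma CinfM W F G : open W -> Cinf W F -> Cinf W G -> Cinf W (fun u => F u * G u).
Proof. by move=> oW CF CG m; apply: CkM. Qed.
Lemma CinfZ W F c : open W -> Cinf W F -> Cinf W (fun u => c * F u).
Proof. by move=> oW CF; apply: CinfM => //; apply: Cinf_cst. Qed.
Lemma CinfB W F G : open W -> Cinf W F -> Cinf W G -> Cinf W (fun u => F u - G u).
Proof.
move=> oW CF CG; apply: CinfD => //.
by apply: Cinf_ext (CinfZ (-1) oW CG) => // u _; rewrite mulN1r.
Qed.
Lemma Cinf_sum W n (F : 'I_n -> 'rV[R]_k -> R) : open W -> (forall i, Cinf W (F i)) ->
  Cinf W (fun u => \sum_i F i u).
Proof. by move=> oW C m; apply: Ck_sum => // i; apply: C. Qed.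
Lemma Cinf_inv W F : open W -> (forall u, W u -> F u != 0) -> Cinf W F ->
  Cinf W (fun u => (F u)^-1).
Proof. by move=> oW F0 C m; apply: Ck_inv. Qed.
Lemma Cinf_local W F : open W ->
  (forall u, W u -> exists W' F',
     [/\ open W', W' u, Cinf W' F' & forall v, W' v -> F v = F' v]) -> Cinf W F.
Proof.
move=> oW H m; apply: Ck_local => // u /H[W' [F' [oW' Wu C E]]].
by exists W', F'; split=> //; apply: C.
Qed.
Lemma Cinf_comp l W (O : set 'rV[R]_l) (F : 'rV[R]_l -> R) (G : 'I_l -> 'rV[R]_k -> R) :
  open W -> open O -> (forall u, W u -> O (\row_i G i u)) ->
  Cinf O F -> (forall i, Cinf W (G i)) -> Cinf W (fun u => F (\row_i G i u)).
Proof. by move=> oW oO WO CF CG m; apply: Ck_comp WO (CF m) _ => // i; apply: CG. Qed.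

Lemma partialD F G W i u : Cinf W F -> Cinf W G -> W u ->
  partial i (fun u => F u + G u) u = partial i F u + partial i G u.
Proof.
move=> CF CG Wu; apply: partial_eq.
exact: is_deriveD (Cinf_is_derive i CF Wu) (Cinf_is_derive i CG Wu).
Qed.

Lemma partialM F G W i u : Cinf W F -> Cinf W G -> W u ->
  partial i (fun u => F u * G u) u = F u * partial i G u + G u * partial i F u.
Proof.
move=> CF CG Wu; apply: partial_eq.
have := is_deriveM (Cinf_is_derive i CF Wu) (Cinf_is_derive i CG Wu).
by rewrite scale0r addr0.
Qed.

Lemma partial_cst i (c : R) u : partial i (fun=> c) u = 0.
Proof. by apply: partial_eq; apply: is_derive_cst. Qed.

Lemma partialZ F W i (c : R) u : Cinf W F -> W u ->
  partial i (fun u => c * F u) u = c * partial i F u.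
Proof.
move=> CF Wu; apply: partial_eq; have := is_deriveZ c (Cinf_is_derive i CF Wu); exact.
Qed.

Lemma partial_coord i j u : partial i (fun u => u 0 j) u = (j == i)%:R.
Proof. by apply: partial_eq; apply: is_derive_coord. Qed.

Lemma partial_sum n (F : 'I_n -> 'rV[R]_k -> R) W i u : open W ->
  (forall j, Cinf W (F j)) -> W u ->
  partial i (fun u => \sum_j F j u) u = \sum_j partial i (F j) u.
Proof.
move=> oW CF Wu; elim: n F CF => [|n IH] F CF.
  rewrite big_ord0 -[RHS](partial_cst i 0 u); congr (partial i _ u).
  by apply/funext => v; rewrite big_ord0.
rewrite big_ord_recl -IH //.
rewrite -(partialD i (CF ord0) (Cinf_sum oW (fun j => CF (lift ord0 j))) Wu).
by congr (partial i _ u); apply/funext => v; rewrite big_ord_recl.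
Qed.

(** The mean value theorem is applied in direction i and then in direction j. When i = j the two
    displacements add up to as much as 2h, which the assumption 3h <= d keeps inside the cube. *)
Lemma second_difference W F i j u d h : Ck W 2 F -> cube u d `<=` W ->
  0 < h -> 3%:R * h <= d ->
  exists2 v, cube u d v &
    F (u + h *: delta_mx 0 j + h *: delta_mx 0 i) - F (u + h *: delta_mx 0 i) -
    (F (u + h *: delta_mx 0 j) - F u) = h * h * partial j (partial i F) v.
Proof.
move=> CF Wd h0 hd.
have d0 : 0 < d by apply: lt_le_trans hd; rewrite mulr_gt0.
have in_d (s t : R) : `|s| <= h -> `|t| <= h ->
    cube u d (u + s *: delta_mx 0 j + t *: delta_mx 0 i).
  move=> sh th l; rewrite !lineE.
  have -> : u 0 l + s *+ (l == j) + t *+ (l == i) - u 0 l = s *+ (l == j) + t *+ (l == i).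
    by ring.
  apply: le_lt_trans (ler_normD _ _) _.
  have bnd (x : R) (b : bool) : `|x| <= h -> `|x *+ b| <= h.
    by case: b => // _; rewrite normr0 ltW.
  by apply: le_lt_trans (lerD (bnd _ _ sh) (bnd _ _ th)) _; lra.
have hh : `|h| = h by rewrite ger0_norm // ltW.
have [|t th] := @MVT_abs R
    (fun t => F (u + h *: delta_mx 0 j + t *: delta_mx 0 i) - F (u + t *: delta_mx 0 i))
    (fun t => partial i F (u + h *: delta_mx 0 j + t *: delta_mx 0 i)
      - partial i F (u + t *: delta_mx 0 i)) h.
  rewrite hh => t th; apply: is_deriveB; apply: Ck_partial_at CF _; apply: Wd.
    by apply: in_d; rewrite ?hh.
  by have := in_d 0 t; rewrite scale0r addr0; apply=> //; rewrite normr0 ltW.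
rewrite !scale0r !addr0 => ->; rewrite hh in th.
have [|s sh] := @MVT_abs R
    (fun s => partial i F (u + t *: delta_mx 0 i + s *: delta_mx 0 j))
    (fun s => partial j (partial i F) (u + t *: delta_mx 0 i + s *: delta_mx 0 j)) h.
  rewrite hh => s sh; apply: Ck_partial_at (CkS i CF) _; apply: Wd.
  by rewrite addrAC; apply: in_d.
rewrite hh in sh; rewrite scale0r addr0 addrAC => ->.
exists (u + t *: delta_mx 0 i + s *: delta_mx 0 j); first by rewrite addrAC; apply: in_d.
by ring.
Qed.

Lemma half_dist (A B C e : R) : `|B - A| < e / 2 -> `|A - C| < e / 2 -> `|B - C| <= e.
Proof. 
move=> H1 H2; apply: le_trans (ler_distD A _ _) _.
by rewrite [e]splitr lerD // ltW.
 Qed.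

(** The second difference is symmetric in i and j, so the two mixed derivatives take a common value
    at two points arbitrarily close to u, and continuity concludes. *)
Lemma schwarz W F i j u : open W -> Cinf W F -> W u ->
  partial i (partial j F) u = partial j (partial i F) u.
Proof.
move=> oW CF Wu; have /open_cubeP/(_ u Wu)[d d0 Wd] := oW.
apply/eqP; rewrite -subr_eq0 -normr_le0; apply/ler_addgt0Pl => e e0; rewrite addr0.
have e2 : 0 < e / 2 by rewrite divr_gt0.
have c1 := Cinf_cont (Cinf_partial i (Cinf_partial j CF)) Wu.
have c2 := Cinf_cont (Cinf_partial j (Cinf_partial i CF)) Wu.
have /cont_cubeP/(_ _ e2)[d1 d10 H1] := c1.
have /cont_cubeP/(_ _ e2)[d2 d20 H2] := c2.
pose r := Num.min d (Num.min d1 d2).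
have r0 : 0 < r by rewrite !lt_min d0 d10.
have [rd rd1 rd2] : [/\ r <= d, r <= d1 & r <= d2].
  by split; rewrite /r !ge_min lexx ?orbT.
pose h := r / 3.
have h0 : 0 < h by rewrite divr_gt0.
have hr : 3%:R * h <= r by rewrite /h mulrCA divff ?mulr1 // pnatr_eq0.
have Wr : cube u r `<=` W by move=> v /(sub_cube rd)/Wd.
have [v vr E1] := second_difference i j (CF 2%N) Wr h0 hr.
have [w wr E2] := second_difference j i (CF 2%N) Wr h0 hr.
have E : partial j (partial i F) v = partial i (partial j F) w.
  have hh : h * h != 0 by rewrite mulf_neq0 // gt_eqF.
  have swap (p q r' s : R) : p - q - (r' - s) = p - r' - (q - s) by ring.
  rewrite (addrAC u) swap E2 in E1.
  by move: E1; move: (partial j _ v) (partial i _ w) => A B /(mulfI hh).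
have := H2 v (sub_cube rd2 vr); have := H1 w (sub_cube rd1 wr); rewrite E.
move: (partial i (partial j F) w) (partial i _ u) (partial j _ u) => A B C.
rewrite (distrC A B); exact: half_dist.
Qed.

Fixpoint iter_partial i l F := if l is l'.+1 then partial i (iter_partial i l' F) else F.

Lemma Cinf_iter_partial W i l F : Cinf W F -> Cinf W (iter_partial i l F).
Proof. by move=> CF; elim: l => //= l; apply: Cinf_partial. Qed.

(* For F flat to order n along the hyperplane u_i = 0, this is the continuous
   extension of F / u_i ^ n. *)
Definition power_quotient i n F u : R :=
  if u 0 i == 0 then iter_partial i n F u / n`!%:R else F u / u 0 i ^+ n.

Definition flat i n F := forall l, (l < n)%N -> forall u, u 0 i = 0 -> iter_partial i l F u = 0.

(** At a point of the hyperplane, Taylor's formula along coordinate i loses its first n terms by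
    flatness and leaves F(v) = c v_i^n / n! up to e|v_i|^n; dividing by v_i^n gives the estimate. *)
Lemma power_quotient_cont i n F u : Cinf setT F -> flat i n F ->
  {for u, continuous (power_quotient i n F)}.
Proof.
move=> CF flatF; have [u0|u0] := eqVneq (u 0 i) 0; last first.
  apply: (@cont_near _ _ (fun u => F u * (u 0 i ^+ n)^-1) _ _ `|u 0 i|).
  - by rewrite normr_gt0.
  - move=> v /(_ i) vu; rewrite /power_quotient; case: eqP => // v0.
    by move: vu; rewrite v0 sub0r normrN ltxx.
  - apply: contM; first exact: Cinf_cont CF _.
    apply: contV; first by rewrite expf_neq0.
    elim: n {flatF} => [|n IH]; first exact: cont_cst.
    apply: (@cont_near _ _ (fun v => v 0 i * v 0 i ^+ n) _ _ 1) => // [v _|].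
      by rewrite exprS.
    by apply: contM => //; apply: cont_coord.
apply/cont_cubeP => e e0; set c := iter_partial i n F u.
have e2 : 0 < e / 2 by rewrite divr_gt0.
have /cont_cubeP/(_ _ e2)[d d0 Hd] := Cinf_cont (u := u) (Cinf_iter_partial i n CF) I.
exists d => // v vd; rewrite {2}/power_quotient u0 eqxx -/c.
apply: le_lt_trans (_ : e / 2 < e); last by lra.
rewrite /power_quotient; case: eqP => [v0|/eqP v0].
  rewrite -mulrBl normrM; have := Hd v vd; rewrite -/c => /ltW H.
  rewrite -[leRHS]mulr1; apply: ler_pM => //.
  rewrite normfV ger0_norm // invf_le1 ?ltr0n ?fact_gt0 //.
  by rewrite ler1n fact_gt0.
(* The line through v in direction i, parametrised by its i-th coordinate, so that t = 0 lies on the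
   hyperplane and t = v_i at v. *)
pose g l t := iter_partial i l F (v + (t - v 0 i) *: delta_mx 0 i).
have gd t : `|t| < d -> cube u d (v + (t - v 0 i) *: delta_mx 0 i).
  by move=> td; apply: cube_line => //; rewrite u0 subr0 addrC subrK.
have vd0 : `|v 0 i| < d by have := vd i; rewrite u0 subr0.
have dg l t : is_derive t (1 : R) (g l) (g l.+1 t).
  apply/is_derive_shiftP.
  have -> : (fun s => g l (t + s)) =
     fun s => iter_partial i l F (v + (t - v 0 i) *: delta_mx 0 i + s *: delta_mx 0 i).
    by apply/funext => s; rewrite /g (addrAC t) scalerDl addrA.
  exact: Cinf_is_derive (Cinf_iter_partial i l CF) I.
have gn t : `|t| < d -> `|g n t - c| <= e / 2 by move=> /gd/Hd/ltW.
have := taylor_bound (fun l t _ _ => dg l t) gn vd0.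
have g0 l : (l < n)%N -> g l 0 = 0.
  by move=> ln; apply: flatF => //; rewrite lineE eqxx sub0r mulr1n subrr.
rewrite big1 => [|j _]; last by rewrite g0 ?mul0r.
have -> : g 0%N (v 0 i) = F v by rewrite /g subrr scale0r addr0.
rewrite subr0 -ler_pdivrMr ?exprn_gt0 ?normr_gt0 // -normrX -normfV -normrM.
rewrite mulrBl (mulrC (v 0 i ^+ n)) mulrA -!mulrA mulfV ?expf_neq0 // mulr1.
by [].
Qed.

End SmoothFunctions.

(** * Division by a coordinate and Hadamard's lemma *)

Section Division.
Variables (R : realType) (k : nat).
Implicit Types (u v a : 'rV[R]_k) (F G : 'rV[R]_k -> R) (W : set 'rV[R]_k).

(** The numerator in the quotient rule for the derivative of F / u_i^n, over the denominator
    u_i^(n+1). *)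
Definition flat_step i n F u := u 0 i * partial i F u - n%:R * F u.

Lemma Cinf_flat_step i n F : Cinf setT F -> Cinf setT (flat_step i n F).
Proof.
move=> CF; apply: CinfB; rewrite //; [exact: openT| |].
  by apply: CinfM; [exact: openT|apply: Cinf_coord; exact: openT|exact: Cinf_partial].
by apply: CinfZ => //; exact: openT.
Qed.

(** On the hyperplane only the second term survives, and its coefficient vanishes for l = n: this
    raises the order of flatness from n to n + 1. *)
Lemma iter_partial_flat_step i n l F u : Cinf setT F ->
  iter_partial i l (flat_step i n F) u =
  u 0 i * iter_partial i l.+1 F u + (l%:R - n%:R) * iter_partial i l F u.
Proof.
move=> CF; elim: l u => [|l IH] u; first by rewrite /flat_step /= sub0r mulNr.
rewrite /=; set A := partial i (iter_partial i l F).
have CA : Cinf setT A by apply/Cinf_partial/Cinf_iter_partial.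
have Cl : Cinf setT (iter_partial i l F) by apply/Cinf_iter_partial.
have Ci : Cinf setT (fun u : 'rV[R]_k => u 0 i) by apply: Cinf_coord; exact: openT.
have -> : iter_partial i l (flat_step i n F) =
    fun u => u 0 i * A u + (l%:R - n%:R) * iter_partial i l F u.
  by apply/funext => v; rewrite IH.
rewrite (@partialD _ _ _ _ setT) //; last by apply: CinfZ => //; exact: openT.
  rewrite (@partialM _ _ _ _ setT) // (@partialZ _ _ _ setT) // partial_coord eqxx.
  by rewrite -/A -natr1 mulr1n; ring.
by apply: CinfM => //; exact: openT.
Qed.

Lemma iter_partial_comm i j l F u : Cinf setT F ->
  iter_partial i l (partial j F) u = partial j (iter_partial i l F) u.
Proof.
move=> CF; elim: l u => //= l IH u.
have -> : iter_partial i l (partial j F) = partial j (iter_partial i l F).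
  by apply/funext => v; rewrite IH.
by apply: (schwarz i j (@openT _)) => //; apply: Cinf_iter_partial.
Qed.

(** Off the hyperplane this is the quotient rule. On it, a direction j other than i stays in the
    hyperplane, where the quotient is a derivative of F divided by n!, while direction i needs
    Taylor's formula to order n + 1. *)
Lemma power_quotient_derive i n F j u : Cinf setT F -> flat i n F ->
  is_derive (0 : R) (1 : R) (fun t : R => power_quotient i n F (u + t *: delta_mx 0 j))
    (if j == i then power_quotient i n.+1 (flat_step i n F) u
     else power_quotient i n (partial j F) u).
Proof.
move=> CF flatF; have [u0|u0] := eqVneq (u 0 i) 0; last first.
  pose s := (i == j)%:R : R.
  have lE t : (u + t *: delta_mx 0 j) 0 i = u 0 i + t * s.
    by rewrite lineE /s mulr_natr.
  have dl : is_derive (0 : R) (1 : R) (fun t : R => u 0 i + t * s) s.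
    apply/is_derive_epsP => e e0; exists 1 => // h _.
    by rewrite add0r mul0r addr0 (addrC _ (h * s)) addrK mulrC subrr normr0 mulr_ge0 // ltW.
  have p0 : (fun t : R => (u 0 i + t * s) ^+ n) 0 != 0 by rewrite mul0r addr0 expf_neq0.
  have dX : is_derive (0 : R) (1 : R) (fun t : R => (u 0 i + t * s) ^+ n)
      ((n%:R * (u 0 i + 0 * s) ^+ n.-1) *: s).
    by apply: is_derive_near ltr01 _ (is_deriveX n dl) => y _; rewrite fctE.
  have dV := @is_deriveV R (fun t : R => (u 0 i + t * s) ^+ n) 0 _ 1 p0 dX.
  have dM := is_deriveM (Cinf_is_derive j CF (I : setT u)) dV.
  apply: (@is_derive_near _ (fun t => F (u + t *: delta_mx 0 j) * ((u 0 i + t * s) ^+ n)^-1)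
    _ _ _ `|u 0 i|); first by rewrite normr_gt0.
    move=> t; rewrite subr0 => tu; rewrite /power_quotient lE; case: eqP => // E.
    have st : `|t * s| <= `|t|.
      by rewrite /s; case: (i == j); rewrite ?mulr1 ?mulr0 ?normr0.
    move: E => /eqP; rewrite addr_eq0 => /eqP E.
    by move: st; rewrite -normrN -E leNgt tu.
  apply: is_derive_eq dM _.
  rewrite scale0r addr0 /power_quotient (negbTE u0) /GRing.scale /= mul0r addr0.
  rewrite /flat_step /s (eq_sym i j).
  have un : u 0 i ^+ n != 0 by rewrite expf_neq0.
  case: (eqVneq j i) => [->|_]; last by rewrite !mulr0 add0r mulrC.
  case: n {flatF p0 dX dV} un => [|n] un.
    by rewrite !expr0 expr1 mul0r; field.
  by rewrite -pred_Sn !exprS expr0 mulr1n; field; rewrite u0 expf_neq0.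
have flatu t : power_quotient i n F (u + t *: delta_mx 0 j) =
    if (u + t *: delta_mx 0 j) 0 i == 0 then iter_partial i n F (u + t *: delta_mx 0 j) / n`!%:R
    else F (u + t *: delta_mx 0 j) / (u + t *: delta_mx 0 j) 0 i ^+ n by [].
case: (eqVneq j i) => [->|ji]; last first.
  have -> : (fun t => power_quotient i n F (u + t *: delta_mx 0 j)) =
      fun t => n`!%:R^-1 * iter_partial i n F (u + t *: delta_mx 0 j).
    apply/funext => t; rewrite /power_quotient lineE u0 (eq_sym i) (negbTE ji) addr0 eqxx.
    exact: mulrC.
  rewrite /power_quotient u0 eqxx iter_partial_comm // mulrC.
  have := is_deriveZ (n`!%:R^-1) (Cinf_is_derive j (Cinf_iter_partial i n CF) (I : setT u)).
  exact.
rewrite /power_quotient u0 eqxx iter_partial_flat_step // u0 mul0r add0r.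
rewrite -natr1 (addrC n%:R) addrK mul1r.
set c := iter_partial i n.+1 F u.
apply/is_derive_epsP => e e0.
have /cont_cubeP/(_ _ e0)[d d0 Hd] := Cinf_cont (u := u) (Cinf_iter_partial i n.+1 CF) I.
exists d => // h hd; rewrite add0r scale0r addr0 lineE u0 eqxx add0r mulr1n.
have [->|h0] := eqVneq h 0.
  by rewrite ?eqxx scale0r addr0 mulr0 subrr subr0 normr0 mulr0.
pose g l t := iter_partial i l F (u + t *: delta_mx 0 i).
have dg l t : (l < n.+1)%N -> `|t| < d -> is_derive t (1 : R) (g l) (g l.+1 t).
  by move=> _ _; apply: Ck_partial_at (Cinf_iter_partial i l CF 1%N) _.
have gn t : `|t| < d -> `|g n.+1 t - c| <= e.
  move=> td; apply/ltW/Hd/cube_line; first exact: cube_center.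
  by rewrite addrAC subrr add0r.
have := taylor_bound dg gn hd.
rewrite big_ord_recr /= big1 ?add0r => [|l _]; last first.
  by rewrite /g scale0r addr0 flatF // mul0r.
rewrite /g scale0r addr0 /=.
have hn : h ^+ n != 0 by rewrite expf_neq0.
rewrite [X in _ <= X -> _](_ : _ = e * `|h| * `|h ^+ n|); last by rewrite normrX exprSr mulrA mulrAC.
rewrite -ler_pdivrMr ?normr_gt0 // -normfV -normrM; apply: le_trans.
rewrite le_eqVlt; apply/orP; left; apply/eqP; congr (`| _ |).
rewrite eqxx exprS; move: (F _) (iter_partial i n F u) => A B.
have f0 m : m`!%:R != 0 :> R by rewrite pnatr_eq0 -lt0n fact_gt0.
move: (n.+1`!%:R : R) (f0 n.+1) (n`!%:R : R) (f0 n) (h ^+ n) hn => p p0 q q0 x x0.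
by field; rewrite p0 q0 x0.
Qed.

(** The family of all power quotients is closed under partial derivatives and consists of continuous
    functions; the induction on m must therefore let n and F vary. *)
Lemma Ck_power_quotient m i n F : Cinf setT F -> flat i n F ->
  Ck setT m (power_quotient i n F).
Proof.
elim: m n F => [|m IH] n F CF flatF.
  by split=> // u _; apply: power_quotient_cont.
apply: (Ck_intro (@openT _) (dF := fun j u =>
   if j == i then power_quotient i n.+1 (flat_step i n F) u
   else power_quotient i n (partial j F) u)) => [u _|j u _|j].
- exact: power_quotient_cont.
- exact: power_quotient_derive.
- case: eqVneq => [_|ji]; apply: IH.
  + exact: Cinf_flat_step.
  + move=> l ln u u0; rewrite iter_partial_flat_step // u0 mul0r add0r.
    move: ln; rewrite ltnS leq_eqVlt => /orP[/eqP ->|ln]; first by rewrite subrr mul0r.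
    by rewrite flatF // mulr0.
  + exact: Cinf_partial.
  + move=> l ln u u0; rewrite iter_partial_comm //; apply: partial_eq.
    have -> : (fun t => iter_partial i l F (u + t *: delta_mx 0 j)) = fun=> 0.
      by apply/funext => t; rewrite flatF // lineE u0 (eq_sym i) (negbTE ji) addr0.
    exact: is_derive_cst.
Qed.

(** The case n = 1 of power quotients, after translating the hyperplane u_i = c to u_i = 0. *)
Lemma division i F (c : R) : Cinf setT F -> (forall u, u 0 i = c -> F u = 0) ->
  exists2 G, Cinf setT G & forall u, F u = (u 0 i - c) * G u.
Proof.
move=> CF F0; pose F1 u := F (\row_l (u 0 l + c *+ (l == i))).
have shiftC d : forall m l, Ck setT m (fun u : 'rV[R]_k => u 0 l + d *+ (l == i)).
  by move=> m l; apply: CkD; [exact: openT|apply: Ck_coord; exact: openT|apply: Ck_cst; exact: openT].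
have CF1 : Cinf setT F1.
  by apply: Cinf_comp CF _ => //; [exact: openT|exact: openT|move=> l m; apply: shiftC].
have fl : flat i 1 F1.
  by case=> // _ u u0; apply: F0; rewrite mxE u0 eqxx add0r.
exists (fun u => power_quotient i 1 F1 (\row_l (u 0 l + (- c) *+ (l == i)))).
  apply: (Cinf_comp (openT) (openT) _ (fun m => Ck_power_quotient m CF1 fl)) => // l m.
  exact: shiftC.
move=> u; have E : \row_l ((\row_l0 (u 0 l0 + (- c) *+ (l0 == i))) 0 l + c *+ (l == i)) = u.
  by apply/rowP => l; rewrite !mxE mulNrn subrK.
rewrite /power_quotient mxE eqxx mulr1n expr1; case: eqP => [uc|/eqP uc].
  by rewrite uc mul0r F0 //; apply/eqP; rewrite -subr_eq0 uc.
by rewrite /F1 E mulrC divfK.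
Qed.

(** F u - F a telescopes over the points that mix coordinates of u and a; the i-th difference
    vanishes where u_i = a_i and is divisible by u_i - a_i. Differentiating the resulting formula at
    a identifies [G i a]. *)
Lemma hadamard F a : Cinf setT F -> exists G : 'I_k -> 'rV[R]_k -> R,
  [/\ forall i, Cinf setT (G i), forall i, G i a = partial i F a &
      forall u, F u = F a + \sum_i (u 0 i - a 0 i) * G i u].
Proof.
move=> CF; pose w j (u : 'rV[R]_k) : 'rV[R]_k := \row_l (if (l < j)%N then u 0 l else a 0 l).
have Cw j : Cinf setT (fun u => F (w j u)).
  apply: Cinf_comp CF _ => //; [exact: openT|exact: openT|move=> l].
  by case: (l < j)%N; [apply: Cinf_coord|apply: Cinf_cst]; exact: openT.
have H (i : 'I_k) : exists G, Cinf setT G /\ forall u, F (w i.+1 u) - F (w i u) = (u 0 i - a 0 i) * G u.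
  have [|u ua|G CG GE] := @division i (fun u => F (w i.+1 u) - F (w i u)) (a 0 i).
  - by apply: CinfB => //; exact: openT.
  - suff -> : w i.+1 u = w i u by rewrite subrr.
    apply/rowP => l; rewrite !mxE ltnS leq_eqVlt.
    by case: eqP => // /val_inj ->; rewrite ltnn.
  - by exists G.
have [G GP] := choice H; have CG i := (GP i).1.
have FE u : F u = F a + \sum_i (u 0 i - a 0 i) * G i u.
  under eq_bigr do rewrite -(GP _).2.
  rewrite -(big_mkord xpredT (fun i => F (w i.+1 u) - F (w i u))) telescope_sumr //.
  have -> : w k u = u by apply/rowP => l; rewrite mxE ltn_ord.
  have -> : w 0%N u = a by apply/rowP => l; rewrite mxE.
  by rewrite addrC subrK.
exists G; split=> // i.
have CZ j : Cinf setT (fun u : 'rV[R]_k => u 0 j - a 0 j).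
  by apply: CinfB; [exact: openT|apply: Cinf_coord; exact: openT|apply: Cinf_cst; exact: openT].
have CM j : Cinf setT (fun u => (u 0 j - a 0 j) * G j u) by apply: CinfM => //; exact: openT.
have -> : F = fun u => F a + \sum_i (u 0 i - a 0 i) * G i u by apply/funext.
rewrite (@partialD _ _ _ _ setT) //.
- rewrite partial_cst add0r (@partial_sum _ _ _ _ setT) //; last exact: openT.
  rewrite (bigD1 i) //= (@partialM _ _ _ _ setT) // subrr mul0r add0r.
  rewrite big1 => [|j ji]; last first.
    rewrite (@partialM _ _ _ _ setT) // subrr mul0r add0r.
    rewrite (@partialD _ _ _ _ setT) ?partial_coord ?partial_cst ?(negbTE ji) ?addr0 ?mulr0 //.
    + by apply: Cinf_coord; exact: openT.
    + by apply: Cinf_cst; exact: openT.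
  rewrite (@partialD _ _ _ _ setT) ?partial_coord ?partial_cst ?eqxx ?addr0 ?mulr1 //.
  + by apply: Cinf_coord; exact: openT.
  + by apply: Cinf_cst; exact: openT.
- by apply: Cinf_cst; exact: openT.
- by apply: Cinf_sum => //; exact: openT.
Qed.

End Division.

(** * Bump functions and extension of local smooth functions *)

Section Bump.
Variable R : realType.
Implicit Types (p : {poly R}) (x y t : R).

(** The polynomial p makes the family closed under differentiation: the derivative replaces p by (p
    - p') X^2. *)
Definition flat_exp p x : R := if 0 < x then p.[x^-1] * expR (- x^-1) else 0.

(** Since y^(N+1) <= (N+1)! e^y with N + 1 = size p + 2, the exponential absorbs the polynomial and
    leaves a factor y^-2. At y = 1/h this is a bound C h^2, small enough for a zero derivative at
    0. *)
Lemma horner_expN_bound p : exists2 C, 0 <= C &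
  forall y, 1 <= y -> `|p.[y]| * expR (- y) <= C * y ^- 2.
Proof.
pose N := (size p).+1; pose K := N.+1`!%:R : R.
exists ((\sum_(i < size p) `|p`_i|) * K).
  by rewrite mulr_ge0 ?sumr_ge0.
move=> y y1; have y0 : 0 < y by apply: lt_le_trans y1.
have eK : y ^+ N.+1 <= K * expR y.
  rewrite mulrC -ler_pdivrMr ?ltr0n ?fact_gt0 //.
  by apply: le_trans (expR_ge1Dxn N (ltW y0)); rewrite lerDr.
have pb : `|p.[y]| <= (\sum_(i < size p) `|p`_i|) * y ^+ size p.
  rewrite horner_coef (le_trans (ler_norm_sum _ _ _)) // mulr_suml ler_sum // => i _.
  rewrite normrM ler_wpM2l // normrX ger0_norm ?(ltW y0) //.
  by rewrite ler_weXn2l // ltnW.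
rewrite expRN ler_pdivrMr ?expR_gt0 //; apply: le_trans pb _.
rewrite -!mulrA ler_wpM2l ?sumr_ge0 //.
rewrite mulrCA ler_pdivlMl ?exprn_gt0 // -exprD add2n.
exact: eK.
Qed.

Lemma is_derive_flat_exp p x :
  is_derive x (1 : R) (flat_exp p) (flat_exp ((p - p^`()) * 'X^2) x).
Proof.
have [x0|x0|->] := ltgtP x 0.
- apply: (@is_derive_near _ (fun=> 0) _ _ _ `|x|); first by rewrite normr_gt0 lt_eqF.
    move=> y; rewrite (ltr0_norm x0) ltr_distl => /andP[_]; rewrite subrr /flat_exp => y0.
    by rewrite ltNge ltW.
  by rewrite /flat_exp ltNge ltW //; apply: is_derive_cst.
- apply: (@is_derive_near _ (fun x => p.[x^-1] * expR (- x^-1)) _ _ _ x) => //.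
    move=> y; rewrite ltr_distl => /andP[+ _]; rewrite subrr /flat_exp => y0.
    by rewrite y0.
  have xn : id x != 0 :> R by rewrite /= gt_eqF.
  have dV := is_deriveV xn (is_derive_id x (1 : R)).
  have dp := is_derive1_comp (is_derive_poly p _) dV.
  have dE := is_derive1_comp (is_derive_expR _) (is_deriveN dV).
  apply: is_derive_eq (is_deriveM dp dE) _.
  rewrite /flat_exp x0 hornerM hornerXn hornerD hornerN /GRing.scale /=.
  rewrite -[(- _) x]/(- x^-1); move: (expR _) p.[_] p^`().[_] => A B C.
  by field; rewrite gt_eqF.
apply/is_derive_epsP => e e0; have [C C0 HC] := horner_expN_bound p.
pose r := Num.min 1 (e / (C + 1)).
have C1 : 0 < C + 1 by rewrite ltr_wpDl.
exists r => [|h]; first by rewrite lt_min ltr01 divr_gt0.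
rewrite lt_min => /andP[h1 hC].
rewrite {2 3}/flat_exp ltxx add0r subr0 mul0r subr0 /flat_exp.
case: ifP => [h0|_]; last by rewrite normr0 mulr_ge0 // ltW.
rewrite (ger0_norm (ltW h0)) in h1 hC *.
rewrite normrM (ger0_norm (expR_ge0 _)).
apply: le_trans (HC _ _) _; first by rewrite invf_ge1 // ltW.
rewrite exprVn invrK expr2 mulrA ler_pM2r // ltW //.
rewrite ltr_pdivlMr // in hC; nra.
Qed.

Definition flat_fun := flat_exp 1.

Lemma flat_fun_gt0 x : (0 < flat_fun x) = (0 < x).
Proof.
rewrite /flat_fun /flat_exp hornerE mul1r.
by case: (ltP 0 x) => _; rewrite ?expR_gt0 ?ltxx.
Qed.

Lemma flat_fun_ge0 x : 0 <= flat_fun x.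
Proof. by rewrite /flat_fun /flat_exp hornerE mul1r; case: ifP => // _; apply: expR_ge0. Qed.

Lemma flat_fun_eq0 x : x <= 0 -> flat_fun x = 0.
Proof. by rewrite /flat_fun /flat_exp ltNge => ->. Qed.

Lemma Cinf_flat_fun k (W : set 'rV[R]_k) G : open W -> Cinf W G ->
  Cinf W (fun u => flat_fun (G u)).
Proof.
move=> oW CG m.
pose T p := (p - p^`()) * 'X^2; pose phi l := flat_exp (iter l T (1 : {poly R})).
by apply: (Ck_tower (phi := phi) 0 oW) => // l t; apply: is_derive_flat_exp.
Qed.

Definition smooth_step x : R := flat_fun x / (flat_fun x + flat_fun (1 - x)).

Lemma smooth_step_den x : 0 < flat_fun x + flat_fun (1 - x).
Proof.
have [x0|x0] := leP x 0.
  by rewrite ltr_wpDl ?flat_fun_ge0 // flat_fun_gt0 subr_gt0 (le_lt_trans x0).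
by rewrite ltr_pwDl ?flat_fun_ge0 // flat_fun_gt0.
Qed.

Lemma smooth_step0 x : x <= 0 -> smooth_step x = 0.
Proof. by move=> x0; rewrite /smooth_step flat_fun_eq0 // mul0r. Qed.

Lemma smooth_step1 x : 1 <= x -> smooth_step x = 1.
Proof.
move=> x1; have := smooth_step_den x; rewrite /smooth_step (@flat_fun_eq0 (1 - x)) ?subr_le0 //.
by rewrite addr0 => H; rewrite divff // gt_eqF.
Qed.

Lemma Cinf_smooth_step k (W : set 'rV[R]_k) G : open W -> Cinf W G ->
  Cinf W (fun u => smooth_step (G u)).
Proof.
move=> oW CG; apply: CinfM => //; first exact: Cinf_flat_fun.
apply: Cinf_inv => // [u _|]; first by rewrite gt_eqF // smooth_step_den.
apply: CinfD => //; first exact: Cinf_flat_fun.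
by apply: Cinf_flat_fun => //; apply: CinfB => //; apply: Cinf_cst.
Qed.

Lemma cube_bump k (a : 'rV[R]_k) d : 0 < d -> exists chi : 'rV[R]_k -> R,
  [/\ Cinf setT chi, forall u, cube a (d / 2) u -> chi u = 1 &
      forall u, ~ cube a d u -> chi u = 0].
Proof.
(* Normalised to be 0 when |u_i - a_i| = d and 1 when |u_i - a_i| = d / 2, since d^2 - (d/2)^2 = 3/4
   d^2. Squares replace absolute values to keep it smooth. *)
move=> d0; pose s (u : 'rV[R]_k) i := (d ^+ 2 - (u 0 i - a 0 i) ^+ 2) / (3%:R / 4%:R * d ^+ 2).
have D0 : 0 < 3%:R / 4%:R * d ^+ 2 :> R by rewrite !mulr_gt0 ?invr_gt0 // exprn_gt0.
exists (fun u => \prod_i smooth_step (s u i)); split.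
- have Cs i : Cinf setT (fun u => smooth_step (s u i)).
    apply: Cinf_smooth_step; first exact: openT.
    have oT := @openT 'rV[R]_k.
    have Cc : Cinf setT (fun u : 'rV[R]_k => u 0 i - a 0 i).
      by apply: CinfB => //; [apply: Cinf_coord|apply: Cinf_cst].
    apply: CinfM => //; last exact: Cinf_cst.
    by apply: CinfB => //; [apply: Cinf_cst|apply: CinfM].
  elim: (index_enum _) => [|i l IH].
    by apply: Cinf_ext (Cinf_cst 1 (@openT _)) => [|u _]; [exact: openT|rewrite big_nil].
  apply: (@Cinf_ext _ _ _ (fun u => smooth_step (s u i) * \prod_(j <- l) smooth_step (s u j))).
  + exact: openT.
  + by move=> u _; rewrite big_cons.
  + by apply: CinfM => //; exact: openT.
- move=> u ua; rewrite big1 // => i _; rewrite smooth_step1 // /s ler_pdivlMr // mul1r.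
  have : (u 0 i - a 0 i) ^+ 2 <= (d / 2) ^+ 2.
    rewrite -(real_normK (num_real (u 0 i - a 0 i))) lerXn2r ?nnegrE //.
      by rewrite divr_ge0 // ltW.
    exact/ltW/ua.
  by set x := _ ^+ 2; rewrite !expr2 => H; lra.
- move=> u ua; have [i ia] : exists i, d <= `|u 0 i - a 0 i|.
    apply: contrapT => H; apply: ua => i; rewrite ltNge; apply/negP => H1.
    by apply: H; exists i.
  rewrite (bigD1 i) //= smooth_step0 ?mul0r // /s pmulr_lle0 ?invr_gt0 // subr_le0.
  rewrite -(real_normK (num_real (u 0 i - a 0 i))) lerXn2r // ?nnegrE //.
  exact: ltW.
Qed.

(** Closure under [gen] and Hadamard's lemma speak of functions smooth on all of R^k, so local
    expressions must be extended. The last clause keeps the zeros of F, on which divisibility by a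
    coordinate relies. *)
Lemma Cinf_extend k (O : set 'rV[R]_k) F a : open O -> O a -> Cinf O F ->
  exists d F', [/\ 0 < d, cube a d `<=` O, Cinf setT F',
    forall u, cube a d u -> F' u = F u & forall u, (O u -> F u = 0) -> F' u = 0].
Proof.
move=> oO Oa CF; have /open_cubeP/(_ a Oa)[d d0 dO] := oO.
have d20 : 0 < d / 2 by rewrite divr_gt0.
have d2d : d / 2 <= d by rewrite ler_pdivrMr // ler_peMr ?ltW // ltr1n.
have [chi [Cchi chi1 chi0]] := cube_bump a d20.
exists (d / 2 / 2), (fun u => chi u * F u); split=> //.
- by rewrite divr_gt0.
- move=> u ua; apply: dO => i; apply: lt_le_trans (ua i) _; apply: le_trans _ d2d.
  by rewrite ler_pdivrMr // ler_peMr ?ltW // ltr1n.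
- apply: Cinf_local; first exact: openT.
  move=> u _; have [uO|uO] := pselect (O u).
    exists O, (fun u => chi u * F u); split=> //; apply: CinfM => //.
    by apply: Cinf_sub Cchi.
  (* The bump is supported in the cube of half-width d / 2, and the cube of half-width d lies in O,
     so a point outside O has a whole cube on which the product is 0. *)
  exists (cube u (d / 2)), (fun=> 0); split=> //; first exact: open_cube.
  + exact: cube_center.
  + by apply: Cinf_cst; apply: open_cube.
  + move=> v uv; rewrite chi0 ?mul0r // => va; apply: uO; apply: dO => i.
    rewrite [d](splitr d); apply: le_lt_trans (ler_distD (v 0 i) _ _) _.
    by rewrite ltrD // distrC.
- by move=> u /chi1 ->; rewrite mul1r.
- move=> u F0; have [uO|uO] := pselect (O u); first by rewrite F0 ?mulr0.
  rewrite chi0 ?mul0r // => ua; apply/uO/dO => i.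
  exact: lt_le_trans (ua i) d2d.
Qed.

End Bump.

(** * The implicit function theorem and functional dependence *)

Section ImplicitFunction.
Variables (R : realType) (k : nat).

Definition upd (b : 'I_k) (u : 'rV[R]_k) (s : R) : 'rV[R]_k :=
  \row_i (if i == b then s else u 0 i).

(** A product rule in which c need only be continuous at 0. For the implicit function, n is the
    defect in the equation and c the inverse of an intermediate slope. *)
Lemma is_derive_factor (f n c : R -> R) (dn c0 r : R) : 0 < r ->
  (forall t, `|t| < r -> f t - f 0 = n t * c t) -> n 0 = 0 ->
  is_derive (0 : R) (1 : R) n dn ->
  (forall e, 0 < e -> exists2 r, 0 < r & forall t, `|t| < r -> `|c t - c0| < e) ->
  is_derive (0 : R) (1 : R) f (dn * c0).
Proof.
move=> r0 fE n0 /is_derive_epsP Dn Hc; apply/is_derive_epsP => e e0.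
have A0 : 0 < `|c0| + 1 by rewrite ltr_wpDl.
have B0 : 0 < `|dn| + 1 by rewrite ltr_wpDl.
have e10 : 0 < e / (2 * (`|c0| + 1)) by rewrite divr_gt0 // mulr_gt0.
have e20 : 0 < Num.min 1 (e / (2 * (`|dn| + 1))) by rewrite lt_min ltr01 divr_gt0 // mulr_gt0.
have [r1 r10 H1] := Dn _ e10; have [r2 r20 H2] := Hc _ e20.
exists (Num.min r (Num.min r1 r2)) => [|t]; first by rewrite !lt_min r0 r10.
rewrite !lt_min => /and3P[tr /H1 t1 /H2]; rewrite lt_min => /andP[t2 t3].
rewrite n0 add0r subr0 in t1; rewrite add0r fE //.
have -> : n t * c t - dn * c0 * t = (n t - dn * t) * c t + dn * t * (c t - c0) by ring.
apply: le_trans (ler_normD _ _) _; rewrite !normrM.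
have c1 : `|c t| <= `|c0| + 1.
  have : `|c t| <= `|c t - c0| + `|c0| by rewrite -{1}(subrK c0 (c t)) ler_normD.
  by move=> /le_trans; apply; rewrite addrC lerD2l ltW.
have F1 : `|n t - dn * t| * `|c t| <= e / 2 * `|t|.
  apply: le_trans (ler_pM _ _ t1 c1) _ => //.
  by rewrite le_eqVlt; apply/orP; left; apply/eqP; field; rewrite gt_eqF.
have F2 : `|dn| * `|t| * `|c t - c0| <= e / 2 * `|t|.
  rewrite mulrAC ler_wpM2r //; apply: le_trans (_ : (`|dn| + 1) * (e / (2 * (`|dn| + 1))) <= _).
    by apply: ler_pM => //; [rewrite lerDl|exact: ltW].
  by rewrite le_eqVlt; apply/orP; left; apply/eqP; field; rewrite gt_eqF.
by rewrite [e in leRHS]splitr mulrDl lerD.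
Qed.

Lemma upd_line b u s t : upd b u s + t *: delta_mx 0 b = upd b u (s + t).
Proof.
by apply/rowP => i; rewrite lineE !mxE; case: (i == b); rewrite ?mulr1n ?mulr0n ?addr0.
Qed.

Lemma upd_id b u : upd b u (u 0 b) = u.
Proof. by apply/rowP => i; rewrite mxE; case: eqP => // ->. Qed.

Lemma upd_upd b u s t : upd b (upd b u s) t = upd b u t.
Proof. by apply/rowP => i; rewrite !mxE; case: eqP. Qed.

Lemma cube_upd a d b u s : cube a d u -> `|s - a 0 b| < d -> cube a d (upd b u s).
Proof. by move=> ua sa i; rewrite mxE; case: eqP => // ->. Qed.

Section Root.
Variables (a : 'rV[R]_k) (d : R) (b : 'I_k) (Y : 'rV[R]_k -> R).
Hypotheses (d0 : 0 < d) (CY : Cinf (cube a d) Y).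
Hypothesis dYb : forall u, cube a d u -> 2^-1 < partial b Y u < 2.

(** Two points within h of [a 0 b] are at most 2h apart, so every intermediate point stays within 3h
    < d, where the bounds on the slope hold. *)
Let h := d / 4.
Let h0 : 0 < h. Proof. by rewrite divr_gt0. Qed.
Let hd : 4 * h = d. Proof. by rewrite /h mulrCA divff ?mulr1 // pnatr_eq0. Qed.

Lemma increment u s s' : cube a d (upd b u (a 0 b)) ->
  `|s - a 0 b| <= h -> `|s' - a 0 b| <= h ->
  exists t, [/\ `|t - s| <= `|s' - s|, `|t - a 0 b| < d &
    Y (upd b u s') - Y (upd b u s) = partial b Y (upd b u t) * (s' - s)].
Proof.
move=> ua sa s'a.
have far x : `|x| <= `|s' - s| -> `|s + x - a 0 b| < d.
  move=> xs; rewrite addrAC; apply: le_lt_trans (ler_normD _ _) _.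
  have : `|s' - s| <= h + h.
    by apply: le_trans (ler_distD (a 0 b) _ _) _; rewrite lerD // distrC.
  by have := h0; move: xs sa; rewrite -hd; lra.
have inc x : `|x| <= `|s' - s| -> cube a d (upd b u (s + x)).
  by move=> /far xd; have := cube_upd ua xd; rewrite upd_upd.
have [|x xs E] := @MVT_abs R (fun x => Y (upd b u s + x *: delta_mx 0 b))
    (fun x => partial b Y (upd b u s + x *: delta_mx 0 b)) (s' - s).
  by move=> x xs; apply: Ck_partial_at (CY 1%N) _; rewrite upd_line; apply: inc.
exists (s + x); split; first by rewrite addrC addKr.
  exact: far.
by move: E; rewrite scale0r addr0 !upd_line (addrC s (s' - s)) subrK.
Qed.

(** The slope in direction b exceeds 1/2. The inequality yields uniqueness of the root and, applied
    at two different points, its Lipschitz estimate. *)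
Lemma root_unique u s s' : cube a d (upd b u (a 0 b)) ->
  `|s - a 0 b| <= h -> `|s' - a 0 b| <= h ->
  `|s' - s| <= 2 * `|Y (upd b u s') - Y (upd b u s)|.
Proof.
move=> ua sa s'a; have [t [_ ta ->]] := increment ua sa s'a.
have /dYb/andP[H _] : cube a d (upd b u t) by have := cube_upd ua ta; rewrite upd_upd.
rewrite normrM mulrA ler_peMl // ger0_norm; last by rewrite ltW // (lt_trans _ H) // invr_gt0.
by rewrite mulrC -ler_pdivrMr // div1r ltW.
Qed.

(** Coordinate b of u holds the prescribed value of Y. Moving by h up or down changes Y by more than
    h / 2, while the value at the centre misses the target by less than h / 4 + h / 4; the
    intermediate value theorem applies. *)
Lemma root_exists : exists2 r, 0 < r & forall u, cube (upd b a (Y a)) r u ->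
  cube a d (upd b u (a 0 b)) /\
  exists s, `|s - a 0 b| < h /\ Y (upd b u s) = u 0 b.
Proof.
have h4 : 0 < h / 4 by rewrite divr_gt0.
have /cont_cubeP/(_ _ h4)[r1 r10 H1] := Cinf_cont CY (cube_center a d0).
exists (Num.min (Num.min r1 d) (h / 4)) => [|u ur]; first by rewrite !lt_min r10 d0 h4.
set r := Num.min _ _ in ur.
have [rr1 rd rh] : [/\ r <= r1, r <= d & r <= h / 4] by rewrite /r !ge_min !lexx !orbT; split.
have uar : cube a r (upd b u (a 0 b)).
  move=> i; have := ur i; rewrite !mxE; case: eqP => [->|_ //].
  by rewrite subrr normr0; apply: le_lt_trans.
have uad : cube a d (upd b u (a 0 b)) by apply: sub_cube uar.
split=> //.
have Ya : `|Y (upd b u (a 0 b)) - Y a| < h / 4 by apply/H1/(sub_cube rr1).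
have ub : `|u 0 b - Y a| < h / 4.
  by have := ur b; rewrite mxE eqxx => /lt_le_trans; apply.
have aa : `|a 0 b - a 0 b| <= h by rewrite subrr normr0 ltW.
have ah : `|a 0 b + h - a 0 b| <= h by rewrite addrC addKr ger0_norm // ltW.
have anh : `|a 0 b - h - a 0 b| <= h by rewrite addrC addKr normrN ger0_norm // ltW.
have pd t : `|t - a 0 b| < d -> 2^-1 < partial b Y (upd b u t).
  by move=> ta; have := cube_upd uad ta; rewrite upd_upd => /dYb/andP[].
have up : u 0 b < Y (upd b u (a 0 b + h)).
  have [t [_ /pd tp E]] := increment uad aa ah.
  have : h / 2 < Y (upd b u (a 0 b + h)) - Y (upd b u (a 0 b)).
    by rewrite E (addrC _ h) addrK mulrC ltr_pM2r.
  by move: Ya ub; rewrite !ltr_distl; move: (Y _) (Y _) (Y _) => A B C; lra.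
have down : Y (upd b u (a 0 b - h)) < u 0 b.
  have [t [_ /pd tp E]] := increment uad anh aa.
  have : h / 2 < Y (upd b u (a 0 b)) - Y (upd b u (a 0 b - h)).
    by rewrite E opprB addrCA subrr addr0 mulrC ltr_pM2r.
  by move: Ya ub; rewrite !ltr_distl; move: (Y _) (Y _) (Y _) => A B C; lra.
have le_h : a 0 b - h <= a 0 b + h by have := h0; lra.
have [||s] := @IVT R (fun s => Y (upd b u s)) (a 0 b - h) (a 0 b + h) (u 0 b) le_h.
- apply: derivable_within_continuous => s; rewrite in_itv /= => /andP[s1 s2].
  have sd : `|s - a 0 b| < d by rewrite ltr_distl -hd; have := h0; lra.
  have us : cube a d (upd b u s) by have := cube_upd uad sd; rewrite upd_upd.
  have : is_derive s (1 : R) (fun s => Y (upd b u s)) (partial b Y (upd b u s)).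
    apply/is_derive_shiftP; under eq_fun do rewrite -upd_line.
    exact: Ck_partial (CY 1%N) us.
  by case.
- by rewrite ge_min le_max (ltW down) (ltW up) orbT.
- rewrite in_itv /= => /andP[s1 s2] E; exists s; split=> //.
  rewrite ltr_distl; apply/andP; split.
    by rewrite lt_neqAle s1 andbT; apply/eqP => E2; move: down; rewrite E2 E ltxx.
  by rewrite lt_neqAle s2 andbT; apply/eqP => E2; move: up; rewrite -E2 E ltxx.
Qed.

Variable r : R.
Hypothesis r0 : 0 < r.
Let W := cube (upd b a (Y a)) r.
Hypothesis Hr : forall u, W u -> cube a d (upd b u (a 0 b)) /\
  exists s, `|s - a 0 b| < h /\ Y (upd b u s) = u 0 b.

Definition root u : R := xget 0 [set s | `|s - a 0 b| < h /\ Y (upd b u s) = u 0 b].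

(** The inverse of the coordinate change that replaces the b-th coordinate by Y. *)
Definition unstraighten u := upd b u (root u).

Let oW : open W. Proof. exact: open_cube. Qed.

Lemma rootP u : W u -> `|root u - a 0 b| < h /\ Y (unstraighten u) = u 0 b.
Proof.
move=> /Hr[_ [s H]].
exact: (@xgetPex _ 0 [set s | `|s - a 0 b| < h /\ Y (upd b u s) = u 0 b] (ex_intro _ s H)).
Qed.

Lemma unstraighten_cube u : W u -> cube a d (unstraighten u).
Proof.
move=> Wu; have [/cube_upd H _] := rootP Wu; have [ua _] := Hr Wu.
rewrite /unstraighten -(upd_upd b u (a 0 b)); apply: cube_upd => //.
have [+ _] := rootP Wu; move/lt_le_trans; apply; rewrite -hd; have := h0; lra.
Qed.

Lemma root_eq u s : W u -> `|s - a 0 b| <= h -> Y (upd b u s) = u 0 b -> root u = s.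
Proof.
move=> Wu sa E; have [ra rE] := rootP Wu; have [ua _] := Hr Wu.
have := root_unique ua sa (ltW ra); rewrite -/(unstraighten u) rE E subrr normr0 mulr0.
by rewrite normr_le0 subr_eq0 => /eqP.
Qed.

Lemma root_lip u u' : W u -> W u' ->
  `|root u' - root u| <= 2 * `|u' 0 b - Y (upd b u' (root u))|.
Proof.
move=> Wu Wu'; have [ra rE] := rootP Wu; have [ra' rE'] := rootP Wu'; have [ua' _] := Hr Wu'.
by have := root_unique ua' (ltW ra) (ltW ra'); rewrite -/(unstraighten u') rE'.
Qed.

Lemma root_cont u : W u -> {for u, continuous root}.
Proof.
move=> Wu; have /open_cubeP/(_ u Wu)[r1 r10 H1] := oW.
have /cont_cubeP H : {for u, continuous (fun u' : 'rV[R]_k => u' 0 b + (-1) * Y (upd b u' (root u)))}.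
  apply: contD; first exact: cont_coord.
  apply: contM; first exact: cont_cst.
  apply: (@cont_comp _ _ _ Y (fun i (u' : 'rV[R]_k) => if i == b then root u else u' 0 i)) => [i|].
    by case: (i == b); [apply: cont_cst|apply: cont_coord].
  exact: Cinf_cont CY (unstraighten_cube Wu).
apply/cont_cubeP => e e0; have e20 : 0 < e / 2 by rewrite divr_gt0.
have [r2 r20 H2] := H _ e20.
exists (Num.min r1 r2) => [|v vr]; first by rewrite lt_min r10.
have [vr1 vr2] : cube u r1 v /\ cube u r2 v.
  by split; apply: sub_cube vr; rewrite ge_min lexx ?orbT.
apply: le_lt_trans (root_lip Wu (H1 _ vr1)) _.
have := H2 v vr2; have [_ rE] := rootP Wu.
rewrite -/(unstraighten u) rE !mulN1r subrr subr0 => H3.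
by rewrite mulrC -ltr_pdivlMr.
Qed.

(** Obtained by differentiating Y (unstraighten u) = u_b implicitly. *)
Definition droot j u : R :=
  (if j == b then 1 else - partial j Y (unstraighten u)) * (partial b Y (unstraighten u))^-1.

Lemma root_derive j u : W u ->
  is_derive (0 : R) (1 : R) (fun t => root (u + t *: delta_mx 0 j)) (droot j u).
Proof.
move=> Wu; have [r1 r10 H1] := line_in j oW Wu.
(* The defect left when the root at u is kept at the displaced point; by the mean value theorem it
   equals an intermediate slope times the change of the root. *)
pose n (t : R) := (u + t *: delta_mx 0 j) 0 b - Y (upd b (u + t *: delta_mx 0 j) (root u)).
have n0 : n 0 = 0.
  by rewrite /n scale0r addr0 -/(unstraighten u); have [_ ->] := rootP Wu; rewrite subrr.
have Dn : is_derive (0 : R) (1 : R) n (if j == b then 1 else - partial j Y (unstraighten u)).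
  have := is_derive_coord j b u; rewrite (eq_sym b); case: (eqVneq j b) => [jb|jb] Dc.
    have nE (t : R) : n t = u 0 b + t - Y (unstraighten u).
      rewrite /n lineE jb eqxx; congr (_ - Y _); apply/rowP => i.
      by rewrite !mxE; case: eqVneq => //= _; rewrite mulr0 addr0.
    apply/is_derive_epsP => e e0; exists 1 => // t _; rewrite !nE.
    rewrite (_ : _ - _ - _ = 0) ?normr0 ?mulr_ge0 ?(ltW e0) //; by ring.
  rewrite -[X in is_derive _ _ _ X]add0r.
  apply: is_deriveB Dc _.
  have -> : (fun t : R => Y (upd b (u + t *: delta_mx 0 j) (root u))) =
      fun t : R => Y (unstraighten u + t *: delta_mx 0 j).
    apply/funext => t; congr Y; apply/rowP => i; rewrite lineE !mxE.
    case: eqVneq => [->|_]; first by rewrite (eq_sym b) (negbTE jb) addr0.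
    by rewrite eqxx /= mulr_natr eq_sym.
  exact: Ck_partial (CY 1%N) (unstraighten_cube Wu).
have : forall t, exists s, `|t| < r1 ->
    [/\ `|s - root u| <= `|root (u + t *: delta_mx 0 j) - root u|,
        cube a d (upd b (u + t *: delta_mx 0 j) s) &
        n t = partial b Y (upd b (u + t *: delta_mx 0 j) s) *
          (root (u + t *: delta_mx 0 j) - root u)].
  move=> t; have [/H1 Wt|] := boolP (`|t| < r1); last by exists 0.
  have [ra rE] := rootP Wu; have [ra' rE'] := rootP Wt; have [ua' _] := Hr Wt.
  have [s [s1 s2 E]] := increment ua' (ltW ra) (ltW ra'); exists s => _; split=> //.
    by have := cube_upd ua' s2; rewrite upd_upd.
  by rewrite -E -/(unstraighten _) rE'.
case/choice => xi Hxi.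
pose c t := (partial b Y (upd b (u + t *: delta_mx 0 j) (xi t)))^-1.
apply: (@is_derive_factor _ n c _ _ r1) => //.
  move=> t /Hxi[_ tc ->]; rewrite scale0r addr0 /c mulrAC divff ?mul1r //.
  by have /andP[H _] := dYb tc; rewrite gt_eqF // (lt_trans _ H) // invr_gt0.
move=> e e0; have uc := unstraighten_cube Wu.
have /cont_cubeP/(_ e e0)[r2 r20 H2] : {for unstraighten u, continuous (fun v => (partial b Y v)^-1)}.
  apply: contV; last exact: Cinf_cont (Cinf_partial b CY) uc.
  by have /andP[H _] := dYb uc; rewrite gt_eqF // (lt_trans _ H) // invr_gt0.
have /cont_cubeP/(_ r2 r20)[r3 r30 H3] := root_cont Wu.
exists (Num.min r1 (Num.min r2 r3)) => [|t]; first by rewrite !lt_min r10 r20.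
rewrite !lt_min => /and3P[t1 t2 t3].
have [xt _ _] := Hxi t t1.
apply: H2 => i; rewrite !mxE; case: eqVneq => [_|ib].
  apply: le_lt_trans xt _; apply: H3; apply: cube_line; first exact: cube_center.
  by rewrite addrAC subrr add0r.
rewrite addrAC subrr add0r eqxx /=; case: (i == j); rewrite ?mulr1 // mulr0 normr0 //.
Qed.

Lemma Cinf_inv_partial : Cinf (cube a d) (fun v => (partial b Y v)^-1).
Proof.
apply: Cinf_inv; [exact: open_cube| |exact: Cinf_partial].
by move=> u uc; have /andP[H _] := dYb uc; rewrite gt_eqF // (lt_trans _ H) // invr_gt0.
Qed.

(** The derivative of the root is a smooth function of the root and of u, so each order of
    differentiability gives the next. *)
Lemma Ck_root m : Ck W m root.
Proof.
elim: m => [|m IH]; first by split=> // u /root_cont.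
apply: (Ck_intro oW (dF := droot)) => [u|j u|j]; [exact: root_cont|exact: root_derive|].
have Cm : Ck (cube a d) m
    (fun v => (if j == b then 1 else - partial j Y v) * (partial b Y v)^-1).
  apply: CkM; [exact: open_cube| |exact: Cinf_inv_partial].
  have oC : open (cube a d) by apply: open_cube.
  case: (j == b); first exact: Ck_cst.
  apply: Ck_ext (CkM oC (Ck_cst m (-1) oC) (Cinf_partial j CY m)) => // v _.
  by rewrite mulN1r.
have := @Ck_comp _ _ _ m W (cube a d) _ (fun i (u : 'rV[R]_k) => if i == b then root u else u 0 i)
  oW (@open_cube _ _ a d) unstraighten_cube Cm.
by apply=> i; case: (i == b) => //; apply: Ck_coord.
Qed.

Lemma Cinf_unstraighten i : Cinf W (fun u : 'rV[R]_k => if i == b then root u else u 0 i).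
Proof. by move=> m; case: (i == b); [apply: Ck_root|apply: Ck_coord]. Qed.

(** The hypothesis says that the j and b components of dF and dY are proportional; in the new
    coordinates dY is the differential of the b-th one, so the j-th component of dF disappears. *)
Lemma unstraighten_partial F j u : Cinf (cube a d) F -> W u -> j != b ->
  partial j F (unstraighten u) * partial b Y (unstraighten u) =
  partial b F (unstraighten u) * partial j Y (unstraighten u) ->
  partial j (fun u => F (unstraighten u)) u = 0.
Proof.
move=> CF Wu jb dep; have uc := unstraighten_cube Wu.
rewrite (@partial_comp _ _ _ W (cube a d) F
  (fun i (u : 'rV[R]_k) => if i == b then root u else u 0 i) j u (@open_cube _ _ a d) Wu uc (CF 1%N)
  (fun i => Cinf_unstraighten i 1%N)).
rewrite -/(upd b u (root u)) -/(unstraighten u).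
rewrite (bigD1 b) //= eqxx (bigD1 j) //= (negbTE jb) partial_coord eqxx mulr1.
rewrite big1 => [|i /andP[/negbTE -> /negbTE ij]]; last by rewrite partial_coord ij mulr0.
rewrite (partial_eq (root_derive j Wu)) /droot (negbTE jb) addr0.
have /andP[H _] := dYb uc.
have p0 : partial b Y (unstraighten u) != 0 by rewrite gt_eqF // (lt_trans _ H) // invr_gt0.
by rewrite mulNr mulrN mulrA -dep mulfK // addNr.
Qed.

(** The straight segment between the two points keeps coordinate b, and along it the derivative of F
    in the straightened coordinates is zero. *)
Lemma straighten_const F u : Cinf (cube a d) F -> W u ->
  (forall v j, cube a d v -> partial j F v * partial b Y v = partial b F v * partial j Y v) ->
  F (unstraighten u) = F (unstraighten (upd b a (u 0 b))).
Proof.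
move=> CF Wu dep; pose u0 := upd b a (u 0 b).
pose c i (t : R) := u0 0 i + t * (u 0 i - u0 0 i).
have Wc t : `|t| <= 1 -> W (\row_i c i t).
  move=> t1 i; rewrite !mxE /c; case: eqVneq => [->|ib].
    by have := Wu b; rewrite !mxE eqxx subrr mulr0 addr0.
  rewrite !mxE (negbTE ib) (addrC (a 0 i)) addrK normrM.
  have := Wu i; rewrite mxE (negbTE ib); apply: le_lt_trans.
  by rewrite -[leRHS]mul1r ler_wpM2r.
pose Phi u := F (unstraighten u).
have CPhi : Cinf W Phi.
  apply: (@Cinf_comp _ _ _ W (cube a d) _ (fun i (u : 'rV[R]_k) => if i == b then root u else u 0 i)
   oW (@open_cube _ _ a d) unstraighten_cube CF) => i; exact: Cinf_unstraighten.
have [|t _] := @MVT_abs R (fun t => Phi (\row_i c i t)) (fun=> 0) 1.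
  rewrite normr1 => t /Wc Wt.
  have -> : 0 = \sum_i partial i Phi (\row_i c i t) * (u 0 i - u0 0 i).
    rewrite big1 // => i _; have [->|ib] := eqVneq i b.
      by rewrite /u0 mxE eqxx subrr mulr0.
    by rewrite unstraighten_partial ?mul0r //; apply: dep; apply: unstraighten_cube.
  apply: (chain_rule oW (CPhi 1%N) Wt) => i.
  apply/is_derive_epsP => e e0; exists 1 => // s _.
  by rewrite /c (_ : _ - _ - _ = 0) ?normr0 ?mulr_ge0 ?(ltW e0) //; ring.
rewrite mul0r => /eqP; rewrite subr_eq0 /Phi => /eqP E.
have E1 : \row_i c i 1 = u by apply/rowP => i; rewrite mxE /c mul1r addrC subrK.
have E0 : \row_i c i 0 = u0 by apply/rowP => i; rewrite mxE /c mul0r addr0.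
by rewrite -{1}E1 E E0.
Qed.

End Root.

(** Functions whose differentials are proportional to dY factor through Y near a. The factor is the
    restriction to a curve c transverse to the level sets of Y; c, d and r are chosen before F, so
    that one curve serves all functions pulled back from G/H. *)
Lemma functional_dependence (O : set 'rV[R]_k) Y a b : open O -> Cinf O Y -> O a ->
  partial b Y a = 1 ->
  exists (c : R -> 'rV[R]_k) d r, [/\ 0 < d, 0 < r,
    forall t, `|t - Y a| < r -> O (c t) /\ Y (c t) = t,
    forall e, 0 < e -> exists2 r', 0 < r' & forall t, `|t - Y a| < r' -> cube a e (c t) &
    (forall x, cube a d x -> O x /\ `|Y x - Y a| < r) /\
    forall F, Cinf O F ->
      (forall v j, O v -> partial j F v * partial b Y v = partial b F v * partial j Y v) ->
      Cinf [set u : 'rV[R]_1 | `|u 0 0 - Y a| < r] (fun u => F (c (u 0 0))) /\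
      forall x, cube a d x -> F x = F (c (Y x))].
Proof.
move=> oO CY Oa Ya; have /open_cubeP/(_ a Oa)[d1 d10 dO] := oO.
have h0 : 0 < 2^-1 :> R by rewrite invr_gt0.
have /cont_cubeP/(_ _ h0)[d2 d20 Hd2] := Cinf_cont (Cinf_partial b CY) Oa.
pose d := Num.min d1 d2.
have d0 : 0 < d by rewrite lt_min d10.
have dd1 : cube a d `<=` O by move=> u /(sub_cube (_ : d <= d1))/dO; apply; rewrite ge_min lexx.
have CYd : Cinf (cube a d) Y by apply: Cinf_sub CY.
have dYb u : cube a d u -> 2^-1 < partial b Y u < 2.
  move=> /(sub_cube (_ : d <= d2)) H; have {H} := Hd2 u (H _); rewrite Ya ge_min lexx orbT => /(_ isT).
  by rewrite ltr_distl; move: (partial b Y u) => p; lra.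
have [r r0 Hr] := root_exists d0 CYd dYb.
pose c t := unstraighten a d b Y (upd b a t).
have Wt t : `|t - Y a| < r -> cube (upd b a (Y a)) r (upd b a t).
  by move=> tr i; rewrite !mxE; case: eqP => // _; rewrite subrr normr0.
have Wa := Wt (Y a); rewrite subrr normr0 in Wa.
have ca : c (Y a) = a.
  rewrite /c /unstraighten (@root_eq a d b Y d0 CYd dYb r Hr _ (a 0 b)) ?upd_upd ?upd_id //.
  - exact: Wa.
  - by rewrite subrr normr0 ltW // divr_gt0.
  - by rewrite mxE eqxx.
have cont_c e : 0 < e -> exists2 r', 0 < r' & forall t, `|t - Y a| < r' -> cube a e (c t).
  move=> e0; have /cont_cubeP/(_ e e0)[r' r'0 Hr'] := root_cont d0 CYd dYb Hr (Wa r0).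
  exists r' => // t tr i; rewrite /c /unstraighten upd_upd.
  have -> : a 0 i = c (Y a) 0 i by rewrite ca.
  rewrite /c /unstraighten upd_upd !mxE; case: eqP => [_|_].
    by apply: Hr' => j; rewrite !mxE; case: eqP => // _; rewrite subrr normr0.
  by rewrite subrr normr0.
have /cont_cubeP/(_ r r0)[d3 d30 Hd3] := Cinf_cont CY Oa.
(* The bound d / 4 puts x_b in the range where the root is unique, [d3] keeps Y x within r of Y a,
   and r bounds the remaining coordinates. *)
pose d4 := Num.min (d / 4) (Num.min d3 r).
have d40 : 0 < d4 by rewrite !lt_min d30 r0 divr_gt0.
have sub4 x : cube a d4 x -> [/\ cube a (d / 4) x, cube a d3 x & cube a r x].
  by move=> xd; split; apply: sub_cube xd; rewrite /d4 !ge_min lexx ?orbT.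
have sd x : cube a (d / 4) x -> cube a d x.
  by apply: sub_cube; rewrite ler_pdivrMr // ler_peMr ?ltW // ltr1n.
exists c, d4, r; split=> //.
- move=> t /Wt Wtt; split; first by apply/dd1/(unstraighten_cube d0 Hr Wtt).
  by have [_ ->] := rootP Hr Wtt; rewrite mxE eqxx.
split=> [x /sub4[x1 x2 x3]|F CF dep]; first by split; [apply/dd1/sd|apply: Hd3].
have CFd : Cinf (cube a d) F by apply: Cinf_sub CF.
split=> [|x /sub4[x1 x2 x3]].
  have oV : open [set u : 'rV[R]_1 | `|u 0 0 - Y a| < r].
    apply/open_cubeP => u /= ur; exists (r - `|u 0 0 - Y a|); first by rewrite subr_gt0.
    move=> v /(_ 0); rewrite ltrBrDr; apply: le_lt_trans.
    by rewrite -(subrKA (u 0 0)) ler_normD.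
  apply: (@Cinf_comp _ _ _ _ (cube a d) F
     (fun i (u : 'rV[R]_1) => if i == b then root a d b Y (upd b a (u 0 0))
        else upd b a (u 0 0) 0 i) oV (@open_cube _ _ a d) _ CFd) => [u ur|i].
    by have := unstraighten_cube d0 Hr (Wt _ ur).
  have Ci j : Cinf [set u : 'rV[R]_1 | `|u 0 0 - Y a| < r]
      (fun u : 'rV[R]_1 => if j == b then u 0 0 else a 0 j).
    by case: (j == b); [apply: Cinf_coord|apply: Cinf_cst].
  case: (i == b); last first.
    by apply: Cinf_ext (Ci i) => // u _; rewrite mxE.
  apply: (@Cinf_comp _ _ _ _ (cube (upd b a (Y a)) r) (root a d b Y)
     (fun i (u : 'rV[R]_1) => if i == b then u 0 0 else a 0 i) oV (@open_cube _ _ _ _)) => // [u ur|].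
    exact: Wt.
  by move=> m; apply: (Ck_root d0 CYd dYb Hr).
have Wx : cube (upd b a (Y a)) r (upd b x (Y x)).
  by move=> i; rewrite !mxE; case: eqP => [_|_]; [apply: Hd3|apply: x3].
have ux : unstraighten a d b Y (upd b x (Y x)) = x.
  rewrite /unstraighten (root_eq d0 CYd dYb Hr Wx (ltW (x1 b))) ?upd_upd ?upd_id //.
  by rewrite mxE eqxx.
have := straighten_const d0 CYd dYb Hr CFd Wx.
rewrite ux mxE eqxx; apply=> v j vd.
exact/dep/dd1.
Qed.

End ImplicitFunction.

(** * Spaces closed under smooth composition: gluing, neighbourhoods, bump functions *)

Section GeneratedSpaces.
Variable R : realType.

Section Gen.
Variable X : Type.
Implicit Types (S T : set (X -> R)).

Lemma sub_gen S : S `<=` gen S.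
Proof.
move=> f Sf x; exists 1%N, (fun=> f), (fun u => u 0 0), 1; split=> //.
  by apply: Cinf_coord; apply: openT.
by move=> y _; rewrite mxE.
Qed.

(** Substituting local expressions of the inner functions into the outer one. The radius must also
    keep the inner functions within the range where the outer expression is valid. *)
Lemma gen_mono S T : S `<=` gen T -> gen S `<=` gen T.
Proof.
move=> ST f Sf x; have [k [g [F [e [Sg CF e0 fE]]]]] := Sf x.
have : forall i, exists d : {k' & (('I_k' -> X -> R) * ('rV[R]_k' -> R))%type},
    [/\ forall j, T ((tagged d).1 j), Cinf setT (tagged d).2 & exists2 r, 0 < r &
      forall y, (forall j, `|(tagged d).1 j y - (tagged d).1 j x| < r) ->
        g i y = (tagged d).2 (\row_j (tagged d).1 j y) /\ `|g i y - g i x| < e].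
  move=> i; have [k' [h [H [r [Th CH r0 gE]]]]] := ST _ (Sg i) x.
  exists (existT _ k' (h, H)); split=> //=.
  have /cont_cubeP/(_ e e0)[r' r'0 Hr'] := Cinf_cont (u := \row_j h j x) CH I.
  exists (Num.min r r') => [|y yr]; first by rewrite lt_min r0.
  have Ey : g i y = H (\row_j h j y).
    by apply: gE => j; apply: lt_le_trans (yr j) _; rewrite ge_min lexx.
  have Ex : g i x = H (\row_j h j x) by apply: gE => j; rewrite subrr normr0.
  split=> //; rewrite Ey Ex; apply: Hr' => j; rewrite !mxE.
  by apply: lt_le_trans (yr j) _; rewrite ge_min lexx orbT.
(* The generators used by all inner functions together are indexed by pairs, enumerated as one
   finite ordinal. *)
case/choice => d Hd; pose I := {i : 'I_k & 'I_(tag (d i))}.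
pose h (n : 'I_#|{: I}|) := (tagged (d (tag (enum_val n)))).1 (tagged (enum_val n)).
have [||r r0 Hr] := @ex_common_radius R k (fun i r => forall y,
   (forall j, `|(tagged (d i)).1 j y - (tagged (d i)).1 j x| < r) ->
    g i y = (tagged (d i)).2 (\row_j (tagged (d i)).1 j y) /\ `|g i y - g i x| < e).
- by move=> i r r' rr H y yr; apply: H => j; apply: lt_le_trans rr.
- by move=> i; have [_ _ [r r0 H]] := Hd i; exists r.
exists #|{: I}|, h, (fun u => F (\row_i (tagged (d i)).2
   (\row_j u 0 (enum_rank (Tagged (fun i => 'I_(tag (d i))) j))))), r; split=> //.
- by move=> n; rewrite /h; case: (Hd (tag (enum_val n))) => H _ _; apply: H.
- apply: (Cinf_comp (@openT _) (@openT _) _ CF) => // i.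
  have [_ CH _] := Hd i.
  apply: (Cinf_comp (@openT _) (@openT _) _ CH) => // j.
  by apply: Cinf_coord; apply: openT.
- move=> y yr.
  have Hy i : g i y = (tagged (d i)).2 (\row_j (tagged (d i)).1 j y) /\ `|g i y - g i x| < e.
    apply: Hr => j; have := yr (enum_rank (Tagged (fun i => 'I_(tag (d i))) j)).
    by rewrite /h enum_rankK.
  rewrite fE => [|i]; last by case: (Hy i).
  congr F; apply/rowP => i; rewrite !mxE; have [-> _] := Hy i.
  by congr ((tagged (d i)).2 _); apply/rowP => j; rewrite !mxE /h enum_rankK.
Qed.

Lemma gen_idem S : gen (gen S) `<=` gen S.
Proof. exact: gen_mono. Qed.

End Gen.

Definition gen_closed (X : diffSpace R) := gen (@smooth R X) `<=` @smooth R X.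

Section Closed.
Variable X : diffSpace R.
Hypothesis gX : gen_closed X.
Implicit Types (f g : X -> R) (x y : X) (P Q : set X).

Lemma smooth_comp k (g : 'I_k -> X -> R) F : (forall i, smooth (g i)) -> Cinf setT F ->
  smooth (fun x => F (\row_i g i x)).
Proof. by move=> sg CF; apply: gX => x; exists k, g, F, 1. Qed.

Lemma smooth_cst (c : R) : smooth (fun _ : X => c).
Proof.
apply: gX => x; exists 0%N, (fun _ _ => 0), (fun=> c), 1; split=> //.
  by case.
by apply: Cinf_cst; apply: openT.
Qed.

Lemma smooth_comp1 f F : smooth f -> Cinf (setT : set 'rV[R]_1) F ->
  smooth (fun x => F (\row_i f x)).
Proof. by move=> sf CF; apply: (@smooth_comp 1 (fun=> f)). Qed.

Lemma smooth_comp2 f g F : smooth f -> smooth g -> Cinf (setT : set 'rV[R]_2) F ->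
  smooth (fun x => F (\row_(i < 2) if i == 0 then f x else g x)).
Proof.
by move=> sf sg CF; apply: (@smooth_comp 2 (fun i x => if i == 0 then f x else g x)) => // i;
  case: (i == 0).
Qed.

Lemma smooth_eq f g : f =1 g -> smooth f -> smooth g.
Proof. by move=> /funext ->. Qed.

Lemma smoothD f g : smooth f -> smooth g -> smooth (fun x => f x + g x).
Proof.
move=> sf sg; apply: (smooth_eq _ (smooth_comp2 (F := fun u => u 0 0 + u 0 1) sf sg _)) => [x|].
  by rewrite !mxE.
by apply: CinfD; [exact: openT|apply: Cinf_coord; apply: openT|apply: Cinf_coord; apply: openT].
Qed.

Lemma smoothM f g : smooth f -> smooth g -> smooth (fun x => f x * g x).
Proof.
move=> sf sg; apply: (smooth_eq _ (smooth_comp2 (F := fun u => u 0 0 * u 0 1) sf sg _)) => [x|].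
  by rewrite !mxE.
by apply: CinfM; [exact: openT|apply: Cinf_coord; apply: openT|apply: Cinf_coord; apply: openT].
Qed.

Lemma smoothZ c f : smooth f -> smooth (fun x => c * f x).
Proof. by move=> sf; apply: smoothM => //; apply: smooth_cst. Qed.

Lemma smoothB f g : smooth f -> smooth g -> smooth (fun x => f x - g x).
Proof.
move=> sf sg; apply: (smooth_eq _ (smoothD sf (smoothZ (-1) sg))) => x.
by rewrite mulN1r.
Qed.

Lemma smooth_sum n (f : 'I_n -> X -> R) : (forall i, smooth (f i)) ->
  smooth (fun x => \sum_i f i x).
Proof.
move=> sf; apply: (smooth_eq _ (smooth_comp (F := fun u => \sum_i u 0 i) sf _)) => [x|].
  by apply: eq_bigr => i _; rewrite mxE.
apply: Cinf_sum => [|i]; first exact: openT.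
by apply: Cinf_coord; apply: openT.
Qed.

(** Basic open sets are non-vanishing loci, and [flat_fun] vanishes exactly on the non-positive
    reals. *)
Lemma dopen_pos f : smooth f -> dopen [set x | 0 < f x].
Proof.
move=> sf x /= fx; exists (fun x => flat_fun (f x)); split.
- apply: (smooth_eq _ (smooth_comp1 (F := fun u => flat_fun (u 0 0)) sf _)) => [y|].
    by rewrite mxE.
  apply: Cinf_flat_fun; first exact: openT.
  by apply: Cinf_coord; apply: openT.
- by rewrite gt_eqF // flat_fun_gt0.
- by move=> y; rewrite /= -flat_fun_gt0 lt_def flat_fun_ge0 andbT.
Qed.

Lemma dopenT : dopen [set: X].
Proof. by move=> x _; exists (fun=> 1); split=> //; [apply: smooth_cst|apply: oner_neq0]. Qed.

Lemma dopenI P Q : dopen P -> dopen Q -> dopen (P `&` Q).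
Proof.
move=> oP oQ x [/oP[f [sf fx fP]] /oQ[g [sg gx gQ]]]; exists (fun x => f x * g x); split.
- exact: smoothM.
- by rewrite mulf_neq0.
- by move=> y; rewrite mulf_eq0 negb_or => /andP[/fP ? /gQ].
Qed.

Lemma dopen_ball f c e : smooth f -> dopen [set x | `|f x - c| < e].
Proof.
move=> sf; have -> : [set x | `|f x - c| < e] =
    [set x | 0 < f x - (c - e)] `&` [set x | 0 < (c + e) - f x].
  by apply/seteqP; split=> x /=; rewrite ltr_distl !subr_gt0; [move=> /andP[]|case=> -> ->].
by apply: dopenI; apply: dopen_pos; apply: smoothB => //; apply: smooth_cst.
Qed.

Lemma dopen_all k (P : 'I_k -> set X) : (forall i, dopen (P i)) -> dopen [set x | forall i, P i x].
Proof.
elim: k P => [|k IH] P oP.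
  by move=> x _; exists (fun=> 1); split=> [||y _ []//]; [apply: smooth_cst|apply: oner_neq0].
have -> : [set x | forall i, P i x] = P ord0 `&` [set x | forall i, P (lift ord0 i) x].
  apply/seteqP; split=> [x H|x [H0 H] i]; first by split=> [|i]; apply: H.
  by case: (unliftP ord0 i) => [j|] ->.
by apply: dopenI => //; apply: IH.
Qed.

Definition dnbhs x P := exists N, [/\ dopen N, N x & N `<=` P].

Lemma dnbhs_dopen N x : dopen N -> N x -> dnbhs x N.
Proof. by exists N; split. Qed.

Lemma dnbhs_self x P : dnbhs x P -> P x.
Proof. by case=> N [_ Nx]; apply. Qed.

Lemma dnbhsS x P Q : P `<=` Q -> dnbhs x P -> dnbhs x Q.
Proof. by move=> PQ [N [oN Nx NP]]; exists N; split=> // y /NP/PQ. Qed.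

Lemma dnbhsT x P : (forall y, P y) -> dnbhs x P.
Proof. by move=> H; exists setT; split=> //; apply: dopenT. Qed.

Lemma dnbhsI x P Q : dnbhs x P -> dnbhs x Q -> dnbhs x (P `&` Q).
Proof.
move=> [N [oN Nx NP]] [N' [oN' Nx' NQ]]; exists (N `&` N'); split=> //.
  exact: dopenI.
by move=> y [/NP ? /NQ].
Qed.

Lemma dnbhs_all k x (P : 'I_k -> set X) : (forall i, dnbhs x (P i)) ->
  dnbhs x [set y | forall i, P i y].
Proof.
move=> /choice[N HN]; exists [set y | forall i, N i y]; split=> //.
- by apply: dopen_all => i; case: (HN i).
- by move=> i; case: (HN i).
- by move=> y Ny i; case: (HN i) => _ _; apply; apply: Ny.
Qed.

Lemma dnbhs_dnbhs x P : dnbhs x P -> dnbhs x [set y | dnbhs y P].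
Proof. by move=> [N [oN Nx NP]]; exists N; split=> // y Ny; exists N. Qed.

Lemma dnbhs_cvg k (g : 'I_k -> X -> R) x e : (forall i, smooth (g i)) -> 0 < e ->
  dnbhs x [set y | forall i, `|g i y - g i x| < e].
Proof.
move=> sg e0; apply: dnbhs_all => i.
exists [set y | `|g i y - g i x| < e]; split=> //=; first exact: dopen_ball.
by rewrite subrr normr0.
Qed.

Definition smooth_at x f := exists2 g : X -> R, smooth g & dnbhs x [set y | f y = g y].

Lemma smooth_smooth_at x f : smooth f -> smooth_at x f.
Proof. by move=> sf; exists f => //; apply: dnbhsT. Qed.

Lemma smooth_local f : (forall x, smooth_at x f) -> smooth f.
Proof.
move=> H; apply: gX => x; have [g sg [N [oN Nx fg]]] := H x.
have [b [sb bx bN]] := oN x Nx.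
(* The function b is listed only to confine the neighbourhood to N; the expression itself is the
   first coordinate. *)
exists 2%N, (fun i => if i == 0 then g else b), (fun u => u 0 0), `|b x|; split.
- by move=> i; case: (i == 0).
- by apply: Cinf_coord; apply: openT.
- by rewrite normr_gt0.
- move=> y /(_ 1) /= yb; rewrite !mxE /=; apply/fg/bN/eqP => by0.
  by move: yb; rewrite by0 sub0r normrN ltxx.
Qed.

Lemma smooth_at_comp k (g : 'I_k -> X -> R) (O : set 'rV[R]_k) F x : open O ->
  (forall i, smooth_at x (g i)) -> Cinf O F -> O (\row_i g i x) ->
  smooth_at x (fun y => F (\row_i g i y)).
Proof.
move=> oO sg CF Ox.
have [d [F' [d0 dO CF' F'E _]]] := Cinf_extend oO Ox CF.
have {}sg i : exists h : X -> R, smooth h /\ dnbhs x [set y | g i y = h y].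
  by have [h ? ?] := sg i; exists h.
have [h hP] := choice sg.
exists (fun y => F' (\row_i h i y)).
  by apply: smooth_comp => // i; case: (hP i).
have H1 : dnbhs x [set y | forall i, g i y = h i y].
  by apply: dnbhs_all => i; case: (hP i).
have H2 : dnbhs x [set y | forall i, `|h i y - h i x| < d].
  by apply: dnbhs_cvg => // i; case: (hP i).
apply: dnbhsS (dnbhsI H1 H2) => y [/= gh hd].
have -> : \row_i h i y = \row_i g i y by apply/rowP => i; rewrite !mxE gh.
rewrite F'E // => i; rewrite !mxE gh.
by have /dnbhs_self/(_ i) /= -> := H1.
Qed.

Lemma smooth_at_ext x f g : dnbhs x [set y | f y = g y] -> smooth_at x f -> smooth_at x g.
Proof.
move=> fg [h sh fh]; exists h => //.
by apply: dnbhsS (dnbhsI fg fh) => y /= [<- <-].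
Qed.

Lemma smooth_atD x f g : smooth_at x f -> smooth_at x g -> smooth_at x (fun y => f y + g y).
Proof.
move=> [f' sf ff'] [g' sg gg']; exists (fun y => f' y + g' y); first exact: smoothD.
by apply: dnbhsS (dnbhsI ff' gg') => y /= [-> ->].
Qed.

Lemma smooth_atM x f g : smooth_at x f -> smooth_at x g -> smooth_at x (fun y => f y * g y).
Proof.
move=> [f' sf ff'] [g' sg gg']; exists (fun y => f' y * g' y); first exact: smoothM.
by apply: dnbhsS (dnbhsI ff' gg') => y /= [-> ->].
Qed.

Lemma smooth_at_sum n x (f : 'I_n -> X -> R) : (forall i, smooth_at x (f i)) ->
  smooth_at x (fun y => \sum_i f i y).
Proof.
elim: n f => [|n IH] f sf.
  by apply: (smooth_at_ext _ (smooth_smooth_at _ (smooth_cst 0))); apply: dnbhsT => y /=; rewrite big_ord0.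
apply: (@smooth_at_ext _ (fun y => f ord0 y + \sum_i f (lift ord0 i) y)).
  by apply: dnbhsT => y /=; rewrite big_ord_recl.
by apply: smooth_atD => //; apply: IH => i.
Qed.

(** For f non-zero at x and zero off W, the function below is 1 where f^2 >= f(x)^2 / 2 and 0 where
    f^2 <= f(x)^2 / 4. Vanishing near each point off W, and not only at it, is what permits
    extension by zero. *)
Lemma bump W x : dopen W -> W x -> exists b : X -> R,
  [/\ smooth b, dnbhs x [set y | b y = 1] & forall y, ~ W y -> dnbhs y [set z | b z = 0]].
Proof.
move=> oW Wx; have [f [sf fx fW]] := oW x Wx.
have fx0 : 0 < f x ^+ 2 by rewrite lt_def sqr_ge0 andbT expf_neq0.
pose F (t : R) := smooth_step (4 * t ^+ 2 / f x ^+ 2 - 1).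
exists (fun y => F (f y)).
have f2 : smooth (fun y => f y * f y) by apply: smoothM.
split.
- apply: (smooth_eq _ (smooth_comp1 (F := fun u => F (u 0 0)) sf _)) => [y|].
    by rewrite mxE.
  have oT := @openT 'rV[R]_1; apply: Cinf_smooth_step => //; apply: CinfB => //; last exact: Cinf_cst.
  apply: CinfM => //; last exact: Cinf_cst.
  by apply: CinfZ => //; apply: CinfM => //; apply: Cinf_coord.
- exists [set y | 0 < f y * f y - f x ^+ 2 / 2]; split.
  + by apply: dopen_pos; apply: smoothB => //; apply: smooth_cst.
  + by rewrite /= -expr2 subr_gt0 ltr_pdivrMr // ltr_pMr // ltr1n.
  + move=> y /= H; rewrite /F smooth_step1 // lerBrDr ler_pdivlMr //.
    by move: H; rewrite subr_gt0 ltr_pdivrMr // -expr2; lra.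
- move=> y nWy; have fy : f y = 0.
    by apply/eqP; apply: contrapT => /negP/fW.
  exists [set z | 0 < f x ^+ 2 / 4 - f z * f z]; split.
  + by apply: dopen_pos; apply: smoothB => //; apply: smooth_cst.
  + by rewrite /= fy mul0r subr0 divr_gt0.
  + move=> z /= H; rewrite /F smooth_step0 // subr_le0 ler_pdivrMr // mul1r.
    by move: H; rewrite subr_gt0 ltr_pdivlMr // -expr2; lra.
Qed.

Lemma smooth_cutoff W b f : smooth b -> (forall y, ~ W y -> dnbhs y [set z | b z = 0]) ->
  (forall y, W y -> smooth_at y f) -> smooth (fun y => b y * f y).
Proof.
move=> sb b0 sf; apply: smooth_local => y; have [Wy|/b0 H] := pselect (W y).
  by apply: smooth_atM; [apply: smooth_smooth_at|apply: sf].
exists (fun=> 0); first exact: smooth_cst.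
by apply: dnbhsS H => z /= ->; rewrite mul0r.
Qed.

End Closed.
End GeneratedSpaces.
Arguments dnbhs {R X}.
Arguments smooth_at {R X}.

(** * Point derivations, vector fields and b-vector fields *)

Section Derivations.
Variable R : realType.

Definition pder (X : diffSpace R) (x : X) (xi : (X -> R) -> R) : Prop :=
  [/\ forall f g, smooth f -> smooth g -> xi (fun y => f y + g y) = xi f + xi g,
      forall c f, smooth f -> xi (fun y => c * f y) = c * xi f &
      forall f g, smooth f -> smooth g -> xi (fun y => f y * g y) = f x * xi g + g x * xi f].

Section PointDerivations.
Variable X : diffSpace R.
Hypothesis gX : gen_closed X.
Implicit Types (x : X) (f g : X -> R) (xi : (X -> R) -> R).

Lemma pder_cst x xi c : pder x xi -> xi (fun=> c) = 0.
Proof.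
move=> [xiD xiZ xiM]; have s1 := smooth_cst gX 1.
have E1 : xi (fun=> 1) = 0.
  have := xiM _ _ s1 s1; rewrite !mul1r.
  by rewrite -[LHS]addr0 => /addrI.
have -> : (fun _ : X => c) = (fun _ => c * 1) by apply/funext => y; rewrite mulr1.
by rewrite xiZ // E1 mulr0.
Qed.

(** Multiplication by a function b supported in the neighbourhood makes f and g equal; Leibniz's
    rule then allows cancelling the non-zero b x. *)
Lemma pder_local x xi f g : pder x xi -> smooth f -> smooth g ->
  dnbhs x [set y | f y = g y] -> xi f = xi g.
Proof.
move=> [_ _ xiM] sf sg fg; have fgx := dnbhs_self fg.
have [N [oN Nx NE]] := fg; have [b [sb bx bN]] := oN x Nx.
have E : (fun y => b y * f y) = (fun y => b y * g y).
  by apply/funext => y; have [->|/bN/NE/= ->] := eqVneq (b y) 0; rewrite ?mul0r.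
have := xiM _ _ sb sf; rewrite E xiM // fgx => /addIr/(mulfI bx).
by [].
Qed.

Lemma pder_sum x xi n (f : 'I_n -> X -> R) : pder x xi -> (forall i, smooth (f i)) ->
  xi (fun y => \sum_i f i y) = \sum_i xi (f i).
Proof.
move=> pxi sf; have [xiD _ _] := pxi; elim: n f sf => [|n IH] f sf.
  rewrite big_ord0 -[RHS](pder_cst 0 pxi); congr xi.
  by apply/funext => y; rewrite big_ord0.
rewrite big_ord_recl -IH // -xiD //; last by apply: smooth_sum => //.
by congr xi; apply/funext => y; rewrite big_ord_recl.
Qed.

(** In Hadamard's formula at [g x] each factor g_i - g_i(x) vanishes at x, so Leibniz's rule retains
    only the first-order coefficients. *)
Lemma pder_chain x xi k (g : 'I_k -> X -> R) F f : pder x xi -> smooth f ->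
  (forall i, smooth (g i)) -> Cinf setT F -> dnbhs x [set y | f y = F (\row_i g i y)] ->
  xi f = \sum_i partial i F (\row_i g i x) * xi (g i).
Proof.
move=> pxi sf sg CF fF; have [xiD _ xiM] := pxi.
have [G [CG Ga FE]] := hadamard (\row_i g i x) CF.
have sG i : smooth (fun y => G i (\row_i g i y)) by apply: smooth_comp.
have sgc i : smooth (fun y => g i y - g i x) by apply: smoothB => //; apply: smooth_cst.
have sgG i : smooth (fun y => (g i y - g i x) * G i (\row_i g i y)) by apply: smoothM.
have -> : xi f = xi (fun y => F (\row_i g i x) + \sum_i (g i y - g i x) * G i (\row_i g i y)).
  apply: (pder_local pxi) => //.
    by apply: smoothD => //; [apply: smooth_cst|apply: smooth_sum].
  apply: dnbhsS fF => y /= ->; rewrite FE; congr (_ + _).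
  by apply: eq_bigr => i _; rewrite !mxE.
rewrite xiD; [|exact: smooth_cst|exact: smooth_sum].
rewrite (pder_cst _ pxi) add0r (pder_sum pxi) //; apply: eq_bigr => i _.
rewrite xiM // subrr mul0r add0r Ga; congr (_ * _).
by have := xiD (g i) (fun=> - g i x) (sg i) (smooth_cst gX _); rewrite (pder_cst _ pxi) addr0.
Qed.

Lemma pder_chain_at x xi k (g : 'I_k -> X -> R) O F f : pder x xi -> smooth f ->
  (forall i, smooth (g i)) -> open O -> Cinf O F -> O (\row_i g i x) ->
  dnbhs x [set y | f y = F (\row_i g i y)] ->
  xi f = \sum_i partial i F (\row_i g i x) * xi (g i).
Proof.
move=> pxi sf sg oO CF Ox fF; have [d [F' [d0 dO CF' F'E _]]] := Cinf_extend oO Ox CF.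
rewrite (@pder_chain x xi k g F' f) //.
  by apply: eq_bigr => i _; congr (_ * _); apply: (partial_local _ d0) => v /F'E.
apply: dnbhsS (dnbhsI gX fF (dnbhs_cvg gX x sg d0)) => y [/= -> H].
by rewrite F'E // => i; rewrite !mxE.
Qed.

(** The consequence of the chain rule on which all comparisons of brackets rest. *)
Lemma pder_gen_eq (S : set (X -> R)) x xi xi' : smooth `<=` gen S -> S `<=` smooth ->
  pder x xi -> pder x xi' -> (forall f, S f -> xi f = xi' f) ->
  forall f, smooth f -> xi f = xi' f.
Proof.
move=> sub Ssm pxi pxi' E f sf; have [k [g [F [e [Sg CF e0 fE]]]]] := sub f sf x.
have sg i : smooth (g i) by apply/Ssm/Sg.
have fF : dnbhs x [set y | f y = F (\row_i g i y)].
  by apply: dnbhsS (dnbhs_cvg gX x sg e0) => y /fE.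
rewrite (pder_chain pxi sf sg CF fF) (pder_chain pxi' sf sg CF fF).
by apply: eq_bigr => i _; rewrite E.
Qed.

Lemma vfield_pder D x : is_vfield D -> pder x (fun f => D f x).
Proof.
by move=> [_ _ DD DZ DM]; split=> [f g sf sg|c f sf|f g sf sg]; rewrite ?DD ?DZ ?DM.
Qed.

Lemma vfield_local D x f g : is_vfield D -> smooth f -> smooth g ->
  dnbhs x [set y | f y = g y] -> D f x = D g x.
Proof. by move=> /vfield_pder vD; apply: pder_local (vD x). Qed.

(** Enforces the convention that operators vanish on functions that are not smooth, under which
    equal derivations are equal operators. *)
Definition mkop (D : (X -> R) -> X -> R) : operator X :=
  fun f => if `[< smooth f >] then D f else fun=> 0.

Lemma mkopE D f : smooth f -> mkop D f = D f.
Proof. by rewrite /mkop; case: asboolP. Qed.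

Lemma mkop_vfield D : (forall f, smooth f -> smooth (D f)) ->
  (forall x, pder x (fun f => D f x)) -> is_vfield (mkop D).
Proof.
move=> sD pD; split=> [f|f sf|f g sf sg|c f sf|f g sf sg].
- by rewrite /mkop; case: asboolP.
- by rewrite mkopE //; apply: sD.
- rewrite !mkopE //; last exact: smoothD.
  by apply/funext => x; have [H _ _] := pD x; apply: H.
- rewrite !mkopE //; last exact: smoothZ.
  by apply/funext => x; have [_ H _] := pD x; apply: H.
- rewrite !mkopE //; last exact: smoothM.
  by apply/funext => x; have [_ _ H] := pD x; apply: H.
Qed.

Lemma vfield_ext D E : is_vfield D -> is_vfield E ->
  (forall f, smooth f -> forall x, D f x = E f x) -> D = E.
Proof.
move=> vD vE DE; apply/funext => f; have [sf|nf] := pselect (smooth f).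
  by apply/funext => x; apply: DE.
by case: vD => -> // _ _ _ _; case: vE => ->.
Qed.

Lemma vfieldD D E : is_vfield D -> is_vfield E -> is_vfield (fun f x => D f x + E f x).
Proof.
move=> vD vE; have [D0 sD _ _ _] := vD; have [E0 sE _ _ _] := vE.
have -> : (fun f x => D f x + E f x) = mkop (fun f x => D f x + E f x).
  apply/funext => f; rewrite /mkop; case: asboolP => // nf.
  by apply/funext => x; rewrite D0 // E0 // addr0.
apply: mkop_vfield => [f sf|x]; first by apply: smoothD => //; [apply: sD|apply: sE].
have [a1 a2 a3] := vfield_pder x vD; have [b1 b2 b3] := vfield_pder x vE.
split=> [f g sf sg|c f sf|f g sf sg].
- by rewrite a1 // b1 //; ring.
- by rewrite a2 // b2 //; ring.
- by rewrite a3 // b3 //; ring.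
Qed.

Lemma vfieldM f D : smooth f -> is_vfield D -> is_vfield (fun h x => f x * D h x).
Proof.
move=> sf vD; have [D0 sD _ _ _] := vD.
have -> : (fun h x => f x * D h x) = mkop (fun h x => f x * D h x).
  apply/funext => h; rewrite /mkop; case: asboolP => // nh.
  by apply/funext => x; rewrite D0 // mulr0.
apply: mkop_vfield => [h sh|x]; first by apply: smoothM => //; apply: sD.
have [a1 a2 a3] := vfield_pder x vD.
split=> [h g sh sg|c h sh|h g sh sg].
- by rewrite a1 //; ring.
- by rewrite a2 //; ring.
- by rewrite a3 //; ring.
Qed.

Lemma vfield0 : is_vfield (fun (f : X -> R) (x : X) => 0 : R).
Proof.
have -> : (fun (f : X -> R) (x : X) => 0 : R) = mkop (fun _ _ => 0).
  by apply/funext => f; rewrite /mkop; case: asboolP.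
apply: mkop_vfield => [f _|x]; first exact: smooth_cst.
by split=> *; rewrite ?mulr0 ?addr0.
Qed.

Lemma vfieldZ c D : is_vfield D -> is_vfield (fun h x => c * D h x).
Proof. by apply: (@vfieldM (fun=> c)); apply: smooth_cst. Qed.

Lemma vfield_lie (D E : operator X) : is_vfield D -> is_vfield E -> is_vfield (lie_br D E).
Proof.
move=> vD vE; have [D0 sD DD DZ DM] := vD; have [E0 sE ED EZ EM] := vE.
have D00 : D (fun=> 0) = fun=> 0 by apply/funext => x; rewrite (pder_cst _ (vfield_pder x vD)).
have E00 : E (fun=> 0) = fun=> 0 by apply/funext => x; rewrite (pder_cst _ (vfield_pder x vE)).
have -> : lie_br D E = mkop (lie_br D E).
  apply/funext => f; rewrite /mkop; case: asboolP => // nf.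
  by apply/funext => x; rewrite /lie_br (D0 f) // (E0 f) // D00 E00 subrr.
apply: mkop_vfield => [f sf|x].
  by apply: smoothB => //; [apply/sD/sE|apply/sE/sD].
split=> [f g sf sg|c f sf|f g sf sg]; rewrite /lie_br.
- by rewrite (ED _ _ sf sg) (DD _ _ sf sg) (DD _ _ (sE _ sf) (sE _ sg))
    (ED _ _ (sD _ sf) (sD _ sg)); ring.
- by rewrite (EZ _ _ sf) (DZ _ _ sf) (DZ _ _ (sE _ sf)) (EZ _ _ (sD _ sf)); ring.
- have [sDf sDg sEf sEg] : [/\ smooth (D f), smooth (D g), smooth (E f) & smooth (E g)].
    by split; [apply: sD|apply: sD|apply: sE|apply: sE].
  rewrite (EM _ _ sf sg) (DM _ _ sf sg) DD ?ED; [|exact: smoothM..].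
  by rewrite !DM // !EM //; ring.
Qed.

End PointDerivations.

Section Bfields.
Variables (X : diffSpace R) (Z : set X).
Hypothesis gX : gen_closed X.

Lemma bfieldD D E : is_bfield Z D -> is_bfield Z E -> is_bfield Z (fun f x => D f x + E f x).
Proof.
move=> [vD zD] [vE zE]; split=> [|f sf f0 z Zz]; first exact: vfieldD.
by rewrite zD // zE // addr0.
Qed.

Lemma bfieldM f D : smooth f -> is_bfield Z D -> is_bfield Z (fun h x => f x * D h x).
Proof.
move=> sf [vD zD]; split=> [|h sh h0 z Zz]; first exact: vfieldM.
by rewrite zD // mulr0.
Qed.

Lemma bfield0 : is_bfield Z (fun (f : X -> R) (x : X) => 0 : R).
Proof. by split=> //; apply: vfield0. Qed.

Lemma bfieldZ c D : is_bfield Z D -> is_bfield Z (fun h x => c * D h x).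
Proof. by apply: (@bfieldM (fun=> c)); apply: smooth_cst. Qed.

Lemma bfieldB D E : is_bfield Z D -> is_bfield Z E -> is_bfield Z (fun f x => D f x - E f x).
Proof.
move=> bD bE; have := bfieldD bD (bfieldZ (-1) bE).
by congr is_bfield; apply/funext => f; apply/funext => x; rewrite mulN1r.
Qed.

Lemma bfield_lie (D E : operator X) : is_bfield Z D -> is_bfield Z E -> is_bfield Z (lie_br D E).
Proof.
move=> [vD zD] [vE zE]; split=> [|f sf f0 z Zz]; first exact: vfield_lie.
have [_ sD _ _ _] := vD; have [_ sE _ _ _] := vE.
by rewrite /lie_br (zD _ (sE _ sf) (zE f sf f0)) // (zE _ (sD _ sf) (zD f sf f0)) // subrr.
Qed.

Lemma bfield_sum n (D : 'I_n -> operator X) : (forall i, is_bfield Z (D i)) ->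
  is_bfield Z (fun f x => \sum_i D i f x).
Proof.
elim: n D => [|n IH] D bD.
  have := bfield0; congr is_bfield; apply/funext => f; apply/funext => x.
  by rewrite big_ord0.
have := bfieldD (bD ord0) (IH (fun i => D (lift ord0 i)) (fun i => bD _)).
by congr is_bfield; apply/funext => f; apply/funext => x; rewrite big_ord_recl.
Qed.

End Bfields.

Section Maps.
Variables X Y : diffSpace R.
Hypothesis gX : gen_closed X.

Lemma smooth_map_gen (S : set (Y -> R)) (phi : X -> Y) : smooth `<=` gen S ->
  (forall f, S f -> smooth (f \o phi)) -> smooth_map phi.
Proof.
move=> sub Sphi f /sub Sf; apply: gX => x.
have [k [g [F [e [Sg CF e0 fE]]]]] := Sf (phi x).
exists k, (fun i => g i \o phi), F, e; split=> //.
  by move=> i; apply/Sphi/Sg.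
by move=> y yx /=; rewrite fE.
Qed.

End Maps.

(** * Subspaces, products, quotients and derivations depending on parameters *)

Section Constructions.
Variables X Y P : diffSpace R.
Hypotheses (gX : gen_closed X) (gY : gen_closed Y) (gP : gen_closed P).

Lemma smooth_map_dopen (phi : X -> Y) N : smooth_map phi -> dopen N -> dopen (phi @^-1` N).
Proof.
move=> sphi oN x /oN[f [sf fx fN]]; exists (f \o phi); split=> //; first exact: sphi.
by move=> y /fN.
Qed.

Lemma smooth_map_dnbhs (phi : X -> Y) x N : smooth_map phi -> dnbhs (phi x) N ->
  dnbhs x (phi @^-1` N).
Proof.
move=> sphi [N' [oN' Nx NN]]; exists (phi @^-1` N'); split=> //.
  exact: smooth_map_dopen.
by move=> y /NN.
Qed.

Lemma smooth_map_at (phi : X -> Y) x f : smooth_map phi -> smooth_at (phi x) f ->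
  smooth_at x (f \o phi).
Proof.
move=> sphi [g sg fg]; exists (g \o phi); first exact: sphi.
by have := smooth_map_dnbhs sphi fg.
Qed.

Lemma pder_push (phi : X -> Y) x xi : smooth_map phi -> pder x xi ->
  pder (phi x) (fun f => xi (f \o phi)).
Proof.
move=> sphi [xD xZ xM]; split=> [f g sf sg|c f sf|f g sf sg].
- exact: xD (sphi _ sf) (sphi _ sg).
- exact: xZ (sphi _ sf).
- exact: xM (sphi _ sf) (sphi _ sg).
Qed.

Lemma gen_closed_sub (A : set X) : gen_closed (subSpace A).
Proof. exact: gen_idem. Qed.

Lemma gen_closed_prod : gen_closed (prodSpace X Y).
Proof. exact: gen_idem. Qed.

Lemma gen_closed_quot (E : X -> X -> Prop) : gen_closed (quotSpace E).
Proof.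
move=> f gf; apply: gX => x; have [k [g [F [e [Sg CF e0 fE]]]]] := gf (orbit_of E x).
exists k, (fun i y => g i (orbit_of E y)), F, e; split=> //.
by move=> y yx; rewrite fE.
Qed.

Lemma smooth_sval (A : set X) : smooth_map (sval : subSpace A -> X).
Proof. by move=> f sf; apply: sub_gen; exists f. Qed.

Lemma smooth_fst : smooth_map (fst : prodSpace X Y -> X).
Proof. by move=> f sf; apply: sub_gen; left; exists f. Qed.

Lemma smooth_snd : smooth_map (snd : prodSpace X Y -> Y).
Proof. by move=> f sf; apply: sub_gen; right; exists f. Qed.

Lemma smooth_into_sub (A : set Y) (phi : X -> subSpace A) :
  smooth_map (fun x => sval (phi x) : Y) -> smooth_map phi.
Proof. 
move=> sphi; apply: (@smooth_map_gen X (subSpace A) gX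
  [set f | exists2 g : Y -> R, smooth g & f = fun x => g (sval x)]) => // _ [g sg ->].
exact: sphi.
 Qed.

Lemma smooth_pair (phi : P -> X) (psi : P -> Y) : smooth_map phi -> smooth_map psi ->
  smooth_map ((fun p => (phi p, psi p)) : P -> prodSpace X Y).
Proof.
move=> sphi spsi f Sf; apply: gP => p.
have [k [g [F [e [Sg CF e0 fE]]]]] := Sf (phi p, psi p).
exists k, (fun i q => g i (phi q, psi q)), F, e; split=> //.
  by move=> i; case: (Sg i) => -[h sh ->]; [apply: sphi|apply: spsi].
by move=> y yx /=; rewrite fE.
Qed.

Lemma smooth_const_map (y : Y) : smooth_map (fun _ : X => y).
Proof. by move=> f _; apply: smooth_cst. Qed.

Lemma smooth_id : smooth_map (fun x : X => x).
Proof. by []. Qed.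

Lemma sub_ext (A : set X) (f : subSpace A -> R) (x : subSpace A) : smooth f ->
  exists2 g : X -> R, smooth g &
    dnbhs (sval x : X) [set z | forall y : subSpace A, sval y = z -> f y = g z].
Proof.
move=> /(_ x)[k [g [F [e [Sg CF e0 fE]]]]].
have {}Sg i : exists h : X -> R, smooth h /\ g i = fun x => h (sval x).
  by have [h sh gE] := Sg i; exists h.
have [h hP] := choice Sg; have sh i := (hP i).1.
exists (fun z => F (\row_i h i z)); first exact: smooth_comp.
apply: dnbhsS (dnbhs_cvg gX (sval x : X) sh e0) => z /= zx y yz.
rewrite fE => [|i]; last by rewrite (hP i).2 yz.
by congr F; apply/rowP => i; rewrite !mxE (hP i).2 yz.
Qed.

Lemma smooth_at_sub (A : set X) (f : subSpace A -> R) (x : subSpace A) :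
  smooth_at x f -> exists2 g : X -> R, smooth g &
    dnbhs (sval x : X) [set z | forall y : subSpace A, sval y = z -> f y = g z].
Proof.
move=> [f' sf' [N [oN Nx NE]]]; have [g sg gE] := sub_ext x sf'.
have [b [sb bx bN]] := oN x Nx; have [c sc cE] := sub_ext x sb.
exists g => //; have cx : c (sval x) != 0 by have := dnbhs_self cE x erefl => <-.
have cN : dnbhs (sval x : X) [set z | c z != 0].
  exists [set z | 0 < c z * c z]; split.
  - by apply: dopen_pos => //; apply: smoothM.
  - by rewrite /= lt_def mulf_neq0 //= -expr2 sqr_ge0.
  - by move=> z /= H; apply/eqP => E; move: H; rewrite E mul0r ltxx.
apply: dnbhsS (dnbhsI gX (dnbhsI gX gE cE) cN) => z [[H1 H2] H3] y yz.
rewrite -(H1 y yz); apply/NE/bN; by rewrite (H2 y yz).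
Qed.

Lemma smooth_prod_slice (f : prodSpace X Y -> R) x : smooth f -> smooth (fun y => f (x, y)).
Proof.
move=> sf; apply: gY => y; have [k [g [F [e [Sg CF e0 fE]]]]] := sf (x, y).
exists k, (fun i y => g i (x, y)), F, e; split=> //.
  by move=> i; case: (Sg i) => -[h sh ->] //=; apply: smooth_cst.
by move=> z zy; rewrite fE.
Qed.

(** Near a given parameter f is a smooth function of finitely many functions of one factor each.
    Those of the first factor are constants for [xi p], those of the second give smooth functions of
    p, and the chain rule assembles them. *)
Lemma smooth_param_pder (f : prodSpace X Y -> R) (al : P -> X) (be : P -> Y)
    (xi : P -> (Y -> R) -> R) :
  smooth f -> smooth_map al -> smooth_map be -> (forall p, pder (be p) (xi p)) ->
  (forall k, smooth k -> smooth (fun p => xi p k)) ->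
  smooth (fun p => xi p (fun y => f (al p, y))).
Proof.
move=> sf sal sbe pxi sxi; apply: smooth_local => // p0.
have [k [g [F [e [Sg CF e0 fE]]]]] := sf (al p0, be p0).
have sg i : smooth (fun p => g i (al p, be p)).
  by case: (Sg i) => -[h sh ->] /=; [apply: sal|apply: sbe].
have sgy i p : smooth (fun y => g i (al p, y)).
  by case: (Sg i) => -[h sh ->] //=; apply: smooth_cst.
have sgxi i : smooth (fun p => xi p (fun y => g i (al p, y))).
  case: (Sg i) => -[h sh ->] /=; last exact: sxi.
  apply: smooth_eq (smooth_cst gP 0) => p.
  by rewrite (pder_cst gY _ (pxi p)).
exists (fun p => \sum_i partial i F (\row_i g i (al p, be p)) * xi p (fun y => g i (al p, y))).
  apply: smooth_sum => // i; apply: smoothM => //; apply: smooth_comp => //.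
  exact: Cinf_partial.
have H := dnbhs_dnbhs (dnbhs_cvg gP p0 sg e0).
apply: dnbhsS (dnbhs_cvg gP p0 sg e0) => p /= pe.
rewrite (pder_chain gY (pxi p) (smooth_prod_slice (al p) sf) (fun i => sgy i p) CF) //.
(* The expression of f is valid within e of the base values; at the displaced p only the margin r
   that remains may be used. *)
have r0 : exists2 r, 0 < r & forall i, `|g i (al p, be p) - g i (al p0, be p0)| + r <= e.
  have [||r r0 Hr] := @ex_common_radius R k (fun i r => `|g i (al p, be p) - g i (al p0, be p0)| + r <= e).
  - by move=> i d d' dd; apply: le_trans; rewrite lerD2l.
  - by move=> i; exists (e - `|g i (al p, be p) - g i (al p0, be p0)|); rewrite ?subr_gt0 // addrC subrK.
  by exists r.
have [r r0' Hr] := r0.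
apply: dnbhsS (dnbhs_cvg gY (be p) (fun i => sgy i p) r0') => y /= yr.
rewrite fE // => i; apply: lt_le_trans (Hr i).
apply: le_lt_trans (ler_distD (g i (al p, be p)) _ _) _.
by rewrite [ltRHS]addrC ltrD2r.
Qed.

End Constructions.
End Derivations.

(** * Charts, charts adapted to Z, and frames of b-vector fields *)

Section Charts.
Variable R : realType.

Definition crd (X : Type) m (x : 'I_m -> X -> R) (p : X) : 'rV[R]_m := \row_i x i p.

(** In contrast with [is_chart], the coordinates are smooth on the whole space, so that derivations
    and vector fields can be applied to them. *)
Definition nchart (X : diffSpace R) m (W : set X) (x : 'I_m -> X -> R) : Prop :=
  [/\ dopen W, forall i, smooth (x i),
      forall p q, W p -> W q -> crd x p = crd x q -> p = q,
      open (crd x @` W) &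
      forall f, smooth f -> exists2 F, Cinf (crd x @` W) F &
        forall q, W q -> f q = F (crd x q)].

Section Chart.
Variables (X : diffSpace R) (m : nat) (W : set X) (x : 'I_m -> X -> R).
Hypothesis gX : gen_closed X.

Definition loc (f : X -> R) (u : 'rV[R]_m) : R :=
  if pselect (exists q, W q /\ crd x q = u) is left H then f (projT1 (cid H)) else 0.

Definition cder (i : 'I_m) (f : X -> R) (p : X) : R := partial i (loc f) (crd x p).

Hypothesis nc : nchart W x.
Implicit Types (f g : X -> R) (p q : X).

Let img : set 'rV[R]_m := crd x @` W.
Let oimg : open img. Proof. by case: nc. Qed.
Let sx i : smooth (x i). Proof. by case: nc. Qed.
Let oW : dopen W. Proof. by case: nc. Qed.

Lemma loc_crd f q : W q -> loc f (crd x q) = f q.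
Proof.
move=> Wq; rewrite /loc; case: pselect => [H|[]]; last by exists q.
have [Wq' E] := projT2 (cid H); congr f.
by have [_ _ inj _ _] := nc; apply: inj.
Qed.

Lemma img_crd q : W q -> img (crd x q).
Proof. by exists q. Qed.

(** A basic neighbourhood is the non-vanishing locus of a smooth function, whose coordinate
    expression is continuous and so stays non-zero on a cube. *)
Lemma chart_dnbhs p N : W p -> dnbhs p N -> exists2 d, 0 < d &
  forall u, cube (crd x p) d u -> exists q, [/\ W q, crd x q = u & N q].
Proof.
move=> Wp [N' [oN Np NN]]; have [f [sf fp fN]] := oN p Np.
have [_ _ _ _ /(_ f sf)[F CF fF]] := nc.
have Fp : `|F (crd x p)| > 0 by rewrite -fF // normr_gt0.
have /cont_cubeP/(_ _ Fp)[d d0 Hd] := Cinf_cont CF (img_crd Wp).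
have /open_cubeP/(_ _ (img_crd Wp))[d' d'0 Hd'] := oimg.
exists (Num.min d d') => [|u ud]; first by rewrite lt_min d0.
have [ud1 ud2] : cube (crd x p) d u /\ cube (crd x p) d' u.
  by split; apply: sub_cube ud; rewrite ge_min lexx ?orbT.
have [q Wq uq] := Hd' u ud2; exists q; split=> //; apply/NN/fN; rewrite fF // uq.
by apply/eqP => E; have := Hd u ud1; rewrite E sub0r normrN ltxx.
Qed.

Lemma Cinf_loc f : (forall q, W q -> smooth_at q f) -> Cinf img (loc f).
Proof.
move=> sf; apply: Cinf_local => // _ [p Wp <-].
have [g sg fg] := sf p Wp; have [d d0 Hd] := chart_dnbhs Wp fg.
have [_ _ _ _ /(_ g sg)[G CG gG]] := nc.
exists (cube (crd x p) d `&` img), G; split.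
- by apply: openI => //; apply: open_cube.
- by split; [apply: cube_center|apply: img_crd].
- by apply: Cinf_sub CG => u [].
- by move=> u [/Hd[q [Wq <- E]] _]; rewrite loc_crd // E gG.
Qed.

Lemma Cinf_loc_smooth f : smooth f -> Cinf img (loc f).
Proof. by move=> sf; apply: Cinf_loc => q _; apply: smooth_smooth_at. Qed.

Lemma cder_pder i p : W p -> pder p (fun f => cder i f p).
Proof.
move=> Wp; have ip := img_crd Wp.
have locE (op : R -> R -> R) f g u : op 0 0 = 0 ->
    loc (fun y => op (f y) (g y)) u = op (loc f u) (loc g u).
  by move=> op0; rewrite /loc; case: pselect.
split=> [f g sf sg|c f sf|f g sf sg].
- by rewrite /cder -(partialD i (Cinf_loc_smooth sf) (Cinf_loc_smooth sg) ip); congr partial;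
    apply/funext => u; rewrite (locE (fun a b => a + b)) // addr0.
- rewrite /cder -(partialZ i c (Cinf_loc_smooth sf) ip); congr partial.
  by apply/funext => u; rewrite (locE (fun a _ => c * a) f f) // mulr0.
- have := partialM i (Cinf_loc_smooth sf) (Cinf_loc_smooth sg) ip; rewrite !loc_crd // /cder => <-.
  by congr partial; apply/funext => u; rewrite (locE (fun a b => a * b)) // mulr0.
Qed.

Lemma cder_coord i j p : W p -> cder i (x j) p = (j == i)%:R.
Proof.
move=> Wp; rewrite -(partial_coord i j (crd x p)).
have /open_cubeP/(_ _ (img_crd Wp))[d d0 Hd] := oimg.
apply: (partial_local _ d0) => u /Hd[q Wq <-]; rewrite loc_crd //.
by rewrite mxE.
Qed.

Lemma pder_cder p xi f : W p -> pder p xi -> smooth f ->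
  xi f = \sum_i cder i f p * xi (x i).
Proof.
move=> Wp pxi sf.
apply: (pder_chain_at gX pxi sf sx oimg (Cinf_loc_smooth sf) (img_crd Wp)).
by exists W; split=> // q Wq /=; rewrite -/(crd x q) loc_crd.
Qed.

Lemma smooth_at_chart p O F : open O -> Cinf O F -> O (crd x p) ->
  smooth_at p (fun q => F (crd x q)).
Proof. by move=> oO CF Op; apply: smooth_at_comp oO _ CF Op => // i; apply: smooth_smooth_at. Qed.

Lemma cder_smooth_at i f p : smooth f -> W p -> smooth_at p (cder i f).
Proof.
move=> sf Wp; apply: smooth_at_chart oimg _ (img_crd Wp).
by apply: Cinf_partial; apply: Cinf_loc_smooth.
Qed.

End Chart.

Lemma nchart_sub (X : diffSpace R) m (W N : set X) (x : 'I_m -> X -> R) :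
  nchart W x -> dopen N -> N `<=` W -> nchart N x.
Proof.
move=> nc oN NW; have [oW sx inj oi fx] := nc; split=> //.
- by move=> p q /NW Wp /NW Wq; apply: inj.
- apply/open_cubeP => _ [p Np <-].
  have [|d d0 Hd] := chart_dnbhs nc (NW p Np) (_ : dnbhs p N); first by exists N; split.
  by exists d => // u /Hd[q [Wq <- Nq]]; exists q.
- move=> f /fx[F CF fF]; exists F; last by move=> q /NW/fF.
  by apply: Cinf_sub CF => _ [p /NW Wp <-]; exists p.
Qed.

Lemma cder_sub (X : diffSpace R) m (W N : set X) (x : 'I_m -> X -> R) i f p :
  nchart W x -> dopen N -> N `<=` W -> N p -> cder N x i f p = cder W x i f p.
Proof.
move=> nc oN NW Np; have nc' := nchart_sub nc oN NW.
have [|d d0 Hd] := chart_dnbhs nc' Np (_ : dnbhs p N); first by exists N; split.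
apply: (partial_local _ d0) => u /Hd[q [Nq <- _]].
by rewrite (loc_crd nc') // (loc_crd nc) //; apply: NW.
Qed.

(* b is the index of the coordinate defining Z, if the chart meets Z. *)
Definition bchart (X : diffSpace R) (Z : set X) m (W : set X) (x : 'I_m -> X -> R)
    (b : option 'I_m) : Prop :=
  nchart W x /\ forall q, W q -> (Z q <-> exists2 i, b = Some i & x i q = 0).

(** The factors that turn the coordinate fields into a b-frame: the coordinate itself in the
    direction that defines Z, and 1 in the others. *)
Definition rr (X : Type) m (x : 'I_m -> X -> R) (b : option 'I_m) (i : 'I_m) (q : X) : R :=
  if b == Some i then x i q else 1.

Section BChart.
Variables (X : diffSpace R) (Z : set X) (m : nat) (W : set X) (x : 'I_m -> X -> R)
  (b : option 'I_m).
Hypotheses (gX : gen_closed X) (bc : bchart Z W x b).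

Let nc : nchart W x. Proof. by case: bc. Qed.
Let sx i : smooth (x i). Proof. by case: nc. Qed.
Let oW : dopen W. Proof. by case: nc. Qed.

Lemma smooth_rr i : smooth (rr x b i).
Proof. by rewrite /rr; case: (b == Some i) => //; apply: smooth_cst. Qed.

(** In the direction defining Z the factor is 0; in any other direction the coordinate line stays in
    Z, where f is 0. *)
Lemma cder_vanish i f z : W z -> smooth f -> (forall y, Z y -> f y = 0) -> Z z ->
  rr x b i z * cder W x i f z = 0.
Proof.
move=> Wz sf f0 Zz; have [j bj xj] : exists2 j, b = Some j & x j z = 0 by apply/(bc.2 z Wz).
rewrite /rr bj; case: eqP => [[<-]|nij]; first by rewrite xj mul0r.
rewrite mul1r; apply: partial_eq.
have [_ _ _ oi _] := nc; have ip : (crd x @` W) (crd x z) by exists z.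
have [d d0 Hd] := line_in i oi ip.
apply: (is_derive_near d0 _ (is_derive_cst _ _ _ : is_derive _ _ (fun=> 0 : R) 0)) => t.
rewrite subr0 => /Hd[q Wq E]; rewrite -E (loc_crd nc) // f0 //; apply/(bc.2 q Wq).
exists j => //; have := congr1 (fun u : 'rV[R]_m => u 0 j) E; rewrite lineE !mxE xj => ->.
by case: eqP => [ji|_]; rewrite ?addr0 //; case: nij; rewrite ji.
Qed.

Lemma frame_field p i : W p -> exists e, is_bfield Z e /\
  dnbhs p [set q | W q /\ forall f, smooth f -> e f q = rr x b i q * cder W x i f q].
Proof.
move=> Wp; have [c [sc c1 c0]] := bump gX oW Wp.
have c00 q : ~ W q -> c q = 0 by move/c0/dnbhs_self.
pose e := mkop (fun f q => c q * (rr x b i q * cder W x i f q)).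
exists e; split; first split.
- apply: mkop_vfield => // [f sf|q].
    apply: (smooth_cutoff gX sc c0) => y Wy; apply: smooth_atM => //.
      by apply: smooth_smooth_at => //; apply: smooth_rr.
    exact: cder_smooth_at.
  have [Wq|nWq] := pselect (W q); last first.
    by split=> [f g sf sg|a f sf|f g sf sg]; rewrite !c00 //; ring.
  have [a1 a2 a3] := cder_pder gX nc i Wq.
  by split=> [f g sf sg|a f sf|f g sf sg]; rewrite ?a1 ?a2 ?a3 //; ring.
- move=> f sf f0 z Zz; rewrite /e mkopE //.
  have [Wz|nWz] := pselect (W z); last by rewrite c00 // mul0r.
  by rewrite cder_vanish // mulr0.
- have WW : dnbhs p W by exists W; split.
  apply: dnbhsS (dnbhsI gX WW c1) => q [Wq /= cq]; split=> // f sf.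
  by rewrite /e mkopE // cq mul1r.
Qed.

(** The extension of the coordinate expression to R^m keeps its zeros, hence vanishes on the full
    hyperplane as [division] requires. *)
Lemma div_coord h p i : b = Some i -> W p -> smooth h -> (forall q, Z q -> h q = 0) ->
  exists2 d, smooth d & dnbhs p [set q | h q = x i q * d q].
Proof.
move=> bi Wp sh h0; have [_ _ _ oi _] := nc.
have [d [F [d0 dO CF FE F0]]] := Cinf_extend oi (ex_intro2 _ _ p Wp erefl : (crd x @` W) (crd x p))
  (Cinf_loc_smooth gX nc sh).
have [|G CG FG] := @division R m i F 0 CF.
  move=> u ui; apply: F0 => -[q Wq qu]; rewrite -qu (loc_crd nc) //; apply/h0/(bc.2 q Wq).
  by exists i => //; rewrite -ui -qu mxE.
exists (fun q => G (crd x q)); first by apply: smooth_comp.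
have WW : dnbhs p W by exists W; split.
apply: dnbhsS (dnbhsI gX WW (dnbhs_cvg gX p sx d0)) => q [Wq /= qd].
rewrite -(loc_crd nc h Wq) -FE ?FG ?subr0 ?mxE // => j.
by rewrite !mxE.
Qed.

(** A b-field preserves only functions vanishing on all of Z, whereas x_i is known to vanish on Z
    only inside W. The cutoff c repairs this without changing x_i near p. *)
Lemma bfield_coef D p i : is_bfield Z D -> W p ->
  exists2 d, smooth d & dnbhs p [set q | D (x i) q = rr x b i q * d q].
Proof.
move=> [vD zD] Wp; have [_ sD _ _ _] := vD.
rewrite /rr; case: eqP => [bi|_]; last first.
  by exists (D (x i)); [apply: sD|apply: dnbhsT => // q /=; rewrite mul1r].
have [c [sc c1 c0]] := bump gX oW Wp.
have c00 q : ~ W q -> c q = 0 by move/c0/dnbhs_self.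
have scx : smooth (fun q => c q * x i q) by apply: smoothM.
have [|d sd dE] := div_coord bi Wp (sD _ scx).
  apply: zD => // z Zz; have [Wz|nWz] := pselect (W z); last by rewrite c00 // mul0r.
  have [j] := (bc.2 z Wz).1 Zz; rewrite bi => -[<-] ->.
  by rewrite mulr0.
exists d => //; apply: dnbhsS (dnbhsI gX dE (dnbhs_dnbhs c1)) => q [/= <- cq].
apply: vfield_local => //; apply: dnbhsS cq => z /= ->.
by rewrite mul1r.
Qed.

(** The factor is non-zero at points displaced along coordinate i, so u vanishes there and by
    continuity at p. This makes the coefficients in a b-frame unique on Z. *)
Lemma rr_dense p i u : W p -> smooth u -> dnbhs p [set q | rr x b i q * u q = 0] -> u p = 0.
Proof.
move=> Wp su H; have := dnbhs_self H; rewrite /= /rr; case: eqP => [bi|_]; last by rewrite mul1r.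
have [xp|xp] := eqVneq (x i p) 0; last by move=> /eqP; rewrite mulf_eq0 (negbTE xp) => /eqP.
move=> _; apply/eqP; apply: contrapT => /negP up.
have up0 : 0 < `|u p| by rewrite normr_gt0.
have ip : (crd x @` W) (crd x p) by exists p.
have /cont_cubeP/(_ _ up0)[d d0 Hd] := Cinf_cont (Cinf_loc_smooth gX nc su) ip.
have [d' d'0 Hd'] := chart_dnbhs nc Wp H.
pose t := Num.min d d' / 2.
have t0 : 0 < t by rewrite divr_gt0 // lt_min d0.
have tm : t < Num.min d d' by rewrite ltr_pdivrMr // ltr_pMr ?ltr1n // lt_min d0.
have [td td'] : t < d /\ t < d' by move: tm; rewrite lt_min => /andP[].
have cu r : t < r -> cube (crd x p) r (crd x p + t *: delta_mx 0 i).
  move=> tr; apply: cube_line; first by apply: cube_center; apply: lt_trans tr.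
  by rewrite addrAC subrr add0r ger0_norm // ltW.
have [q [Wq qE]] := Hd' _ (cu _ td').
rewrite /= /rr bi eqxx => /eqP; rewrite mulf_eq0.
have -> : x i q = t.
  have := congr1 (fun u : 'rV[R]_m => u 0 i) qE.
  by rewrite lineE eqxx !mxE xp add0r.
rewrite gt_eqF //= => /eqP uq.
have := Hd _ (cu _ td); rewrite -qE !(loc_crd nc) // uq sub0r normrN.
by rewrite ltxx.
Qed.

End BChart.

Definition is_bmfd (X : diffSpace R) (Z : set X) m : Prop :=
  gen_closed X /\ forall p, exists W (x : 'I_m -> X -> R) b, bchart Z W x b /\ W p.

Definition is_frame (X : diffSpace R) (Z : set X) m (W : set X) (x : 'I_m -> X -> R) b
    (e : 'I_m -> operator X) : Prop :=
  [/\ bchart Z W x b, forall i, is_bfield Z (e i) &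
      forall i f q, smooth f -> W q -> e i f q = rr x b i q * cder W x i f q].

Lemma frame_exists (X : diffSpace R) (Z : set X) m p : is_bmfd Z m ->
  exists W (x : 'I_m -> X -> R) b e, is_frame Z W x b e /\ W p.
Proof.
move=> [gX /(_ p)[W [x [b [bc Wp]]]]].
have [e eP] := choice (fun i => frame_field gX bc i Wp).
have := dnbhs_all gX (fun i => (eP i).2).
have WW : dnbhs p W by exists W; split=> //; case: bc => -[].
move=> /(dnbhsI gX WW) [N [oN Np NE]].
have NW : N `<=` W by move=> q /NE[].
have [nc bZ] := bc; have nc' := nchart_sub nc oN NW.
exists N, x, b, e; split=> //; split.
- by split=> // q /NW/bZ.
- by move=> i; case: (eP i).
- move=> i f q sf Nq; have [Wq /(_ i)[_ ->//]] := NE q Nq.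
  by rewrite (cder_sub _ _ nc oN NW).
Qed.

End Charts.

(** * The b-cotangent bundle and its charts *)

Section BCotangent.
Variable R : realType.

Section Covectors.
Variables (M : diffSpace R) (Z : set M).
Hypothesis gM : gen_closed M.
Implicit Types (e : bcot Z) (D E : operator M) (f g : M -> R).

Lemma gen_closed_bcot : gen_closed (bcot Z).
Proof. exact: gen_idem. Qed.

Lemma smooth_bproj : smooth_map (@bproj R M Z).
Proof. by move=> f sf; apply: sub_gen; left; exists f. Qed.

Lemma smooth_bpair D : is_bfield Z D -> smooth (fun e => bpair e D).
Proof. by move=> bD; apply: sub_gen; right; exists D. Qed.

Lemma bpairD e D E : is_bfield Z D -> is_bfield Z E ->
  bpair e (fun f x => D f x + E f x) = bpair e D + bpair e E.
Proof. by case: (svalP e) => _ H _; apply: H. Qed.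

Lemma bpairM e f D : smooth f -> is_bfield Z D ->
  bpair e (fun h x => f x * D h x) = f (bproj e) * bpair e D.
Proof. by case: (svalP e) => _ _ H; apply: H. Qed.

Lemma bpairZ e (c : R) D : is_bfield Z D -> bpair e (fun h x => c * D h x) = c * bpair e D.
Proof. by apply: (@bpairM e (fun=> c)); apply: smooth_cst. Qed.

Lemma bpairB e D E : is_bfield Z D -> is_bfield Z E ->
  bpair e (fun f x => D f x - E f x) = bpair e D - bpair e E.
Proof.
move=> bD bE; have bN := bfieldZ gM (-1) bE.
have := bpairD e bD bN; rewrite bpairZ // mulN1r => <-.
by congr bpair; apply/funext => f; apply/funext => x; rewrite mulN1r.
Qed.

Lemma bpair0 e : bpair e (fun _ _ => 0) = 0.
Proof.
rewrite -[RHS](mul0r (bpair e (fun _ _ => 0))) -(bpairZ e 0 (@bfield0 R M Z gM)).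
by congr bpair; apply/funext => f; apply/funext => x; rewrite mul0r.
Qed.

Lemma bpair_sum e n (D : 'I_n -> operator M) : (forall i, is_bfield Z (D i)) ->
  bpair e (fun f x => \sum_i D i f x) = \sum_i bpair e (D i).
Proof.
elim: n D => [|n IH] D bD.
  rewrite big_ord0 -[RHS](bpair0 e); congr bpair.
  by apply/funext => f; apply/funext => x; rewrite big_ord0.
rewrite big_ord_recl -IH // -bpairD //; last exact: bfield_sum.
by congr bpair; apply/funext => f; apply/funext => x; rewrite big_ord_recl.
Qed.

(** Multiplying by a function supported in the neighbourhood turns the two fields into the same
    operator. Equality at the point alone would not do: on Z the field x d/dx is zero as a
    derivation but not in the fibre. *)
Lemma bpair_eq_local e D E : is_bfield Z D -> is_bfield Z E ->
  dnbhs (bproj e) [set q | forall f, smooth f -> D f q = E f q] -> bpair e D = bpair e E.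
Proof.
move=> bD bE [N [oN Ne NE]]; have [b [sb be bN]] := oN _ Ne.
apply: (mulfI be); rewrite -!bpairM //; congr bpair.
apply/funext => f; apply/funext => x; have [->|bx] := eqVneq (b x) 0; first by rewrite !mul0r.
have [sf|nf] := pselect (smooth f); first by rewrite (NE x (bN x bx) f sf).
by case: bD => -[-> // _ _ _ _ _]; case: bE => -[->].
Qed.

Lemma bcot_eq e e' : bproj e = bproj e' ->
  (forall D, is_bfield Z D -> bpair e D = bpair e' D) -> e = e'.
Proof.
case: e e' => [[p a] ea] [[p' a'] ea']; rewrite /bproj /bpair /= => E H; subst p'.
have E : a = a'.
  apply/funext => D; have [bD|nD] := pselect (is_bfield Z D); first exact: H.
  by case: ea => /= -> // _ _; case: ea' => /= ->.
by subst a'; congr exist; apply: Prop_irrelevance.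
Qed.

End Covectors.

Section Coefficients.
Variables (M : diffSpace R) (Z : set M) (m : nat) (W : set M) (x : 'I_m -> M -> R)
  (b : option 'I_m).
Hypotheses (gM : gen_closed M) (bc : bchart Z W x b).

Let nc : nchart W x. Proof. by case: bc. Qed.
Let sx i : smooth (x i). Proof. by case: nc. Qed.
Let oW : dopen W. Proof. by case: nc. Qed.
Let r_ i := rr x b i.
Let sr i : smooth (r_ i). Proof. exact: smooth_rr gM bc i. Qed.

(** The quotient of D(x_i) by the frame factor. It is read off from a smooth germ because on Z the
    quotient of values has the form 0 / 0. *)
Definition coef (i : 'I_m) (D : operator M) (q : M) : R :=
  xget 0 [set c | exists d : M -> R, [/\ smooth d,
    dnbhs q [set q' | D (x i) q' = rr x b i q' * d q'] & c = d q]].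

Lemma coef_eq i D d q : W q -> smooth d ->
  dnbhs q [set q' | D (x i) q' = r_ i q' * d q'] -> coef i D q = d q.
Proof.
move=> Wq sd Hd; rewrite /coef; apply: xget_unique; first by exists d.
move=> _ [d' [sd' Hd' ->]]; apply/eqP; rewrite -subr_eq0; apply/eqP.
apply: (@rr_dense R M Z m W x b gM bc q i (fun q => d' q - d q) Wq); first exact: smoothB.
by apply: dnbhsS (dnbhsI gM Hd Hd') => z /= [H1 H2]; rewrite mulrBr -H2 -/(r_ i z) -H1 subrr.
Qed.

Lemma coefP i D q : is_bfield Z D -> W q -> exists2 d, smooth d &
  dnbhs q [set q' | [/\ W q', D (x i) q' = r_ i q' * d q' & coef i D q' = d q']].
Proof.
move=> bD Wq; have [d sd Hd] := bfield_coef gM bc i bD Wq; exists d => //.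
have WW : dnbhs q W by exists W; split.
apply: dnbhsS (dnbhsI gM WW (dnbhs_dnbhs Hd)) => z [Wz Hz]; split=> //.
  exact: dnbhs_self Hz.
exact: coef_eq.
Qed.

Lemma coef_field i D q : is_bfield Z D -> W q -> D (x i) q = r_ i q * coef i D q.
Proof. by move=> bD Wq; have [d _ /dnbhs_self[_ -> ->]] := coefP i bD Wq. Qed.

Lemma coef_smooth_at i D q : is_bfield Z D -> W q -> smooth_at q (coef i D).
Proof.
move=> bD Wq; have [d sd Hd] := coefP i bD Wq; exists d => //.
by apply: dnbhsS Hd => z [].
Qed.

Lemma bfield_expand D f q : is_bfield Z D -> W q -> smooth f ->
  D f q = \sum_i coef i D q * (r_ i q * cder W x i f q).
Proof.
move=> bD Wq sf; have [vD _] := bD.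
rewrite (pder_cder gM nc Wq (vfield_pder q vD) sf); apply: eq_bigr => i _.
by rewrite coef_field //; ring.
Qed.

Lemma coefD i D E q : is_bfield Z D -> is_bfield Z E -> W q ->
  coef i (fun f x => D f x + E f x) q = coef i D q + coef i E q.
Proof.
move=> bD bE Wq; have [d sd Hd] := coefP i bD Wq; have [d' sd' Hd'] := coefP i bE Wq.
rewrite (@coef_eq i _ (fun q => d q + d' q)) //; last 2 first.
- exact: smoothD.
- by apply: dnbhsS (dnbhsI gM Hd Hd') => z [[_ H1 _] [_ H2 _]] /=; rewrite H1 H2 mulrDr.
by case: (dnbhs_self Hd) => _ _ ->; case: (dnbhs_self Hd') => _ _ ->.
Qed.

Lemma coefM i f D q : smooth f -> is_bfield Z D -> W q ->
  coef i (fun h x => f x * D h x) q = f q * coef i D q.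
Proof.
move=> sf bD Wq; have [d sd Hd] := coefP i bD Wq.
rewrite (@coef_eq i _ (fun q => f q * d q)) //; last 2 first.
- exact: smoothM.
- by apply: dnbhsS Hd => z [_ H1 _] /=; rewrite H1 mulrCA.
by case: (dnbhs_self Hd) => _ _ ->.
Qed.

(* rr only depends on its own coordinate, so the frame commutes. *)
Lemma coef_lie i D E q : is_bfield Z D -> is_bfield Z E -> W q ->
  forall d d' : M -> R, smooth d -> smooth d' ->
  dnbhs q [set q' | [/\ W q', D (x i) q' = r_ i q' * d q' & coef i D q' = d q']] ->
  dnbhs q [set q' | [/\ W q', E (x i) q' = r_ i q' * d' q' & coef i E q' = d' q']] ->
  coef i (lie_br D E) q = D d' q - E d q.
Proof.
move=> bD bE Wq d d' sd sd' Hd Hd'; have [vD _] := bD; have [vE _] := bE.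
have [_ sDs _ _ _] := vD; have [_ sEs _ _ _] := vE.
apply: (@coef_eq i (lie_br D E) (fun q => D d' q - E d q)) => //.
  by apply: smoothB => //; [apply: sDs|apply: sEs].
apply: dnbhsS (dnbhsI gM (dnbhs_dnbhs Hd) (dnbhs_dnbhs Hd')) => z /= [Hz Hz'].
have E1 : D (E (x i)) z = D (fun q => r_ i q * d' q) z.
  apply: vfield_local => //; [exact: sEs|exact: smoothM|].
  by apply: dnbhsS Hz' => w [].
have E2 : E (D (x i)) z = E (fun q => r_ i q * d q) z.
  apply: vfield_local => //; [exact: sDs|exact: smoothM|].
  by apply: dnbhsS Hz => w [].
have [_ _ MD] := vfield_pder z vD; have [_ _ ME] := vfield_pder z vE.
rewrite /lie_br E1 E2 MD // ME //.
have [_ Dz _] := dnbhs_self Hz; have [_ Ez _] := dnbhs_self Hz'.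
suff : d' z * D (r_ i) z = d z * E (r_ i) z by rewrite -/(r_ i z) => ->; ring.
have [bi|bi] := eqVneq b (Some i).
  have -> : r_ i = x i by apply/funext => w; rewrite /r_ /rr bi eqxx.
  by rewrite Dz Ez; ring.
have -> : r_ i = fun=> 1 by apply/funext => w; rewrite /r_ /rr (negbTE bi).
by rewrite (pder_cst gM _ (vfield_pder z vD)) (pder_cst gM _ (vfield_pder z vE)) !mulr0.
Qed.

End Coefficients.

Section Frame.
Variables (M : diffSpace R) (Z : set M) (m : nat) (W : set M) (x : 'I_m -> M -> R)
  (b : option 'I_m) (ee : 'I_m -> operator M).
Hypotheses (gM : gen_closed M) (fr : is_frame Z W x b ee).

Let bc : bchart Z W x b. Proof. by case: fr. Qed.
Let nc : nchart W x. Proof. by case: bc. Qed.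
Let sx i : smooth (x i). Proof. by case: nc. Qed.
Let oW : dopen W. Proof. by case: nc. Qed.
Let bee i : is_bfield Z (ee i). Proof. by case: fr. Qed.
Let eeE i f q : smooth f -> W q -> ee i f q = rr x b i q * cder W x i f q.
Proof. by case: fr => _ _; apply. Qed.
Let r_ i := rr x b i.
Let coef := coef x b.
Let coefP := coefP gM bc.

Lemma frame_expand D f q : is_bfield Z D -> W q -> smooth f ->
  D f q = \sum_i coef i D q * ee i f q.
Proof.
move=> bD Wq sf; rewrite (bfield_expand gM bc) //.
by apply: eq_bigr => i _; rewrite eeE.
Qed.

Lemma coef_frame i j q : W q -> coef i (ee j) q = (i == j)%:R.
Proof.
move=> Wq; apply: (coef_eq gM bc (d := fun=> (i == j)%:R)) => //; first exact: smooth_cst.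
exists W; split=> // z Wz /=; rewrite eeE // (cder_coord nc) //.
by rewrite /r_ /rr; case: (eqVneq i j) => [->|_] //=; rewrite !mulr0.
Qed.

Lemma bpair_expand (e : bcot Z) D : is_bfield Z D -> W (bproj e) ->
  bpair e D = \sum_i coef i D (bproj e) * bpair e (ee i).
Proof.
move=> bD We; have H i := coefP i bD We.
have {}H i : exists d : M -> R, smooth d /\ dnbhs (bproj e)
   [set q' | [/\ W q', D (x i) q' = r_ i q' * d q' & coef i D q' = d q']].
  by have [d ? ?] := H i; exists d.
have [d dP] := choice H; have sd i := (dP i).1.
have bde i : is_bfield Z (fun f q => d i q * ee i f q) by apply: bfieldM.
have -> : bpair e D = bpair e (fun f q => \sum_i d i q * ee i f q).
  apply: bpair_eq_local => //; first exact: bfield_sum.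
  have WW : dnbhs (bproj e) W by exists W; split.
  apply: dnbhsS (dnbhsI gM WW (dnbhs_all gM (fun i => (dP i).2))) => z [Wz Hz] f sf.
  by rewrite (frame_expand bD Wz sf); apply: eq_bigr => i _; case: (Hz i) => _ _ ->.
rewrite bpair_sum //; apply: eq_bigr => i _; rewrite bpairM //.
by case: (dnbhs_self (dP i).2) => _ _ ->.
Qed.

Definition cov_fun (q : M) (c : 'I_m -> R) (D : operator M) : R :=
  if `[< is_bfield Z D >] then \sum_i coef i D q * c i else 0.

Lemma cov_funP q c : W q -> is_bcovector Z q (cov_fun q c).
Proof.
move=> Wq; split=> [D nD|D E bD bE|f D sf bD]; rewrite /cov_fun.
- by case: asboolP.
- have bDE := bfieldD gM bD bE.
  do 3!case: asboolP => // _; rewrite -big_split /=; apply: eq_bigr => i _.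
  by rewrite /coef (coefD gM bc) // mulrDl.
- have bfD := bfieldM gM sf bD.
  do 2!case: asboolP => // _; rewrite mulr_sumr; apply: eq_bigr => i _.
  by rewrite /coef (coefM gM bc) // mulrA.
Qed.

Lemma bcot_point q c : W q -> exists e : bcot Z, bproj e = q /\ forall i, bpair e (ee i) = c i.
Proof.
move=> Wq; exists (exist (fun e : M * (operator M -> R) => is_bcovector Z e.1 e.2) (q, cov_fun q c) (cov_funP c Wq)).
split=> // i; rewrite /bpair /= /cov_fun; case: asboolP => // _.
rewrite (bigD1 i) //= coef_frame // eqxx mul1r big1 ?addr0 // => j ji.
by rewrite coef_frame // (negbTE ji) mul0r.
Qed.

Definition bcot_coord (k : 'I_(m + m)) (e : bcot Z) : R :=
  match fintype.split k with inl i => x i (bproj e) | inr i => bpair e (ee i) end.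

Lemma bcot_coord_l i e : bcot_coord (lshift m i) e = x i (bproj e).
Proof. by rewrite /bcot_coord (unsplitK (inl i)). Qed.

Lemma bcot_coord_r i e : bcot_coord (rshift m i) e = bpair e (ee i).
Proof. by rewrite /bcot_coord (unsplitK (inr i)). Qed.

Lemma smooth_bcot_coord k : smooth (bcot_coord k).
Proof.
case: (split_ordP k) => i ->.
  by apply: smooth_eq (smooth_bproj (sx i)) => e; rewrite bcot_coord_l.
by apply: smooth_eq (smooth_bpair (bee i)) => e; rewrite bcot_coord_r.
Qed.

Let lsub (u : 'rV[R]_(m + m)) : 'rV[R]_m := \row_i u 0 (lshift m i).

Let lsub_crd e : lsub (crd bcot_coord e) = crd x (bproj e).
Proof. by apply/rowP => i; rewrite !mxE bcot_coord_l. Qed.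

Let open_lsub V : open V -> open [set u | V (lsub u)].
Proof.
move=> /open_cubeP oV; apply/open_cubeP => u /= /oV[d d0 Hd]; exists d => // v vd.
by apply: Hd => i; rewrite !mxE.
Qed.

Lemma Cinf_lsub V F : open V -> Cinf V F -> Cinf [set u | V (lsub u)] (fun u => F (lsub u)).
Proof.
move=> oV CF; apply: (@Cinf_comp _ _ _ _ V F (fun i u => u 0 (lshift m i))) => //.
  exact: open_lsub.
by move=> i; apply: Cinf_coord; apply: open_lsub.
Qed.

Let gens := [set f : bcot Z -> R | (exists2 g : M -> R, smooth g & f = fun e => g (sval e).1) \/
                  (exists2 D, is_bfield Z D & f = fun e => (sval e).2 D)].

(** A function from the base involves the first m coordinates only; the pairing with D is the sum of
    its coefficients times the fibre coordinates, hence linear in the last m. *)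
Lemma bcot_gen_chart s e0 : gens s -> W (bproj e0) -> exists O S,
  [/\ open O, O (crd bcot_coord e0), Cinf O S &
      forall e, W (bproj e) -> O (crd bcot_coord e) -> s e = S (crd bcot_coord e)].
Proof.
have [_ _ _ oi _] := nc; move=> [[g sg ->]|[D bD ->]] We.
  exists [set u | (crd x @` W) (lsub u)], (fun u => loc W x g (lsub u)); split.
  - exact: open_lsub.
  - by rewrite /= lsub_crd; exists (bproj e0).
  - by apply: Cinf_lsub => //; apply: Cinf_loc_smooth.
  - by move=> e We' _; rewrite lsub_crd (loc_crd nc).
have H i : exists d : M -> R, smooth d /\ dnbhs (bproj e0)
   [set q' | [/\ W q', D (x i) q' = r_ i q' * d q' & coef i D q' = d q']].
  by have [d ? ?] := coefP i bD We; exists d.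
have [d dP] := choice H; have sd i := (dP i).1.
have [r r0 Hr] := chart_dnbhs nc We (dnbhs_all gM (fun i => (dP i).2)).
pose V := cube (crd x (bproj e0)) r `&` (crd x @` W).
have oV : open V by apply: openI => //; apply: open_cube.
exists [set u | V (lsub u)],
  (fun u => \sum_i loc W x (d i) (lsub u) * u 0 (rshift m i)); split.
- exact: open_lsub.
- by rewrite /= lsub_crd; split; [apply: cube_center|exists (bproj e0)].
- apply: Cinf_sum => [|i]; first exact: open_lsub.
  apply: CinfM; [exact: open_lsub| |by apply: Cinf_coord; apply: open_lsub].
  apply: Cinf_lsub => //; apply: Cinf_sub (Cinf_loc_smooth gM nc (sd i)).
  by move=> u [].
- move=> e We' /=; rewrite lsub_crd => -[/Hr[q [Wq E Hq]] _].
  have qe : q = bproj e by have [_ _ inj _ _] := nc; apply: inj.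
  subst q; rewrite -[LHS]/(bpair e D) (bpair_expand bD We'); apply: eq_bigr => i _.
  have [_ _ ->] := Hq i; rewrite (loc_crd nc) //.
  by rewrite [in RHS]mxE bcot_coord_r.
Qed.

(** Injectivity and openness come from expanding a b-field in the frame and from prescribing a
    covector on it. Smooth functions are locally functions of generators, whose coordinate
    expressions have been found. *)
Lemma bcot_nchart : nchart [set e : bcot Z | W (bproj e)] bcot_coord.
Proof.
have gE : gen_closed (bcot Z) by apply: gen_closed_bcot.
have inj e e' : W (bproj e) -> W (bproj e') -> crd bcot_coord e = crd bcot_coord e' -> e = e'.
  move=> We We' E.
  have Ep : bproj e = bproj e'.
    by have [_ _ inj _ _] := nc; apply: inj => //; rewrite -!lsub_crd E.
  apply: bcot_eq => // D bD; rewrite (bpair_expand bD We) (bpair_expand bD We') Ep.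
  apply: eq_bigr => i _; congr (_ * _).
  have := congr1 (fun u : 'rV[R]_(m + m) => u 0 (rshift m i)) E.
  by rewrite !mxE !bcot_coord_r.
have oi : open (crd bcot_coord @` [set e : bcot Z | W (bproj e)]).
  apply/open_cubeP => _ [e We <-]; have [_ _ _ /open_cubeP oi _] := nc.
  have [d d0 Hd] := oi _ (ex_intro2 _ _ (bproj e) We erefl).
  exists d => // u ud; have [|q Wq qE] := Hd (lsub u).
    by rewrite -lsub_crd => i; rewrite !mxE; have := ud (lshift m i); rewrite mxE.
  have [e' [e'q e'p]] := bcot_point (fun i => u 0 (rshift m i)) Wq.
  exists e'; first by rewrite /= e'q.
  apply/rowP => k; rewrite mxE; case: (split_ordP k) => i ->.
    rewrite bcot_coord_l e'q; have := congr1 (fun u : 'rV[R]_m => u 0 i) qE.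
    by rewrite !mxE.
  by rewrite bcot_coord_r e'p.
split=> //.
- exact: (@smooth_map_dopen R (bcot Z) M (@bproj R M Z) W (@smooth_bproj M Z) oW).
- exact: smooth_bcot_coord.
move=> f sf; pose F := loc [set e : bcot Z | W (bproj e)] bcot_coord f.
have FE e : W (bproj e) -> F (crd bcot_coord e) = f e.
  move=> We; rewrite /F /loc; case: pselect => [H|[]]; last by exists e.
  by have [We' E] := projT2 (cid H); congr f; apply: inj.
exists F; last by move=> e We; rewrite FE.
apply: Cinf_local => // _ [e0 We0 <-].
have [k [g [F0 [eps [Sg CF eps0 fE]]]]] := sf e0.
have /choice[OS OSP] : forall i, exists OS : set 'rV[R]_(m + m) * ('rV[R]_(m + m) -> R),
   [/\ open OS.1, OS.1 (crd bcot_coord e0), Cinf OS.1 OS.2 &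
      forall e, W (bproj e) -> OS.1 (crd bcot_coord e) -> g i e = OS.2 (crd bcot_coord e)].
  by move=> i; have [O [S H]] := bcot_gen_chart (Sg i) We0; exists (O, S).
have [||r r0 Hr] := @ex_common_radius R k (fun i r => forall u, cube (crd bcot_coord e0) r u ->
   (OS i).1 u /\ `|(OS i).2 u - (OS i).2 (crd bcot_coord e0)| < eps).
- by move=> i r r' rr' H u ur; apply: H; apply: sub_cube ur.
- move=> i; have [/open_cubeP oO O0 CS _] := OSP i; have [r r0 Hr] := oO _ O0.
  have /cont_cubeP/(_ _ eps0)[r' r'0 Hr'] := Cinf_cont CS O0.
  exists (Num.min r r') => [|u ur]; first by rewrite lt_min r0.
  by split; [apply: Hr|apply: Hr']; apply: sub_cube ur; rewrite ge_min lexx ?orbT.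
exists (cube (crd bcot_coord e0) r `&` (crd bcot_coord @` [set e : bcot Z | W (bproj e)])),
  (fun u => F0 (\row_i (OS i).2 u)); split.
- by apply: openI => //; apply: open_cube.
- by split; [apply: cube_center|exists e0].
- apply: (@Cinf_comp _ _ _ _ setT F0 (fun i => (OS i).2)) => //.
  + by apply: openI => //; apply: open_cube.
  + exact: openT.
  + by move=> i; have [_ _ CS _] := OSP i; apply: Cinf_sub CS => u [/(Hr i)[]].
- move=> u [ur [e We uE]]; subst u; have H i := Hr i _ ur; rewrite FE // fE => [|i].
    congr F0; apply/rowP => i; rewrite !mxE; have [_ _ _ ->//] := OSP i.
    by case: (H i).
  have [H1 H2] := H i; have [_ O0 _ gE'] := OSP i.
  by rewrite !gE' //; apply: H1.
Qed.

Lemma bcot_bchart : bchart (@bcot_crit R M Z) [set e : bcot Z | W (bproj e)] bcot_coord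
  (omap (lshift m) b).
Proof.
split=> [|e We]; first exact: bcot_nchart.
rewrite /bcot_crit /=; split=> [/(bc.2 _ We)[i bi xi]|[k]].
  by exists (lshift m i); rewrite ?bi // bcot_coord_l.
case bi: b => [i|] //= [<-]; rewrite bcot_coord_l => xi.
by apply/(bc.2 _ We); exists i.
Qed.

End Frame.

End BCotangent.

(** * Operations that are derivations in each of two arguments *)

Section Biderivations.
Variables (R : realType) (X : diffSpace R).
Hypothesis gX : gen_closed X.

Definition bider (x : X) (be : (X -> R) -> (X -> R) -> R) : Prop :=
  (forall g, smooth g -> pder x (fun f => be f g)) /\
  (forall f, smooth f -> pder x (be f)).

Lemma bider_gen_eq (S : set (X -> R)) x be be' : smooth `<=` gen S -> S `<=` smooth ->
  bider x be -> bider x be' -> (forall f g, S f -> S g -> be f g = be' f g) ->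
  forall f g, smooth f -> smooth g -> be f g = be' f g.
Proof.
move=> sub Ssm [b1 b2] [b1' b2'] E f g sf sg.
apply: (pder_gen_eq gX sub Ssm (b1 g sg) (b1' g sg)) => // h Sh.
have sh := Ssm _ Sh.
by apply: (pder_gen_eq gX sub Ssm (b2 h sh) (b2' h sh)) => // h' Sh'; apply: E.
Qed.

Lemma bider_local x be f f' g g' : bider x be -> smooth f -> smooth f' -> smooth g ->
  smooth g' -> dnbhs x [set y | f y = f' y] -> dnbhs x [set y | g y = g' y] ->
  be f g = be f' g'.
Proof.
move=> [b1 b2] sf sf' sg sg' ff gg.
rewrite (pder_local (b1 g sg) sf sf' ff); exact: (pder_local (b2 f' sf') sg sg' gg).
Qed.

Lemma pderN x xi : pder x xi -> pder x (fun f : X -> R => - xi f).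
Proof.
move=> [aD aZ aM]; split=> [f g sf sg|c f sf|f g sf sg].
- by rewrite aD // opprD.
- by rewrite aZ // mulrN.
- by rewrite aM // opprD !mulrN.
Qed.

Lemma bider_anti x be : (forall f g, be f g = - be g f) ->
  (forall g, smooth g -> pder x (fun f => be f g)) -> bider x be.
Proof.
move=> anti H; split=> // f sf.
have -> : be f = fun g => - be g f by apply/funext => g; apply: anti.
exact: pderN (H f sf).
Qed.

End Biderivations.

(** * The canonical bracket in coordinates *)

Section Canonical.
Variable R : realType.

Section PoissonBracket.
Variables (M : diffSpace R) (Z : set M).
Hypothesis gM : gen_closed M.

(* The canonical bracket at e, characterised on the generators of the smooth
   functions on the b-cotangent bundle. *)
Definition is_pb (e : bcot Z) (be : (bcot Z -> R) -> (bcot Z -> R) -> R) : Prop :=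
  [/\ bider e be,
      forall g g' : M -> R, smooth g -> smooth g' -> be (g \o bproj (Z := Z)) (g' \o bproj (Z := Z)) = 0,
      forall (g : M -> R) D, smooth g -> is_bfield Z D ->
        be (g \o bproj (Z := Z)) (fun e => bpair e D) = D g (bproj e),
      forall (g : M -> R) D, smooth g -> is_bfield Z D ->
        be (fun e => bpair e D) (g \o bproj (Z := Z)) = - D g (bproj e) &
      forall D E, is_bfield Z D -> is_bfield Z E ->
        be (fun e => bpair e D) (fun e => bpair e E) = - bpair e (lie_br D E)].

Lemma bcot_smooth_gen : (@smooth R (bcot Z)) `<=` gen [set f : bcot Z -> R |
    (exists2 g : M -> R, smooth g & f = g \o bproj (Z := Z)) \/
    (exists2 D, is_bfield Z D & f = fun e => bpair e D)].
Proof. by []. Qed.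

Lemma bcot_gen_smooth : [set f : bcot Z -> R |
    (exists2 g : M -> R, smooth g & f = g \o bproj (Z := Z)) \/
    (exists2 D, is_bfield Z D & f = fun e => bpair e D)] `<=` (@smooth R (bcot Z)).
Proof. exact: sub_gen. Qed.

Lemma is_pb_unique e be be' : is_pb e be -> is_pb e be' ->
  forall f g, smooth f -> smooth g -> be f g = be' f g.
Proof.
move=> [bd p1 p2 p3 p4] [bd' p1' p2' p3' p4'].
apply: (bider_gen_eq (@gen_closed_bcot R M Z) bcot_smooth_gen bcot_gen_smooth bd bd').
move=> _ _ [[g sg ->]|[D bD ->]] [[g' sg' ->]|[E bE ->]].
- by rewrite p1 // p1'.
- by rewrite p2 // p2'.
- by rewrite p3 // p3'.
- by rewrite p4 // p4'.
Qed.

End PoissonBracket.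

Section LocalBracket.
Variables (M : diffSpace R) (Z : set M) (m : nat) (W : set M) (x : 'I_m -> M -> R)
  (b : option 'I_m) (ee : 'I_m -> operator M).
Hypotheses (gM : gen_closed M) (fr : is_frame Z W x b ee).

Let bc : bchart Z W x b. Proof. by case: fr. Qed.
Let nc : nchart W x. Proof. by case: bc. Qed.
Let sx i : smooth (x i). Proof. by case: nc. Qed.
Let WE := [set e : bcot Z | W (bproj e)].
Let xE := bcot_coord x ee : 'I_(m + m) -> bcot Z -> R.
Let bE := omap (lshift m) b.
Let gE : gen_closed (bcot Z). Proof. exact: gen_closed_bcot. Qed.
Let bcE : bchart (@bcot_crit R M Z) WE xE bE. Proof. exact: bcot_bchart gM fr. Qed.
Let ncE : nchart WE xE. Proof. by case: bcE. Qed.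
Let sxE k : smooth (xE k). Proof. by case: ncE. Qed.
Local Notation L i := (cder WE xE (lshift m i)).
Local Notation P i := (cder WE xE (rshift m i)).
Local Notation rB i e := (rr x b i (bproj e)).
Implicit Types (f g : bcot Z -> R) (e : bcot Z).

(** The bivector dual to the sum of (dx_i / r_i) /\ dp_i, where r_i is the frame factor, signed so
    that {x_i, p_i} = r_i. *)
Definition local_pb f g e : R := \sum_i rB i e * (L i f e * P i g e - P i f e * L i g e).

Lemma rr_lshift i e : rr xE bE (lshift m i) e = rB i e.
Proof.
rewrite /rr /bE /xE; case: b => [j|] //=; rewrite !(inj_eq Some_inj) (inj_eq (@lshift_inj m m)).
by rewrite bcot_coord_l.
Qed.

Lemma rr_rshift i e : rr xE bE (rshift m i) e = 1.
Proof.
by rewrite /rr /bE; case: b => [j|] //=; rewrite (inj_eq Some_inj) eq_lrshift.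
Qed.

Lemma xE_l i : xE (lshift m i) = x i \o bproj (Z := Z).
Proof. by apply/funext => e; rewrite /xE bcot_coord_l. Qed.

Lemma xE_r i : xE (rshift m i) = fun e => bpair e (ee i).
Proof. by apply/funext => e; rewrite /xE bcot_coord_r. Qed.

Lemma L_proj i (g : M -> R) e : WE e -> smooth g ->
  L i (g \o bproj (Z := Z)) e = cder W x i g (bproj e).
Proof.
move=> We sg; have := pder_push (@smooth_bproj R M Z) (cder_pder gE ncE (lshift m i) We).
move=> /(pder_cder gM nc We) /(_ sg); move=> ->.
rewrite (bigD1 i) //= big1 ?addr0 => [|j ji]; rewrite -xE_l (cder_coord ncE) //.
  by rewrite eqxx mulr1.
by rewrite (inj_eq (@lshift_inj m m)) (negbTE ji) mulr0.
Qed.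

Lemma P_proj i (g : M -> R) e : WE e -> smooth g -> P i (g \o bproj (Z := Z)) e = 0.
Proof.
move=> We sg; have := pder_push (@smooth_bproj R M Z) (cder_pder gE ncE (rshift m i) We).
move=> /(pder_cder gM nc We) /(_ sg); move=> ->.
by rewrite big1 // => j _; rewrite -xE_l (cder_coord ncE) // eq_lrshift mulr0.
Qed.

Lemma P_coord i k e : WE e -> P i (xE k) e = (k == rshift m i)%:R.
Proof. by move=> We; rewrite (cder_coord ncE). Qed.

Lemma L_coord i k e : WE e -> L i (xE k) e = (k == lshift m i)%:R.
Proof. by move=> We; rewrite (cder_coord ncE). Qed.

(** Leibniz's rule for the fibre-linear function of D, with its coefficients replaced by global
    smooth functions. Leaving [xi] arbitrary covers the derivatives in base and fibre directions
    together. *)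
Lemma pder_bpair D e : is_bfield Z D -> WE e -> exists d : 'I_m -> M -> R,
  [/\ forall i, smooth (d i),
      forall i, dnbhs (bproj e)
        [set q | [/\ W q, D (x i) q = rr x b i q * d i q & coef x b i D q = d i q]] &
      forall xi, pder e xi -> xi (fun e => bpair e D) =
        \sum_i (d i (bproj e) * xi (xE (rshift m i)) + bpair e (ee i) * xi (d i \o bproj (Z := Z)))].
Proof.
move=> bD We; have H i : exists d : M -> R, smooth d /\ dnbhs (bproj e)
   [set q | [/\ W q, D (x i) q = rr x b i q * d q & coef x b i D q = d q]].
  by have [d ? ?] := coefP gM bc i bD We; exists d.
have [d dP] := choice H; have sd i := (dP i).1.
exists d; split=> // [i|xi pxi]; first by case: (dP i).
have sdp i : smooth (d i \o bproj (Z := Z)) by apply: smooth_bproj.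
have st i : smooth (fun e => (d i \o bproj (Z := Z)) e * xE (rshift m i) e) by apply: smoothM.
have [_ _ xM] := pxi.
have -> : xi (fun e => bpair e D) = xi (fun e => \sum_i (d i \o bproj (Z := Z)) e * xE (rshift m i) e).
  apply: (pder_local pxi); [exact: smooth_bpair|exact: smooth_sum|].
  have := smooth_map_dnbhs (@smooth_bproj R M Z) (dnbhs_all gM (fun i => (dP i).2)).
  have WW : dnbhs e WE by exists WE; split=> //; case: ncE.
  move=> /(dnbhsI gE WW); apply: dnbhsS => e' [We' /= He'].
  rewrite (bpair_expand gM fr bD We'); apply: eq_bigr => i _.
  by have [_ _ ->] := He' i; rewrite xE_r.
rewrite (pder_sum gE pxi) //; apply: eq_bigr => i _.
by rewrite (xM _ _ (sdp i) (sxE _)) /= [xE _ e]bcot_coord_r.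
Qed.

(** The essential case has two fibre-linear functions: differentiating their expressions gives the
    sum over j of p_j (E d_j - D d'_j), and by [coef_lie] these brackets are minus the coefficients
    of the commutator. *)
Lemma local_pb_is_pb e : WE e -> is_pb e (fun f g => local_pb f g e).
Proof.
move=> We.
have anti f g : local_pb f g e = - local_pb g f e.
  by rewrite /local_pb -sumrN; apply: eq_bigr => i _; ring.
have fg1 (g : M -> R) D : smooth g -> is_bfield Z D ->
    local_pb (g \o bproj (Z := Z)) (fun e => bpair e D) e = D g (bproj e).
  move=> sg bD; rewrite (bfield_expand gM bc bD We sg); apply: eq_bigr => i _.
  rewrite L_proj // P_proj // mul0r subr0.
  have [d [sd Hd Ed]] := pder_bpair bD We.
  have /= -> := Ed (fun f => P i f e) (cder_pder gE ncE (rshift m i) We).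
  rewrite (bigD1 i) //= big1 ?addr0 => [|j ji].
    rewrite P_coord // eqxx P_proj // mulr0 addr0 mulr1.
    by have [_ _ ->] := dnbhs_self (Hd i); ring.
  rewrite P_coord // (inj_eq (@rshift_inj m m)) (negbTE ji) P_proj //.
  by rewrite !mulr0 addr0.
split=> //.
- apply: bider_anti => // g sg; split=> [f f' sf sf'|c f sf|f f' sf sf'].
  + rewrite /local_pb -big_split /=; apply: eq_bigr => i _.
    have [aD _ _] := cder_pder gE ncE (lshift m i) We; have [bD _ _] := cder_pder gE ncE (rshift m i) We.
    rewrite aD // bD //.
    generalize (cder WE xE (lshift m i) f e) (cder WE xE (rshift m i) f e)
      (cder WE xE (lshift m i) g e) (cder WE xE (rshift m i) g e) (cder WE xE (lshift m i) f' e)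
      (cder WE xE (rshift m i) f' e) (rB i e) => *; ring.
  + rewrite /local_pb mulr_sumr; apply: eq_bigr => i _.
    have [_ aZ _] := cder_pder gE ncE (lshift m i) We; have [_ bZ _] := cder_pder gE ncE (rshift m i) We.
    rewrite aZ // bZ //.
    generalize (cder WE xE (lshift m i) f e) (cder WE xE (rshift m i) f e)
      (cder WE xE (lshift m i) g e) (cder WE xE (rshift m i) g e) (rB i e) => *; ring.
  + rewrite /local_pb !mulr_sumr -big_split /=; apply: eq_bigr => i _.
    have [_ _ aM] := cder_pder gE ncE (lshift m i) We; have [_ _ bM] := cder_pder gE ncE (rshift m i) We.
    rewrite aM // bM //.
    generalize (cder WE xE (lshift m i) f e) (cder WE xE (rshift m i) f e)
      (cder WE xE (lshift m i) g e) (cder WE xE (rshift m i) g e) (cder WE xE (lshift m i) f' e)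
      (cder WE xE (rshift m i) f' e) (rB i e) => *; ring.
- move=> g g' sg sg'; rewrite /local_pb big1 // => i _.
  by rewrite !P_proj // mulr0 mul0r subrr mulr0.
- by move=> g D sg bD; rewrite anti fg1.
move=> D E bD bE'; have [d [sd Hd Ed]] := pder_bpair bD We.
have [d' [sd' Hd' Ed']] := pder_bpair bE' We.
have PD i : P i (fun e => bpair e D) e = d i (bproj e).
  have /= -> := Ed (fun f => P i f e) (cder_pder gE ncE (rshift m i) We).
  rewrite (bigD1 i) //= big1 ?addr0 => [|j ji]; rewrite P_coord // P_proj //.
    by rewrite eqxx mulr1 mulr0 addr0.
  by rewrite (inj_eq (@rshift_inj m m)) (negbTE ji) !mulr0 addr0.
have PE i : P i (fun e => bpair e E) e = d' i (bproj e).
  have /= -> := Ed' (fun f => P i f e) (cder_pder gE ncE (rshift m i) We).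
  rewrite (bigD1 i) //= big1 ?addr0 => [|j ji]; rewrite P_coord // P_proj //.
    by rewrite eqxx mulr1 mulr0 addr0.
  by rewrite (inj_eq (@rshift_inj m m)) (negbTE ji) !mulr0 addr0.
have LD i : L i (fun e => bpair e D) e = \sum_j bpair e (ee j) * cder W x i (d j) (bproj e).
  have /= -> := Ed (fun f => L i f e) (cder_pder gE ncE (lshift m i) We).
  by apply: eq_bigr => j _; rewrite L_coord // eq_rlshift mulr0 add0r L_proj.
have LE i : L i (fun e => bpair e E) e = \sum_j bpair e (ee j) * cder W x i (d' j) (bproj e).
  have /= -> := Ed' (fun f => L i f e) (cder_pder gE ncE (lshift m i) We).
  by apply: eq_bigr => j _; rewrite L_coord // eq_rlshift mulr0 add0r L_proj.
have Dd j : D (d' j) (bproj e) = \sum_i d i (bproj e) * (rB i e * cder W x i (d' j) (bproj e)).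
  rewrite (bfield_expand gM bc bD We (sd' j)); apply: eq_bigr => i _.
  by have [_ _ ->] := dnbhs_self (Hd i).
have Ed2 j : E (d j) (bproj e) = \sum_i d' i (bproj e) * (rB i e * cder W x i (d j) (bproj e)).
  rewrite (bfield_expand gM bc bE' We (sd j)); apply: eq_bigr => i _.
  by have [_ _ ->] := dnbhs_self (Hd' i).
rewrite (bpair_expand gM fr (bfield_lie gM bD bE') We).
transitivity (\sum_j bpair e (ee j) * (E (d j) (bproj e) - D (d' j) (bproj e))).
  under [RHS]eq_bigr do rewrite Dd Ed2 -sumrB mulr_sumr.
  rewrite exchange_big /=; apply: eq_bigr => i _.
  rewrite PD PE LD LE mulr_suml mulr_sumr -sumrB mulr_sumr; apply: eq_bigr => j _.
  by ring.
rewrite -sumrN; apply: eq_bigr => j _.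
rewrite (coef_lie gM bc bD bE' We (sd j) (sd' j) (Hd j) (Hd' j)).
by ring.
Qed.

(** This makes bracketing with g a b-field on the b-cotangent bundle, as a Hamiltonian field has to
    be. *)
Lemma local_pb_crit f g e : WE e -> smooth f -> (forall e', bcot_crit e' -> f e' = 0) ->
  bcot_crit e -> local_pb f g e = 0.
Proof.
move=> We sf f0 Ze; rewrite /local_pb big1 // => i _.
have := cder_vanish bcE (lshift m i) We sf f0 Ze; rewrite rr_lshift => HL.
have := cder_vanish bcE (rshift m i) We sf f0 Ze; rewrite rr_rshift mul1r => ->.
by rewrite mul0r subr0 mulrA HL mul0r.
Qed.

Lemma local_pb_smooth_at f g e : WE e -> smooth f -> smooth g ->
  smooth_at e (local_pb f g).
Proof.
move=> We sf sg; apply: smooth_at_sum => // i; apply: smooth_atM => //.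
  by apply: smooth_smooth_at => //; apply: (smooth_bproj (smooth_rr gM bc i)).
have sL h : smooth h -> smooth_at e (L i h) by move=> sh; apply: cder_smooth_at.
have sP h : smooth h -> smooth_at e (P i h) by move=> sh; apply: cder_smooth_at.
apply: (@smooth_at_ext _ _ gE _ (fun e => L i f e * P i g e + (-1) * (P i f e * L i g e))).
  by apply: dnbhsT => // z /=; rewrite mulN1r.
apply: smooth_atD => //; apply: smooth_atM => //; [exact: sL|exact: sP| |].
  by apply: smooth_smooth_at => //; apply: smooth_cst.
by apply: smooth_atM => //; [exact: sP|exact: sL].
Qed.

End LocalBracket.
End Canonical.

(** * The Liouville form, the canonical form and Hamiltonian fields *)

Section Hamiltonian.
Variables (R : realType) (M : diffSpace R) (Z : set M) (m : nat).
Hypothesis bM : is_bmfd Z m.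

Let gM : gen_closed M. Proof. by case: bM. Qed.
Let gE : gen_closed (bcot Z). Proof. exact: gen_closed_bcot. Qed.
Let crit : set (bcot Z) := @bcot_crit R M Z.
Implicit Types (f g : bcot Z -> R) (e : bcot Z) (V : operator (bcot Z)).

Section InChart.
Variables (W : set M) (x : 'I_m -> M -> R) (b : option 'I_m) (ee : 'I_m -> operator M).
Hypothesis fr : is_frame Z W x b ee.

Let bc : bchart Z W x b. Proof. by case: fr. Qed.
Let nc : nchart W x. Proof. by case: bc. Qed.
Let bee i : is_bfield Z (ee i). Proof. by case: fr. Qed.
Let WE := [set e : bcot Z | W (bproj e)].
Let xE := bcot_coord x ee : 'I_(m + m) -> bcot Z -> R.
Let bE := omap (lshift m) b.
Let bcE : bchart crit WE xE bE. Proof. exact: bcot_bchart gM fr. Qed.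
Let ncE : nchart WE xE. Proof. by case: bcE. Qed.
Let sxE k : smooth (xE k). Proof. by case: ncE. Qed.
Local Notation p_ i := (fun e => bpair e (ee i)).
Local Notation v_ i V := (coef xE bE (lshift m i) V).
Let oWE e : WE e -> dnbhs e WE. Proof. by exists WE; split=> //; case: ncE. Qed.

Lemma bfield_proj V e (f : M -> R) : is_bfield crit V -> WE e -> smooth f ->
  V (f \o bproj (Z := Z)) e = \sum_i v_ i V e * ee i f (bproj e).
Proof.
move=> bV We sf; have sfp := @smooth_bproj R M Z f sf.
rewrite (bfield_expand gE bcE bV We sfp) big_split_ord /=.
rewrite [X in _ + X]big1 ?addr0 => [|i _]; last by rewrite (P_proj gM fr) // !mulr0.
apply: eq_bigr => i _; congr (_ * _).
case: fr => _ _ -> //; rewrite (L_proj gM fr) //; congr (_ * _).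
exact: (rr_lshift (Z := Z) x b ee).
Qed.

(** The frame provides one admissible decomposition of the projected field. Any other one, evaluated
    on the coordinates and divided by the frame factors, has the same coefficients, so the chosen
    value is the only one. *)
Lemma liouvilleE V e : is_bfield crit V -> WE e ->
  liouville V e = \sum_i v_ i V e * bpair e (ee i).
Proof.
move=> bV We; apply: xget_unique.
  have /choice[d dP] : forall i, exists d : bcot Z -> R, smooth d /\ dnbhs e
      [set e' | [/\ WE e', V (xE (lshift m i)) e' = rr xE bE (lshift m i) e' * d e' & v_ i V e' = d e']].
    by move=> i; have [d ? ?] := coefP gE bcE (lshift m i) bV We; exists d.
  have [N [oN Ne NE]] := dnbhsI gE (oWE We) (dnbhs_all gE (fun i => (dP i).2)).
  exists m, d, ee, N; split=> //.
  - by move=> i; case: (dP i).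
  - move=> f sf e' /NE[We' /= H]; rewrite bfield_proj //; apply: eq_bigr => i _.
    by have [_ _ ->] := H i.
  - by apply: eq_bigr => i _; have [_ /(_ i)[_ _ ->]] := NE e Ne.
move=> c [k [a [X [N [sa bX [oN Ne] NE ->]]]]].
have /choice[d dP] : forall j, exists d : 'I_m -> M -> R, forall i, smooth (d i) /\ dnbhs (bproj e)
   [set q | [/\ W q, X j (x i) q = rr x b i q * d i q & coef x b i (X j) q = d i q]].
  move=> j; have /choice[d dP] : forall i, exists d : M -> R, smooth d /\ dnbhs (bproj e)
     [set q | [/\ W q, X j (x i) q = rr x b i q * d q & coef x b i (X j) q = d q]].
    by move=> i; have [d ? ?] := coefP gM bc i (bX j) (We : W (bproj e)); exists d.
  by exists d.
have vE i : v_ i V e = \sum_j a j e * d j i (bproj e).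
  apply: (@coef_eq R (bcot Z) crit (m + m) WE xE bE gE bcE (lshift m i) V
     (fun e => \sum_j a j e * d j i (bproj e)) e We).
    apply: smooth_sum => // j; apply: smoothM => //.
    by apply: (@smooth_bproj R M Z); case: (dP j i).
  have H1 : dnbhs e N by exists N; split.
  have H2 := smooth_map_dnbhs (@smooth_bproj R M Z)
     (dnbhs_all gM (fun j => (dP j i).2)).
  apply: dnbhsS (dnbhsI gE (dnbhsI gE (oWE We) H1) H2) => e' [[We' Ne'] /= He'].
  have sxi : smooth (x i) by case: nc.
  have := NE _ sxi e' Ne'; rewrite [xE _](xE_l Z x ee) => ->.
  rewrite [rr xE _ _ _](rr_lshift (Z := Z) x b ee) mulr_sumr; apply: eq_bigr => j _.
  by have [_ -> _] := He' j; ring.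
under [RHS]eq_bigr do rewrite vE mulr_suml.
rewrite exchange_big /=; apply: eq_bigr => j _.
rewrite (bpair_expand gM fr (bX j) We) mulr_sumr; apply: eq_bigr => i _.
by have [_ /dnbhs_self[_ _ ->]] := dP j i; ring.
Qed.

Lemma coef_rshift V e i : is_bfield crit V -> WE e ->
  coef xE bE (rshift m i) V e = V (p_ i) e.
Proof.
move=> bV We; have := coef_field gE bcE (rshift m i) bV We.
by rewrite [rr _ _ _ _](rr_rshift (Z := Z) x b ee) mul1r [xE _](xE_r Z x ee).
Qed.

End InChart.

Lemma smooth_liouville V : is_bfield crit V -> smooth (liouville V).
Proof.
move=> bV; apply: smooth_local => // e.
have [W [x [b [ee [fr We]]]]] := frame_exists (bproj e) bM.
have bcE := bcot_bchart gM fr; have [ncE _] := bcE; have [oW _ _ _ _] := ncE.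
apply: (smooth_at_ext gE _ (_ : smooth_at e (fun e =>
    \sum_i coef (bcot_coord x ee) (omap (lshift m) b) (lshift m i) V e * bpair e (ee i)))).
  by exists [set e | W (bproj e)]; split=> // e' We' /=; rewrite (liouvilleE fr).
apply: smooth_at_sum => // i; apply: smooth_atM => //.
  exact: (coef_smooth_at gE bcE).
by apply: smooth_smooth_at => //; apply: smooth_bpair; case: fr.
Qed.

Section FormInChart.
Variables (W : set M) (x : 'I_m -> M -> R) (b : option 'I_m) (ee : 'I_m -> operator M).
Hypothesis fr : is_frame Z W x b ee.
Let WE := [set e : bcot Z | W (bproj e)].
Let xE := bcot_coord x ee : 'I_(m + m) -> bcot Z -> R.
Let bE := omap (lshift m) b.
Let bcE : bchart crit WE xE bE. Proof. exact: bcot_bchart gM fr. Qed.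
Local Notation p_ i := (fun e => bpair e (ee i)).
Local Notation v_ i V := (coef xE bE (lshift m i) V).
Let oWE e : WE e -> dnbhs e WE. Proof. by exists WE; split=> //; case: bcE => -[]. Qed.

(** Leibniz's rule applied to the Liouville form yields terms in which the coefficients are
    differentiated; they cancel against its value on the commutator by [coef_lie]. What remains is
    the sum of (dx_i / r_i) /\ dp_i. *)
Lemma bcan_formE V V' e : is_bfield crit V -> is_bfield crit V' -> WE e ->
  bcan_form V V' e = \sum_i (v_ i V e * V' (p_ i) e - v_ i V' e * V (p_ i) e).
Proof.
move=> bV bV' We; have bL := bfield_lie gE bV bV'.
have germ U : is_bfield crit U -> exists d : 'I_m -> bcot Z -> R,
   (forall i, smooth (d i)) /\ forall i, dnbhs e [set e' | [/\ WE e',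
     U (xE (lshift m i)) e' = rr xE bE (lshift m i) e' * d i e' & v_ i U e' = d i e']].
  move=> bU; have /choice[d dP] : forall i, exists d : bcot Z -> R, smooth d /\ dnbhs e
      [set e' | [/\ WE e', U (xE (lshift m i)) e' = rr xE bE (lshift m i) e' * d e' & v_ i U e' = d e']].
    by move=> i; have [d ? ?] := coefP gE bcE (lshift m i) bU We; exists d.
  by exists d; split=> i; case: (dP i).
have [d [sd Hd]] := germ V bV; have [d' [sd' Hd']] := germ V' bV'.
have sp i : smooth (p_ i) by apply: smooth_bpair; case: fr.
have appl U (t : 'I_m -> bcot Z -> R) U' : is_vfield U -> is_bfield crit U' ->
   (forall i, smooth (t i)) -> (forall i, dnbhs e [set e' | [/\ WE e',
     U' (xE (lshift m i)) e' = rr xE bE (lshift m i) e' * t i e' & v_ i U' e' = t i e']]) ->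
   U (liouville U') e = \sum_i (t i e * U (p_ i) e + bpair e (ee i) * U (t i) e).
  move=> vU bU' st Ht; have stp i : smooth (fun e => t i e * bpair e (ee i)) by apply: smoothM.
  rewrite (vfield_local (g := fun e => \sum_i t i e * bpair e (ee i)) vU (smooth_liouville bU')).
  - rewrite (pder_sum gE (vfield_pder e vU) stp); apply: eq_bigr => i _.
    by have [_ _ UM] := vfield_pder e vU; rewrite UM.
  - exact: smooth_sum.
  - apply: dnbhsS (dnbhsI gE (oWE We) (dnbhs_all gE Ht)) => e' [We' /= He'].
    rewrite (liouvilleE fr bU' We'); apply: eq_bigr => i _.
    by have [_ _ ->] := He' i.
rewrite /bcan_form /ext_d (appl V d' V' bV.1 bV' sd' Hd') (appl V' d V bV'.1 bV sd Hd).
rewrite (liouvilleE fr bL We) -!sumrB -sumrN; apply: eq_bigr => i _.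
rewrite (coef_lie gE bcE bV bV' We (sd i) (sd' i) (Hd i) (Hd' i)).
have [_ _ ->] := dnbhs_self (Hd i); have [_ _ ->] := dnbhs_self (Hd' i).
generalize (d i e) (d' i e) (V (p_ i) e) (V' (p_ i) e) (V (d' i) e) (V' (d i) e) (bpair e (ee i)).
by move=> *; ring.
Qed.

(** Hamilton's equations: the coefficient of X along the i-th base direction is the derivative of g
    by p_i, and X p_i is minus r_i times the derivative of g by x_i. *)
Lemma bcan_form_ham X g V e : is_bfield crit X -> is_bfield crit V -> WE e -> smooth g ->
  (forall f e', smooth f -> WE e' -> X f e' = local_pb W x b ee f g e') ->
  bcan_form X V e = V g e.
Proof.
move=> bX bV We sg XE; rewrite bcan_formE //.
have sp i : smooth (p_ i) by apply: smooth_bpair; case: fr.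
have sx k : smooth (xE k) by case: bcE => -[].
rewrite (bfield_expand gE bcE bV We sg) big_split_ord /= -big_split /=.
apply: eq_bigr => i _.
rewrite (coef_rshift fr i bV We) [rr xE bE (rshift m i) e](rr_rshift (Z := Z) x b ee) mul1r.
rewrite [rr xE bE (lshift m i) e](rr_lshift (Z := Z) x b ee).
have pE : p_ i = xE (rshift m i) by rewrite [RHS](xE_r Z x ee).
have -> : X (p_ i) e = - (rr x b i (bproj e) * cder WE xE (lshift m i) g e).
  rewrite XE // pE /local_pb (bigD1 i) //= big1 ?addr0 => [|j ji].
    rewrite (L_coord gM fr) // (P_coord gM fr) // eqxx eq_rlshift.
    by rewrite mul0r sub0r mul1r mulrN.
  rewrite (L_coord gM fr) // (P_coord gM fr) // eq_rlshift (inj_eq (@rshift_inj m m)).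
  by rewrite eq_sym (negbTE ji) !mul0r subrr mulr0.
have [d sd Hd] := cder_smooth_at gE (proj1 bcE) (rshift m i) sg We.
have -> : v_ i X e = cder WE xE (rshift m i) g e.
  rewrite (dnbhs_self Hd); apply: (coef_eq gE bcE) => //.
  apply: dnbhsS (dnbhsI gE (oWE We) Hd) => e' [We' /= <-].
  rewrite XE // [rr xE bE _ _](rr_lshift (Z := Z) x b ee) /local_pb (bigD1 i) //= big1 ?addr0 => [|j ji].
    rewrite (L_coord gM fr) // (P_coord gM fr) // eqxx eq_lrshift.
    by rewrite mul0r subr0 mul1r.
  rewrite (L_coord gM fr) // (P_coord gM fr) // eq_lrshift (inj_eq (@lshift_inj m m)).
  by rewrite eq_sym (negbTE ji) !mul0r subrr mulr0.
rewrite mulrN opprK.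
by rewrite [LHS]addrC; congr (_ + _); apply: mulrC.
Qed.

End FormInChart.

Lemma bcan_form_anti V V' e : is_bfield crit V -> is_bfield crit V' ->
  bcan_form V V' e = - bcan_form V' V e.
Proof.
move=> bV bV'; have [W [x [b [ee [fr We]]]]] := frame_exists (bproj e) bM.
by rewrite !(bcan_formE fr) // -sumrN; apply: eq_bigr => i _; rewrite opprB.
Qed.

(** A frame is chosen at every point without any coherence; [is_pb_unique] shows that the value is
    that of any frame around, whence smoothness. The resulting fields [B g] are then the Hamiltonian
    fields. *)
Lemma bcan_pbr_local : exists pb : (bcot Z -> R) -> (bcot Z -> R) -> bcot Z -> R,
  [/\ forall e, is_pb e (fun f g => pb f g e),
      forall f g, smooth f -> smooth g -> smooth (pb f g) &
      forall f g, smooth f -> smooth g -> @pbr R (bcan Z) f g = pb f g].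
Proof.
have /choice[c cP] : forall p : M, exists c : set M * ('I_m -> M -> R) * option 'I_m * ('I_m -> operator M),
    is_frame Z c.1.1.1 c.1.1.2 c.1.2 c.2 /\ c.1.1.1 p.
  by move=> p; have [W [x [b [ee H]]]] := frame_exists p bM; exists (W, x, b, ee).
pose pb f g e := let: cc := c (bproj e) in local_pb cc.1.1.1 cc.1.1.2 cc.1.2 cc.2 f g e.
have pb_pb e : is_pb e (fun f g => pb f g e).
  by have [fr We] := cP (bproj e); apply: local_pb_is_pb.
have pbE W x b ee f g e : is_frame Z W x b ee -> W (bproj e) -> smooth f -> smooth g ->
    pb f g e = local_pb W x b ee f g e.
  move=> fr We sf sg.
  by have := is_pb_unique (pb_pb e) (local_pb_is_pb gM fr We) sf sg; apply.
have spb f g : smooth f -> smooth g -> smooth (pb f g).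
  move=> sf sg; apply: smooth_local => // e; have [fr We] := cP (bproj e).
  set cc := c _ in fr We; have := local_pb_smooth_at gM fr We sf sg.
  apply: smooth_at_ext => //; exists [set e | cc.1.1.1 (bproj e)]; split=> //.
    by have := bcot_nchart gM fr; case.
  by move=> e' We' /=; rewrite (pbE _ _ _ _ _ _ _ _ fr).
pose B g := mkop (fun f => pb f g).
have bB g : smooth g -> is_bfield crit (B g).
  move=> sg; split.
    apply: mkop_vfield => // [f sf|e]; first exact: spb.
    by have [[H _] _ _ _ _] := pb_pb e; apply: H.
  move=> f sf f0 e Ze; rewrite /B mkopE //; have [fr We] := cP (bproj e).
  exact: (local_pb_crit gM fr).
have hB g V : smooth g -> is_bfield crit V -> bcan_form (B g) V = V g.
  move=> sg bV; apply/funext => e; have [fr We] := cP (bproj e).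
  apply: (bcan_form_ham fr (bB g sg) bV We sg) => f e' sf We'.
  by rewrite /B mkopE // (pbE _ _ _ _ _ _ _ _ fr).
exists pb; split=> // f g sf sg.
suff E : ham_field crit (@bcan_form R M Z) g = B g.
  by rewrite -[LHS]/(ham_field crit (@bcan_form R M Z) g f) E /B mkopE.
apply: xget_unique; first by split=> [|V bV]; [exact: bB|exact: hB].
move=> D [bD hD]; apply: vfield_ext bD.1 (bB g sg).1 _ => h sh e.
(* Non-degeneracy in disguise: testing D against the field of h gives w(D, B h) = {g, h}, while
   antisymmetry gives w(D, B h) = - D h, so D h = {h, g}. *)
have := congr1 (fun F => F e) (hD _ (bB h sh)).
rewrite bcan_form_anti //; last exact: bB.
rewrite hB // /B !mkopE // => E.
have anti : pb g h e = - pb h g e.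
  have [fr We] := cP (bproj e).
  rewrite !(pbE _ _ _ _ _ _ _ _ fr) // /local_pb -sumrN; apply: eq_bigr => i _.
  generalize (rr (c (bproj e)).1.1.2 (c (bproj e)).1.2 i (bproj e)).
  move: (cder _ _ (lshift m i) _ _) (cder _ _ (rshift m i) _ _) (cder _ _ (rshift m i) _ _) (cder _ _ (lshift m i) _ _).
  by move=> *; ring.
by apply: oppr_inj; rewrite E anti.
Qed.

Lemma bcan_is_pb e : is_pb e (fun f g => @pbr R (bcan Z) f g e).
Proof.
have [pb [pb_pb spb pbE]] := bcan_pbr_local.
have [[b1 b2] p1 p2 p3 p4] := pb_pb e.
have sp (g : M -> R) : smooth g -> smooth (g \o bproj (Z := Z)) by apply: smooth_bproj.
split.
- split=> [g sg|f sf]; [have [D1 D2 D3] := b1 g sg|have [D1 D2 D3] := b2 f sf];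
    (split=> [h h' sh sh'|c h sh|h h' sh sh']; rewrite ?pbE //;
      [exact: D1|exact: smoothD|exact: D2|exact: smoothZ|exact: D3|exact: smoothM]).
- by move=> g g' sg sg'; rewrite pbE ?p1 //; apply: sp.
- by move=> g D sg bD; rewrite pbE ?p2 //; [apply: sp|apply: smooth_bpair].
- by move=> g D sg bD; rewrite pbE ?p3 //; [apply: smooth_bpair|apply: sp].
- by move=> D E bD bE; rewrite pbE ?p4 //; apply: smooth_bpair.
Qed.

Lemma bcan_smooth f g : smooth f -> smooth g -> smooth (@pbr R (bcan Z) f g).
Proof. by move=> sf sg; have [pb [_ spb pbE]] := bcan_pbr_local; rewrite pbE //; apply: spb. Qed.

End Hamiltonian.

(** * Antisymmetry and the Jacobi identity of the canonical bracket *)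

Section CanonicalPoisson.
Variables (R : realType) (M : diffSpace R) (Z : set M) (m : nat).
Hypothesis bM : is_bmfd Z m.

Let gM : gen_closed M. Proof. by case: bM. Qed.
Let gE : gen_closed (bcot Z). Proof. exact: gen_closed_bcot. Qed.
Implicit Types (f g h : bcot Z -> R) (e : bcot Z).
Local Notation "{[ f , g ]}" := (@pbr R (bcan Z) f g).
Local Notation prj := (bproj (Z := Z)).
Local Notation fib D := (fun e : bcot Z => bpair e D).

Let spb f g : smooth f -> smooth g -> smooth {[f, g]}. Proof. exact: bcan_smooth bM f g. Qed.

Let sprj (g : M -> R) : smooth g -> smooth (g \o prj). Proof. exact: smooth_bproj. Qed.

(** The opposite of the bracket with exchanged arguments satisfies the same characterisation on
    generators. *)
Lemma pbr_anti f g : smooth f -> smooth g -> {[f, g]} = fun e => - {[g, f]} e.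
Proof.
move=> sf sg; apply/funext => e; have pb := bcan_is_pb bM e.
apply: (is_pb_unique (be' := fun f g => - {[g, f]} e) pb) => //.
case: pb => -[b1 b2] p1 p2 p3 p4; split.
- by split=> [k sk|k sk]; apply: pderN; [apply: b2|apply: b1].
- by move=> k k' sk sk'; rewrite p1 // oppr0.
- by move=> k D sk bD; rewrite p3 // opprK.
- by move=> k D sk bD; rewrite p2.
- move=> D E bD bE; rewrite p4 // opprK.
  have bl := bfield_lie gM bD bE; have := bpairZ gM e (-1) bl.
  rewrite mulN1r => <-; congr bpair; apply/funext => k; apply/funext => y.
  by rewrite /lie_br mulN1r opprB.
Qed.

Let brg (g g' : M -> R) : smooth g -> smooth g' -> {[g \o prj, g' \o prj]} = fun=> 0.
Proof.
by move=> sg sg'; apply/funext => e; have [_ H _ _ _] := bcan_is_pb bM e; apply: H.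
Qed.

Let brgD (g : M -> R) D : smooth g -> is_bfield Z D -> {[g \o prj, fib D]} = D g \o prj.
Proof.
by move=> sg bD; apply/funext => e; have [_ _ H _ _] := bcan_is_pb bM e; apply: H.
Qed.

Let brDE D E : is_bfield Z D -> is_bfield Z E -> {[fib D, fib E]} = fib (lie_br E D).
Proof.
move=> bD bE; apply/funext => e; have [_ _ _ _ H] := bcan_is_pb bM e; rewrite H //.
have bl := bfield_lie gM bD bE; have := bpairZ gM e (-1) bl.
rewrite mulN1r => <-; congr bpair; apply/funext => k; apply/funext => y.
by rewrite /lie_br mulN1r opprB.
Qed.

Let br0 f e : smooth f -> {[f, fun=> 0]} e = 0.
Proof.
by move=> sf; have [[_ b2] _ _ _ _] := bcan_is_pb bM e; apply: (pder_cst gE _ (b2 f sf)).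
Qed.

Let brN f g e : smooth f -> smooth g -> {[f, fun e => - g e]} e = - {[f, g]} e.
Proof.
move=> sf sg; have [[_ b2] _ _ _ _] := bcan_is_pb bM e; have [_ H _] := b2 f sf.
have := H (-1) g sg; rewrite mulN1r => <-.
by congr ({[f, _]} e); apply/funext => y; rewrite mulN1r.
Qed.

Let J f g h e : R := {[f, {[g, h]}]} e + {[g, {[h, f]}]} e + {[h, {[f, g]}]} e.

Let Jcyc f g h e : J f g h e = J g h f e.
Proof. by rewrite /J -addrA addrC. Qed.

(** As a function of f the Jacobiator is the field of {g, h} plus the commutator of the fields of g
    and h; the second-order parts cancel and a derivation is left. *)
Let Jpder g h e : smooth g -> smooth h -> pder e (fun f => J f g h e).
Proof.
move=> sg sh; pose X g := mkop (fun f => {[f, g]}).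
have vX k : smooth k -> is_vfield (X k).
  move=> sk; apply: mkop_vfield => // [f sf|e']; first exact: spb.
  by have [[H _] _ _ _ _] := bcan_is_pb bM e'; apply: H.
have sgh := spb sg sh.
have vT := vfieldD gE (vX _ sgh) (vfield_lie gE (vX g sg) (vX h sh)).
have E f : smooth f -> J f g h e = X {[g, h]} f e + lie_br (X g) (X h) f e.
  move=> sf; rewrite /J /lie_br /X !mkopE //; [|exact: spb..].
  rewrite -addrA; congr (_ + (_ + _)).
    rewrite (pbr_anti sh sf) brN //; last exact: spb.
    by rewrite (pbr_anti sg (spb sf sh)) opprK.
  by rewrite (pbr_anti sh (spb sf sg)).
have [a1 a2 a3] := vfield_pder e vT.
split=> [f f' sf sf'|c f sf|f f' sf sf'].
- by rewrite !E ?a1 //; apply: smoothD.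
- by rewrite !E ?a2 //; apply: smoothZ.
- by rewrite !E ?a3 //; apply: smoothM.
Qed.

Let gens : set (bcot Z -> R) := [set f |
    (exists2 g : M -> R, smooth g & f = g \o prj) \/
    (exists2 D, is_bfield Z D & f = fib D)].

Let Jgens f g h e : gens f -> gens g -> gens h -> J f g h e = 0.
Proof.
have J0 (a b c : M -> R) : smooth a -> smooth b -> smooth c ->
    J (a \o prj) (b \o prj) (c \o prj) e = 0.
  by move=> sa sb sc; rewrite /J !brg // !br0 ?addr0 //; apply: sprj.
have J1 (a b : M -> R) D : smooth a -> smooth b -> is_bfield Z D ->
    J (a \o prj) (b \o prj) (fib D) e = 0.
  move=> sa sb bD; have [[_ sD _ _ _] _] := bD.
  have sfD := smooth_bpair bD.
  rewrite /J brg // br0 // addr0 (pbr_anti sfD (sprj sa)) !brgD // brN; [|exact: sprj|by apply/sprj/sD].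
  by rewrite !brg ?oppr0 ?addr0 //; apply: sD.
have J2 (a : M -> R) D E : smooth a -> is_bfield Z D -> is_bfield Z E ->
    J (a \o prj) (fib D) (fib E) e = 0.
  move=> sa bD bE; have [[_ sD _ _ _] _] := bD; have [[_ sE _ _ _] _] := bE.
  have sfD := smooth_bpair bD; have sfE := smooth_bpair bE.
  rewrite /J brDE // brgD //; last exact: bfield_lie.
  rewrite (pbr_anti sfE (sprj sa)) !brgD // brN; [|exact: sfD|by apply/sprj/sE].
  rewrite (pbr_anti sfD (sprj (sE _ sa))) (pbr_anti sfE (sprj (sD _ sa))).
  by rewrite !brgD //; [rewrite /lie_br /=; ring|exact: sD|exact: sE].
move=> [[a sa ->]|[D bD ->]] [[b sb ->]|[E bE ->]] [[c sc ->]|[F bF ->]].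
- exact: J0.
- exact: J1.
- by rewrite Jcyc Jcyc; apply: J1.
- exact: J2.
- by rewrite Jcyc; apply: J1.
- by rewrite Jcyc; apply: J2.
- by rewrite Jcyc Jcyc; apply: J2.
have bDE := bfield_lie gM bD bE; have bEF := bfield_lie gM bE bF; have bFD := bfield_lie gM bF bD.
have bED := bfield_lie gM bE bD; have bFE := bfield_lie gM bF bE; have bDF := bfield_lie gM bD bF.
have b1 := bfield_lie gM bFE bD; have b2 := bfield_lie gM bDF bE; have b3 := bfield_lie gM bED bF.
rewrite /J !brDE // -!(bpairD _ _) //; last exact: bfieldD.
rewrite -[RHS](bpair0 gM e); congr bpair.
have vT := vfieldD gM (vfieldD gM b1.1 b2.1) b3.1.
apply: vfield_ext vT (vfield0 gM) _ => k sk y.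
have [[_ sD _ _ _] _] := bD; have [[_ sE _ _ _] _] := bE; have [[_ sF _ _ _] _] := bF.
have lieD X Y U w : is_bfield Z X -> is_bfield Z Y -> is_bfield Z U ->
    U (lie_br X Y k) w = U (X (Y k)) w - U (Y (X k)) w.
  move=> bX bY [vU _]; have [[_ sX _ _ _] _] := bX; have [[_ sY _ _ _] _] := bY.
  have [a1 a2 _] := vfield_pder w vU.
  have s1 := sX _ (sY _ sk); have s2 := sY _ (sX _ sk).
  rewrite -[RHS]/(U (X (Y k)) w + - U (Y (X k)) w) -mulN1r -a2 // -a1 //; last exact: smoothZ.
  by congr (U _ w); apply/funext => z; rewrite /lie_br mulN1r.
have L X Y U : is_bfield Z X -> is_bfield Z Y -> is_bfield Z U ->
    lie_br (lie_br X Y) U k y = X (Y (U k)) y - Y (X (U k)) y - (U (X (Y k)) y - U (Y (X k)) y).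
  by move=> bX bY bU; rewrite -(lieD X Y U y).
by rewrite !L //; ring.
Qed.

Lemma pder0 (X : diffSpace R) (x : X) : pder x (fun _ => 0).
Proof. by split=> *; rewrite ?mulr0 ?addr0. Qed.

(** Being cyclic, the Jacobiator is a derivation in each argument, and the arguments can be replaced
    by generators one after another. *)
Lemma pbr_jacobi f g h e : smooth f -> smooth g -> smooth h ->
  {[f, {[g, h]}]} e + {[g, {[h, f]}]} e + {[h, {[f, g]}]} e = 0.
Proof.
move=> sf sg sh; rewrite -/(J f g h e).
have Gs : gens `<=` smooth by apply: bcot_gen_smooth.
have step f' g' h' : smooth g' -> smooth h' -> (forall s, gens s -> J s g' h' e = 0) ->
    smooth f' -> J f' g' h' e = 0.
  move=> sg' sh' H sf'.
  exact: (pder_gen_eq gE (@bcot_smooth_gen R M Z) Gs (Jpder e sg' sh') (pder0 e) H sf').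
apply: (step) => // s1 G1; rewrite Jcyc; apply: (step) => //; first exact: Gs.
move=> s2 G2; rewrite Jcyc; apply: (step) => //; [exact: Gs|exact: Gs|].
by move=> s3 G3; apply: Jgens.
Qed.

End CanonicalPoisson.

(** * Adapted charts on b-manifolds *)

Section BManifolds.
Variable R : realType.

(** The coordinates are replaced by global smooth functions with the same germs at p, at the price
    of a smaller domain. *)
Lemma is_chart_nchart n (X : diffSpace R) (W : set X) (x : X -> 'rV[R]_n) p :
  gen_closed X -> is_chart W x -> W p ->
  exists N (y : 'I_n -> X -> R), [/\ nchart N y, N p, N `<=` W &
    forall q, N q -> crd y q = x q].
Proof.
move=> gX [oW inj oi fx] Wp.
have sxi i : smooth_on W (fun q => x q 0 i).
  by apply/fx; exists (fun u => u 0 i) => //; apply: Cinf_coord.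
have /choice[y yP] : forall i, exists g : X -> R, smooth g /\ dnbhs p [set q | x q 0 i = g q].
  by move=> i; have [N [g [oN Np sg E]]] := sxi i p Wp; exists g; split=> //; exists N.
have [N [oN Np NE]] := dnbhsI gX (dnbhs_dopen oW Wp) (dnbhs_all gX (fun i => (yP i).2)).
have NW : N `<=` W by move=> q /NE[].
have yx q : N q -> crd y q = x q by move=> /NE[_ /= H]; apply/rowP => i; rewrite mxE H.
have sF f : smooth f -> exists2 F, Cinf (x @` W) F & forall q, W q -> f q = F (x q).
  move=> sf; apply/fx => q Wq; exists setT, f; split=> //; exact: dopenT.
have imN : crd y @` N `<=` x @` W.
  by move=> _ [q Nq <-]; exists q; [apply: NW|rewrite yx].
exists N, y; split=> //; split=> //.
- by move=> i; case: (yP i).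
- by move=> q q' Nq Nq'; rewrite !yx //; apply: inj; apply: NW.
- apply/open_cubeP => _ [q Nq <-]; rewrite yx //.
  have [f [sf fq fN]] := oN q Nq; have [F CF fF] := sF f sf.
  have iq : (x @` W) (x q) by exists q => //; apply: NW.
  have Fq : 0 < `|F (x q)| by rewrite -fF ?normr_gt0 //; apply: NW.
  have /cont_cubeP/(_ _ Fq)[d d0 Hd] := Cinf_cont CF iq.
  have /open_cubeP/(_ _ iq)[d' d'0 Hd'] := oi.
  exists (Num.min d d') => [|u ud]; first by rewrite lt_min d0.
  have [ud1 ud2] : cube (x q) d u /\ cube (x q) d' u.
    by split; apply: sub_cube ud; rewrite ge_min lexx ?orbT.
  have [q' Wq' q'u] := Hd' u ud2; have Nq' : N q'.
    apply/fN/eqP => E; have := Hd u ud1; rewrite -q'u -fF // E sub0r normrN.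
    by rewrite ltxx.
  by exists q' => //; rewrite yx.
- move=> f /sF[F CF fF]; exists F; first exact: Cinf_sub CF.
  by move=> q Nq; rewrite yx // fF //; apply: NW.
Qed.

(** Closedness of Z lets a chart at a point off Z be shrunk until it misses Z. *)
Lemma bmanifold_bmfd n (X : diffSpace R) (Z : set X) :
  is_bmanifold n Z -> dopen (~` Z) -> is_bmfd Z n.+1.
Proof.
move=> [[gX _ _ charts] _ hyp _] cZ; split=> // p; have [Zp|nZp] := pselect (Z p).
  have [W [x [cx Wp Zx]]] := hyp p Zp.
  have [N [y [nc Np NW yx]]] := is_chart_nchart gX cx Wp.
  exists N, y, (Some ord0); split=> //; split=> // q Nq.
  have -> : Z q <-> x q 0 0 = 0 by apply: Zx; apply: NW.
  rewrite -yx // mxE; split=> [E|[i [<-]//]]; by exists ord0.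
have [W [x [cx Wp]]] := charts p.
have [N [y [nc Np NW yx]]] := is_chart_nchart gX cx Wp.
have oN : dopen N by case: nc.
exists (N `&` ~` Z), y, None; split=> //; split.
  by apply: nchart_sub nc _ _ => [|q []] //; apply: dopenI.
by move=> q [_ nZq]; split=> // -[].
Qed.

End BManifolds.

(** * Cotangent lifts of diffeomorphisms preserving Z *)

Definition conj_op (R : realType) (X Y : diffSpace R) (phi : X -> Y) (psi : Y -> X)
  (D : operator X) : operator Y := fun f y => D (f \o phi) (psi y).

Section Lifts.
Variables (R : realType) (M : diffSpace R) (Z : set M) (phi psi : M -> M).
Hypotheses (gM : gen_closed M) (sphi : smooth_map phi) (spsi : smooth_map psi)
  (phiK : cancel phi psi) (psiK : cancel psi phi) (Zphi : forall x, Z (phi x) <-> Z x).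

Lemma push_bfield D : is_bfield Z D -> is_bfield Z (conj_op psi phi D).
Proof.
move=> [vD ZD]; have [D0 sD _ _ _] := vD; split; last first.
  by move=> f sf fZ z Zz; apply: ZD; [exact: spsi|move=> y Zy; apply/fZ/Zphi; rewrite psiK|apply/Zphi].
split=> [f nf|f sf|f g sf sg|a f sf|f g sf sg].
- rewrite /conj_op D0 // => /sphi; congr (~ _) : nf => //.
  by congr smooth; apply/funext => x; rewrite /= phiK.
- exact: (sphi (sD _ (spsi sf))).
- by have [_ _ H' _ _] := vD; apply/funext => x; have /(congr1 (@^~ (phi x))) := H' _ _ (spsi sf) (spsi sg).
- by have [_ _ _ H' _] := vD; apply/funext => x; have /(congr1 (@^~ (phi x))) := H' a _ (spsi sf).
- have [_ _ _ _ H'] := vD; apply/funext => x; have /(congr1 (@^~ (phi x))) := H' _ _ (spsi sf) (spsi sg).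
  by rewrite /= !phiK.
Qed.

Definition lift_val (a : bcot Z) (D : operator M) : R :=
  if `[< is_bfield Z D >] then bpair a (conj_op psi phi D) else 0.

Lemma lift_valP a : is_bcovector Z (phi (bproj a)) (lift_val a).
Proof.
split=> [D nD|D E bD bE|f D sf bD]; rewrite /lift_val.
- by case: asboolP.
- rewrite !asboolT //; last exact: bfieldD.
  by rewrite -bpairD //; apply: push_bfield.
- rewrite !asboolT //; last exact: bfieldM.
  by rewrite -(bpairM a (sphi sf)) //; apply: push_bfield.
Qed.

Definition blift (a : bcot Z) : bcot Z := exist _ (phi (bproj a), lift_val a) (lift_valP a).

Lemma lift_pair a D : is_bfield Z D -> bpair (blift a) D = bpair a (conj_op psi phi D).
Proof. by move=> bD; rewrite /bpair /= /lift_val asboolT. Qed.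

Lemma smooth_lift : smooth_map blift.
Proof.
apply: (smooth_map_gen (@gen_closed_bcot R M Z) (@bcot_smooth_gen R M Z)).
move=> _ [[g sg ->]|[D bD ->]].
  exact: (smooth_bproj (sphi sg)).
apply: (smooth_eq (f := fun a => bpair a (conj_op psi phi D))).
  by move=> a; rewrite /= lift_pair.
exact/smooth_bpair/push_bfield.
Qed.

(** The lift pulls generators back to generators, and conjugation by the diffeomorphism respects
    both the action on functions and commutators; uniqueness of the bracket does the rest. *)
Lemma lift_bracket m f g e : is_bmfd Z m -> smooth f -> smooth g ->
  @pbr R (bcan Z) (f \o blift) (g \o blift) e = @pbr R (bcan Z) f g (blift e).
Proof.
move=> bM; have [b0 p1 p2 p3 p4] := bcan_is_pb bM e.
have pb' := bcan_is_pb bM (blift e); have [b' _ _ _ _] := pb'.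
apply: (is_pb_unique (be := fun f g => @pbr R (bcan Z) (f \o blift) (g \o blift) e) _ pb').
have fibE D : is_bfield Z D ->
    (fun a => bpair a D) \o blift = fun a => bpair a (conj_op psi phi D).
  by move=> bD; apply/funext => a; rewrite /= lift_pair.
have prjE (k : M -> R) : (k \o bproj (Z := Z)) \o blift = (k \o phi) \o bproj (Z := Z) by [].
have psiKf (k : M -> R) : (k \o phi) \o psi = k by apply/funext => x; rewrite /= psiK.
split.
- split=> k sk; have sk' := smooth_lift sk; have [b1 b2] := b0.
    exact: (pder_push smooth_lift (b1 _ sk')).
  exact: (pder_push smooth_lift (b2 _ sk')).
- by move=> k k' sk sk'; rewrite !prjE p1 //; apply: sphi.
- move=> k D sk bD; rewrite prjE fibE // p2 /conj_op ?psiKf //; first exact: sphi.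
  exact: push_bfield.
- move=> k D sk bD; rewrite prjE fibE // p3 /conj_op ?psiKf //; first exact: sphi.
  exact: push_bfield.
- move=> D E bD bE; rewrite !fibE // p4; [|exact: push_bfield..].
  rewrite lift_pair; last exact: bfield_lie.
  congr (- bpair _ _); apply/funext => k; apply/funext => x; rewrite /lie_br /conj_op.
  have c (F : M -> R) : (fun y => F (phi y)) \o psi = F by apply/funext => y; rewrite /= psiK.
  by rewrite !c.
Qed.

End Lifts.

(** * Left translations by H and the lifted action *)

Lemma bmanifold_bmfd_group (R : realType) n (G : bLieGroup R n) :
  is_bmfd (X := bspace G) (@bH R n G) n.+1.
Proof. by apply: bmanifold_bmfd; [exact: bgroup_bmanifold|exact: bH_closed]. Qed.

Section LeftTranslations.
Variables (R : realType) (n : nat) (G : bLieGroup R n).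
Local Notation M := (bspace G).
Local Notation H := (@bH R n G : set M).

Lemma group_gen_closed : gen_closed M.
Proof. by case: (bmanifold_bmfd_group G). Qed.

Lemma smooth_lmul (g : G) : smooth_map ((fun x => g * x)%g : M -> M).
Proof.
move=> f sf; have gM := group_gen_closed.
exact: (smooth_pair gM (smooth_const_map gM (g : M)) (@smooth_id R M) (bgroup_mul sf)).
Qed.

Lemma smooth_rmul (g : G) : smooth_map ((fun x => x * g)%g : M -> M).
Proof.
move=> f sf; have gM := group_gen_closed.
exact: (smooth_pair gM (@smooth_id R M) (smooth_const_map gM (g : M)) (bgroup_mul sf)).
Qed.

Lemma lmulK (g : G) : cancel (fun x : M => g * x : G)%g (fun x => g^-1 * x : G)%g.
Proof. by move=> x; rewrite mulgA mulVg mul1g. Qed.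

Lemma lmulVK (g : G) : cancel (fun x : M => g^-1 * x : G)%g (fun x => g * x : G)%g.
Proof. by move=> x; rewrite mulgA mulgV mul1g. Qed.

Lemma bH_lmul (h : G) : H h -> forall x : M, H (h * x : G)%g <-> H x.
Proof.
move=> Hh x; split=> [Hx|Hx]; last exact: bHM.
by rewrite -[x](lmulK h); apply: bHM => //; apply: bHV.
Qed.

Lemma liftrelP (a b : bcot H) : liftrel a b <-> exists h : G, exists2 Hh : H h, True &
  b = blift group_gen_closed (smooth_lmul h) (smooth_lmul h^-1) (lmulK h) (lmulVK h) (bH_lmul Hh) a.
Proof.
split=> [[h Hh [pb eb]]|[h [Hh _ ->]]].
  exists h, Hh => //; apply: bcot_eq => // D bD; rewrite eb //.
  by rewrite lift_pair.
by exists h => //; split=> // D bD; rewrite lift_pair.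
Qed.

Lemma liftrel_refl (a : bcot H) : liftrel a a.
Proof.
exists 1%g; first exact: bH1.
split=> [|D bD]; first by rewrite mul1g.
congr bpair; apply/funext => f; apply/funext => x; rewrite /push_op mul1g.
by congr (D _ _); apply/funext => y; rewrite /= invg1 mul1g.
Qed.

Lemma liftrel_trans (a b c : bcot H) : liftrel a b -> liftrel b c -> liftrel a c.
Proof.
move=> [h Hh [p1 e1]] [k Hk [p2 e2]]; exists (k * h)%g; first exact: bHM.
split=> [|D bD]; first by rewrite p2 p1 mulgA.
rewrite e2 // e1; last exact: (push_bfield (smooth_lmul k) (smooth_lmul k^-1) (lmulK k) (lmulVK k) (bH_lmul Hk)).
congr bpair; apply/funext => f; apply/funext => x; rewrite /push_op mulgA.
by congr (D _ _); apply/funext => y; rewrite /= invgM mulgA.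
Qed.

Lemma liftrel_sym (a b : bcot H) : liftrel a b -> liftrel b a.
Proof.
move=> [h Hh [p1 e1]]; exists h^-1%g; first exact: bHV.
split=> [|D bD]; first by rewrite p1 lmulK.
rewrite e1; last first.
  have Hv := bHV Hh.
  exact: (push_bfield (smooth_lmul h^-1) (smooth_lmul h^-1^-1) (lmulK h^-1) (lmulVK h^-1) (bH_lmul Hv)).
congr bpair; apply/funext => f; apply/funext => x; rewrite /push_op lmulK.
by congr (D _ _); apply/funext => y; rewrite /= invgK lmulK.
Qed.

End LeftTranslations.

(** * Orbit spaces and the reduced bracket *)

Section Quotients.
Variables (R : realType) (X : diffSpace R) (E : X -> X -> Prop).
Hypotheses (Er : forall x, E x x) (Es : forall x y, E x y -> E y x)
  (Et : forall x y z, E x y -> E y z -> E x z).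
Local Notation q := (quot_map E).

Lemma quot_map_eq x y : q x = q y <-> E x y.
Proof.
split=> [/(congr1 sval)/= e|xy].
  by have : [set z | E y z] y by []; rewrite -e.
apply: eq_exist => /=; apply/seteqP; split=> z /=; last exact: Et.
by apply: Et; apply: Es.
Qed.

Lemma quot_map_surj (c : quotSpace E) : exists x, q x = c.
Proof.
case: c => A [y Ay]; exists y; apply: eq_exist; exact/esym.
Qed.

End Quotients.

Section ReducedBracket.
Variables (R : realType) (n : nat) (G : bLieGroup R n).
Local Notation M := (bspace G).
Local Notation H := (@bH R n G : set M).
Local Notation q := (quot_map (@liftrel R n G)).

Lemma quot_liftrel (a b : bcot H) : q a = q b <-> liftrel a b.
Proof. by apply: quot_map_eq; [exact: liftrel_refl|exact: liftrel_sym|exact: liftrel_trans]. Qed.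

(** The bracket of pulled-back functions is evaluated at an arbitrary point of each orbit;
    invariance under lifted translations makes the choice immaterial. The Poisson identities descend
    because the quotient map is onto. *)
Theorem reduced_exists : exists red, is_reduced (G := G) red.
Proof.
have bM := bmanifold_bmfd_group G; have gM := @group_gen_closed R n G.
have gE : gen_closed (bcot H) by exact: gen_closed_bcot.
have /choice[rep repK] := @quot_map_surj R (bcot H) (@liftrel R n G).
pose red (f g : bcot_modH G -> R) x := @pbr R (bcan H) (f \o q) (g \o q) (rep x).
have redE f g : smooth f -> smooth g -> red f g \o q = @pbr R (bcan H) (f \o q) (g \o q).
  move=> sf sg; apply/funext => a; change (@pbr R (bcan H) (f \o q) (g \o q) (rep (q a)) = @pbr R (bcan H) (f \o q) (g \o q) a).
  have /quot_liftrel/liftrelP[h [Hh _ ra]] := repK (q a).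
  rewrite [in RHS]ra. rewrite -(lift_bracket _ _ _ _ _ _ _ bM) //.
  have lq e : q (blift (@group_gen_closed R n G) (smooth_lmul h) (smooth_lmul h^-1) (lmulK h) (lmulVK h) (bH_lmul Hh) e) = q e.
    by apply/esym/quot_liftrel/liftrelP; exists h, Hh.
  by congr (pbr _ _ _); apply/funext => e; rewrite /= lq.
have sred f g : smooth f -> smooth g -> smooth (red f g).
  by move=> sf sg; suff: @smooth R (bcot H) (red f g \o q) by []; rewrite redE //; apply: (bcan_smooth bM).
exists red; split; last by split=> // f g sf sg; rewrite redE.
split=> /=.
- exact: sred.
- by move=> f g sf sg; apply/funext => x; rewrite /red (pbr_anti bM).
- move=> a f f' g sf sf' sg; apply/funext => x; rewrite /red.
  have [[b1 _] _ _ _ _] := bcan_is_pb bM (rep x); have [p1 p2 _] := b1 (g \o q) sg.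
  by rewrite -p2 // -p1 //; apply: smoothZ.
- move=> f f' g sf sf' sg; apply/funext => x; rewrite /red.
  have [[b1 _] _ _ _ _] := bcan_is_pb bM (rep x); have [_ _ p3] := b1 (g \o q) sg.
  by rewrite p3 //= !repK.
- move=> f g h sf sg sh x; rewrite {1 3 5}/red !redE //.
  exact: (pbr_jacobi bM).
Qed.

End ReducedBracket.

Lemma sval_inj (T : Type) (P : T -> Prop) (x y : {z | P z}) : sval x = sval y -> x = y.
Proof. by case: x y => [x Px] [y Py]; apply: eq_exist. Qed.

(** * Germs and derivations on open subspaces *)

Section Germs.
Variables (R : realType) (X : diffSpace R).
Hypothesis gX : gen_closed X.
Implicit Types (x : X) (a b : X -> R) (xi : (X -> R) -> R).

Lemma dopen_dnbhs (A : set X) : (forall x, A x -> dnbhs x A) -> dopen A.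
Proof.
move=> H x /H[N [oN Nx NA]]; have [f [sf fx fN]] := oN x Nx.
by exists f; split=> // y /fN/NA.
Qed.

(** A global smooth representative of a near x, so that operators on global functions can act on
    functions smooth only near x. *)
Definition germ x a : X -> R := xget (fun=> 0) [set b | smooth b /\ dnbhs x [set y | a y = b y]].

Lemma germP x a : smooth_at x a -> smooth (germ x a) /\ dnbhs x [set y | a y = germ x a y].
Proof.
move=> [b sb ab]; rewrite /germ; case: xgetP => [y _ []//|H].
by have := H b; case.
Qed.

Lemma germ_eq x xi a b : pder x xi -> smooth b -> dnbhs x [set y | a y = b y] ->
  xi (germ x a) = xi b.
Proof.
move=> px sb ab; have [sg ag] : smooth (germ x a) /\ dnbhs x [set y | a y = germ x a y].
  by apply: germP; exists b.
by apply: (pder_local px sg sb); apply: dnbhsS (dnbhsI gX ag ab) => y [/= <-].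
Qed.

Lemma germD x xi a b : pder x xi -> smooth_at x a -> smooth_at x b ->
  xi (germ x (fun y => a y + b y)) = xi (germ x a) + xi (germ x b).
Proof.
move=> px /germP[sa ea] /germP[sb eb]; have [p1 _ _] := px; rewrite -p1 //.
apply: germ_eq => //; first exact: smoothD.
by apply: dnbhsS (dnbhsI gX ea eb) => y [/= <- <-].
Qed.

Lemma germZ x xi c a : pder x xi -> smooth_at x a ->
  xi (germ x (fun y => c * a y)) = c * xi (germ x a).
Proof.
move=> px /germP[sa ea]; have [_ p2 _] := px; rewrite -p2 //.
apply: germ_eq => //; first exact: smoothZ.
by apply: dnbhsS ea => y /= <-.
Qed.

Lemma germM x xi a b : pder x xi -> smooth_at x a -> smooth_at x b ->
  xi (germ x (fun y => a y * b y)) = a x * xi (germ x b) + b x * xi (germ x a).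
Proof.
move=> px /germP[sa ea] /germP[sb eb]; have [_ _ p3] := px.
rewrite (dnbhs_self ea) (dnbhs_self eb) -p3 //.
apply: germ_eq => //; first exact: smoothM.
by apply: dnbhsS (dnbhsI gX ea eb) => y [/= <- <-].
Qed.

Section OpenSubspace.
Variable A : set X.
Hypothesis oA : dopen A.

Definition ext0 (a : subSpace A -> R) (x : X) : R :=
  if pselect (A x) is left Ax then a (exist _ x Ax) else 0.

Lemma ext0E (a : subSpace A -> R) (y : subSpace A) : ext0 a (sval y) = a y.
Proof.
rewrite /ext0; case: pselect => [Ax|]; last by case: y.
by congr a; exact: sval_inj.
Qed.

Lemma ext0_smooth_at (a : subSpace A -> R) (y : subSpace A) : smooth_at y a -> smooth_at (sval y : X) (ext0 a).
Proof.
move=> /(smooth_at_sub gX)[g sg ag]; exists g => //.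
apply: dnbhsS (dnbhsI gX ag (dnbhs_dopen oA (svalP y))) => z [/= E Az].
by rewrite -(E (exist _ z Az)) // -[z]/(sval (exist _ z Az)) ext0E.
Qed.

Lemma dnbhs_sub (y : subSpace A) P : dnbhs y P ->
  dnbhs (sval y : X) [set z | forall y' : subSpace A, sval y' = z -> P y'].
Proof.
move=> [N [oN Ny NP]]; have [f [sf fy fN]] := oN y Ny.
have [sg eg] := germP (ext0_smooth_at (smooth_smooth_at (@gen_closed_sub R X A) y sf)).
set g := germ _ _ in sg eg.
have gy : g (sval y) != 0 by rewrite -(dnbhs_self eg) ext0E.
have o : dopen [set z | g z != 0] by move=> z gz; exists g; split.
apply: dnbhsS (dnbhsI gX eg (dnbhs_dopen o gy)) => z [/= E gz y' y'z].
by apply/NP/fN; rewrite -ext0E y'z E.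
Qed.

(** The identification of tangent vectors of X at a point of the open set A with tangent vectors of
    A. *)
Definition res xi (y : subSpace A) (a : subSpace A -> R) : R := xi (germ (sval y) (ext0 a)).

Lemma res_pder xi (y : subSpace A) : pder (sval y : X) xi -> pder y (res xi y).
Proof.
move=> px; have sa (a : subSpace A -> R) : smooth a -> smooth_at (sval y : X) (ext0 a).
  by move=> sa; apply/ext0_smooth_at/smooth_smooth_at => //; exact: gen_closed_sub.
have eqf (a b : X -> R) : (forall z : subSpace A, a (sval z) = b (sval z)) ->
    smooth_at (sval y : X) a -> xi (germ (sval y) a) = xi (germ (sval y) b).
  move=> ab /germP[sg eg]; apply/esym/germ_eq => //.
  apply: dnbhsS (dnbhsI gX eg (dnbhs_dopen oA (svalP y))) => z [/= <- Az].
  exact/esym/(ab (exist _ z Az)).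
split=> [a b s1 s2|c a s1|a b s1 s2].
- rewrite /res -germD //; [|exact: sa..].
  apply: eqf; last by apply: sa; apply: smoothD => //; exact: gen_closed_sub.
  by move=> z; rewrite !ext0E.
- rewrite /res -germZ //; last exact: sa.
  apply: eqf; last by apply: sa; apply: smoothZ => //; exact: gen_closed_sub.
  by move=> z; rewrite !ext0E.
- rewrite /res -[in a y](ext0E a) -[in b y](ext0E b) -germM //; [|exact: sa..].
  apply: eqf; last by apply: sa; apply: smoothM => //; exact: gen_closed_sub.
  by move=> z; rewrite !ext0E.
Qed.

End OpenSubspace.
End Germs.

(** * The trivialisation of G over V *)

Section Trivialisation.
Variables (R : realType) (n : nat) (G : bLieGroup R n).
Local Notation M := (bspace G).
Local Notation H := (@bH R n G : set M).
Local Notation Hs := (subgroupSpace G).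
Local Notation B := (GmodH G).
Local Notation pi := (quot_map (@leftrel R n G)).

Lemma pi_eq (x y : M) : pi x = pi y <-> leftrel x y.
Proof.
apply: quot_map_eq.
- by move=> z; exists 1%g; [exact: bH1|rewrite mul1g].
- by move=> z w [h Hh ->]; exists h^-1%g; [exact: bHV|rewrite (lmulK h z)].
- by move=> z w u [h Hh ->] [k Hk ->]; exists (k * h)%g; [exact: bHM|rewrite mulgA].
Qed.

Lemma pi_base (x : M) : pi x = base_pt G <-> H x.
Proof.
split=> [/esym/pi_eq[h Hh ->]|Hx]; first by rewrite mulg1.
by apply/esym/pi_eq; exists x => //; rewrite mulg1.
Qed.

Lemma smooth_pi : smooth_map (pi : M -> B). Proof. by []. Qed.

Lemma gen_closed_B : gen_closed B. Proof. exact/gen_closed_quot/group_gen_closed. Qed.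

Lemma gen_closed_H : gen_closed Hs. Proof. exact: gen_closed_sub. Qed.

Definition oneH : Hs := exist _ (1%g : G) (bH1 G).

(** The trivialisation g |-> (eta g, pi g) and its inverse j as total maps between the ambient
    spaces, meaningful only over V. This avoids carrying points of subspaces through the
    computations. *)
Definition is_triv (V : set B) (eta : M -> Hs) (j : Hs -> B -> M) : Prop :=
  [/\ dopen V, V (base_pt G),
      (forall (k : Hs -> R) g, smooth k -> V (pi g) -> smooth_at g (k \o eta)) /\
      (forall f : M -> R, smooth f ->
        smooth (fun p : prodSpace Hs (subSpace V) => f (j p.1 (sval p.2)))),
      (forall g, V (pi g) -> j (eta g) (pi g) = g) /\
      (forall h v, V v -> pi (j h v) = v /\ eta (j h v) = h) &
      forall (h : Hs) g, V (pi g) -> eta (sval h * g : G)%g = mulH h (eta g)].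

Lemma trivial_is_triv V : dopen V -> V (base_pt G) -> trivial_over V ->
  exists eta j, is_triv V eta j.
Proof.
move=> oV Vb [t [st [psi [spsi tK psiK]]] [tpi teq]].
have gM := @group_gen_closed R n G.
have oU : dopen (preimV V) by apply: smooth_map_dopen oV; exact: smooth_pi.
pose eta (g : M) := if pselect (preimV V g) is left Ug then (t (exist _ g Ug)).1 else oneH.
have etaE (g : subSpace (preimV V)) : eta (sval g) = (t g).1.
  rewrite /eta; case: pselect => [Ug|]; last by case: g.
  by congr (t _).1; exact: sval_inj.
pose j (h : Hs) (v : B) : M :=
  if pselect (V v) is left Vv then sval (psi (h, exist _ v Vv)) else (1%g : G).
have jE h (v : subSpace V) : j h (sval v) = sval (psi (h, v)).
  rewrite /j; case: pselect => [Vv|]; last by case: v.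
  by congr (sval (psi (h, _))); exact: sval_inj.
exists eta, j; split=> //.
- split=> [k g sk Vg|f sf].
    pose g' : subSpace (preimV V) := exist _ g Vg.
    have s1 : smooth (fun x => k (t x).1) by exact: (st _ (smooth_fst sk)).
    have [sG eG] := germP (ext0_smooth_at gM oU
      (smooth_smooth_at (@gen_closed_sub R _ _) g' s1)).
    exists (germ g (ext0 (fun x => k (t x).1))) => //.
    apply: dnbhsS (dnbhsI gM eG (dnbhs_dopen oU Vg)) => z [/= <- Uz].
    by rewrite -[z]/(sval (exist _ z Uz)) ext0E etaE.
  have := spsi _ (smooth_sval sf).
  by apply: smooth_eq => -[h v] /=; rewrite jE.
- split=> [g Vg|h v Vv].
    pose g' : subSpace (preimV V) := exist _ g Vg.
    have E1 : eta g = (t g').1 := etaE g'.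
    have E2 : pi g = sval (t g').2 := esym (tpi g').
    by rewrite E1 E2 jE -surjective_pairing tK.
  have := jE h (exist _ v Vv); rewrite /= => ->.
  by rewrite etaE psiK -tpi psiK.
- move=> h g Vg; pose g' : subSpace (preimV V) := exist _ g Vg.
  have Vhg : V (pi (sval h * g : G)%g).
    by have <- : pi g = pi (sval h * g : G)%g by apply/pi_eq; exists (sval h) => //; case: (h).
  rewrite -[in LHS]/(sval (exist _ _ Vhg : subSpace (preimV V))) etaE.
  by rewrite (teq h g') //; congr mulH; rewrite -etaE.
Qed.

End Trivialisation.

(** * Lifting fields from H and from G/H to G *)

Section LiftedFields.
Variables (R : realType) (n : nat) (G : bLieGroup R n).
Local Notation M := (bspace G).
Local Notation H := (@bH R n G : set M).
Local Notation Hs := (subgroupSpace G).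
Local Notation B := (GmodH G).
Local Notation pi := (quot_map (@leftrel R n G)).
Variables (V : set B) (eta : M -> Hs) (j : Hs -> B -> M).
Hypothesis tr : is_triv V eta j.
Local Notation Vs := (subSpace V).
Local Notation Us := (subSpace (pi @^-1` V)).

Let gM : gen_closed M. Proof. exact: group_gen_closed. Qed.
Let gB : gen_closed B. Proof. exact: gen_closed_B. Qed.
Let gH : gen_closed Hs. Proof. exact: gen_closed_H. Qed.
Let gV : gen_closed Vs. Proof. exact: gen_closed_sub. Qed.
Let oV : dopen V. Proof. by case: tr. Qed.
Let Vb : V (base_pt G). Proof. by case: tr. Qed.
Let spi : smooth_map (pi : M -> B). Proof. exact: smooth_pi. Qed.
Let oU : dopen (pi @^-1` V : set M). Proof. exact: smooth_map_dopen spi oV. Qed.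

Lemma triv_eta_at (k : Hs -> R) g : smooth k -> V (pi g) -> smooth_at g (k \o eta).
Proof. by case: tr => _ _ [+ _] _ _; apply. Qed.

Lemma triv_jK g : V (pi g) -> j (eta g) (pi g) = g.
Proof. by case: tr => _ _ _ [+ _] _; apply. Qed.

Lemma triv_pi h v : V v -> pi (j h v) = v.
Proof. by case: tr => _ _ _ [_ H'] _ /(H' h)[]. Qed.

Lemma triv_eta h v : V v -> eta (j h v) = h.
Proof. by case: tr => _ _ _ [_ H'] _ /(H' h)[]. Qed.

Lemma triv_etaM (h : Hs) g : V (pi g) -> eta (sval h * g : G)%g = mulH h (eta g).
Proof. by case: tr => _ _ _ _; apply. Qed.

Lemma triv_smooth (f : M -> R) : smooth f ->
  smooth (fun p : prodSpace Hs Vs => f (j p.1 (sval p.2))).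
Proof. by case: tr => _ _ [_ H'] _ _; apply: H'. Qed.

Lemma smooth_triv_h v : V v -> smooth_map ((fun h => j h v) : Hs -> M).
Proof.
move=> Vv f sf; pose v' : Vs := exist _ v Vv.
have := smooth_pair gH (@smooth_id R Hs) (smooth_const_map gH v') (triv_smooth sf).
exact: smooth_eq.
Qed.

Lemma smooth_triv_v h : smooth_map ((fun v => j h (sval v)) : Vs -> M).
Proof. by move=> f sf; exact: (smooth_prod_slice gV h (triv_smooth sf)). Qed.

Lemma smooth_piV : smooth_map ((fun x => exist _ (pi (sval x)) (svalP x)) : Us -> Vs).
Proof.
apply: smooth_into_sub; first exact: gen_closed_sub.
by move=> f sf; apply: (smooth_sval (spi sf)).
Qed.

Lemma smooth_etaU : smooth_map ((fun x => eta (sval x)) : Us -> Hs).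
Proof.
move=> k sk; apply: smooth_local => [|x]; first exact: gen_closed_sub.
have := triv_eta_at sk (svalP x); apply: smooth_map_at; exact: smooth_sval.
Qed.

Lemma smooth_at_open_sub (X : diffSpace R) (A : set X) (a : X -> R) (y : subSpace A) :
  gen_closed X -> dopen A -> smooth_at y (a \o sval) -> smooth_at (sval y : X) a.
Proof.
move=> gX oA /(ext0_smooth_at gX oA); apply: smooth_at_ext => //.
apply: dnbhsS (dnbhs_dopen oA (svalP y)) => z Az.
exact: (ext0E (a \o sval) (exist _ z Az)).
Qed.

Definition cutoff (chi : B -> R) : Prop :=
  smooth chi /\ forall v, ~ V v -> dnbhs v [set w | chi w = 0].

(** D acting along the fibres of pi through the trivialisation, damped by chi to become a field on
    the whole of G. *)
Definition hlift (chi : B -> R) (D : operator Hs) : operator M :=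
  mkop (fun f g => chi (pi g) * D (fun h => f (j h (pi g))) (eta g)).

(** E acting along the sections with constant H-component. A germ is taken since such a section
    exists only over V. *)
Definition vlift (chi : B -> R) (E : operator B) : operator M :=
  mkop (fun f g => chi (pi g) *
    E (germ (pi g) (ext0 (fun v : Vs => f (j (eta g) (sval v))))) (pi g)).

Lemma pderZ (X : diffSpace R) (x : X) c xi : pder x xi -> pder x (fun f => c * xi f).
Proof.
move=> [p1 p2 p3]; split=> [f g sf sg|a f sf|f g sf sg].
- by rewrite p1 // mulrDr.
- by rewrite p2 // mulrCA.
- by rewrite p3 // mulrDr; congr (_ + _); rewrite mulrCA.
Qed.

Lemma cutoff_smooth chi (W : M -> R) : cutoff chi ->
  smooth (fun x : Us => W (sval x)) -> smooth (fun g => chi (pi g) * W g).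
Proof.
move=> [sc c0] sW; apply: (smooth_cutoff gM (W := pi @^-1` V) (spi sc)) => g Ug.
  exact: (smooth_map_dnbhs spi (c0 _ Ug)).
apply: (smooth_at_open_sub (y := exist _ g Ug : Us)) => //.
by apply: smooth_smooth_at => //; exact: gen_closed_sub.
Qed.

Lemma cutoff_pder chi g (xi : (M -> R) -> R) : cutoff chi -> (V (pi g) -> pder g xi) ->
  pder g (fun f => chi (pi g) * xi f).
Proof.
move=> [sc c0] px; have [Vg|nV] := pselect (V (pi g)); first exact/pderZ/px.
have E : chi (pi g) = 0 by exact: (dnbhs_self (c0 _ nV)).
have -> : (fun f => chi (pi g) * xi f) = (fun=> 0) by apply/funext => f; rewrite E mul0r.
exact: pder0.
Qed.

Lemma hpder g (xi : (Hs -> R) -> R) : V (pi g) -> pder (eta g) xi ->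
  pder g (fun f : M -> R => xi (fun h => f (j h (pi g)))).
Proof. by move=> Vg /(pder_push (smooth_triv_h Vg)); rewrite triv_jK. Qed.

Lemma vpder g (xi : (B -> R) -> R) : V (pi g) -> pder (pi g) xi ->
  pder g (fun f : M -> R => xi (germ (pi g) (ext0 (fun v : Vs => f (j (eta g) (sval v)))))).
Proof.
move=> Vg px; have := res_pder gB oV (y := exist _ (pi g) Vg : Vs) px.
by move=> /(pder_push (@smooth_triv_v (eta g))); rewrite /= triv_jK.
Qed.

(** The lift is tangent to the fibres of pi, and H is the fibre over the base point: a function
    vanishing on H restricts to zero there. *)
Lemma hlift_bfield chi D : cutoff chi -> is_vfield D -> is_bfield H (hlift chi D).
Proof.
move=> cc vD; split.
  apply: mkop_vfield => // [f sf|g]; last first.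
    by apply: cutoff_pder => // Vg; exact: (hpder Vg (vfield_pder (eta g) vD)).
  apply: cutoff_smooth => //.
  apply: (smooth_param_pder (X := Vs) (f := fun p => f (j p.2 (sval p.1))) gH
     (@gen_closed_sub R _ _) _ smooth_piV smooth_etaU
     (xi := fun x k => D k (eta (sval x)))).
  - have gP : gen_closed (prodSpace Vs Hs) by exact: gen_closed_prod.
    exact: (smooth_pair gP (@smooth_snd R Vs Hs) (@smooth_fst R Vs Hs) (triv_smooth sf)).
  - by move=> x; apply: vfield_pder.
  - by move=> k sk; have [_ sD _ _ _] := vD; exact: (smooth_etaU (sD _ sk)).
move=> f sf f0 g Hg; rewrite /hlift mkopE //; have /pi_base E := Hg.
have -> : (fun h => f (j h (pi g))) = fun=> 0.
  by apply/funext => h; apply/f0/pi_base; rewrite triv_pi E.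
by rewrite (pder_cst gH 0 (vfield_pder (eta g) vD)) mulr0.
Qed.

(** Restricting a function vanishing on H to a section gives a function vanishing at the base point,
    whose ideal E preserves. *)
Lemma vlift_bfield chi E : cutoff chi -> is_bfield [set base_pt G] E ->
  is_bfield H (vlift chi E).
Proof.
move=> cc bE; have [vE E0] := bE; split.
  apply: mkop_vfield => // [f sf|g]; last first.
    by apply: cutoff_pder => // Vg; exact: (vpder Vg (vfield_pder (pi g) vE)).
  apply: cutoff_smooth => //.
  apply: (smooth_param_pder (X := Hs) (f := fun p => f (j p.1 (sval p.2))) gV
     (@gen_closed_sub R _ _) _ smooth_etaU smooth_piV
     (xi := fun x a => E (germ (pi (sval x)) (ext0 a)) (pi (sval x)))).
  - exact: triv_smooth.
  - move=> x.
    exact: (res_pder gB oV (y := exist _ (pi (sval x)) (svalP x) : Vs) (vfield_pder (pi (sval x)) vE)).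
  - move=> a sa; apply: smooth_local => [|x]; first exact: gen_closed_sub.
    have gU : gen_closed Us by exact: gen_closed_sub.
    have := ext0_smooth_at gB oV (smooth_smooth_at gV (exist _ (pi (sval x)) (svalP x) : Vs) sa).
    move=> /germP[sb eb]; set b := germ _ _ in sb eb.
    have [_ sE _ _ _] := vE.
    exists (fun y => E b (pi (sval y))); first exact: (smooth_sval (spi (sE _ sb))).
    have := smooth_map_dnbhs (smooth_sval (A := pi @^-1` V)) (smooth_map_dnbhs spi (dnbhs_dnbhs eb)).
    by apply: dnbhsS => y /= H'; apply: (germ_eq gB (vfield_pder _ vE)).
move=> f sf f0 g Hg; rewrite /vlift mkopE //; have /pi_base E' := Hg.
have Vg : V (pi g) by rewrite E'.
rewrite [X in _ * X]E0 ?mulr0 //.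
- apply: (germP _).1; apply: (ext0_smooth_at gB oV (y := exist _ (pi g) Vg : Vs)).
  by apply/smooth_smooth_at/smooth_triv_v.
- move=> z ->; rewrite -E'; have sa : smooth_at (pi g : B) (ext0 (fun v : Vs => f (j (eta g) (sval v)))).
    apply: (ext0_smooth_at gB oV (y := exist _ (pi g) Vg : Vs)).
    by apply/smooth_smooth_at/smooth_triv_v.
  rewrite -(dnbhs_self (germP sa).2) (ext0E _ (exist _ (pi g) Vg : Vs)) /= triv_jK //.
  exact: f0.
Qed.

(** Over V the group is a product, so functions of [eta] and functions of [pi] generate. As k o eta
    is smooth only over V, it is represented by any global f with its germ. *)
Lemma triv_pder_eq g xi xi' : V (pi g) -> pder g xi -> pder g xi' ->
  (forall (f : M -> R) k, smooth f -> smooth k -> dnbhs g [set q | f q = k (eta q)] -> xi f = xi' f) ->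
  (forall b : B -> R, smooth b -> xi (b \o pi) = xi' (b \o pi)) ->
  forall f : M -> R, smooth f -> xi f = xi' f.
Proof.
move=> Vg px px' Heta Hpi f sf.
have [k [s [F [e [Ss CF e0 fF]]]]] := triv_smooth sf (eta g, exist _ (pi g) Vg : Vs).
have /choice[s' s'P] : forall i, exists a : M -> R, [/\ smooth a, xi a = xi' a &
    dnbhs g [set q | forall Vq : V (pi q), a q = s i (eta q, exist _ (pi q) Vq : Vs)]].
  move=> i; have [[c sc ->]|[c sc ->]] := Ss i.
    have [sa ea] := germP (triv_eta_at sc Vg); exists (germ g (c \o eta)); split=> //.
      by apply: (Heta _ c) => //; apply: dnbhsS ea => q /= <-.
    by apply: dnbhsS ea => q /= <-.
  have [b sb eb] := sub_ext gB (exist _ (pi g) Vg : Vs) sc.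
  exists (b \o pi); split; [exact: (spi sb)|exact: Hpi|].
  by apply: dnbhsS (smooth_map_dnbhs spi eb) => q /= H' Vq; rewrite (H' (exist _ (pi q) Vq : Vs)).
have ss i : smooth (s' i) by case: (s'P i).
have s3 i : dnbhs g [set q | forall Vq : V (pi q), s' i q = s i (eta q, exist _ (pi q) Vq : Vs)].
  by case: (s'P i).
have N : dnbhs g [set q | f q = F (\row_i s' i q)].
  have N1 := dnbhs_all gM s3.
  have N2 := dnbhs_cvg gM g ss e0.
  apply: dnbhsS (dnbhsI gM (dnbhsI gM N1 N2) (dnbhs_dopen oU Vg)) => q [[/= E1 E2] Vq].
  rewrite -{1}(triv_jK Vq) (fF (eta q, exist _ (pi q) Vq : Vs)) => [|i].
    by congr F; apply/rowP => i; rewrite !mxE E1.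
  by rewrite -E1 -(dnbhs_self (s3 i) Vg).
rewrite (pder_chain gM px sf ss CF N) (pder_chain gM px' sf ss CF N).
by apply: eq_bigr => i _; case: (s'P i) => _ ->.
Qed.

Lemma hlift_eta chi D f k g : is_vfield D -> smooth f -> smooth k -> V (pi g) ->
  dnbhs g [set q | f q = k (eta q)] -> hlift chi D f g = chi (pi g) * D k (eta g).
Proof.
move=> vD sf sk Vg fk; rewrite /hlift mkopE //; congr (_ * _).
apply: (vfield_local vD) => //; first exact: (smooth_triv_h Vg sf).
rewrite -(triv_jK Vg) in fk.
by apply: dnbhsS (smooth_map_dnbhs (smooth_triv_h Vg) fk) => h /= ->; rewrite triv_eta.
Qed.

Lemma hlift_pi chi D (b : B -> R) g : is_vfield D -> smooth b -> V (pi g) ->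
  hlift chi D (b \o pi) g = 0.
Proof.
move=> vD sb Vg; rewrite /hlift mkopE; last exact: (spi sb).
have -> : (fun h => (b \o pi) (j h (pi g))) = fun=> b (pi g).
  by apply/funext => h /=; rewrite triv_pi.
by rewrite (pder_cst gH _ (vfield_pder (eta g) vD)) mulr0.
Qed.

Lemma vlift_eta chi E f k g : is_vfield E -> smooth f -> smooth k -> V (pi g) ->
  dnbhs g [set q | f q = k (eta q)] -> vlift chi E f g = 0.
Proof.
move=> vE sf sk Vg fk; rewrite /vlift mkopE // (germ_eq gB (vfield_pder _ vE) (b := fun=> k (eta g))).
- by rewrite (pder_cst gB _ (vfield_pder (pi g) vE)) mulr0.
- exact: smooth_cst.
rewrite -{1}(triv_jK Vg) in fk.
have := smooth_map_dnbhs (x := exist _ (pi g) Vg : Vs) (@smooth_triv_v (eta g)) fk.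
move=> /(dnbhs_sub gB oV) N; apply: dnbhsS (dnbhsI gB N (dnbhs_dopen oV Vg)) => v [/= E1 Vv].
rewrite (ext0E _ (exist _ v Vv : Vs)) /= (E1 (exist _ v Vv : Vs)) //=.
by rewrite triv_eta.
Qed.

Lemma vlift_pi chi E (b : B -> R) g : is_vfield E -> smooth b -> V (pi g) ->
  vlift chi E (b \o pi) g = chi (pi g) * E b (pi g).
Proof.
move=> vE sb Vg; rewrite /vlift mkopE; last exact: (spi sb).
congr (_ * _); apply: (germ_eq gB (vfield_pder _ vE)) => //.
apply: dnbhsS (dnbhs_dopen oV Vg) => v Vv.
by rewrite /= (ext0E _ (exist _ v Vv : Vs)) /= triv_pi.
Qed.

(** The comparison on the two kinds of functions has to hold on a neighbourhood, since only then do
    the fields agree in the fibre of the b-tangent bundle. *)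
Lemma bpair_triv_eq (e : bcot H) T T' : V (pi (bproj e)) -> is_bfield H T -> is_bfield H T' ->
  dnbhs (bproj e) [set g | (forall (f : M -> R) k, smooth f -> smooth k ->
      dnbhs g [set q | f q = k (eta q)] -> T f g = T' f g) /\
    forall b : B -> R, smooth b -> T (b \o pi) g = T' (b \o pi) g] ->
  bpair e T = bpair e T'.
Proof.
move=> Ve bT bT' N; apply: bpair_eq_local => //.
apply: dnbhsS (dnbhsI gM N (dnbhs_dopen oU Ve)) => g [[/= H1 H2] Vg] f sf.
exact: (triv_pder_eq Vg (vfield_pder g bT.1) (vfield_pder g bT'.1)).
Qed.

Let one_near (chi : B -> R) (e : bcot H) : dnbhs (pi (bproj e)) [set v | chi v = 1] -> V (pi (bproj e)) ->
  dnbhs (bproj e) [set g | [/\ V (pi g), chi (pi g) = 1 & dnbhs g [set q | chi (pi q) = 1]]].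
Proof.
move=> c1 Ve; have N := smooth_map_dnbhs spi c1.
apply: dnbhsS (dnbhsI gM (dnbhs_dopen oU Ve) (dnbhs_dnbhs N)) => g [Vg Ng].
by split=> //; exact: (dnbhs_self Ng).
Qed.

Section Brackets.
Variables (chi : B -> R) (e : bcot H).
Hypotheses (cc : cutoff chi) (c1 : dnbhs (pi (bproj e)) [set v | chi v = 1])
  (Ve : V (pi (bproj e))).

Let N1 := one_near c1 Ve.

Let hl_eta D f k g : is_vfield D -> smooth f -> smooth k -> V (pi g) ->
  dnbhs g [set q | chi (pi q) = 1] -> dnbhs g [set q | f q = k (eta q)] ->
  dnbhs g [set q | hlift chi D f q = D k (eta q)].
Proof.
move=> vD sf sk Vg c fk.
apply: dnbhsS (dnbhsI gM (dnbhsI gM (dnbhs_dopen oU Vg) c) (dnbhs_dnbhs fk)).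
by move=> q [[/= Vq cq] fq]; rewrite (hlift_eta _ vD sf sk Vq fq) cq mul1r.
Qed.

Lemma bpair_hlift_chi (chi' : B -> R) D : cutoff chi' -> dnbhs (pi (bproj e)) [set v | chi' v = 1] ->
  is_vfield D -> bpair e (hlift chi D) = bpair e (hlift chi' D).
Proof.
move=> cc' c1' vD; apply: bpair_triv_eq => //; try exact: hlift_bfield.
apply: dnbhsS (dnbhsI gM N1 (one_near c1' Ve)) => g [[Vg c _] [_ c' _]].
split=> [f k sf sk fk|b sb]; last by rewrite !hlift_pi.
by rewrite !(hlift_eta _ vD sf sk Vg fk) c c'.
Qed.

Lemma bpair_vlift_chi (chi' : B -> R) E : cutoff chi' -> dnbhs (pi (bproj e)) [set v | chi' v = 1] ->
  is_bfield [set base_pt G] E -> bpair e (vlift chi E) = bpair e (vlift chi' E).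
Proof.
move=> cc' c1' bE; have vE := bE.1; apply: bpair_triv_eq => //; try exact: vlift_bfield.
apply: dnbhsS (dnbhsI gM N1 (one_near c1' Ve)) => g [[Vg c _] [_ c' _]].
split=> [f k sf sk fk|b sb]; last by rewrite !vlift_pi // c c'.
by rewrite !(vlift_eta _ vE sf sk Vg fk).
Qed.

Lemma bpair_hlift_lie D D' : is_vfield D -> is_vfield D' ->
  bpair e (lie_br (hlift chi D) (hlift chi D')) = bpair e (hlift chi (lie_br D D')).
Proof.
move=> vD vD'; have vDD := vfield_lie gH vD vD'.
have bD := hlift_bfield cc vD; have bD' := hlift_bfield cc vD'.
have [_ sD _ _ _] := vD; have [_ sD' _ _ _] := vD'.
have [[_ sT _ _ _] _] := bD; have [[_ sT' _ _ _] _] := bD'.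
apply: bpair_triv_eq => //; [exact: bfield_lie|exact: hlift_bfield|].
apply: dnbhsS N1 => g [Vg c cn]; split=> [f k sf sk fk|b sb].
  rewrite (hlift_eta _ vDD sf sk Vg fk) c mul1r /lie_br.
  rewrite (hlift_eta _ vD (sT' _ sf) (sD' _ sk) Vg); last exact: hl_eta.
  rewrite (hlift_eta _ vD' (sT _ sf) (sD _ sk) Vg); last exact: hl_eta.
  by rewrite c !mul1r.
rewrite hlift_pi // /lie_br.
have z D0 (vD0 : is_vfield D0) : dnbhs g [set q | hlift chi D0 (b \o pi) q = 0].
  apply: dnbhsS (dnbhs_dopen oU Vg) => q Vq; exact: (hlift_pi _ vD0 sb Vq).
have sb' := spi sb.
rewrite (vfield_local bD.1 (sT' _ sb') (smooth_cst gM 0) (z _ vD')).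
rewrite (vfield_local bD'.1 (sT _ sb') (smooth_cst gM 0) (z _ vD)).
by rewrite !(pder_cst gM 0 (vfield_pder g _)) ?subr0 //; [exact: bD'.1|exact: bD.1].
Qed.

(** Where chi is 1, the first lift kills functions of [pi] and the second kills functions of [eta],
    while each preserves the kind on which it acts; hence the two commute near the point. *)
Lemma bpair_hv_lie D E : is_vfield D -> is_bfield [set base_pt G] E ->
  bpair e (lie_br (hlift chi D) (vlift chi E)) = 0.
Proof.
move=> vD bE; have vE := bE.1; have [_ sD _ _ _] := vD; have [_ sE _ _ _] := vE.
have bT := hlift_bfield cc vD; have bS := vlift_bfield cc bE.
have [[_ sT _ _ _] _] := bT; have [[_ sS _ _ _] _] := bS.
rewrite -[RHS](bpair0 gM e).
apply: bpair_triv_eq => //; [exact: bfield_lie|exact: bfield0|].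
apply: dnbhsS N1 => g [Vg c cn]; split=> [f k sf sk fk|b sb]; rewrite /lie_br.
  rewrite [X in _ - X](vlift_eta _ vE (sT _ sf) (sD _ sk) Vg) ?subr0; last exact: hl_eta.
  have z : dnbhs g [set q | vlift chi E f q = 0].
    apply: dnbhsS (dnbhsI gM (dnbhs_dopen oU Vg) (dnbhs_dnbhs fk)) => q [Vq fq].
    exact: (vlift_eta _ vE sf sk Vq fq).
  by rewrite (vfield_local bT.1 (sS _ sf) (smooth_cst gM 0) z) (pder_cst gM 0 (vfield_pder g bT.1)).
have sb' := spi sb.
have z : dnbhs g [set q | hlift chi D (b \o pi) q = 0].
  apply: dnbhsS (dnbhs_dopen oU Vg) => q Vq; exact: (hlift_pi _ vD sb Vq).
have z' : dnbhs g [set q | vlift chi E (b \o pi) q = (E b \o pi) q].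
  apply: dnbhsS (dnbhsI gM (dnbhs_dopen oU Vg) cn) => q [Vq /= cq].
  by rewrite vlift_pi // cq mul1r.
rewrite (vfield_local bS.1 (sT _ sb') (smooth_cst gM 0) z) (pder_cst gM 0 (vfield_pder g bS.1)) subr0.
by rewrite (vfield_local bT.1 (sS _ sb') (spi (sE _ sb)) z') hlift_pi //; exact: sE.
Qed.

Lemma bpair_vlift_lie E E' : is_bfield [set base_pt G] E -> is_bfield [set base_pt G] E' ->
  bpair e (lie_br (vlift chi E) (vlift chi E')) = bpair e (vlift chi (lie_br E E')).
Proof.
move=> bE bE'; have bEE := bfield_lie gB bE bE'; have vE := bE.1; have vE' := bE'.1.
have [_ sE _ _ _] := vE; have [_ sE' _ _ _] := vE'.
have bT := vlift_bfield cc bE; have bT' := vlift_bfield cc bE'.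
have [[_ sT _ _ _] _] := bT; have [[_ sT' _ _ _] _] := bT'.
apply: bpair_triv_eq => //; [exact: bfield_lie|exact: vlift_bfield|].
apply: dnbhsS N1 => g [Vg c cn]; split=> [f k sf sk fk|b sb].
  rewrite (vlift_eta _ bEE.1 sf sk Vg fk) /lie_br.
  have z E0 (vE0 : is_vfield E0) : dnbhs g [set q | vlift chi E0 f q = 0].
    apply: dnbhsS (dnbhsI gM (dnbhs_dopen oU Vg) (dnbhs_dnbhs fk)) => q [Vq fq].
    exact: (vlift_eta _ vE0 sf sk Vq fq).
  rewrite (vfield_local bT.1 (sT' _ sf) (smooth_cst gM 0) (z _ vE')).
  rewrite (vfield_local bT'.1 (sT _ sf) (smooth_cst gM 0) (z _ vE)).
  by rewrite (pder_cst gM 0 (vfield_pder g bT.1)) (pder_cst gM 0 (vfield_pder g bT'.1)) subr0.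
have sb' := spi sb.
have z E0 (vE0 : is_vfield E0) : dnbhs g [set q | vlift chi E0 (b \o pi) q = (E0 b \o pi) q].
  apply: dnbhsS (dnbhsI gM (dnbhs_dopen oU Vg) cn) => q [Vq /= cq].
  by rewrite vlift_pi // cq mul1r.
rewrite vlift_pi //; last exact: bEE.1.
rewrite /lie_br (vfield_local bT.1 (sT' _ sb') (spi (sE' _ sb)) (z _ vE')).
rewrite (vfield_local bT'.1 (sT _ sb') (spi (sE _ sb)) (z _ vE)).
by rewrite (vlift_pi _ vE (sE' _ sb) Vg) (vlift_pi _ vE' (sE _ sb) Vg) c !mul1r.
Qed.

End Brackets.
End LiftedFields.

(** * Linear algebra: kernels of dimension one *)

Section RankOne.
Variable F : fieldType.

Lemma rank_le1_minors r m (D D' : 'rV[F]_r) (A : 'M[F]_(r, m)) a c : (r <= 1)%N ->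
  (D *m A) 0 a * (D' *m A) 0 c = (D *m A) 0 c * (D' *m A) 0 a.
Proof.
case: r D D' A => [|[|//]] D D' A _; rewrite !mxE ?big_ord0 ?mul0r //.
by rewrite !big_ord1 -!mulrA; congr (_ * _); rewrite mulrCA [RHS]mulrCA; congr (_ * _); rewrite mulrC.
Qed.

(** The left inverse C forces Q to have rank m, so the left kernel is a line and any two of its
    vectors are proportional. *)
Lemma kernel_minors m (Q : 'M[F]_(m.+1, m)) (C : 'M[F]_(m, m.+1)) (p p' : 'rV[F]_m.+1) a c :
  C *m Q = 1%:M -> p *m Q = 0 -> p' *m Q = 0 -> p 0 a * p' 0 c = p 0 c * p' 0 a.
Proof.
move=> CQ pQ p'Q.
have rQ : \rank Q = m.
  apply/eqP; rewrite eqn_leq rank_leq_col -{1}(mxrank1 F m) -CQ.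
  exact: mxrankM_maxr.
have rk : \rank (kermx Q) = 1%N by rewrite mxrank_ker rQ subSnn.
have /submxP[D ->] : (p <= row_base (kermx Q))%MS by rewrite eq_row_base; apply/sub_kermxP.
have /submxP[D' ->] : (p' <= row_base (kermx Q))%MS by rewrite eq_row_base; apply/sub_kermxP.
by apply: rank_le1_minors; rewrite rk.
Qed.

Lemma left_kernel m (A : 'M[F]_(m.+1, m)) : exists2 w : 'rV[F]_m.+1, w != 0 & w *m A = 0.
Proof.
have /rowV0Pn[w wA w0] : kermx A != 0.
  by rewrite kermx_eq0 /row_free neq_ltn ltnS rank_leq_col.
by exists w => //; apply/sub_kermxP.
Qed.

End RankOne.

(** * Charts of hypersurfaces and transport of charts *)

Section Submanifold.
Variable R : realType.

Lemma hyper_nchart n (X : diffSpace R) (Z N : set X) (y : 'I_n.+1 -> X -> R) :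
  gen_closed X -> nchart N y -> (forall q, N q -> (Z q <-> y ord0 q = 0)) ->
  nchart (sval @^-1` N : set (subSpace Z))
    (fun i (q : subSpace Z) => y (lift ord0 i) (sval q)).
Proof.
move=> gX nc ZN; have [oN sy inj oi fy] := nc.
pose z i (q : subSpace Z) := y (lift ord0 i) (sval q).
pose e_ i (u : 'rV[R]_n) : R := if unlift ord0 i is Some k then u 0 k else 0.
(* The inclusion of the hypersurface in coordinates: a zero is inserted in position 0. *)
pose emb (u : 'rV[R]_n) : 'rV[R]_n.+1 := \row_i e_ i u.
have embE (q : subSpace Z) : N (sval q) -> emb (crd z q) = crd y (sval q).
  move=> Nq; apply/rowP => i; rewrite !mxE /e_; case: unliftP => [k ->|->]; first by rewrite mxE.
  by apply/esym/(ZN _ Nq); exact: (svalP q).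
have embI u v : emb u = emb v -> u = v.
  move=> E; apply/rowP => k; have /rowP/(_ (lift ord0 k)) := E.
  by rewrite !mxE /e_ liftK.
have cubeE u v d : 0 < d -> cube u d v -> cube (emb u) d (emb v).
  move=> d0 uv i; rewrite !mxE /e_; case: unlift => [k|]; last by rewrite subrr normr0.
  exact: uv.
have ZE q u : N q -> crd y q = emb u -> exists2 q' : subSpace Z, sval q' = q & crd z q' = u.
  move=> Nq E; have Zq : Z q.
    by apply/(ZN _ Nq); have /rowP/(_ ord0) := E; rewrite !mxE /e_ unlift_none.
  exists (exist _ q Zq) => //; apply: embI; rewrite embE //.
have imE : crd z @` (sval @^-1` N) = emb @^-1` (crd y @` N).
  apply/seteqP; split=> u /=.
    by move=> [q Nq <-]; exists (sval q) => //; rewrite embE.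
  by move=> [q Nq /(ZE _ _ Nq)[q' qq <-]]; exists q' => //; rewrite /preimage /= qq.
have oim : open (emb @^-1` (crd y @` N)).
  apply/open_cubeP => u /=; move/open_cubeP: oi => oi /oi[d d0 Hd].
  by exists d => // v uv; apply/Hd/cubeE.
have Ce i W : open W -> Cinf W (e_ i).
  move=> oW; rewrite /e_; case: (unlift ord0 i) => [k|]; last exact: Cinf_cst.
  exact: Cinf_coord.
have injz p q : N (sval p) -> N (sval q) -> crd z p = crd z q -> p = q.
  by move=> Np Nq E; apply/sval_inj/inj => //; rewrite -!embE // E.
split=> //.
- exact: (smooth_map_dopen (@smooth_sval R X Z) oN).
- by move=> i; exact: (smooth_sval (sy _)).
- by rewrite imE.
move=> f sf; pose F := loc (sval @^-1` N : set (subSpace Z)) z f.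
have FE q : N (sval q) -> F (crd z q) = f q.
  move=> Nq; rewrite /F /loc; case: pselect => [H'|H']; last by case: H'; exists q.
  by case: (cid H') => q' [/= Nq' E]; congr f; apply: injz.
exists F; last by move=> q Nq; rewrite FE.
rewrite imE; apply: Cinf_local => // u; rewrite /= => -[q Nq /(ZE _ _ Nq)[q' qq qu]].
have [g sg eg] := sub_ext gX q' sf; rewrite qq in eg.
have [d d0 Hd] := chart_dnbhs nc Nq eg.
have Hd' v : cube u d v -> exists q2, [/\ N q2, crd y q2 = emb v &
    forall q3 : subSpace Z, sval q3 = q2 -> f q3 = g q2].
  move=> uv; apply: Hd; rewrite -qq -embE ?qu; last by rewrite qq.
  exact: cubeE.
exists (cube u d), (fun v => loc N y g (emb v)); split.
- exact: open_cube.
- exact: cube_center.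
- apply: (@Cinf_comp _ _ _ _ (crd y @` N)) => //.
  + exact: open_cube.
  + by move=> v /Hd'[q2 [Nq2 E _]]; exists q2.
  + exact: Cinf_loc_smooth.
  + by move=> i; apply/Ce/open_cube.
- move=> v /Hd'[q2 [Nq2 E H2]]; have [q3 q32 q3v] := ZE _ _ Nq2 E.
  by rewrite -E (loc_crd nc) // -(H2 q3) // -q3v FE // q32.
Qed.

Lemma nchart_transport m (X : diffSpace R) (W : set X) (x : 'I_m -> X -> R) (phi psi : X -> X) :
  smooth_map phi -> smooth_map psi -> cancel phi psi -> cancel psi phi ->
  nchart W x -> nchart (phi @^-1` W) (fun i => x i \o phi).
Proof.
move=> sphi spsi phiK psiK [oW sx inj oi fx].
have E q : crd (fun i => x i \o phi) q = crd x (phi q) by apply/rowP => i; rewrite !mxE.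
have imE : crd (fun i => x i \o phi) @` (phi @^-1` W) = crd x @` W.
  apply/seteqP; split=> u /= [q Wq <-]; first by exists (phi q).
  by exists (psi q); rewrite /preimage /= ?E psiK.
split=> //.
- exact: (smooth_map_dopen sphi).
- by move=> i; exact: (sphi _ (sx i)).
- by move=> p q Wp Wq; rewrite !E => /(inj _ _ Wp Wq)/(can_inj phiK).
- by rewrite imE.
move=> f sf; have [F CF fF] := fx _ (spsi _ sf); exists F; first by rewrite imE.
by move=> q Wq; rewrite E -fF //= phiK.
Qed.

Lemma pder_linear_sum (X : diffSpace R) (x : X) m (w : 'I_m -> R) (xi : 'I_m -> (X -> R) -> R) :
  (forall i, pder x (xi i)) -> pder x (fun f => \sum_i w i * xi i f).
Proof.
move=> px; split=> [f g sf sg|c f sf|f g sf sg].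
- rewrite -big_split /=; apply: eq_bigr => i _; have [p1 _ _] := px i.
  by rewrite p1 // mulrDr.
- rewrite mulr_sumr; apply: eq_bigr => i _; have [_ p2 _] := px i.
  by rewrite p2 // mulrCA.
- rewrite !mulr_sumr -big_split /=; apply: eq_bigr => i _; have [_ _ p3] := px i.
  by rewrite p3 // mulrDr; congr (_ + _); rewrite mulrCA.
Qed.

End Submanifold.

(** * Functions on G/H: separation of points, rank and dependence of differentials *)

Section OrbitSpace.
Variables (R : realType) (n : nat) (G : bLieGroup R n).
Local Notation M := (bspace G).
Local Notation Hs := (subgroupSpace G).
Local Notation B := (GmodH G).
Local Notation pi := (quot_map (@leftrel R n G)).

Let gM : gen_closed M. Proof. exact: group_gen_closed. Qed.
Let gB : gen_closed B. Proof. exact: gen_closed_B. Qed.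
Let gH : gen_closed Hs. Proof. exact: gen_closed_H. Qed.
Let spi : smooth_map (pi : M -> B). Proof. exact: smooth_pi. Qed.

Lemma subgroup_nchart : exists (N : set Hs) (z : 'I_n -> Hs -> R), nchart N z /\ N (oneH G).
Proof.
have [[_ _ _ _] _ hyp _] := bgroup_bmanifold G.
have [W [x [cx W1 Zx]]] := hyp _ (bH1 G).
have [N [y [nc N1 NW yx]]] := is_chart_nchart gM cx W1.
have nz : nchart (sval @^-1` N : set Hs) (fun i (q : Hs) => y (lift ord0 i) (sval q)).
  apply: hyper_nchart => // q Nq; have -> : y ord0 q = x q 0 0 by rewrite -yx // mxE.
  by apply: Zx; apply: NW.
by eexists; eexists; split; [exact: nz|].
Qed.

(** Right translations commute with the left action of H and descend to G/H; they move the base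
    point to any other point. *)
Definition rtrans (g : G) (v : B) : B := pi (projT1 (cid (@quot_map_surj R M (@leftrel R n G) v)) * g : G)%g.

Lemma rtransE g (x : M) : rtrans g (pi x) = pi (x * g : G)%g.
Proof.
rewrite /rtrans; case: cid => y /= /pi_eq[h Hh ->].
by apply/pi_eq; exists h => //; rewrite mulgA.
Qed.

Lemma smooth_rtrans g : smooth_map (rtrans g).
Proof.
move=> f sf; suff: @smooth R M (f \o rtrans g \o pi) by [].
by apply: smooth_eq (smooth_rmul g (spi sf)) => x; rewrite /= -rtransE.
Qed.

Lemma rtransK g : cancel (rtrans g) (rtrans g^-1).
Proof.
by move=> v; have [x <-] := quot_map_surj v; rewrite !rtransE -mulgA mulgV mulg1.
Qed.

Variables (V : set B) (eta : M -> Hs) (j : Hs -> B -> M).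
Hypothesis tr : is_triv V eta j.
Local Notation Vs := (subSpace V).
Let oV : dopen V. Proof. by case: tr. Qed.
Let oU : dopen (pi @^-1` V : set M). Proof. exact: smooth_map_dopen spi oV. Qed.

Lemma dnbhs_eta g P : V (pi g) -> dnbhs (eta g) P -> dnbhs g [set q : M | P (eta q)].
Proof.
move=> Vg dP; pose g' : subSpace (pi @^-1` V) := exist _ g Vg.
have := dnbhs_sub gM oU (smooth_map_dnbhs (x := g') (smooth_etaU tr) dP).
move=> N; apply: dnbhsS (dnbhsI gM N (dnbhs_dopen oU Vg)) => q [/= E Vq].
exact: (E (exist _ q Vq)).
Qed.

Lemma eta_pder g xi : V (pi g) -> pder g xi ->
  pder (eta g) (fun k : Hs -> R => xi (germ g (k \o eta))).
Proof.
move=> Vg px; split=> [a b sa sb|c a sa|a b sa sb].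
- by rewrite -germD //; exact: (triv_eta_at tr).
- by rewrite -germZ //; exact: (triv_eta_at tr).
- by rewrite -[a (eta g)]/((a \o eta) g) -[b (eta g)]/((b \o eta) g) -germM //; exact: (triv_eta_at tr).
Qed.

Lemma section_at (f : M -> R) h v : smooth f -> V v -> smooth_at v (fun v => f (j h v)).
Proof.
move=> sf Vv; apply: (smooth_at_open_sub (y := exist _ v Vv : Vs)) => //.
apply: smooth_smooth_at; first exact: gen_closed_sub.
exact: (@smooth_triv_v _ _ _ _ _ _ tr h f sf).
Qed.

Lemma cutoff_section chi (f : M -> R) h : cutoff V chi -> smooth f ->
  smooth (fun v => chi v * f (j h v)).
Proof.
move=> [sc c0] sf; apply: (smooth_cutoff gB (W := V)) => // v Vv; exact: section_at.
Qed.

(** Functions separating points of G, restricted to the section through 1 and cut off, become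
    functions on G/H. Applying the hypothesis to the cutoff itself shows that it is 1 at both
    points. *)
Lemma orbit_separated v v' : V v -> V v' -> (forall f : B -> R, smooth f -> f v = f v') -> v = v'.
Proof.
move=> Vv Vv' E; have [chi [sc /dnbhs_self c1 c0]] := bump gB oV Vv.
have c1' : chi v' = 1 by rewrite -E.
have [[_ sep _ _] _ _ _] := bgroup_bmanifold G.
have [jj|/sep[f sf]] := pselect (j (oneH G) v = j (oneH G) v').
  by rewrite -(triv_pi tr (oneH G) Vv) jj (triv_pi tr).
have := E _ (cutoff_section (oneH G) (conj sc c0) sf).
by rewrite c1 c1' !mul1r => ->; rewrite eqxx.
Qed.

Section Dependence.
Variables (N : set Hs) (z : 'I_n -> Hs -> R) (W : set M) (x : 'I_n.+1 -> M -> R).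
Hypotheses (nz : nchart N z) (nx : nchart W x).

(** Otherwise every function from the base has zero differential at g. Among n + 1 directions some
    non-zero vector kills the n functions z_l o eta; it then kills both kinds of generators, hence
    all functions, including the coordinates. *)
Lemma base_submersion g : W g -> V (pi g) -> N (eta g) ->
  exists (b : B -> R) i, smooth b /\ cder W x i (b \o pi) g != 0.
Proof.
move=> Wg Vg Ng; apply: contrapT => /forallNP Hn.
have H0 (b : B -> R) i : smooth b -> cder W x i (b \o pi) g = 0.
  by move=> sb; have /forallNP/(_ i) := Hn b => H'; apply/eqP/negP => /negP ?; apply: H'.
have [_ sz _ _ _] := nz; have [_ sx _ _ _] := nx.
have [w w0 wA] := left_kernel
  (\matrix_(i < n.+1, l < n) cder W x i (germ g (z l \o eta)) g).
pose xi (f : M -> R) := \sum_i w 0 i * cder W x i f g.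
have px : pder g xi by apply: pder_linear_sum => i; exact: (cder_pder gM nx).
have xz l : xi (germ g (z l \o eta)) = 0.
  have /rowP/(_ l) := wA; rewrite !mxE => <-.
  by apply: eq_bigr => i _; rewrite mxE.
have xH (k : Hs -> R) : smooth k -> xi (germ g (k \o eta)) = 0.
  move=> sk; rewrite (pder_cder gH nz Ng (eta_pder Vg px) sk).
  by rewrite big1 // => l _; rewrite xz mulr0.
have x0 (f : M -> R) : smooth f -> xi f = 0.
  move=> sf; apply: (triv_pder_eq tr Vg px (pder0 g)) => // [f' k sf' sk fk|b sb].
    rewrite -(xH k) //; apply/esym/(germ_eq gM px) => //.
    by apply: dnbhsS fk => q /= ->.
  by rewrite /xi big1 // => i _; rewrite H0 // mulr0.
case/eqP: w0; apply/rowP => i; rewrite mxE -(x0 (x i)) // /xi (bigD1 i) //= big1 => [|i' ii'].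
  by rewrite (cder_coord nx) // eqxx mulr1 addr0.
by rewrite (cder_coord nx) // eq_sym (negbTE ii') mulr0.
Qed.

(** The n vectors [ze l] along the fibre are dual to the functions z_l o eta, so Q has a left
    inverse. They kill functions from the base, whose differentials therefore lie in a
    one-dimensional kernel. *)
Lemma base_dependence g (b b' : B -> R) a c : W g -> V (pi g) -> N (eta g) -> smooth b -> smooth b' ->
  cder W x a (b \o pi) g * cder W x c (b' \o pi) g =
  cder W x c (b \o pi) g * cder W x a (b' \o pi) g.
Proof.
move=> Wg Vg Ng sb sb'; have [_ sz _ _ _] := nz; have [_ sx _ _ _] := nx.
pose ze l (f : M -> R) := cder N z l (fun h => f (j h (pi g))) (eta g).
have pz l : pder g (ze l) by exact: (hpder tr Vg (cder_pder gH nz l Ng)).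
have zb l (b0 : B -> R) : ze l (b0 \o pi) = 0.
  rewrite /ze; have -> : (fun h => (b0 \o pi) (j h (pi g))) = fun=> b0 (pi g).
    by apply/funext => h /=; rewrite (triv_pi tr).
  exact: (pder_cst gH _ (cder_pder gH nz l Ng)).
have zz l m : ze l (germ g (z m \o eta)) = (m == l)%:R.
  have [sg eg] := germP (triv_eta_at tr (sz m) Vg).
  rewrite -(cder_coord nz l m Ng) /ze; apply: (pder_local (cder_pder gH nz l Ng) _ (sz m)).
    exact: (smooth_triv_h tr Vg sg).
  rewrite -{1}(triv_jK tr Vg) in eg.
  by apply: dnbhsS (smooth_map_dnbhs (smooth_triv_h tr Vg) eg) => h /= <-; rewrite (triv_eta tr).
pose row0 (b0 : B -> R) := \row_i cder W x i (b0 \o pi) g.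
pose Q := \matrix_(i < n.+1, l < n) ze l (x i).
pose C := \matrix_(m < n, i < n.+1) cder W x i (germ g (z m \o eta)) g.
have CQ : C *m Q = 1%:M.
  apply/matrixP => m l; rewrite !mxE -zz.
  rewrite (pder_cder gM nx Wg (pz l)); last by apply: (germP _).1; exact: (triv_eta_at tr).
  by apply: eq_bigr => i _; rewrite !mxE.
have rQ (b0 : B -> R) : smooth b0 -> row0 b0 *m Q = 0.
  move=> s0; apply/rowP => l; rewrite !mxE.
  transitivity (ze l (b0 \o pi)); last exact: zb.
  rewrite (pder_cder gM nx Wg (pz l) (spi s0)); by apply: eq_bigr => i _; rewrite !mxE.
by have := kernel_minors a c CQ (rQ b sb) (rQ b' sb'); rewrite !mxE.
Qed.

End Dependence.
End OrbitSpace.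

(** * G/H as a one-dimensional b-manifold *)

Section OrbitChart.
Variables (R : realType) (n : nat) (G : bLieGroup R n).
Local Notation M := (bspace G).
Local Notation Hs := (subgroupSpace G).
Local Notation B := (GmodH G).
Local Notation pi := (quot_map (@leftrel R n G)).
Variables (V : set B) (eta : M -> Hs) (j : Hs -> B -> M).
Hypothesis tr : is_triv V eta j.
Local Notation Vs := (subSpace V).

Let gM : gen_closed M. Proof. exact: group_gen_closed. Qed.
Let gB : gen_closed B. Proof. exact: gen_closed_B. Qed.
Let spi : smooth_map (pi : M -> B). Proof. exact: smooth_pi. Qed.
Let oV : dopen V. Proof. by case: tr. Qed.
Let Vb : V (base_pt G). Proof. by case: tr. Qed.
Let oU : dopen (pi @^-1` V : set M). Proof. exact: smooth_map_dopen spi oV. Qed.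

(** The section through a point of N stays in N over a neighbourhood of its projection. *)
Lemma pi_open (N : set M) : dopen N -> N `<=` pi @^-1` V -> dopen (pi @` N).
Proof.
move=> oN NV; apply: dopen_dnbhs => _ [q Nq <-]; have Vq : V (pi q) := NV _ Nq.
have dN : dnbhs (j (eta q) (pi q)) N by rewrite (triv_jK tr Vq); exact: dnbhs_dopen.
have := smooth_map_dnbhs (x := exist _ (pi q) Vq : Vs) (@smooth_triv_v _ _ _ _ _ _ tr (eta q)) dN.
move=> /(dnbhs_sub gB oV) K; apply: dnbhsS (dnbhsI gB K (dnbhs_dopen oV Vq)) => v [/= E Vv].
exists (j (eta q) v); last by rewrite (triv_pi tr).
exact: (E (exist _ v Vv)).
Qed.

(** By functional dependence every function from the base is, near [g0], a function of y alone,
    namely its restriction to the curve c. Since functions separate orbits over V, y is injective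
    there. *)
Lemma base_chart : exists (W : set B) (y : B -> R),
  [/\ nchart W (fun _ : 'I_1 => y), W (base_pt G) & y (base_pt G) = 0].
Proof.
have [N [z [nz N1]]] := subgroup_nchart G; have [oN _ _ _ _] := nz.
pose g0 : M := j (oneH G) (base_pt G).
have pg0 : pi g0 = base_pt G by rewrite (triv_pi tr).
have eg0 : eta g0 = oneH G by rewrite (triv_eta tr).
have Vg0 : V (pi g0) by rewrite pg0.
have [_ /(_ g0)[W0 [x [b0 [[nx0 _] Wg0]]]]] := bmanifold_bmfd_group G.
have oW0 : dopen W0 by case: nx0.
have dN : dnbhs g0 [set q | N (eta q)].
  by apply: (dnbhs_eta tr Vg0); rewrite eg0; exact: dnbhs_dopen.
have [W [oW Wg WP]] := dnbhsI gM (dnbhs_dopen oW0 Wg0) (dnbhsI gM dN (dnbhs_dopen oU Vg0)).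
have nx : nchart W x by apply: nchart_sub nx0 oW _ => q /WP[].
have WV q : W q -> V (pi q) by move=> /WP[_ []].
have WN q : W q -> N (eta q) by move=> /WP[_ []].
have [b [i [sb ne]]] := base_submersion tr nz nx Wg Vg0 (WN _ Wg).
set ka := cder W x i (b \o pi) g0 in ne.
(* Normalised to vanish at the base point and to have derivative 1 in direction i, as the dependence
   theorem requires. *)
pose y (v : B) := ka^-1 * (b v + - b (base_pt G)).
have sy : smooth y by apply/smoothZ/smoothD => //; exact: smooth_cst.
have y0 : y (base_pt G) = 0 by rewrite /y subrr mulr0.
have [_ sx _ oi _] := nx; set O := crd x @` W in oi.
pose Y := loc W x (y \o pi).
pose a := crd x g0.
have Oa : O a by exists g0.
have YE q : W q -> Y (crd x q) = y (pi q) by move=> Wq; rewrite /Y (loc_crd nx).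
have Ya : Y a = 0 by rewrite YE // pg0.
have dY : partial i Y a = 1.
  rewrite -[LHS]/(cder W x i (y \o pi) g0).
  have [p1 p2 _] := cder_pder gM nx i Wg.
  have -> : y \o pi = fun q => ka^-1 * ((b \o pi) q + (fun=> - b (base_pt G)) q) by [].
  rewrite p2; last by apply: smoothD => //; exact: smooth_cst.
  rewrite p1; [|exact: (spi sb)|exact: smooth_cst].
  by rewrite (pder_cst gM _ (cder_pder gM nx i Wg)) addr0 mulVf.
have CY : Cinf O Y by apply: Cinf_loc_smooth => //; exact: (spi sy).
have [c [d [r [d0 r0 ct cc [Hd HF]]]]] := functional_dependence oi CY Oa dY.
have [r1 r10 Hr1] := cc d d0.
(* Within r the curve is defined and stays in the chart, within [r1] it stays in the cube of
   half-width d; so y takes every value in the interval of radius [r2]. *)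
pose r2 := Num.min r r1; have r20 : 0 < r2 by rewrite lt_min r0.
have dep (f : B -> R) : smooth f ->
   Cinf [set u : 'rV[R]_1 | `|u 0 0 - Y a| < r] (fun u => loc W x (f \o pi) (c (u 0 0))) /\
   forall q, W q -> cube a d (crd x q) -> f (pi q) = loc W x (f \o pi) (c (y (pi q))).
  move=> sf; have [||C1 C2] := HF (loc W x (f \o pi)).
  - by apply: Cinf_loc_smooth => //; exact: (spi sf).
  - move=> _ jj [q Wq <-]; rewrite -!/(cder W x _ _ q).
    exact: (base_dependence tr nz nx jj i Wq (WV _ Wq) (WN _ Wq) sf sy).
  by split=> // q Wq /C2; rewrite (loc_crd nx) // YE.
pose N' : set M := [set q | [/\ W q, cube a d (crd x q) & `|y (pi q)| < r2]].
have oN' : dopen N'.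
  have -> : N' = W `&` ([set q | forall k, `|x k q - x k g0| < d] `&` [set q | `|(y \o pi) q - 0| < r2]).
    apply/seteqP; split=> q /=; rewrite subr0.
      by move=> [Wq cq yq]; split=> //; split=> // k; have := cq k; rewrite !mxE.
    by move=> [Wq [cq yq]]; split=> // k; have := cq k; rewrite !mxE.
  apply: dopenI => //; apply: dopenI => //.
    by apply: (dopen_all gM (P := fun k => [set q | `|x k q - x k g0| < d])) => k; exact: dopen_ball.
  by apply: dopen_ball => //; exact: (spi sy).
have N'V : N' `<=` pi @^-1` V by move=> q [/WV].
exists (pi @` N'), y; split=> //; last first.
  by exists g0 => //; split=> //; [exact: cube_center|rewrite pg0 y0 normr0].
have crdE v : crd (fun _ : 'I_1 => y) v 0 0 = y v by rewrite mxE.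
split=> //.
- exact: pi_open.
- move=> _ _ [q [Wq cq yq] <-] [q' [Wq' cq' yq'] <-] /rowP/(_ 0); rewrite !crdE => E.
  apply: (orbit_separated tr); [exact: WV|exact: WV|].
  by move=> f sf; have [_ H'] := dep f sf; rewrite !H' // E.
- have -> : crd (fun _ : 'I_1 => y) @` (pi @` N') = cube (0 : 'rV[R]_1) r2.
    apply/seteqP; split=> u.
      by move=> [_ [q [Wq cq yq] <-] <-] k; rewrite !mxE subr0.
    move=> /(_ 0); rewrite mxE subr0 => u0.
    have [u1 u2] : `|u 0 0 - Y a| < r /\ `|u 0 0 - Y a| < r1.
      by rewrite Ya subr0; move: u0; rewrite lt_min => /andP[].
    have [[q Wq qc] Yc] := ct _ u1; have yq : y (pi q) = u 0 0 by rewrite -YE // qc.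
    exists (pi q); last by apply/rowP => k; rewrite ord1 crdE.
    by exists q => //; split=> //; [rewrite qc; exact: Hr1|rewrite yq].
  exact: open_cube.
- move=> f sf; have [CF fF] := dep f sf.
  exists (fun u => loc W x (f \o pi) (c (u 0 0))).
    apply: Cinf_sub CF => _ [_ [q [Wq cq yq] <-] <-]; rewrite /= crdE -YE //.
    by have [] := Hd _ cq.
  by move=> _ [q [Wq cq yq] <-]; rewrite crdE; exact: fF.
Qed.

Lemma base_bchart : exists (W : set B) (y : B -> R),
  bchart [set base_pt G] W (fun _ : 'I_1 => y) (Some ord0) /\ W (base_pt G).
Proof.
have [W [y [ny Wb y0]]] := base_chart; have [_ _ inj _ _] := ny.
exists W, y; split=> //; split=> // w Ww; split=> [->|[i _ yw]]; first by exists ord0.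
by apply: inj => //; apply/rowP => k; rewrite !mxE yw y0.
Qed.

(** A chart at another point v is the base chart moved by a right translation. It has to miss the
    base point, which is the critical hypersurface. *)
Lemma orbit_bmfd : is_bmfd [set base_pt G] 1.
Proof.
split=> // v; have [W [y [bc Wb]]] := base_bchart; have ny := bc.1.
have [->|nv] := pselect (v = base_pt G); first by exists W, (fun=> y), (Some ord0).
have [g gv] := quot_map_surj v.
have K1 : cancel (rtrans (G := G) g^-1) (rtrans g).
  by have := @rtransK R n G g^-1; rewrite invgK.
have nt := nchart_transport (@smooth_rtrans R n G g^-1) (@smooth_rtrans R n G g) K1 (@rtransK R n G g) ny.
set W1 := _ @^-1` W in nt; have W1v : W1 v by rewrite /W1 /= -gv rtransE mulgV.
have [oW1 sy1 inj1 _ _] := nt.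
pose y1 := y \o rtrans g^-1.
have [W1b|nW1b] := pselect (W1 (base_pt G)); last first.
  exists W1, (fun=> y1), None; split=> //; split=> // w Ww.
  by split=> [wb|[]//]; case: nW1b; rewrite -wb.
(* The base point is removed by discarding its level of the coordinate; v survives because the
   coordinate is injective. *)
pose W2 := W1 `&` [set w | y1 w - y1 (base_pt G) != 0].
have oW2 : dopen W2.
  apply: dopenI => // w w0; exists (fun w => y1 w - y1 (base_pt G)); split=> //.
  by apply: smoothB => //; [exact: (sy1 ord0)|exact: smooth_cst].
exists W2, (fun=> y1), None; split.
  split; first by apply: nchart_sub nt _ _ => // w [].
  by move=> w [_ /eqP w0]; split=> [wb|[]//]; case: w0; rewrite wb subrr.
split=> //; apply/negP => /eqP/subr0_eq E; apply: nv; apply: inj1 => //.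
by apply/rowP => k; rewrite !mxE.
Qed.

End OrbitChart.

(** * The Lie algebra of H and the Lie-Poisson bracket on its dual *)

Section LieDual.
Variables (R : realType) (n : nat) (G : bLieGroup R n).
Local Notation M := (bspace G).
Local Notation Hs := (subgroupSpace G).
Let gH : gen_closed Hs. Proof. exact: gen_closed_H. Qed.
Implicit Types (D E L : operator Hs) (h : Hs) (k : Hs -> R) (m v : hdual G).

Lemma mulHA h h' h'' : mulH (mulH h h') h'' = mulH h (mulH h' h'').
Proof. by apply: sval_inj; rewrite /= mulgA. Qed.

Lemma mulH1 h : mulH h (oneH G) = h.
Proof. by apply: sval_inj; rewrite /= mulg1. Qed.

Lemma smooth_mulH : smooth_map ((fun p => mulH p.1 p.2) : prodSpace Hs Hs -> Hs).
Proof.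
have gP : gen_closed (prodSpace Hs Hs) by exact: gen_closed_prod.
apply: smooth_into_sub => // f sf.
exact: (smooth_pair gP (fun f sf => smooth_fst (smooth_sval sf))
  (fun f sf => smooth_snd (smooth_sval sf)) (bgroup_mul sf)).
Qed.

Lemma smooth_lmulH h : smooth_map (mulH h).
Proof. by move=> k sk; exact: (smooth_prod_slice gH h (smooth_mulH sk)). Qed.

Lemma lieH_lin (a : R) D E : lieH D -> lieH E -> lieH (fun k h => a * D k h + E k h).
Proof.
move=> [vD lD] [vE lE]; split; first exact: (vfieldD gH (vfieldZ gH a vD) vE).
by move=> h k sk; rewrite lD // lE.
Qed.

Lemma lieH0 : lieH (fun (_ : Hs -> R) (_ : Hs) => 0).
Proof. by split; first exact: vfield0. Qed.

Lemma lieH_lie D E : lieH D -> lieH E -> lieH (lie_br D E).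
Proof.
move=> [vD lD] [vE lE]; split; first exact: vfield_lie.
have [_ sD _ _ _] := vD; have [_ sE _ _ _] := vE.
by move=> h k sk; rewrite /lie_br lD // lE // lD ?lE //; [exact: sD|exact: sE].
Qed.

Lemma lieH_eq D E : lieH D -> lieH E ->
  (forall k, smooth k -> D k (oneH G) = E k (oneH G)) -> D = E.
Proof.
move=> [vD lD] [vE lE] DE; apply: vfield_ext => // k sk h.
have := DE _ (@smooth_lmulH h _ sk); rewrite lD // lE //=.
by rewrite mulH1.
Qed.

Definition leftext (xi : (Hs -> R) -> R) : operator Hs :=
  mkop (fun k h => xi (fun h' => k (mulH h h'))).

(** Smoothness in h is that of a derivation applied to the multiplication with h as a parameter;
    invariance is associativity. *)
Lemma leftext_lieH xi : pder (oneH G) xi -> lieH (leftext xi).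
Proof.
move=> px; split.
  apply: mkop_vfield => // [k sk|h].
    apply: (smooth_param_pder (f := fun p => k (mulH p.1 p.2)) gH gH (smooth_mulH sk)
      (@smooth_id R Hs) (smooth_const_map gH (oneH G)) (xi := fun _ => xi)) => // k' sk'.
    exact: smooth_cst.
  by have := pder_push (@smooth_lmulH h) px; rewrite mulH1.
move=> h k sk; apply/funext => h'; rewrite /leftext !mkopE //=; last exact: smooth_lmulH.
by congr xi; apply/funext => h''; rewrite /= mulHA.
Qed.

Lemma leftext_at1 xi k : smooth k -> leftext xi k (oneH G) = xi k.
Proof.
move=> sk; rewrite /leftext mkopE //; congr xi; apply/funext => h.
by congr k; apply: sval_inj; rewrite /= mul1g.
Qed.

Lemma hdual_lin m (a : R) D E : lieH D -> lieH E ->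
  sval m (fun f x => a * D f x + E f x) = a * sval m D + sval m E.
Proof. by case: m => m' [? H' lD lE]; apply: H'. Qed.

Lemma hdual_out m D : ~ lieH D -> sval m D = 0.
Proof. by case: m => m' [H' ?]; apply: H'. Qed.

Lemma hdual_ext m v : (forall D, lieH D -> sval m D = sval v D) -> m = v.
Proof.
move=> E; apply: sval_inj; apply/funext => D.
by have [/E//|nD] := pselect (lieH D); rewrite !hdual_out.
Qed.

Lemma lieH_sum p (c : 'I_p -> R) (D : 'I_p -> operator Hs) : (forall i, lieH (D i)) ->
  lieH (fun k h => \sum_i c i * D i k h) /\
  forall m, sval m (fun k h => \sum_i c i * D i k h) = \sum_i c i * sval m (D i).
Proof.
elim: p c D => [|p IHp] c D lD.
  have E : (fun k h => \sum_(i < 0) c i * D i k h) = (fun _ _ => 0).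
    by apply/funext => k; apply/funext => h; rewrite big_ord0.
  rewrite E; split=> [|m]; first exact: lieH0.
  have : sval m (fun _ _ => 0) = 1 * sval m (fun _ _ => 0) + sval m (fun _ _ => 0).
    rewrite -hdual_lin; [|exact: lieH0..]; congr (sval m _).
    by apply/funext => k; apply/funext => h; rewrite mulr0 addr0.
  by rewrite big_ord0 mul1r => /esym/eqP; rewrite -subr_eq0 addrK => /eqP.
have [l1 l2] := IHp (fun i => c (lift ord0 i)) (fun i => D (lift ord0 i)) (fun i => lD _).
have E : (fun k h => \sum_i c i * D i k h) =
    (fun k h => c ord0 * D ord0 k h + \sum_i c (lift ord0 i) * D (lift ord0 i) k h).
  by apply/funext => k; apply/funext => h; rewrite big_ord_recl.
rewrite E; split=> [|m]; first exact: lieH_lin.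
by rewrite hdual_lin // l2 big_ord_recl.
Qed.

(** The coordinate vectors at the identity, extended by left invariance. The coefficients of D are
    explicit, which makes their dependence on a parameter tractable. *)
Lemma lieH_basis : exists X : 'I_n -> operator Hs, exists z : 'I_n -> Hs -> R,
  [/\ forall i, lieH (X i), forall i, smooth (z i) &
      forall D, lieH D -> D = fun k h => \sum_i D (z i) (oneH G) * X i k h].
Proof.
have [N [z [nz N1]]] := subgroup_nchart G; have [_ sz _ _ _] := nz.
pose X i := leftext (fun k => cder N z i k (oneH G)).
have lX i : lieH (X i) by apply: leftext_lieH; exact: (cder_pder gH nz).
exists X, z; split=> // D lD; apply: lieH_eq => //; first exact: (lieH_sum _ lX).1.
move=> k sk; rewrite (pder_cder gH nz N1 (vfield_pder _ lD.1) sk).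
by apply: eq_bigr => i _; rewrite /X leftext_at1 // mulrC.
Qed.

Lemma gen_closed_hdual : gen_closed (hdual G).
Proof. exact: gen_idem. Qed.

Lemma smooth_heval D : lieH D -> smooth (fun m => sval m D).
Proof. by move=> lD; apply: sub_gen; exists D. Qed.

(** These functionals separate the Lie algebra, so the differential of a function on the dual is
    unique without an appeal to biduality. *)
Definition at1 k D : R := if `[< lieH D >] then D k (oneH G) else 0.

Lemma at1_hdual k : is_hdual (at1 k).
Proof.
split=> [D nD|a D E lD lE]; rewrite /at1; first by case: asboolP.
by rewrite !asboolT //; exact: lieH_lin.
Qed.

Let is_hdiff (F : hdual G -> R) m D := lieH D /\ forall v,
  is_derive (0 : R) (1 : R) (fun t : R => F (hdual_line m v t)) (sval v D).

Let hdiff_unique F m D E : is_hdiff F m D -> is_hdiff F m E -> D = E.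
Proof.
move=> [lD dD] [lE dE]; apply: lieH_eq => // k sk.
pose v : hdual G := exist _ _ (at1_hdual k).
have [_ e1] := dD v; have [_ e2] := dE v.
by move: (etrans (esym e1) e2); rewrite /= /at1 !asboolT.
Qed.

Let hdiff_is F m D : is_hdiff F m D -> hdiff F m = D.
Proof.
move=> dD; rewrite /hdiff; case: xgetP => [E _ dE|/(_ D)//].
exact: (hdiff_unique dE dD).
Qed.

Lemma hdual_line0 m v : hdual_line m v 0 = m.
Proof. by apply: hdual_ext => D lD; rewrite /= mul0r addr0. Qed.

(** Near m the function is a smooth [Phi] of finitely many evaluations at elements [D i]; its
    differential is the combination of the [D i] with the partial derivatives of [Phi] as
    coefficients. *)
Let hdiffP F m : smooth F -> is_hdiff F m (hdiff F m).
Proof.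
move=> sF; suff [D dD] : exists D, is_hdiff F m D by rewrite (hdiff_is dD).
have [p [g [Phi [e [Sg CP e0 FP]]]]] := sF m.
have /choice[D DP] : forall i, exists D, lieH D /\ g i = fun m => sval m D.
  by move=> i; have [D lD gD] := Sg i; exists D.
have lD i : lieH (D i) by case: (DP i).
have gE i m' : g i m' = sval m' (D i) by case: (DP i) => _ ->.
pose c i := partial i Phi (\row_i g i m).
have [lS mS] := lieH_sum c lD.
exists (fun k h => \sum_i c i * D i k h); split=> // v; rewrite mS.
pose gam i (t : R) := sval m (D i) + t * sval v (D i).
have dg i : is_derive (0 : R) (1 : R) (gam i) (sval v (D i)).
  have d1 : is_derive (0 : R) (1 : R) (fun t : R => t * sval v (D i)) (sval v (D i)).
    have -> : (fun t : R => t * sval v (D i)) = (sval v (D i) *: (fun t : R => t)).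
      by apply/funext => t; rewrite mulrC.
    by apply: is_derive_eq; rewrite scaler1.
  have := is_deriveD (is_derive_cst (sval m (D i)) (0 : R) (1 : R)) d1.
  by rewrite add0r.
have g0 : \row_i gam i 0 = \row_i g i m by apply/rowP => i; rewrite !mxE /gam gE mul0r addr0.
have := chain_rule (@openT _) (CP 1%N) I dg; rewrite g0.
(* For |t| < e / S every evaluation along the line moves by less than e; the summand 1 keeps S
   positive. *)
pose S := 1 + \sum_i `|sval v (D i)|.
have S0 : 0 < S by apply: ltr_pwDl => //; apply: sumr_ge0.
apply: (is_derive_near (r := e / S)); first exact: divr_gt0.
move=> t; rewrite subr0 => te; rewrite FP => [|i].
  by congr Phi; apply/rowP => i; rewrite !mxE gE.
rewrite !gE /= addrC addKr normrM.
apply: le_lt_trans (_ : `|t| * S < e); last by rewrite -ltr_pdivlMr.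
apply: ler_wpM2l => //; rewrite /S (bigD1 i) //= addrCA lerDl addr_ge0 //.
exact: sumr_ge0.
Qed.

Lemma hdiff_lieH F m : smooth F -> lieH (hdiff F m).
Proof. by move=> /(hdiffP m)[]. Qed.

Lemma hdiff_heval D m : lieH D -> hdiff (fun m => sval m D) m = D.
Proof.
move=> lD; apply: hdiff_is; split=> // v.
have d1 : is_derive (0 : R) (1 : R) (fun t : R => t * sval v D) (sval v D).
  have -> : (fun t : R => t * sval v D) = (sval v D *: (fun t : R => t)).
    by apply/funext => t; rewrite mulrC.
  by apply: is_derive_eq; rewrite scaler1.
have := is_deriveD (is_derive_cst (sval m D) (0 : R) (1 : R)) d1.
by rewrite add0r.
Qed.

(** F |-> dF is a derivation with values in the Lie algebra; composing with a linear l gives scalar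
    derivations, to which the two slots of the bracket belong. *)
Lemma hdiff_pder m (l : operator Hs -> R) :
  (forall (a : R) D E, lieH D -> lieH E -> l (fun k h => a * D k h + E k h) = a * l D + l E) ->
  pder m (fun F => l (hdiff F m)).
Proof.
move=> ll; have l0 : l (fun _ _ => 0) = 0.
  have : l (fun _ _ => 0) = 1 * l (fun _ _ => 0) + l (fun _ _ => 0).
    rewrite -ll; [|exact: lieH0..]; congr (l _).
    by apply/funext => k; apply/funext => h; rewrite mulr0 addr0.
  by rewrite mul1r => /esym/eqP; rewrite -subr_eq0 addrK => /eqP.
have lZ a D : lieH D -> l (fun k h => a * D k h) = a * l D.
  move=> lD; rewrite -[RHS]addr0 -l0 -ll //; last exact: lieH0.
  by congr l; apply/funext => k; apply/funext => h; rewrite addr0.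
have dZ a D : lieH D -> lieH (fun k h => a * D k h).
  move=> lD; have := lieH_lin a lD lieH0; congr (lieH _).
  by apply/funext => k; apply/funext => h; rewrite addr0.
have mZ (v : hdual G) a D : lieH D -> sval v (fun k h => a * D k h) = a * sval v D.
  move=> lD; have [_ H1] := lieH_sum (fun _ : 'I_1 => a) (fun _ : 'I_1 => lD).
  have := H1 v; rewrite big_ord1 => <-; congr (sval v _).
  by apply/funext => k; apply/funext => h; rewrite big_ord1.
split=> [F K sF sK|a F sF|F K sF sK].
- have [lF dF] := hdiffP m sF; have [lK dK] := hdiffP m sK.
  rewrite -[l (hdiff F m)]mul1r -ll //; congr l; apply: hdiff_is; split; first exact: lieH_lin.
  by move=> v; rewrite hdual_lin // mul1r; exact: is_deriveD.
- have [lF dF] := hdiffP m sF.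
  rewrite -lZ //; congr l; apply: hdiff_is; split; first exact: dZ.
  by move=> v; rewrite mZ //; exact: is_deriveZ.
- have [lF dF] := hdiffP m sF; have [lK dK] := hdiffP m sK.
  rewrite -(lZ (K m)) // -ll //; last exact: dZ.
  congr l; apply: hdiff_is; split; first by apply: lieH_lin => //; exact: dZ.
  move=> v; rewrite hdual_lin //; last exact: dZ.
  rewrite mZ //; have := is_deriveM (dF v) (dK v).
  by rewrite !hdual_line0.
Qed.

Lemma lie_poisson_bider m : bider m (fun F K => @pbr R (lie_poisson_minus G) F K m).
Proof.
have lieL L (a : R) D E : lieH L -> lieH D -> lieH E ->
    lie_br L (fun k h => a * D k h + E k h) = fun k h => a * lie_br L D k h + lie_br L E k h.
  move=> lL lD lE; have lDE := lieH_lin a lD lE; have l1 := lieH_lie lL lD; have l2 := lieH_lie lL lE.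
  apply: vfield_ext (lieH_lie lL lDE).1 (lieH_lin a l1 l2).1 _ => k sk h.
  have [_ sD _ _ _] := lD.1; have [_ sE _ _ _] := lE.1.
  have [a1 a2 _] := vfield_pder h lL.1.
  rewrite /lie_br a1 ?a2 //; [ring|exact: sD|by apply: smoothZ => //; exact: sD|exact: sE].
have lieN D E : lie_br D E = fun k h => -1 * lie_br E D k h.
  by apply/funext => k; apply/funext => h; rewrite /lie_br mulN1r opprB.
have mN D : lieH D -> sval m (fun k h => -1 * D k h) = - sval m D.
  move=> lD; have [_ H1] := lieH_sum (fun _ : 'I_1 => -1) (fun _ : 'I_1 => lD).
  have := H1 m; rewrite big_ord1 mulN1r => <-; congr (sval m _).
  by apply/funext => k; apply/funext => h; rewrite big_ord1.
split=> [K sK|F sF].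
  have lK := hdiff_lieH m sK.
  apply: (@hdiff_pder m (fun D => - sval m (lie_br D (hdiff K m)))) => a D E lD lE.
  have lDE := lieH_lin a lD lE.
  rewrite !(lieN _ (hdiff K m)) !mN; try exact: lieH_lie.
  by rewrite lieL // hdual_lin; [ring|exact: lieH_lie..].
have lF := hdiff_lieH m sF.
apply: (@hdiff_pder m (fun D => - sval m (lie_br (hdiff F m) D))) => a D E lD lE.
by rewrite lieL // hdual_lin; [ring|exact: lieH_lie..].
Qed.

Lemma lie_poisson_heval D E m : lieH D -> lieH E ->
  @pbr R (lie_poisson_minus G) (fun m => sval m D) (fun m => sval m E) m = - sval m (lie_br D E).
Proof. by move=> lD lE; rewrite /= !hdiff_heval. Qed.

End LieDual.

(** * Brackets on open subspaces and products *)

Section PoissonConstructions.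
Variable R : realType.

Lemma pderD (X : diffSpace R) (x : X) xi xi' : pder x xi -> pder x xi' ->
  pder x (fun f => xi f + xi' f).
Proof.
move=> [p1 p2 p3] [q1 q2 q3]; split=> [f g sf sg|a f sf|f g sf sg].
- by rewrite p1 // q1 // addrACA.
- by rewrite p2 // q2 // mulrDr.
- by rewrite p3 // q3 // !mulrDr addrACA.
Qed.

Lemma pder_ext (X : diffSpace R) (x : X) xi xi' : gen_closed X -> pder x xi ->
  (forall f, smooth f -> xi f = xi' f) -> pder x xi'.
Proof.
move=> gX [p1 p2 p3] E; split=> [f g sf sg|a f sf|f g sf sg].
- by rewrite -!E ?p1 //; apply: smoothD.
- by rewrite -!E ?p2 //; apply: smoothZ.
- by rewrite -!E ?p3 //; apply: smoothM.
Qed.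

Lemma bider_ext (X : diffSpace R) (x : X) be be' : gen_closed X -> bider x be ->
  (forall f g, smooth f -> smooth g -> be f g = be' f g) -> bider x be'.
Proof.
move=> gX [b1 b2] E; split=> g sg.
  by apply: (pder_ext gX (b1 g sg)) => f sf; exact: E.
by apply: (pder_ext gX (b2 g sg)) => f sf; exact: E.
Qed.

Lemma bider_push (X Y : diffSpace R) (phi : X -> Y) (x : X) be : smooth_map phi ->
  bider x be -> bider (phi x) (fun f g => be (f \o phi) (g \o phi)).
Proof.
move=> sp [b1 b2]; split=> g sg; have sg' := sp _ sg.
  exact: (pder_push sp (b1 _ sg')).
exact: (pder_push sp (b2 _ sg')).
Qed.

Section Sub.
Variables (P : poissonSpace R) (A : set P).
Hypotheses (gP : gen_closed P) (oA : dopen A).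
Implicit Types (x : subSpace A) (f g : subSpace A -> R).

(** A biderivation depends only on germs, so all extensions of f and g near x give one and the same
    value to choose. *)
Lemma psub_eq x f g (f' g' : P -> R) :
  bider (sval x : P) (fun f g : P -> R => @pbr R P f g (sval x)) -> smooth f' -> smooth g' ->
  dnbhs (sval x : P) [set z | forall y : subSpace A, sval y = z -> f y = f' z] ->
  dnbhs (sval x : P) [set z | forall y : subSpace A, sval y = z -> g y = g' z] ->
  @pbr R (psub A) f g x = @pbr R P f' g' (sval x).
Proof.
move=> bP sf sg Ef Eg; have [N [oN Nx NP]] := dnbhsI gP Ef Eg.
rewrite /=; case: xgetP => [c _ [f2 [g2 [N2 [oN2 N2x sf2 sg2] [E2 ->]]]]|/(_ (@pbr R P f' g' (sval x)))[]].
  apply: (bider_local bP) => //; apply: dnbhsS (dnbhsI gP (dnbhs_dopen oN Nx)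
    (dnbhsI gP (dnbhs_dopen oN2 N2x) (dnbhs_dopen oA (svalP x)))) => z [/NP[/= H1 H2] [N2z Az]].
    by have [<- _] := E2 (exist _ z Az) N2z; rewrite H1.
  by have [_ <-] := E2 (exist _ z Az) N2z; rewrite H2.
exists f', g', N; split=> //.
by move=> y /NP[/= H1 H2]; rewrite (H1 y) // (H2 y).
Qed.

Let ext_near x f : smooth f -> smooth (germ (sval x) (ext0 f) : P -> R) /\
  dnbhs (sval x : P) [set z | forall y : subSpace A, sval y = z -> f y = germ (sval x) (ext0 f) z].
Proof.
move=> sf; have [] := germP (ext0_smooth_at gP oA (smooth_smooth_at (@gen_closed_sub R _ _) x sf)).
by move=> sg eg; split=> //; apply: dnbhsS eg => z /= <- y <-; rewrite ext0E.
Qed.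

Lemma psub_bider x : bider (sval x : P) (fun f g : P -> R => @pbr R P f g (sval x)) ->
  bider x (fun f g => @pbr R (psub A) f g x).
Proof.
move=> bP; have gA : gen_closed (subSpace A) by exact: gen_closed_sub.
have E f g : smooth f -> smooth g -> @pbr R (psub A) f g x =
    @pbr R P (germ (sval x) (ext0 f)) (germ (sval x) (ext0 g)) (sval x).
  by move=> /(ext_near x)[sf ef] /(ext_near x)[sg eg]; exact: psub_eq.
have [b1 b2] := bP; split=> g sg; have [sg' _] := ext_near x sg.
  apply: (pder_ext gA (res_pder gP oA (b1 _ sg'))) => f sf; by rewrite E.
apply: (pder_ext gA (res_pder gP oA (b2 _ sg'))) => f sf; by rewrite E.
Qed.

End Sub.

Lemma pprod_bider (P Q : poissonSpace R) (z : prodSpace P Q) : gen_closed P -> gen_closed Q ->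
  bider z.1 (fun f g => @pbr R P f g z.1) -> bider z.2 (fun f g => @pbr R Q f g z.2) ->
  bider z (fun f g => @pbr R (pprod P Q) f g z).
Proof.
case: z => a c /= gP gQ bP bQ.
have s1 : smooth_map ((fun x => (x, c)) : P -> prodSpace P Q).
  exact: (smooth_pair gP (@smooth_id R P) (smooth_const_map gP c)).
have s2 : smooth_map ((fun y => (a, y)) : Q -> prodSpace P Q).
  exact: (smooth_pair gQ (smooth_const_map gQ a) (@smooth_id R Q)).
have [b1 b2] := bider_push s1 bP; have [c1 c2] := bider_push s2 bQ.
by split=> g sg; apply: pderD; [exact: b1|exact: c1|exact: b2|exact: c2].
Qed.

Lemma gen_comp (X Y : Type) (phi : X -> Y) (S : set (Y -> R)) (T : set (X -> R)) f :
  (forall s, S s -> T (s \o phi)) -> gen S f -> gen T (f \o phi).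
Proof.
move=> ST Sf x; have [k [g [F [e [Sg CF e0 H]]]]] := Sf (phi x).
exists k, (fun i => g i \o phi), F, e; split=> // [i|y]; first exact: ST.
exact: H.
Qed.

End PoissonConstructions.

(** * Generators and brackets of the model *)

Section Model.
Variables (R : realType) (n : nat) (G : bLieGroup R n).
Local Notation B := (GmodH G).
Local Notation Zb := ([set base_pt G] : set B).
Local Notation P := (model G).
Hypothesis bB : is_bmfd Zb 1.
Let gE : gen_closed (bcot Zb). Proof. exact: gen_closed_bcot. Qed.
Let gD : gen_closed (hdual G). Proof. exact: gen_closed_hdual. Qed.

Definition model_gens : set (P -> R) := [set s |
  [\/ exists2 D, lieH D & s = fun z => sval z.1 D,
      exists2 k : B -> R, smooth k & s = fun z => k (bproj z.2) |
      exists2 E, is_bfield Zb E & s = fun z => bpair z.2 E]].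

Lemma model_smooth_gen : @smooth R P `<=` gen model_gens.
Proof.
apply: gen_mono => f [[g sg ->]|[g sg ->]].
  by apply: (gen_comp (phi := fst)) sg => s [D lD ->]; apply: Or31; exists D.
apply: (gen_comp (phi := snd)) sg => s [[k sk ->]|[E bE ->]]; first by apply: Or32; exists k.
by apply: Or33; exists E.
Qed.

Lemma model_gen_smooth : model_gens `<=` @smooth R P.
Proof.
move=> s [[D lD ->]|[k sk ->]|[E bE ->]].
- exact: (smooth_fst (smooth_heval lD)).
- exact: (smooth_snd (smooth_bproj sk)).
- exact: (smooth_snd (smooth_bpair bE)).
Qed.

Lemma gen_closed_model : gen_closed P. Proof. exact: gen_closed_prod. Qed.

Lemma model_bider (z : P) : bider z (fun f g => @pbr R P f g z).
Proof.
apply: pprod_bider => //; first exact: lie_poisson_bider.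
by have [] := bcan_is_pb bB z.2.
Qed.

Let lpc (f : hdual G -> R) c m : smooth f -> @pbr R (lie_poisson_minus G) f (fun=> c) m = 0.
Proof. by move=> sf; have [_ b2] := lie_poisson_bider m; exact: (pder_cst gD c (b2 f sf)). Qed.
Let lcp (f : hdual G -> R) c m : smooth f -> @pbr R (lie_poisson_minus G) (fun=> c) f m = 0.
Proof. by move=> sf; have [b1 _] := lie_poisson_bider m; exact: (pder_cst gD c (b1 f sf)). Qed.
Let bpc (f : bcot Zb -> R) c e : smooth f -> @pbr R (bcan Zb) f (fun=> c) e = 0.
Proof. by move=> sf; have [[_ b2] _ _ _ _] := bcan_is_pb bB e; exact: (pder_cst gE c (b2 f sf)). Qed.
Let bcp (f : bcot Zb -> R) c e : smooth f -> @pbr R (bcan Zb) (fun=> c) f e = 0.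
Proof. by move=> sf; have [[b1 _] _ _ _ _] := bcan_is_pb bB e; exact: (pder_cst gE c (b1 f sf)). Qed.
Implicit Types (a : hdual G -> R) (c : bcot Zb -> R).

Lemma model_ff a a' z : smooth a -> smooth a' ->
  @pbr R P (fun z => a z.1) (fun z => a' z.1) z = @pbr R (lie_poisson_minus G) a a' z.1.
Proof.
move=> sa sa'; rewrite -[LHS]/(@pbr R (lie_poisson_minus G) a a' z.1 +
  @pbr R (bcan Zb) (fun=> a z.1) (fun=> a' z.1) z.2) bpc ?addr0 //; exact: smooth_cst.
Qed.

Lemma model_ss c c' z : smooth c -> smooth c' ->
  @pbr R P (fun z => c z.2) (fun z => c' z.2) z = @pbr R (bcan Zb) c c' z.2.
Proof.
move=> sc sc'; rewrite -[LHS]/(@pbr R (lie_poisson_minus G) (fun=> c z.2) (fun=> c' z.2) z.1 +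
  @pbr R (bcan Zb) c c' z.2) lpc ?add0r //; exact: smooth_cst.
Qed.

(** In each factor one of the two arguments is constant, so both summands of the product bracket
    vanish. *)
Lemma model_fs a c z : smooth a -> smooth c ->
  @pbr R P (fun z => a z.1) (fun z => c z.2) z = 0.
Proof.
move=> sa sc; rewrite -[LHS]/(@pbr R (lie_poisson_minus G) a (fun=> c z.2) z.1 +
  @pbr R (bcan Zb) (fun=> a z.1) c z.2).
by rewrite lpc // bcp // addr0.
Qed.

Lemma model_sf a c z : smooth a -> smooth c ->
  @pbr R P (fun z => c z.2) (fun z => a z.1) z = 0.
Proof.
move=> sa sc; rewrite -[LHS]/(@pbr R (lie_poisson_minus G) (fun=> c z.2) a z.1 +
  @pbr R (bcan Zb) c (fun=> a z.1) z.2).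
by rewrite lcp // bpc // addr0.
Qed.

End Model.

(** * The components of a covector and its reconstruction along a section *)

Section LocalModel.
Variables (R : realType) (n : nat) (G : bLieGroup R n).
Local Notation M := (bspace G).
Local Notation H := (@bH R n G : set M).
Local Notation Hs := (subgroupSpace G).
Local Notation B := (GmodH G).
Local Notation Zb := ([set base_pt G] : set B).
Local Notation pi := (quot_map (@leftrel R n G)).
Variables (V : set B) (eta : M -> Hs) (j : Hs -> B -> M) (chi : B -> B -> R).
Hypothesis tr : is_triv V eta j.
Hypothesis hchi : forall v, V v -> cutoff V (chi v) /\ dnbhs v [set w | chi v w = 1].
Local Notation jo := (j (oneH G)).
Local Notation hl c D := (hlift eta j c D).
Local Notation vl c E := (vlift V eta j c E).
Implicit Types (e : bcot H) (c : B -> R).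

Let gM : gen_closed M. Proof. exact: group_gen_closed. Qed.
Let gB : gen_closed B. Proof. exact: gen_closed_B. Qed.
Let spi : smooth_map (pi : M -> B). Proof. exact: smooth_pi. Qed.
Let oV : dopen V. Proof. by case: tr. Qed.
Let Vb : V (base_pt G). Proof. by case: tr. Qed.
Let oU : dopen (pi @^-1` V : set M). Proof. exact: smooth_map_dopen spi oV. Qed.

Lemma hlift_lin c (a : R) D E : hl c (fun k h => a * D k h + E k h) =
  fun f g => a * hl c D f g + hl c E f g.
Proof.
apply/funext => f; apply/funext => g; rewrite /hlift /mkop; case: asboolP => _.
  by rewrite mulrDr mulrCA.
by rewrite mulr0 addr0.
Qed.

Lemma vlift_add c D E : vl c (fun k h => D k h + E k h) = fun f g => vl c D f g + vl c E f g.
Proof.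
apply/funext => f; apply/funext => g; rewrite /vlift /mkop; case: asboolP => _.
  by rewrite mulrDr.
by rewrite addr0.
Qed.

Lemma vlift_mul c (k : B -> R) E : vl c (fun f x => k x * E f x) =
  fun f g => k (pi g) * vl c E f g.
Proof.
apply/funext => f; apply/funext => g; rewrite /vlift /mkop; case: asboolP => _.
  by rewrite mulrCA.
by rewrite mulr0.
Qed.

(** The momentum of e. The cutoff is the one centred at the projection of e, and the value 0 away
    from V makes the map total. *)
Definition vert_fun e (D : operator Hs) : R :=
  if `[< V (pi (bproj e)) /\ lieH D >] then bpair e (hl (chi (pi (bproj e))) D) else 0.

Lemma vert_hdual e : is_hdual (vert_fun e).
Proof.
split=> [D nD|a D E lD lE]; rewrite /vert_fun.
  by case: asboolP => // -[].
have [Ve|nV] := pselect (V (pi (bproj e))); last first.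
  by rewrite !asboolF ?mulr0 ?addr0 // => -[].
have [cc _] := hchi Ve.
rewrite !asboolT //; last by split=> //; exact: lieH_lin.
have b1 := hlift_bfield tr cc lD.1; have b2 := hlift_bfield tr cc lE.1.
by rewrite hlift_lin bpairD ?bpairZ //; exact: bfieldZ.
Qed.

Definition vert e : hdual G := exist _ _ (vert_hdual e).

Lemma vertE e c D : V (pi (bproj e)) -> lieH D -> cutoff V c ->
  dnbhs (pi (bproj e)) [set w | c w = 1] -> sval (vert e) D = bpair e (hl c D).
Proof.
move=> Ve lD cc c1; rewrite /= /vert_fun asboolT //; have [cc' c1'] := hchi Ve.
by apply: (bpair_hlift_chi tr) => //; case: lD.
Qed.

Definition horiz_fun e (E : operator B) : R :=
  if `[< V (pi (bproj e)) /\ is_bfield Zb E >] then bpair e (vl (chi (pi (bproj e))) E) else 0.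

Lemma horiz_bcovector e : is_bcovector Zb (pi (bproj e)) (horiz_fun e).
Proof.
have [Ve|nV] := pselect (V (pi (bproj e))); last first.
  have z E : horiz_fun e E = 0 by rewrite /horiz_fun asboolF // => -[].
  by split=> *; rewrite !z ?addr0 ?mulr0.
have [cc _] := hchi Ve.
split=> [D nD|D E bD bE|f D sf bD]; rewrite /horiz_fun.
- by rewrite asboolF // => -[].
- rewrite !asboolT //; last by split=> //; exact: bfieldD.
  by rewrite vlift_add bpairD //; exact: (vlift_bfield tr).
- rewrite !asboolT //; last by split=> //; exact: bfieldM.
  rewrite vlift_mul (bpairM _ (spi sf)) //; exact: (vlift_bfield tr).
Qed.

Definition horiz e : bcot Zb := exist _ (pi (bproj e), horiz_fun e) (horiz_bcovector e).

Lemma horizE e c E : V (pi (bproj e)) -> is_bfield Zb E -> cutoff V c ->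
  dnbhs (pi (bproj e)) [set w | c w = 1] -> bpair (horiz e) E = bpair e (vl c E).
Proof.
move=> Ve bE cc c1; rewrite /bpair /= /horiz_fun asboolT //; have [cc' c1'] := hchi Ve.
exact: (bpair_vlift_chi tr).
Qed.

Lemma liftrel_pi e e' : liftrel e e' -> pi (bproj e') = pi (bproj e).
Proof. by move=> [h Hh [-> _]]; apply/esym/pi_eq; exists h. Qed.

(** Equivariance of [eta]: translating a function of [eta] by h^-1 gives the function k(h^-1 -) of
    [eta]. This reduces invariance of the lifts to left invariance on H. *)
Lemma push_triv (h : G) (Hh : H h) (f : M -> R) k (g : M) : V (pi g) -> smooth f -> smooth k ->
  dnbhs g [set q | f q = k (eta q)] ->
  [/\ pi (h * g : G)%g = pi g, smooth (fun x : M => f (h^-1 * x : G)%g),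
      dnbhs ((h * g)%g : M) [set q | f (h^-1 * q : G)%g = k (mulH (exist _ h^-1%g (bHV Hh) : Hs) (eta q))] &
      mulH (exist _ h^-1%g (bHV Hh) : Hs) (eta (h * g : G)%g) = eta g].
Proof.
move=> Vg sf sk fk; have pE : pi (h * g : G)%g = pi g by apply/esym/pi_eq; exists h.
have Vhg : V (pi (h * g : G)%g) by rewrite pE.
split=> //; first exact: (smooth_lmul h^-1 sf).
  have := @smooth_map_dnbhs _ _ _ _ ((h * g)%g : M) _ (smooth_lmul (G := G) h^-1) _.
  move=> /(_ [set q | f q = k (eta q)]); rewrite lmulK => /(_ fk) N.
  apply: dnbhsS (dnbhsI gM N (dnbhs_dopen oU Vhg)) => q [/= -> Vq].
  by rewrite -(triv_etaM tr (exist _ h^-1%g (bHV Hh) : Hs)).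
by rewrite -(triv_etaM tr) //= lmulK.
Qed.

Let bpair_off e c T : is_bfield H T -> cutoff V c -> ~ V (pi (bproj e)) ->
  (forall f g, smooth f -> c (pi g) = 0 -> T f g = 0) -> bpair e T = 0.
Proof.
move=> bT cc nV T0; rewrite -[RHS](bpair0 gM e); apply: bpair_eq_local => //; first exact: bfield0.
by apply: dnbhsS (smooth_map_dnbhs spi (cc.2 _ nV)) => g /= c0 f sf; exact: T0.
Qed.

(** The lifted field is carried to itself by translations, because D is left invariant and [eta]
    equivariant; chi, a function on orbits, is unaffected. *)
Lemma bpair_hlift_liftrel e e' c D : liftrel e e' -> cutoff V c -> lieH D ->
  bpair e' (hl c D) = bpair e (hl c D).
Proof.
move=> ee' cc lD; have pp := liftrel_pi ee'; have bT := hlift_bfield tr cc lD.1.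
have [Ve|nV] := pselect (V (pi (bproj e))); last first.
  have T0 (f : M -> R) g : smooth f -> c (pi g) = 0 -> hl c D f g = 0.
    by move=> sf c0; rewrite /hlift mkopE // c0 mul0r.
  by rewrite !(bpair_off bT cc _ T0) // pp.
case: ee' => h Hh [_ ->] //.
have bP := push_bfield (smooth_lmul h) (smooth_lmul h^-1) (lmulK h) (lmulVK h) (bH_lmul Hh) bT.
apply: (bpair_triv_eq tr) => //; apply: dnbhsS (dnbhs_dopen oU Ve) => g Vg.
split=> [f k sf sk fk|b sb].
  have [pE sf' fk' eE] := push_triv Hh Vg sf sk fk.
  rewrite (hlift_eta tr _ lD.1 sf sk Vg fk) /push_op.
  have Vhg : V (pi (h * g : G)%g) by rewrite pE.
  rewrite (hlift_eta tr _ lD.1 sf' (smooth_lmulH (exist _ h^-1%g (bHV Hh) : Hs) sk) Vhg fk') pE.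
  by rewrite lD.2 //= eE.
rewrite (hlift_pi tr _ lD.1 sb Vg) /push_op.
have -> : (b \o pi) \o (fun x : M => h^-1 * x : G)%g = b \o pi.
  by apply/funext => x /=; congr b; apply/esym/pi_eq; exists h^-1%g => //; exact: bHV.
apply: (hlift_pi tr _ lD.1 sb); rewrite /=.
by have <- : pi g = pi (h * g : G)%g by apply/pi_eq; exists h.
Qed.

Lemma bpair_vlift_liftrel e e' c E : liftrel e e' -> cutoff V c -> is_bfield Zb E ->
  bpair e' (vl c E) = bpair e (vl c E).
Proof.
move=> ee' cc bE; have pp := liftrel_pi ee'; have bT := vlift_bfield tr cc bE.
have [Ve|nV] := pselect (V (pi (bproj e))); last first.
  have T0 (f : M -> R) g : smooth f -> c (pi g) = 0 -> vl c E f g = 0.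
    by move=> sf c0; rewrite /vlift mkopE // c0 mul0r.
  by rewrite !(bpair_off bT cc _ T0) // pp.
case: ee' => h Hh [_ ->] //.
have bP := push_bfield (smooth_lmul h) (smooth_lmul h^-1) (lmulK h) (lmulVK h) (bH_lmul Hh) bT.
apply: (bpair_triv_eq tr) => //; apply: dnbhsS (dnbhs_dopen oU Ve) => g Vg.
have pE : pi (h * g : G)%g = pi g by apply/esym/pi_eq; exists h.
have Vhg : V (pi (h * g : G)%g) by rewrite pE.
split=> [f k sf sk fk|b sb].
  have [_ sf' fk' eE] := push_triv Hh Vg sf sk fk.
  rewrite (vlift_eta tr _ bE.1 sf sk Vg fk) /push_op.
  exact: (vlift_eta tr _ bE.1 sf' (smooth_lmulH (exist _ h^-1%g (bHV Hh) : Hs) sk) Vhg fk').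
rewrite (vlift_pi tr _ bE.1 sb Vg) /push_op.
have -> : (b \o pi) \o (fun x : M => h^-1 * x : G)%g = b \o pi.
  by apply/funext => x /=; congr b; apply/esym/pi_eq; exists h^-1%g => //; exact: bHV.
by rewrite (vlift_pi tr _ bE.1 sb Vhg) pE.
Qed.

Lemma vert_liftrel e e' : liftrel e e' -> vert e' = vert e.
Proof.
move=> ee'; have pp := liftrel_pi ee'; apply: hdual_ext => D lD.
have [Ve|nV] := pselect (V (pi (bproj e))); last first.
  by rewrite /= /vert_fun pp !asboolF // => -[].
have [cc c1] := hchi Ve; rewrite !(vertE (c := chi (pi (bproj e)))) ?pp //.
exact: bpair_hlift_liftrel.
Qed.

Lemma horiz_liftrel e e' : liftrel e e' -> horiz e' = horiz e.
Proof.
move=> ee'; have pp := liftrel_pi ee'; apply: bcot_eq => // E bE.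
have [Ve|nV] := pselect (V (pi (bproj e))); last first.
  by rewrite /bpair /= /horiz_fun pp !asboolF // => -[].
have [cc c1] := hchi Ve; rewrite !(horizE (c := chi (pi (bproj e)))) ?pp //.
exact: bpair_vlift_liftrel.
Qed.

(** The H-component of D at the point of the section [jo] over v. There [eta] is 1, so it is a
    tangent vector at the identity, extended by left invariance. *)
Definition hproj (D : operator M) (v : B) : operator Hs :=
  leftext (fun k => D (germ (jo v) (k \o eta)) (jo v)).

Definition vproj c (D : operator M) : operator B :=
  mkop (fun b v => c v * D (b \o pi) (jo v)).

Lemma hproj_pder D v : is_vfield D -> V v ->
  pder (oneH G) (fun k : Hs -> R => D (germ (jo v) (k \o eta)) (jo v)).
Proof.
move=> vD Vv; have Vj : V (pi (jo v)) by rewrite (triv_pi tr).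
by have := eta_pder tr Vj (vfield_pder (jo v) vD); rewrite (triv_eta tr).
Qed.

Lemma hproj_lieH D v : is_vfield D -> V v -> lieH (hproj D v).
Proof. by move=> vD Vv; apply: leftext_lieH; exact: hproj_pder. Qed.

Lemma vproj_bfield c D : cutoff V c -> is_bfield H D -> is_bfield Zb (vproj c D).
Proof.
move=> cc [vD zD]; have [_ sD _ _ _] := vD; split.
  apply: mkop_vfield => // [b sb|v]; first exact: (cutoff_section tr (oneH G) cc (sD _ (spi sb))).
  have [Vv|nV] := pselect (V v).
    have := pder_push spi (vfield_pder (jo v) vD); rewrite (triv_pi tr) // => px.
    exact: pderZ px.
  have E : c v = 0 by exact: (dnbhs_self (cc.2 _ nV)).
  have -> : (fun f => c v * D (f \o pi) (jo v)) = (fun=> 0).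
    by apply/funext => f; rewrite E mul0r.
  exact: pder0.
move=> b sb b0 _ ->; rewrite /vproj mkopE // zD ?mulr0 //.
  by move=> z /pi_base E; apply: b0.
by apply/pi_base; rewrite (triv_pi tr).
Qed.

Lemma hprojD D E v : hproj (fun f x => D f x + E f x) v =
  fun k h => 1 * hproj D v k h + hproj E v k h.
Proof.
apply/funext => k; apply/funext => h; rewrite /hproj /leftext /mkop.
by case: asboolP => _; rewrite ?mul1r ?addr0.
Qed.

Lemma hprojM (f : M -> R) D v : hproj (fun k x => f x * D k x) v =
  fun k h => f (jo v) * hproj D v k h + (fun _ _ => 0) k h.
Proof.
apply/funext => k; apply/funext => h; rewrite /hproj /leftext /mkop addr0.
by case: asboolP => _; rewrite ?mulr0.
Qed.

Lemma vprojD c D E : vproj c (fun f x => D f x + E f x) =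
  fun b v => vproj c D b v + vproj c E b v.
Proof.
apply/funext => b; apply/funext => v; rewrite /vproj /mkop.
by case: asboolP => _; rewrite ?mulrDr ?addr0.
Qed.

Lemma hdual0 (m : hdual G) : sval m (fun _ _ => 0) = 0.
Proof.
have := hdual_lin m 1 (lieH0 G) (lieH0 G).
set a := sval m _; set b := sval m _; have -> : a = b.
  by congr (sval m _); apply/funext => k; apply/funext => h; rewrite mulr0 addr0.
by rewrite mul1r => /esym/eqP; rewrite -subr_eq0 addrK => /eqP.
Qed.

(** The covector at the point of the section over [bproj ep] whose H-component is m and whose base
    component is ep; each orbit over V has exactly one representative there. *)
Definition sect_fun (m : hdual G) (ep : bcot Zb) (D : operator M) : R :=
  if `[< V (bproj ep) /\ is_bfield H D >] then
    sval m (hproj D (bproj ep)) + bpair ep (vproj (chi (bproj ep)) D) else 0.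

Lemma bpair_vproj_chi (ep : bcot Zb) c c' D : V (bproj ep) -> is_bfield H D ->
  cutoff V c -> dnbhs (bproj ep) [set w | c w = 1] ->
  cutoff V c' -> dnbhs (bproj ep) [set w | c' w = 1] ->
  bpair ep (vproj c D) = bpair ep (vproj c' D).
Proof.
move=> Ve bD cc c1 cc' c1'; apply: bpair_eq_local; [exact: vproj_bfield..|].
by apply: dnbhsS (dnbhsI gB c1 c1') => v [/= E E'] b sb; rewrite /vproj !mkopE // E E'.
Qed.

Lemma sect_bcovector m ep : is_bcovector H (jo (bproj ep)) (sect_fun m ep).
Proof.
have [Ve|nV] := pselect (V (bproj ep)); last first.
  have z E : sect_fun m ep E = 0 by rewrite /sect_fun asboolF // => -[].
  by split=> *; rewrite !z ?addr0 ?mulr0.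
have [cc c1] := hchi Ve; set c := chi _ in cc c1.
split=> [D nD|D E bD bE|f D sf bD]; rewrite /sect_fun -/c.
- by rewrite asboolF // => -[].
- rewrite !asboolT //; last by split=> //; exact: bfieldD.
  rewrite hprojD vprojD hdual_lin ?bpairD ?mul1r 1?addrACA //.
  + exact: vproj_bfield.
  + exact: vproj_bfield.
  + by apply: hproj_lieH => //; case: bD.
  + by apply: hproj_lieH => //; case: bE.
- rewrite !asboolT //; last by split=> //; exact: bfieldM.
  rewrite hprojM hdual_lin ?hdual0 ?addr0; [|by apply: hproj_lieH => //; case: bD|exact: lieH0].
  rewrite mulrDr; congr (_ + _).
  have sph := cutoff_section tr (oneH G) cc sf.
  have -> : f (jo (bproj ep)) = c (bproj ep) * f (jo (bproj ep)) by rewrite (dnbhs_self c1) mul1r.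
  rewrite -(bpairM ep sph); last exact: vproj_bfield.
  have bV := vproj_bfield cc bD.
  apply: bpair_eq_local; [exact/vproj_bfield/bfieldM|exact: bfieldM|].
  apply: dnbhsS c1 => v /= E b sb; rewrite /vproj !mkopE // E !mul1r //.
Qed.

Definition sect (m : hdual G) (ep : bcot Zb) : bcot H :=
  exist _ (jo (bproj ep), sect_fun m ep) (sect_bcovector m ep).

Lemma sectE m ep c D : V (bproj ep) -> is_bfield H D -> cutoff V c ->
  dnbhs (bproj ep) [set w | c w = 1] ->
  bpair (sect m ep) D = sval m (hproj D (bproj ep)) + bpair ep (vproj c D).
Proof.
move=> Ve bD cc c1; rewrite /bpair /= /sect_fun asboolT //; congr (_ + _).
have [cc' c1'] := hchi Ve.
exact: bpair_vproj_chi.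
Qed.

Lemma vert_sect m ep : V (bproj ep) -> vert (sect m ep) = m.
Proof.
move=> Ve; have [cc c1] := hchi Ve; set c := chi _ in cc c1.
have pE : pi (bproj (sect m ep)) = bproj ep by rewrite (triv_pi tr).
have Ve' : V (pi (bproj (sect m ep))) by rewrite pE.
have Vj : V (pi (jo (bproj ep))) by rewrite (triv_pi tr).
apply: hdual_ext => D lD; rewrite (vertE (c := c)) //; last by rewrite pE.
have bT := hlift_bfield tr cc lD.1.
rewrite (sectE _ Ve bT cc c1).
have -> : vproj c (hl c D) = fun _ _ => 0.
  apply: vfield_ext (vproj_bfield cc bT).1 (vfield0 gB) _ => b sb v.
  rewrite /vproj mkopE //; have [Vv|nV] := pselect (V v).
    by rewrite (hlift_pi tr _ lD.1 sb) ?mulr0 // (triv_pi tr).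
  by rewrite (dnbhs_self (cc.2 _ nV)) mul0r.
rewrite bpair0 // addr0; congr (sval m _).
apply: lieH_eq => //; first by apply: hproj_lieH => //; case: bT.
move=> k sk; rewrite /hproj leftext_at1 //.
have [sg eg] := germP (triv_eta_at tr sk Vj).
rewrite (hlift_eta tr _ lD.1 sg sk Vj) ?(triv_eta tr) ?(triv_pi tr) //; last first.
  by apply: dnbhsS eg => q /= <-.
by rewrite (dnbhs_self c1) mul1r.
Qed.

Lemma horiz_sect m ep : V (bproj ep) -> horiz (sect m ep) = ep.
Proof.
move=> Ve; have [cc c1] := hchi Ve; set c := chi _ in cc c1.
have pE : pi (bproj (sect m ep)) = bproj ep by rewrite (triv_pi tr).
have Ve' : V (pi (bproj (sect m ep))) by rewrite pE.
have Vj : V (pi (jo (bproj ep))) by rewrite (triv_pi tr).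
apply: bcot_eq => // E bE; rewrite (horizE (c := c)) //; last by rewrite pE.
have bT := vlift_bfield tr cc bE.
rewrite (sectE _ Ve bT cc c1).
have -> : hproj (vl c E) (bproj ep) = fun _ _ => 0.
  apply: lieH_eq; [by apply: hproj_lieH => //; case: bT|exact: lieH0|].
  move=> k sk; rewrite /hproj leftext_at1 //.
  have [sg eg] := germP (triv_eta_at tr sk Vj).
  by apply: (vlift_eta tr _ bE.1 sg sk Vj); apply: dnbhsS eg => q /= <-.
rewrite hdual0 add0r; apply: bpair_eq_local => //; first exact: vproj_bfield.
apply: dnbhsS (dnbhsI gB c1 (dnbhs_dopen oV Ve)) => v [/= E1 Vv] b sb.
have Vjv : V (pi (jo v)) by rewrite (triv_pi tr).
by rewrite /vproj mkopE // E1 mul1r (vlift_pi tr _ bE.1 sb Vjv) (triv_pi tr) // E1 mul1r.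
Qed.

End LocalModel.

(** * The section inverts the passage to components *)

Section SectionInverse.
Variables (R : realType) (n : nat) (G : bLieGroup R n).
Local Notation M := (bspace G).
Local Notation H := (@bH R n G : set M).
Local Notation Hs := (subgroupSpace G).
Local Notation B := (GmodH G).
Local Notation Zb := ([set base_pt G] : set B).
Local Notation pi := (quot_map (@leftrel R n G)).
Variables (V : set B) (eta : M -> Hs) (j : Hs -> B -> M) (chi : B -> B -> R).
Hypothesis tr : is_triv V eta j.
Hypothesis hchi : forall v, V v -> cutoff V (chi v) /\ dnbhs v [set w | chi v w = 1].
Local Notation Vs := (subSpace V).
Local Notation jo := (j (oneH G)).
Local Notation hl c D := (hlift eta j c D).
Local Notation vl c E := (vlift V eta j c E).
Local Notation hproj := (hproj eta j).
Local Notation vproj := (vproj (G := G) j).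
Local Notation vert := (vert tr hchi).
Local Notation horiz := (horiz tr hchi).
Local Notation sect := (sect tr hchi).

Let gM : gen_closed M. Proof. exact: group_gen_closed. Qed.
Let gB : gen_closed B. Proof. exact: gen_closed_B. Qed.
Let spi : smooth_map (pi : M -> B). Proof. exact: smooth_pi. Qed.
Let oV : dopen V. Proof. by case: tr. Qed.
Let Vb : V (base_pt G). Proof. by case: tr. Qed.

Lemma sect_dnbhs v P : V v -> dnbhs (jo v) P -> dnbhs v [set w | P (jo w)].
Proof.
move=> Vv dP.
have := smooth_map_dnbhs (x := exist _ v Vv : Vs) (@smooth_triv_v _ _ _ _ _ _ tr (oneH G)) dP.
move=> /(dnbhs_sub gB oV) K; apply: dnbhsS (dnbhsI gB K (dnbhs_dopen oV Vv)) => w [/= E Vw].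
exact: (E (exist _ w Vw)).
Qed.

(* At points of H a b-field that vanishes as a derivation may still be nonzero in
   the b-direction; that coefficient vanishes because S is vertical along the
   whole section, where the defining function of H is not identically zero. *)
Lemma vertical_coef v S (W : set M) (x : 'I_n.+1 -> M -> R) bb i : V v -> is_bfield H S ->
  bchart H W x bb -> W (jo v) ->
  (forall f, smooth f -> S f (jo v) = 0) ->
  (forall b : B -> R, smooth b -> dnbhs v [set w | S (b \o pi) (jo w) = 0]) ->
  coef x bb i S (jo v) = 0.
Proof.
move=> Vv bS bc Wg S0 Sb; have [[_ sx _ _ _] bZ] := bc.
have [[_ sS _ _ _] _] := bS.
have := coef_field gM bc i bS Wg; rewrite S0 // => /esym/eqP; rewrite mulf_eq0.
case/orP => [|/eqP//]; rewrite /rr; case: (bb =P Some i) => [bi /eqP xg|_]; last by rewrite oner_eq0.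
have Hg : H (jo v) by apply/(bZ _ Wg); exists i.
have vb : v = base_pt G by move/pi_base: Hg; rewrite (triv_pi tr).
have [Wb [y [bcB Wb0]]] := base_bchart tr; have [[_ /(_ ord0) sy _ _ _] yZ] := bcB.
have y0 : y (base_pt G) = 0 by have [k _] := (yZ _ Wb0).1 erefl.
have syh : smooth (y \o pi) by exact: (spi sy).
have [|q sq qE] := div_coord gM bc bi Wg syh.
  by move=> h /pi_base /= ->.
have [d sd dE] := coefP gM bc i bS Wg.
have [_ _ ->] := dnbhs_self dE.
(* Near the point y o pi = x_i q, and S(x_i) = x_i d, so S(y o pi) = x_i u. Along the section the
   left side is 0 and y is non-zero at nearby points, which forces u = 0 at the point. *)
pose u g := S q g + q g * d g.
have su : smooth u by apply: smoothD => //; [exact: sS|exact: smoothM].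
have uE : dnbhs (jo v) [set g | S (y \o pi) g = x i g * u g].
  apply: dnbhsS (dnbhsI gM (dnbhs_dnbhs qE) dE) => g [/= qg [_ dg _]].
  rewrite (vfield_local bS.1 syh (smoothM gM (sx i) sq) qg).
  have [_ _ p3] := vfield_pder g bS.1; rewrite p3 // dg /rr bi eqxx /u.
  by rewrite mulrDr; congr (_ + _); rewrite mulrCA.
have [cc c1] := hchi Vv; set c := chi v in cc c1.
have ug : u (jo v) = 0.
  have := rr_dense gB bcB (p := v) (i := ord0) _ (cutoff_section tr (oneH G) cc su).
  rewrite (dnbhs_self c1) mul1r; apply; first by rewrite vb.
  have N1 := sect_dnbhs Vv uE; have N2 := sect_dnbhs Vv qE.
  apply: dnbhsS (dnbhsI gB (dnbhsI gB N1 N2) (dnbhsI gB (Sb _ sy) (dnbhs_dopen oV Vv))).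
  move=> w [[/= E1 E2] [E3 Vw]]; rewrite /rr eqxx.
  have [->|yw] := eqVneq (y w) 0; first by rewrite mul0r.
  move: E2; rewrite (triv_pi tr) // => E2; move: E1; rewrite E3 => /esym/eqP.
  rewrite mulf_eq0 => /orP[/eqP xw|/eqP ->]; last by rewrite !mulr0.
  by move: yw; rewrite E2 xw mul0r eqxx.
move: ug; rewrite /u S0 // add0r => /eqP; rewrite mulf_eq0 => /orP[/eqP qg|/eqP//].
have Vj : V (pi (jo v)) by rewrite (triv_pi tr).
have Wj : Wb (pi (jo v)) by rewrite (triv_pi tr) // vb.
(* Were q zero at the point, y o pi = x_i q would be a product of two functions vanishing there; but
   its derivative along the section is 1. *)
have px := vpder tr Vj (cder_pder gB bcB.1 ord0 Wj).
set xi := (fun f : M -> R => _) in px.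
have xy : xi (y \o pi) = 1.
  transitivity (cder Wb (fun _ : 'I_1 => y) ord0 y (pi (jo v))).
  2: by rewrite (cder_coord bcB.1 ord0 ord0 Wj).
  apply: (germ_eq gB (cder_pder gB bcB.1 ord0 Wj)) => //.
  apply: dnbhsS (dnbhs_dopen oV Vj) => w Vw.
  by rewrite /= (ext0E _ (exist _ w Vw : Vs)) /= (triv_pi tr).
have [_ _ p3] := px.
have := pder_local px syh (smoothM gM (sx i) sq) qE.
rewrite xy p3 // xg qg !mul0r addr0 => /eqP.
by rewrite oner_eq0.
Qed.

(** The difference between D and its two lifted components is zero as a derivation at [jo v] and
    kills functions from the base along the section near v. By [vertical_coef] its coefficients in a
    b-frame vanish as well. *)
Lemma bpair_split (e : bcot H) c v D : V v -> bproj e = jo v -> is_bfield H D ->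
  cutoff V c -> dnbhs v [set w | c w = 1] ->
  bpair e D = bpair e (hl c (hproj D v)) + bpair e (vl c (vproj c D)).
Proof.
move=> Vv pe bD cc c1; have lD := hproj_lieH tr bD.1 Vv.
have bT := hlift_bfield tr cc lD.1; have bP := vproj_bfield tr cc bD.
have bT' := vlift_bfield tr cc bP; have bTT := bfieldD gM bT bT'.
have bS := bfieldB gM bD bTT.
apply/subr0_eq; rewrite -(bpairD e bT bT') -(bpairB gM e bD bTT).
set S := (fun f x => D f x - _) in bS *.
have Vj : V (pi (jo v)) by rewrite (triv_pi tr).
have cv : c v = 1 := dnbhs_self c1.
have Sb (b : B -> R) w : smooth b -> V w -> c w = 1 -> S (b \o pi) (jo w) = 0.
  move=> sb Vw cw; have Vjw : V (pi (jo w)) by rewrite (triv_pi tr).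
  rewrite /S (hlift_pi tr _ lD.1 sb Vjw) (vlift_pi tr _ bP.1 sb Vjw) (triv_pi tr) // cw.
  by rewrite mul1r /vproj mkopE // cw mul1r add0r subrr.
have S0 f : smooth f -> S f (jo v) = 0.
  move=> sf; apply: (triv_pder_eq tr Vj (vfield_pder (jo v) bS.1) (pder0 (jo v))) => //.
    move=> f' k sf' sk fk; rewrite /S (hlift_eta tr _ lD.1 sf' sk Vj fk).
    rewrite (vlift_eta tr _ bP.1 sf' sk Vj fk) (triv_pi tr) // (triv_eta tr) // cv mul1r addr0.
    rewrite /hproj leftext_at1 // (germ_eq gM (vfield_pder (jo v) bD.1) sf') ?subrr //.
    by apply: dnbhsS fk => g /= ->.
  by move=> b sb; exact: Sb.
have [W [x [bb [ee [fr Wg]]]]] := frame_exists (jo v) (bmanifold_bmfd_group G).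
have bc : bchart H W x bb by case: fr.
have We : W (bproj e) by rewrite pe.
rewrite (bpair_expand gM fr bS We) big1 // => i _.
rewrite pe (vertical_coef i Vv bS bc Wg S0) ?mul0r // => b sb.
by apply: dnbhsS (dnbhsI gB c1 (dnbhs_dopen oV Vv)) => w [/= cw Vw]; exact: Sb.
Qed.

(** Translating e by the inverse of its H-component brings it to the section without changing its
    orbit or its components; there the splitting of b-fields applies. *)
Lemma sect_vert_horiz (e : bcot H) : V (pi (bproj e)) ->
  liftrel e (sect (vert e) (horiz e)).
Proof.
move=> Ve; pose h := (sval (eta (bproj e)))^-1%g; have Hh : H h by apply: bHV; case: (eta _).
pose e0 := blift (@group_gen_closed R n G) (smooth_lmul h) (smooth_lmul h^-1) (lmulK h) (lmulVK h) (bH_lmul Hh) e.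
have ee0 : liftrel e e0 by apply/liftrelP; exists h, Hh.
have pE := liftrel_pi ee0.
have Ve0 : V (pi (bproj e0)) by rewrite pE.
rewrite -(vert_liftrel tr hchi ee0) -(horiz_liftrel tr hchi ee0).
suff <- : e0 = sect (vert e0) (horiz e0) by [].
have [cc c1] := hchi Ve0; set c := chi _ in cc c1.
have pj : bproj e0 = jo (pi (bproj e0)).
  rewrite -{1}(triv_jK tr Ve0); congr j; apply: sval_inj.
  have -> : bproj e0 = (sval (exist _ h Hh : Hs) * bproj e : G)%g by [].
  by rewrite (triv_etaM tr) //= mulVg.
apply: bcot_eq; first exact: pj.
move=> D bD; rewrite (sectE tr hchi (ep := horiz e0) _ Ve0 bD cc c1).
rewrite (bpair_split Ve0 pj bD cc c1).
rewrite (vertE tr hchi Ve0 (hproj_lieH tr bD.1 Ve0) cc c1).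
by rewrite (horizE tr hchi Ve0 (vproj_bfield tr cc bD) cc c1).
Qed.

Lemma hproj_smooth_at D k v : is_vfield D -> smooth k -> V v ->
  smooth_at v (fun w => hproj D w k (oneH G)).
Proof.
move=> vD sk Vv; have [_ sD _ _ _] := vD; have Vj : V (pi (jo v)) by rewrite (triv_pi tr).
have [sg eg] := germP (triv_eta_at tr sk Vj).
apply: (smooth_at_ext gB _ (section_at tr (oneH G) (sD _ sg) Vv)).
apply: dnbhsS (sect_dnbhs Vv (dnbhs_dnbhs eg)) => w /= ew.
by rewrite /hproj leftext_at1 // (germ_eq gM (vfield_pder (jo w) vD) sg).
Qed.

Lemma smooth_sect : smooth_map
  ((fun z => sect (sval z).1 (sval z).2) : subSpace (model_over V) -> bcot H).
Proof.
pose Q : diffSpace R := subSpace (model_over V); have gQ : gen_closed Q by exact: gen_closed_sub.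
have s1 : smooth_map ((fun z => (sval z).1) : Q -> hdual G).
  by move=> f sf; exact: (smooth_sval (smooth_fst sf)).
have s2 : smooth_map ((fun z => (sval z).2) : Q -> bcot Zb).
  by move=> f sf; exact: (smooth_sval (smooth_snd sf)).
have s3 : smooth_map ((fun z => bproj (sval z).2) : Q -> B).
  by move=> f sf; exact: (s2 _ (smooth_bproj sf)).
apply: (smooth_map_gen gQ (@bcot_smooth_gen R M H)) => _ [[g sg ->]|[D bD ->]];
    apply: smooth_local => // z; have Vz : V (bproj (sval z).2) by exact: (svalP z).
  exact: (smooth_map_at s3 (section_at tr (oneH G) sg Vz)).
have [cc c1] := hchi Vz; set c := chi _ in cc c1.
(* In a basis of the Lie algebra the pairing of m with the H-component becomes a finite sum of
   functions of the base point times evaluations of m, each of them smooth. *)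
have [X [w [lX sw XE]]] := lieH_basis G.
have bP := vproj_bfield tr cc bD.
apply: (@smooth_at_ext _ _ gQ _ (fun z : Q =>
    \sum_i (fun v => hproj D v (w i) (oneH G)) (bproj (sval z).2) * sval (sval z).1 (X i) +
    bpair (sval z).2 (vproj c D))).
  apply: dnbhsS (smooth_map_dnbhs s3 (dnbhs_dnbhs c1)) => z' /= c1'.
  have Vz' : V (bproj (sval z').2) by exact: (svalP z').
  rewrite (sectE tr hchi _ Vz' bD cc c1'); congr (_ + _).
  rewrite [in RHS](XE _ (hproj_lieH tr bD.1 Vz')).
  by have [_ ->] := lieH_sum (fun i => hproj D (bproj (sval z').2) (w i) (oneH G)) lX.
apply: smooth_atD => //; last exact: (smooth_smooth_at gQ z (s2 _ (smooth_bpair bP))).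
apply: smooth_at_sum => // i; apply: smooth_atM => //.
  exact: (smooth_map_at s3 (hproj_smooth_at bD.1 (sw i) Vz)).
exact: (smooth_smooth_at gQ z (s1 _ (smooth_heval (lX i)))).
Qed.

End SectionInverse.

(** * The Poisson diffeomorphism *)

Section Equivalence.
Variables (R : realType) (n : nat) (G : bLieGroup R n).
Local Notation M := (bspace G).
Local Notation H := (@bH R n G : set M).
Local Notation Hs := (subgroupSpace G).
Local Notation B := (GmodH G).
Local Notation Zb := ([set base_pt G] : set B).
Local Notation pi := (quot_map (@leftrel R n G)).
Local Notation q := (quot_map (@liftrel R n G)).
Variable red : (bcot_modH G -> R) -> (bcot_modH G -> R) -> bcot_modH G -> R.
Hypothesis Hred : is_reduced (G := G) red.
Variables (V : set B) (eta : M -> Hs) (j : Hs -> B -> M) (chi : B -> B -> R).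
Hypothesis tr : is_triv V eta j.
Hypothesis hchi : forall v, V v -> cutoff V (chi v) /\ dnbhs v [set w | chi v w = 1].
Local Notation P := (PoissonSpace red).
Local Notation A := (bcot_modH_over V : set P).
Local Notation O := (model_over V : set (model G)).
Local Notation hl c D := (hlift eta j c D).
Local Notation vl c E := (vlift V eta j c E).
Local Notation vert := (vert tr hchi).
Local Notation horiz := (horiz tr hchi).
Local Notation sect := (sect tr hchi).

Let gB : gen_closed B. Proof. exact: gen_closed_B. Qed.
Let gE : gen_closed (bcot H). Proof. exact: gen_closed_bcot. Qed.
Let gP : gen_closed P. Proof. exact: (@gen_closed_quot R (bcot H) gE). Qed.
Let bM := bmanifold_bmfd_group G.
Let bB : is_bmfd Zb 1. Proof. exact: orbit_bmfd tr. Qed.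
Let spi : smooth_map (pi : M -> B). Proof. exact: smooth_pi. Qed.
Let oV : dopen V. Proof. by case: tr. Qed.

Definition orep (c : bcot_modH G) : bcot H := projT1 (cid (@quot_map_surj R (bcot H) (@liftrel R n G) c)).

Lemma orepK c : q (orep c) = c. Proof. by rewrite /orep; case: cid. Qed.

Lemma orep_liftrel e : liftrel (orep (q e)) e.
Proof. by apply/quot_liftrel; rewrite orepK. Qed.

Lemma smooth_desc (T : bcot H -> R) : smooth T -> (forall e e', liftrel e e' -> T e' = T e) ->
  smooth (T \o orep : P -> R) /\ (T \o orep) \o q = T.
Proof.
move=> sT invT; have E : (T \o orep) \o q = T.
  by apply/funext => e /=; rewrite (invT _ _ (orep_liftrel e)).
by split=> //; suff: @smooth R (bcot H) ((T \o orep) \o q) by []; rewrite E.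
Qed.

Let rho (c : P) : B := pi (bproj (orep c)).

Let smooth_rho : smooth_map rho.
Proof.
move=> k sk; have sT : smooth (fun e : bcot H => k (pi (bproj e))).
  exact: (smooth_bproj (spi sk)).
have inv e e' : @liftrel R n G e e' -> k (pi (bproj e')) = k (pi (bproj e)).
  by move=> /liftrel_pi ->.
exact: (smooth_desc sT inv).1.
Qed.

Let overP c : A c <-> V (rho c).
Proof.
split=> [[e Ve <-]|Vc]; last by exists (orep c); rewrite ?orepK.
by rewrite /rho -(liftrel_pi (orep_liftrel e)).
Qed.

Let oA : dopen A.
Proof.
have -> : A = rho @^-1` V by apply/seteqP; split=> c /overP.
exact: (smooth_map_dopen smooth_rho oV).
Qed.

Let oO : dopen O.
Proof.
have s : smooth_map ((fun z : model G => bproj z.2) : model G -> B).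
  by move=> f sf; exact: (smooth_snd (smooth_bproj sf)).
exact: (smooth_map_dopen s oV).
Qed.

Let gA : gen_closed (subSpace A). Proof. exact: gen_closed_sub. Qed.
Let gO : gen_closed (subSpace O). Proof. exact: gen_closed_sub. Qed.

Let Phi_over (c : subSpace A) : O (vert (orep (sval c)), horiz (orep (sval c))).
Proof. exact/overP/(svalP c). Qed.

Let Phi (c : psub (P := P) A) : psub (P := model G) O := exist _ _ (Phi_over c).

Let Psi_over (z : subSpace O) : A (q (sect (sval z).1 (sval z).2)).
Proof.
exists (sect (sval z).1 (sval z).2) => //.
by rewrite /preimV /= /preimage /= (triv_pi tr); exact: (svalP z).
Qed.

Let Psi (z : psub (P := model G) O) : psub (P := P) A := exist _ _ (Psi_over z).

Let PhiK : cancel Phi Psi.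
Proof.
move=> c; apply: sval_inj; rewrite /= -[RHS]orepK; apply/esym/quot_liftrel.
by apply: sect_vert_horiz; apply/overP; exact: (svalP c).
Qed.

Let PsiK : cancel Psi Phi.
Proof.
move=> z; have Vz : V (bproj (sval z).2) := svalP z.
apply: sval_inj => /=; have Lr := orep_liftrel (sect (sval z).1 (sval z).2).
by rewrite -(vert_liftrel tr hchi Lr) -(horiz_liftrel tr hchi Lr) vert_sect // horiz_sect // -surjective_pairing.
Qed.

(** T is a global invariant function with its cutoff fixed at c, whereas the cutoff inside [Phi]
    moves with the point; the two agree only near c, which suffices for brackets at c. *)
Let represents (c : subSpace A) (s : model G -> R) (T : bcot H -> R) :=
  [/\ smooth T, (forall e e', liftrel e e' -> T e' = T e) &
      dnbhs (sval c : P) [set z | forall y : subSpace A, sval y = z -> s (sval (Phi y)) = T (orep z)]].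

Let near_chi (c : subSpace A) : [/\ V (rho (sval c)), cutoff V (chi (rho (sval c))),
  dnbhs (rho (sval c)) [set w | chi (rho (sval c)) w = 1] &
  dnbhs (sval c : P) [set z | A z /\ dnbhs (rho z) [set w | chi (rho (sval c)) w = 1]]].
Proof.
have Vc : V (rho (sval c)) by apply/overP; exact: (svalP c).
have [cc c1] := hchi Vc; split=> //.
exact: (dnbhsI gP (dnbhs_dopen oA (svalP c)) (smooth_map_dnbhs smooth_rho (dnbhs_dnbhs c1))).
Qed.

Let rep_vert c D : lieH D ->
  represents c (fun z => sval z.1 D) (fun e => bpair e (hl (chi (rho (sval c))) D)).
Proof.
move=> lD; have [Vc cc c1 N] := near_chi c; split.
- exact: (smooth_bpair (hlift_bfield tr cc lD.1)).
- by move=> e e' ee'; exact: (bpair_hlift_liftrel tr).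
- apply: dnbhsS N => z [/overP Vz c1'] y yz.
  by rewrite /= -yz; apply: (vertE tr hchi); rewrite // yz.
Qed.

Let rep_base c (k : B -> R) : smooth k ->
  represents c (fun z => k (bproj z.2)) (fun e => k (pi (bproj e))).
Proof.
move=> sk; split; first exact: (smooth_bproj (spi sk)).
- by move=> e e' /liftrel_pi ->.
- by apply: dnbhsT => // z y /= <-.
Qed.

Let rep_horiz c E : is_bfield Zb E ->
  represents c (fun z => bpair z.2 E) (fun e => bpair e (vl (chi (rho (sval c))) E)).
Proof.
move=> bE; have [Vc cc c1 N] := near_chi c; split.
- exact: (smooth_bpair (vlift_bfield tr cc bE)).
- by move=> e e' ee'; exact: (bpair_vlift_liftrel tr).
- apply: dnbhsS N => z [/overP Vz c1'] y yz.
  by rewrite /= -yz; apply: (horizE tr hchi); rewrite // yz.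
Qed.

Let smooth_Phi : smooth_map Phi.
Proof.
apply: (smooth_into_sub (X := subSpace A) gA).
apply: (smooth_map_gen gA (@model_smooth_gen R n G)) => s Gs.
apply: smooth_local => // c.
have [T [sT invT E]] : exists T, represents c s T.
  case: Gs => [[D lD ->]|[k sk ->]|[E bE ->]]; eexists;
    [exact: rep_vert|exact: rep_base|exact: rep_horiz].
exists (fun y : subSpace A => T (orep (sval y))); first exact: (smooth_sval (smooth_desc sT invT).1).
by apply: dnbhsS (smooth_map_dnbhs (@smooth_sval R P A) E) => y /= ->.
Qed.

Let smooth_Psi : smooth_map Psi.
Proof.
apply: (smooth_into_sub (X := subSpace O) gO) => f sf.
exact: (smooth_sect tr hchi (f := fun e => f (q e)) sf).
Qed.

Let redE f g e : smooth f -> smooth g ->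
  @pbr R P f g (q e) = @pbr R (bcan H) (f \o q) (g \o q) e.
Proof.
by move=> sf sg; have [_ [_ /(_ f g sf sg)/(congr1 (@^~ e))]] := Hred.
Qed.

Let red_bider c : bider (c : P) (fun f g : P -> R => @pbr R P f g c).
Proof.
have [be _ _ _ _] := bcan_is_pb bM (orep c); rewrite -(orepK c).
have sq : smooth_map (q : bcot H -> P) by [].
rewrite orepK in be *; rewrite -{1 2}(orepK c).
apply: (bider_ext gP (bider_push sq be)) => f g sf sg.
by rewrite redE.
Qed.

(** Moves a bracket on the reduced space up to the b-cotangent bundle of G, where it is known on
    generators. *)
Let psub_rep c s s' T T' : represents c s T -> represents c s' T' ->
  @pbr R (psub (P := P) A) (fun y => s (sval (Phi y))) (fun y => s' (sval (Phi y))) c =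
  @pbr R (bcan H) T T' (orep (sval c)).
Proof.
move=> [sT iT eT] [sT' iT' eT']; have [s1 e1] := smooth_desc sT iT; have [s2 e2] := smooth_desc sT' iT'.
rewrite (psub_eq gP oA (red_bider (sval c)) s1 s2 eT eT').
by rewrite -{1}(orepK (sval c)) redE // e1 e2.
Qed.

(** The nine cases match the brackets of lifted fields with those of the two factors; the mixed ones
    vanish since the two kinds of lifts commute. *)
Let gens_bracket c s s' : model_gens s -> model_gens s' ->
  @pbr R (psub (P := P) A) (fun y => s (sval (Phi y))) (fun y => s' (sval (Phi y))) c =
  @pbr R (model G) s s' (sval (Phi c)).
Proof.
have [Vc cc c1 _] := near_chi c; set x := chi _ in cc c1.
have [_ p1 p2 p3 p4] := bcan_is_pb bM (orep (sval c)).
have [_ m1 m2 m3 m4] := bcan_is_pb bB (horiz (orep (sval c))).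
have bh D : lieH D -> is_bfield H (hl x D) by move=> lD; exact: (hlift_bfield tr cc lD.1).
have bv E : is_bfield Zb E -> is_bfield H (vl x E) by move=> bE; exact: (vlift_bfield tr cc bE).
have pp (k : B -> R) : smooth k -> smooth (k \o pi) by move=> sk; exact: (spi sk).
move=> [[D lD ->]|[k sk ->]|[E bE ->]] [[D' lD' ->]|[k' sk' ->]|[E' bE' ->]].
- rewrite (psub_rep (rep_vert c lD) (rep_vert c lD')) -/x.
  rewrite (p4 _ _ (bh _ lD) (bh _ lD')) (bpair_hlift_lie tr cc c1 Vc lD.1 lD'.1).
  rewrite (model_ff bB _ (smooth_heval lD) (smooth_heval lD')) lie_poisson_heval //.
  by rewrite -(vertE tr hchi Vc (lieH_lie lD lD') cc c1).
- rewrite (psub_rep (rep_vert c lD) (rep_base c sk')) -/x (p3 _ _ (pp _ sk') (bh _ lD)).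
  by rewrite (hlift_pi tr _ lD.1 sk' Vc) oppr0 (model_fs bB _ (smooth_heval lD) (smooth_bproj sk')).
- rewrite (psub_rep (rep_vert c lD) (rep_horiz c bE')) -/x (p4 _ _ (bh _ lD) (bv _ bE')).
  rewrite (bpair_hv_lie tr cc c1 Vc lD.1 bE') oppr0.
  by rewrite (model_fs bB _ (smooth_heval lD) (smooth_bpair bE')).
- rewrite (psub_rep (rep_base c sk) (rep_vert c lD')) -/x (p2 _ _ (pp _ sk) (bh _ lD')).
  by rewrite (hlift_pi tr _ lD'.1 sk Vc) (model_sf bB _ (smooth_heval lD') (smooth_bproj sk)).
- rewrite (psub_rep (rep_base c sk) (rep_base c sk')) (p1 _ _ (pp _ sk) (pp _ sk')).
  by rewrite (model_ss _ (smooth_bproj sk) (smooth_bproj sk')) m1.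
- rewrite (psub_rep (rep_base c sk) (rep_horiz c bE')) -/x (p2 _ _ (pp _ sk) (bv _ bE')).
  rewrite (vlift_pi tr _ bE'.1 sk Vc) (dnbhs_self c1) mul1r.
  by rewrite (model_ss _ (smooth_bproj sk) (smooth_bpair bE')) m2.
- rewrite (psub_rep (rep_horiz c bE) (rep_vert c lD')) -/x.
  rewrite (pbr_anti bM (smooth_bpair (bv _ bE)) (smooth_bpair (bh _ lD'))).
  rewrite (p4 _ _ (bh _ lD') (bv _ bE)) (bpair_hv_lie tr cc c1 Vc lD'.1 bE) !oppr0.
  by rewrite (model_sf bB _ (smooth_heval lD') (smooth_bpair bE)).
- rewrite (psub_rep (rep_horiz c bE) (rep_base c sk')) -/x (p3 _ _ (pp _ sk') (bv _ bE)).
  rewrite (vlift_pi tr _ bE.1 sk' Vc) (dnbhs_self c1) mul1r.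
  by rewrite (model_ss _ (smooth_bpair bE) (smooth_bproj sk')) m3.
- rewrite (psub_rep (rep_horiz c bE) (rep_horiz c bE')) -/x.
  rewrite (p4 _ _ (bv _ bE) (bv _ bE')) (bpair_vlift_lie tr cc c1 Vc bE bE').
  rewrite (model_ss _ (smooth_bpair bE) (smooth_bpair bE')) m4 //.
  by rewrite -(horizE tr hchi Vc (bfield_lie gB bE bE') cc c1).
Qed.

Lemma local_equivalence :
  exists2 F : psub (P := P) A -> psub (P := model G) O, diffeo F & poisson_map F.
Proof.
exists Phi; first by split=> //; exists Psi.
split=> // f g sf sg; apply/funext => c /=.
pose S := [set f : subSpace O -> R | exists2 s, model_gens s & f = s \o sval].
have SG : @smooth R (subSpace O) `<=` gen S.
  apply: gen_mono => _ [s ss ->].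
  by apply: (gen_comp (phi := sval)) (@model_smooth_gen R n G s ss) => s' Gs'; exists s'.
have Gs : S `<=` @smooth R (subSpace O).
  by move=> _ [s Gs ->]; exact: (smooth_sval (model_gen_smooth Gs)).
(* Both brackets are biderivations at the image of c, so it remains to compare them on restrictions
   of generators of the model. *)
have b1 := bider_push smooth_Phi (psub_bider gP oA (red_bider (sval c))).
have b2 := psub_bider (gen_closed_model (G := G)) oO (model_bider bB (sval (Phi c))).
apply: (bider_gen_eq gO SG Gs b1 b2 _ sf sg) => _ _ [s Gss ->] [s' Gss' ->].
rewrite (psub_eq (f' := s) (g' := s') (gen_closed_model (G := G)) oO (model_bider bB _)).
- exact: gens_bracket.
- exact: model_gen_smooth.
- exact: model_gen_smooth.
- by apply: (dnbhsT (gen_closed_model (G := G))) => z y /= <-.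
- by apply: (dnbhsT (gen_closed_model (G := G))) => z y /= <-.
Qed.

End Equivalence.

Theorem theorem20 (R : realType) (n : nat) (G : bLieGroup R n) :
  (exists red, is_reduced (G := G) red) /\
  (forall red, is_reduced (G := G) red -> locally_equivalent red).
Proof.
split=> [|red Hred V oV Vb tV]; first exact: reduced_exists.
have [eta [j tr]] := trivial_is_triv oV Vb tV.
have gB := @gen_closed_B R n G.
(* One cutoff for each point, since no single smooth function that vanishes near every point off V
   need be 1 on all of V. *)
have /choice[chi hchi] : forall v, exists c : GmodH G -> R,
    V v -> cutoff V c /\ dnbhs v [set w | c w = 1].
  move=> v; have [Vv|nV] := pselect (V v); last by exists (fun=> 0).
  by have [c [sc c1 c0]] := bump gB oV Vv; exists c.
exact: (local_equivalence Hred tr hchi).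
Qed.
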